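(* Let $K,f,\Gamma_w,\tilde\Gamma_w,\overline\Gamma_w,U$ be as in the context. Fix $\theta\in\mathbb R$. Suppose there exist a function $\alpha_\theta:W\to\mathbb R$, finitely many constants $C_i$ and non-negative integers $m_i$, and for each $w\in W$ an open subset $V_{w,\theta}\subset\mathbb C$ containing the closed half line $\overline{\mathbb R_+^\theta}$, such that for all $w\in W$ $$\mathcal L_\theta^{-1}(\phi_z)\in\mathcal O(V_{w,\theta})\quad\forall z\in\overline\Gamma_w$$ and $$|\mathcal L_\theta^{-1}(\phi_z)(\xi)|\le e^{\alpha_\theta(w)|\xi|}\sum_iC_i|\xi|^{m_i}\quad\forall\xi\in V_{w,\theta},\ z\in\overline\Gamma_w .$$ Further assume that $\gamma\in U_{\theta,\alpha_\theta(w)}$ for all $w\in W$. Then the formal series $g^+_\gamma$ is Borel summable, and $$B_w(\xi)=\mathcal B(g^+_\gamma(w))(\xi)$$ is well defined for $\xi\in V_{w,\theta}$, $B_w\in\mathcal O(V_{w,\theta})$, and it is given by $$B_w(\xi)=\int_{\overline\Gamma_w}K(w,z)\,\mathcal L_\theta^{-1}(\phi_z)(\xi)\,dz .$$ Further, $$g_\gamma(w)=g^-_\gamma(w)+\mathcal L_\theta(B_w)(\gamma)\qquad\forall\gamma\in U_{\theta,\alpha_\theta(w)},\ \forall w\in W .$$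
   Context: Setting. For a meromorphic function $h$ on $\mathbb C$, $P_h$ denotes its set of poles and $h_\gamma(z)=h(\gamma z)$. $D(0,R)$ is the open disc of radius $R$ about $0$; $\mathcal O(V)$ denotes holomorphic functions on $V$. $W\subset\mathbb C$ is open and connected; $K$ is a meromorphic function on $W\times\mathbb C$ such that for every $w\in W$ the set $\{w\}\times\mathbb C$ is not contained in its pole divisor; $K_w(z)=K(w,z)$. $(\Gamma_w)_{w\in W}$ is a continuous family of curves in $\mathbb C$ (possibly non-compact, possibly with fixed boundary) with $\Gamma_w\subset\mathbb C\setminus P_{K_w}$. $U\subset\mathbb C$ is a non-empty connected open set with $0\in\bar U\setminus U$. $f$ is meromorphic on $\mathbb C$ with $\Gamma_w\subset\mathbb C\setminus(P_{K_w}\cup P_{f_\gamma})$ and such that $g_\gamma(w)=\int_{\Gamma_w}K(w,z)f_\gamma(z)\,dz$ exists for all $(w,\gamma)\in W\times U$ and is holomorphic in $w$. The integrals $h_m(w)=\int_{\Gamma_w}K(w,z)z^m\,dz$ ($m\in\mathbb Z$) are assumed to exist and be holomorphic on $W$. The pole order $k_0\in\mathbb Z_{\ge0}$ of $K_w$ at $0$ is independent of $w$. $n_0\in\mathbb Z_{\ge0}$ is the pole order of $f$ at $0$ and $f(z)=\sum_{m\ge-n_0}a_mz^m$ is its Laurent series at $0$. Contour and decay assumptions. $\Gamma_w$ can be continuously deformed (relative to its boundary, if non-empty) inside $\mathbb C\setminus\big((P_{K_w}\cup P_{f_\gamma})\setminus\{0\}\big)$ to a contour $\tilde\Gamma_w$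 consisting of $d$ (finitely many) smooth arc segments (split at $0$ if passing through $0$), along which the following three conditions (E) hold with positive constants $b,c,\delta_1,\delta_2$, $\delta:=\delta_1-\delta_2>0$, and $c_w\in\mathbb R_+$, $\tilde c_\gamma\in[c,\infty)$: (i) $|\cos\Theta(z)|\ge b$, where $\Theta(z)$ is the angle between the line through $0$ and $z$ and the tangent line to the segment at $z$; (ii) $|K(w,z)|\le c_we^{-\delta_1|z|}|z|^{-k_0}$ for $z\ne0$; (iii) $|f_\gamma(z)|\le\tilde c_\gamma e^{\delta_2|z|}|\gamma z|^{-n_0}$ for $z\neq0$; for all $w\in W,\gamma\in U$. Moreover there is a continuous deformation of $\tilde\Gamma_w$ inside $\mathbb C\setminus P_{K_w}$ to a contour $\overline\Gamma_w\subset\mathbb C\setminus(P_{K_w}\cup\{0\})$ for all $w\in W$, and $r(w)\in\mathbb R_+$, such that conditions (E) hold along $\overline\Gamma_w^\infty(r(w))=\overline\Gamma_w\cap(\mathbb C\setminus D(0,r(w)))$. Notation. $g^-_\gamma(w)=\sum_{m=-n_0}^{k_0-1}a_mh_m(w)\gamma^m$; $g^+_\gamma(w)=\sum_{m=k_0}^\infty a_mh_m(w)\gamma^m$ (formal series, regarded in $\gamma\mathcal O(W)[[\gamma]]$). $\phi(z)=f(z)-\sum_{m=-n_0}^{k_0-1}a_mz^m$ and $\phi_z(\gamma)=\phi(\gamma z)$. The formal Borel transform $\mathcal B:\gamma\mathcal O(W)[[\gamma]]\to\mathcal O(W)[[\xi]]$ is the $\mathcal O(W)$-linear map with $\mathcal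 B(\gamma^m)=\xi^{m-1}/(m-1)!$. $\mathbb R_+^\theta=e^{i\theta}\mathbb R_+$, and the Laplace transform is $\mathcal L_\theta(\psi)(\gamma)=\int_{\mathbb R_+^\theta}e^{-\xi/\gamma}\psi(\xi)\,d\xi$; $\mathcal L_\theta^{-1}(\phi_z)$ denotes the function of $\xi$ whose Laplace transform $\mathcal L_\theta$ is $\gamma\mapsto\phi_z(\gamma)$. With $\theta_\gamma=\operatorname{Arg}(\gamma)$, $U_{\theta,\alpha}=\{\gamma\in U:\cos(\theta-\theta_\gamma)>|\gamma|\alpha\}$; the Laplace transform is considered for $\gamma$ in $U_\theta=\{\gamma\in U:\cos(\theta-\theta_\gamma)>0\}$.
   Formalization: The deformation of Γ̃_w to Γ̄_w must also avoid the nonzero poles of f_γ for γ in U_{θ,α(w)} (else residues break the formula); at non-compact ends deformations stay at infinity with vanishing transversal integrals; V_{w,θ} is taken connected. *)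

(* Defs.v *)
From Stdlib Require Import Reals List ZArith.
From Coquelicot Require Import Coquelicot.

Open Scope R_scope.

(** Connectedness of [S] in the induced topology, tested on open sets of [C]. *)
Definition connected_set (S : C -> Prop) : Prop :=
  forall A B : C -> Prop, open A -> open B ->
    (forall z, S z -> A z \/ B z) ->
    (exists z, S z /\ A z) -> (exists z, S z /\ B z) ->
    exists z, S z /\ A z /\ B z.

Definition cont_within {T U : UniformSpace} (D : T -> Prop) (f : T -> U) : Prop :=
  forall x, D x -> filterlim f (within D (locally x)) (locally (f x)).

(** Coquelicot has no complex exponential. *)
Definition Cexp (z : C) : C := (exp (Re z) * cos (Im z), exp (Re z) * sin (Im z)).

Definition cis (t : R) : C := (cos t, sin t).

Definition Czpow (z : C) (m : Z) : C :=
  match m with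
  | Z0 => RtoC 1
  | Zpos p => Cpow z (Pos.to_nat p)
  | Zneg p => Cinv (Cpow z (Pos.to_nat p))
  end.

Definition Csum (n : nat) (u : nat -> C) : C :=
  fold_right Cplus (RtoC 0) (map u (seq 0 n)).

Definition is_arg (z : C) (t : R) : Prop :=
  z <> RtoC 0 /\ - PI < t <= PI /\ z = Cmult (RtoC (Cmod z)) (cis t).

Definition ray (theta : R) (xi : C) : Prop :=
  exists t : R, 0 <= t /\ xi = Cmult (RtoC t) (cis theta).

Definition holo_at (f : C -> C) (z : C) : Prop :=
  locally z (fun x : C => ex_derive (K := C_AbsRing) (V := C_NormedModule) f x).

Definition holo_on (V : C -> Prop) (f : C -> C) : Prop :=
  forall z, V z -> holo_at f z.

Definition pole_of_order (f : C -> C) (z : C) (n : nat) : Prop :=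
  (1 <= n)%nat /\
  exists g : C -> C, holo_at g z /\ g z <> RtoC 0 /\
    locally' z (fun x : C => f x = Cdiv (g x) (Cpow (Cminus x z) n)).

Definition pole (f : C -> C) (z : C) : Prop := exists n, pole_of_order f z n.

(** Order [0] means that there is no pole. *)
Definition pole_order (f : C -> C) (z : C) (n : nat) : Prop :=
  (n = 0%nat /\ holo_at f z) \/ pole_of_order f z n.

(** A meromorphic function on [C] is given by a total function whose removable
    singularities have been filled in; its values at the poles are irrelevant. *)
Definition meromorphic (f : C -> C) : Prop :=
  forall z, holo_at f z \/ pole f z.

Definition uncurry2 (K : C -> C -> C) (p : C * C) : C := K (fst p) (snd p).

Definition CxC : NormedModule C_AbsRing :=
  prod_NormedModule C_AbsRing C_NormedModule C_NormedModule.

(** Joint holomorphy, as complex Frechet differentiability near [(w, z)]. *)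
Definition holo2_at (K : C -> C -> C) (w z : C) : Prop :=
  locally ((w, z) : CxC) (fun p : CxC =>
    ex_filterdiff (K := C_AbsRing) (U := CxC) (V := C_NormedModule)
      (uncurry2 K) (locally p)).

(** Near each point of [W * C], [K] is a quotient [g / h] of holomorphic functions
    whose denominator is not the zero germ.  The last clause fixes the values of the
    total function [K]: where the quotient extends holomorphically, [K] is that
    extension.  Hence the pole divisor is the set of points of [W * C] near which
    [K] is not holomorphic (it contains the points of indeterminacy). *)
Definition meromorphic2 (W : C -> Prop) (K : C -> C -> C) : Prop :=
  forall w z, W w ->
    exists g h : C -> C -> C,
      holo2_at g w z /\ holo2_at h w z /\
      ~ locally ((w, z) : CxC) (fun p : CxC => uncurry2 h p = RtoC 0) /\
      locally ((w, z) : CxC) (fun p : CxC =>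
        uncurry2 h p <> RtoC 0 -> uncurry2 K p = Cdiv (uncurry2 g p) (uncurry2 h p)) /\
      (forall G : C -> C -> C, holo2_at G w z ->
         locally ((w, z) : CxC) (fun p : CxC =>
           Cmult (uncurry2 G p) (uncurry2 h p) = uncurry2 g p) ->
         locally ((w, z) : CxC) (fun p : CxC => uncurry2 K p = uncurry2 G p)).

Definition pole_divisor (W : C -> Prop) (K : C -> C -> C) (w z : C) : Prop :=
  W w /\ ~ holo2_at K w z.

(** [h_gamma (z) = h (gamma z)] *)
Definition dil (f : C -> C) (gam : C) : C -> C := fun z => f (Cmult gam z).

(** [f(z) = sum_(m >= - n0) a_m z^m] near [0]. *)
Definition laurent_at0 (f : C -> C) (n0 : nat) (a : Z -> C) : Prop :=
  locally' (RtoC 0) (fun z : C =>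
    is_series (K := C_AbsRing) (V := C_NormedModule)
      (fun j : nat => Cmult (a (Z.of_nat j - Z.of_nat n0)%Z)
                            (Czpow z (Z.of_nat j - Z.of_nat n0)%Z))
      (f z)).

(** A curve is a map [c : R -> C], considered on the parameter interval with ends
    [lo < hi] in [Rbar].  A finite end belongs to the interval and gives a boundary
    point of the curve (unless the curve is closed); at an infinite end the curve is
    non-compact. *)
Definition in_itv (lo hi : Rbar) (t : R) : Prop := Rbar_le lo t /\ Rbar_le t hi.

Definition in_open_itv (lo hi : Rbar) (t : R) : Prop := Rbar_lt lo t /\ Rbar_lt t hi.

Definition is_end (lo hi e : Rbar) : Prop := e = lo \/ e = hi.

Definition closed_curve (lo hi : Rbar) (c : R -> C) : Prop :=
  is_finite lo /\ is_finite hi /\ c (real lo) = c (real hi).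

Definition C1_curve (p dp : R -> C) : Prop :=
  forall t : R, is_derive (K := R_AbsRing) (V := C_R_NormedModule) p t (dp t) /\
    continuous (dp : R -> C_UniformSpace) t.

(** Up to and including its finite ends, the arc is the restriction of a regular
    C^1 curve. *)
Definition smooth_arc (lo hi : Rbar) (c : R -> C) : Prop :=
  exists p dp : R -> C, C1_curve p dp /\
    forall t, in_itv lo hi t -> c t = p t /\ dp t <> RtoC 0.

Definition subdivision (d : nat) (tau : nat -> Rbar) (lo hi : Rbar) : Prop :=
  tau 0%nat = lo /\ tau d = hi /\
  forall i, (i < d)%nat -> Rbar_lt (tau i) (tau (S i)).

(** The curve runs to infinity at its non-compact ends. *)
Definition proper_ends (lo hi : Rbar) (c : R -> C) : Prop :=
  forall e, is_end lo hi e -> ~ is_finite e ->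
    filterlim (fun t => Cmod (c t)) (Rbar_locally e) (Rbar_locally p_infty).

Definition piecewise_smooth_curve (lo hi : Rbar) (c : R -> C) : Prop :=
  cont_within (in_itv lo hi) (c : R -> C_UniformSpace) /\ proper_ends lo hi c /\
  forall x y : R, in_itv lo hi x -> in_itv lo hi y -> x < y ->
    exists (d : nat) (tau : nat -> Rbar), subdivision d tau x y /\
      forall i, (i < d)%nat -> smooth_arc (tau i) (tau (S i)) c.

(** [d] smooth arc segments, split at [0]. *)
Definition contour (d : nat) (lo hi : Rbar) (c : R -> C) : Prop :=
  cont_within (in_itv lo hi) (c : R -> C_UniformSpace) /\ proper_ends lo hi c /\
  exists tau : nat -> Rbar, subdivision d tau lo hi /\
    forall i, (i < d)%nat -> smooth_arc (tau i) (tau (S i)) c /\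
      forall t, in_open_itv (tau i) (tau (S i)) t -> c t <> RtoC 0.

(** Continuous in [(w, t)]; the boundary, if there is one, does not move with [w]. *)
Definition continuous_family (W : C -> Prop) (lo hi : Rbar) (c : C -> R -> C) : Prop :=
  cont_within (T := prod_UniformSpace C_UniformSpace R_UniformSpace)
    (U := C_UniformSpace)
    (fun p => W (fst p) /\ in_itv lo hi (snd p)) (fun p => c (fst p) (snd p)) /\
  ((forall w, W w -> closed_curve lo hi (c w)) \/
   (forall w w', W w -> W w' -> forall e, is_end lo hi e -> is_finite e ->
      c w (real e) = c w' (real e))).

Definition velocity (c : R -> C) (t : R) : C :=
  (Derive (fun x => Re (c x)) t, Derive (fun x => Im (c x)) t).

Definition end_filter (e : Rbar) : (R -> Prop) -> Prop :=
  match e with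
  | Finite x => at_point x
  | _ => Rbar_locally e
  end.

(** [int_c F(z) dz = l], as an improper Riemann integral at infinite ends. *)
Definition is_contour_int (lo hi : Rbar) (c : R -> C) (F : C -> C) (l : C) : Prop :=
  is_RInt_gen (V := C_R_NormedModule)
    (fun t => Cmult (F (c t)) (velocity c t)) (end_filter lo) (end_filter hi) l.

(** Continuous deformation of [c0] to [c1] inside [O]: relative to the boundary, and
    for a closed curve through closed curves.  A non-compact end stays at infinity
    during the deformation, and the integrands in [FF] give no contribution there: the
    integral of each of them along the transversal [s |-> H s t] tends to [0] as [t]
    tends to that end (trivially so if [H] is stationary near that end).  Without the
    latter, Cauchy's theorem fails: the half-line [0, oo) is rotated to (-oo, 0]
    properly and relative to [0], but the integrals of [exp (- z^2)] differ. *)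
Definition deforms (O : C -> Prop) (FF : (C -> C) -> Prop)
    (lo hi : Rbar) (c0 c1 : R -> C) : Prop :=
  exists H : R -> R -> C,
    cont_within (T := prod_UniformSpace R_UniformSpace R_UniformSpace)
      (U := C_UniformSpace)
      (fun p => 0 <= fst p <= 1 /\ in_itv lo hi (snd p))
      (fun p => H (fst p) (snd p)) /\
    (forall t, in_itv lo hi t -> H 0 t = c0 t /\ H 1 t = c1 t) /\
    (forall s t, 0 <= s <= 1 -> in_itv lo hi t -> O (H s t)) /\
    (closed_curve lo hi c0 ->
       forall s, 0 <= s <= 1 -> H s (real lo) = H s (real hi)) /\
    (~ closed_curve lo hi c0 ->
       forall e, is_end lo hi e -> is_finite e ->
       forall s, 0 <= s <= 1 -> H s (real e) = c0 (real e)) /\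
    (forall e, is_end lo hi e -> ~ is_finite e ->
       (forall M : R, Rbar_locally e (fun t =>
          forall s, 0 <= s <= 1 -> M < Cmod (H s t))) /\
       Rbar_locally e (fun t => exists p dp : R -> C, C1_curve p dp /\
          forall s, 0 <= s <= 1 -> H s t = p s) /\
       forall F, FF F ->
         filterlim (fun t => RInt (V := C_R_CompleteNormedModule)
             (fun s => Cmult (F (H s t)) (velocity (fun x => H x t) s)) 0 1)
           (Rbar_locally e) (locally (RtoC 0 : C_UniformSpace))).

(** [C \ ((P_(K_w) u P_(f_gamma)) \ {0})].  A deformation of contours for the integral
    of [K_w f_gamma] has to avoid the poles of both factors: crossing one of
    [f_gamma] would produce a residue.  The point [0] is allowed, because it is a
    removable singularity of [z |-> K w z * phi (gamma z)]. *)
Definition admissible (K : C -> C -> C) (f : C -> C) (w gam z : C) : Prop :=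
  ~ ((pole (K w) z \/ pole (dil f gam) z) /\ z <> RtoC 0).

(** The integrands defining [g_gamma (w)] and the [h_m (w)]. *)
Inductive integrand (K : C -> C -> C) (f : C -> C) (w gam : C) : (C -> C) -> Prop :=
| integrand_g : integrand K f w gam (fun z => Cmult (K w z) (dil f gam z))
| integrand_h (m : Z) : integrand K f w gam (fun z => Cmult (K w z) (Czpow z m)).

(** Cosine of the angle between [z] and [v], as vectors of the plane. *)
Definition cos_angle (z v : C) : R := Re (Cmult z (Cconj v)) / (Cmod z * Cmod v).

(** Conditions (E) along the part of the curves [c w] that lies in [S w].  At the
    finitely many break points the angle condition for either tangent follows by
    continuity. *)
Definition condE (W U : C -> Prop) (K : C -> C -> C) (f : C -> C) (k0 n0 : nat)
    (b delta1 delta2 : R) (cW cU : C -> R)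
    (lo hi : Rbar) (c : C -> R -> C) (S : C -> C -> Prop) : Prop :=
  (forall w, W w -> forall t v, in_open_itv lo hi t -> S w (c w t) ->
     c w t <> RtoC 0 ->
     is_derive (K := R_AbsRing) (V := C_R_NormedModule) (c w) t v ->
     b <= Rabs (cos_angle (c w t) v)) /\
  (forall w, W w -> forall t, in_itv lo hi t -> S w (c w t) -> c w t <> RtoC 0 ->
     Cmod (K w (c w t)) <= cW w * exp (- delta1 * Cmod (c w t)) / Cmod (c w t) ^ k0) /\
  (forall w gam, W w -> U gam ->
     forall t, in_itv lo hi t -> S w (c w t) -> c w t <> RtoC 0 ->
     Cmod (dil f gam (c w t))
       <= cU gam * exp (delta2 * Cmod (c w t)) / Cmod (Cmult gam (c w t)) ^ n0).

(** [L_theta(psi)(gamma) = l], the half-line being parametrised by [xi = t e^(i theta)]. *)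
Definition is_laplace (theta : R) (psi : C -> C) (gam l : C) : Prop :=
  is_RInt_gen (V := C_R_NormedModule)
    (fun t : R =>
       let xi := Cmult (RtoC t) (cis theta) in
       Cmult (Cmult (Cexp (Copp (Cdiv xi gam))) (psi xi)) (cis theta))
    (at_point 0) (Rbar_locally p_infty) l.

Definition Usec (U : C -> Prop) (theta al : R) (gam : C) : Prop :=
  U gam /\ exists t, is_arg gam t /\ cos (theta - t) > Cmod gam * al.

(** A formal power series in [gamma] with coefficients in [O(W)]: [F m w] is the value
    at [w] of the coefficient of [gamma^m]. *)
Definition fseries := nat -> C -> C.

Definition in_gamma_OW (W : C -> Prop) (F : fseries) : Prop :=
  (forall m, holo_on W (F m)) /\ forall w, W w -> F 0%nat w = RtoC 0.

(** [borel F n w] is the coefficient of [xi^n]. *)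
Definition borel (F : fseries) : fseries :=
  fun n w => Cdiv (F (S n) w) (RtoC (INR (fact n))).

(** The power series [sum_n u_n xi^n] converges near [0], and [B] is its holomorphic
    continuation to [V] (unique when [V] is connected). *)
Definition is_continuation (u : nat -> C) (V : C -> Prop) (B : C -> C) : Prop :=
  holo_on V B /\
  locally (RtoC 0) (fun xi : C =>
    is_series (K := C_AbsRing) (V := C_NormedModule)
      (fun n => Cmult (u n) (Cpow xi n)) (B xi)).

Definition ray_domain (theta : R) (V : C -> Prop) : Prop :=
  open V /\ connected_set V /\ forall xi, ray theta xi -> V xi.

(** Borel summability in the direction [theta]: the Borel transform converges and
    continues to a neighbourhood of the closed half-line, with at most exponential
    growth along it. *)
Definition borel_summable (W : C -> Prop) (theta : R) (F : fseries) : Prop :=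
  in_gamma_OW W F /\
  forall w, W w -> exists (V : C -> Prop) (B : C -> C),
    ray_domain theta V /\ is_continuation (fun n => borel F n w) V B /\
    exists M A : R, forall xi, ray theta xi -> Cmod (B xi) <= M * exp (A * Cmod xi).

(** [phi(z) = f(z) - sum_(- n0 <= m < k0) a_m z^m] *)
Definition phi (f : C -> C) (n0 k0 : nat) (a : Z -> C) (z : C) : C :=
  Cminus (f z) (Csum (n0 + k0) (fun j =>
    Cmult (a (Z.of_nat j - Z.of_nat n0)%Z) (Czpow z (Z.of_nat j - Z.of_nat n0)%Z))).

(** [sum_(- n0 <= m < k0) a_m h_m(w) gamma^m] *)
Definition gminus (n0 k0 : nat) (a : Z -> C) (h : Z -> C -> C) (gam w : C) : C :=
  Csum (n0 + k0) (fun j =>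
    let m := (Z.of_nat j - Z.of_nat n0)%Z in
    Cmult (Cmult (a m) (h m w)) (Czpow gam m)).

(** [sum_(m >= k0) a_m h_m gamma^m] *)
Definition gplus (k0 : nat) (a : Z -> C) (h : Z -> C -> C) : fseries :=
  fun m w => if (k0 <=? m)%nat then Cmult (a (Z.of_nat m)) (h (Z.of_nat m) w)
             else RtoC 0.

(** [psi] is the inverse Laplace transform of [F], holomorphic on [V].  The Laplace
    transform is taken on [D = U_(theta, al)], where the growth bound with exponent
    [al] makes it converge; [V] is connected, so [psi] is determined on [V] by [F]. *)
Definition is_inverse_laplace (theta : R) (D V : C -> Prop) (F psi : C -> C) : Prop :=
  holo_on V psi /\ forall gam, D gam -> is_laplace theta psi gam (F gam).

Definition poly_bound (L : list (R * nat)) (x : R) : R :=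
  fold_right Rplus 0 (map (fun Cm => fst Cm * x ^ snd Cm) L).

(* Main.v *)
Require Import Defs.
From Stdlib Require Import Reals List ZArith.
From Coquelicot Require Import Coquelicot.
From Stdlib Require Import Lra Lia.

(** The Laplace transform of [psi z] equals [phi (gamma z)] only for [gamma] in a subset
    of [U]; analytic continuation in [s = e^(i theta) / gamma] extends this identity to
    all large real [s], and Watson's lemma then determines the Taylor coefficients of
    [psi z] at [0].  Thus [psi z xi = z b(z xi)] with
    [b(u) = sum_(n + 1 >= k0) a_(n+1) u^n / n!], which is entire.  By conditions (E),
    [|K dz|] has finite mass on the contour avoiding [0], so
    [B xi = int K(z) psi z xi dz] converges locally uniformly, is holomorphic, and has
    Taylor coefficients [a_(n+1) int K(z) z^(n+1) dz / n!].  The function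
    [K(z) phi(gamma z)], and likewise [K(z) z^m] for [m >= k0], has a removable
    singularity at [0]; hence Cauchy's theorem identifies these integrals with those over
    the original contour, although the deformation may cross [0].  Interchanging the
    two integrations gives the Laplace transform of [B]. *)

Open Scope R_scope.

(** * Complex differentiability *)

(** The functions [psi z] are given separately for each point of the contour, and no regularity in
    [z] is assumed, so the integral defining [B] might not even exist. The explicit form
    [z * b (z * xi)] removes this obstacle: it is holomorphic in [z], while the growth bound,
    uniform in [z], supplies the majorant. The identity to be continued is known only near one point
    [s0] of a half-plane in which [phi (z * cis theta / s)] may have poles. It is therefore
    propagated in punctured neighbourhoods, along a segment avoiding [s = 0], and Watson's lemma
    receives it only at some arbitrarily large real [s]; this suffices to compare coefficients. For
    [k0 = 0] the comparison also gives [a 0 = 0], because a Laplace transform tends to [0] at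
    infinity; hence [gplus] has no constant term. Deformations are merely continuous, so integrals
    along intermediate paths are defined by chaining segments in discs. Holomorphy of limits, of
    parametric integrals and of Laplace transforms always comes from the inequality [two_point],
    which involves only values of the function and therefore survives integration. *)

Definition has_cderiv (f : C -> C) (z l : C) : Prop :=
  forall eps, 0 < eps -> exists delta, 0 < delta /\
    forall z', Cmod (z' - z) < delta ->
      Cmod (f z' - f z - l * (z' - z)) <= eps * Cmod (z' - z).

Definition ccont (f : C -> C) (z : C) : Prop :=
  forall eps, 0 < eps -> exists delta, 0 < delta /\
    forall z', Cmod (z' - z) < delta -> Cmod (f z' - f z) < eps.

(** Only existence of the derivative at each point is asked; all further regularity comes out of
    Goursat's lemma and Cauchy's formula. *)
Definition holo_ball (f : C -> C) (z : C) (r : R) : Prop :=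
  forall z', Cmod (z' - z) < r -> exists l, has_cderiv f z' l.

Lemma locally_Cmod (z : C) (P : C -> Prop) :
  locally (T := C_UniformSpace) z P <->
  exists r, 0 < r /\ forall z', Cmod (z' - z) < r -> P z'.
Proof.
  rewrite (locally_C z P); split.
  - intros [eps H]; exists eps; split; [apply cond_pos|]; intros z' Hz'; apply H.
    exact Hz'.
  - intros [r [Hr H]]; exists (mkposreal r Hr); intros z' Hz'; apply H; exact Hz'.
Qed.

Lemma is_derive_has_cderiv (f : C -> C) (z l : C) :
  is_derive (K := C_AbsRing) (V := C_NormedModule) f z l <-> has_cderiv f z l.
Proof.
  split.
  - intros [_ H] eps Heps.
    specialize (H z (fun P HP => HP) (mkposreal eps Heps)).
    destruct H as [d Hd]; exists d; split; [apply cond_pos|]; intros z' Hz'.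
    specialize (Hd z' Hz').
    assert (E : (f z' - f z - l * (z' - z))%C =
      minus (minus (f z') (f z)) (scal (V := C_NormedModule) (minus (G := C_AbelianGroup) z' z) l)).
    { unfold minus, plus, opp, scal; simpl; unfold mult; simpl. ring. }
    rewrite E. exact Hd.
  - intros H; split; [apply is_linear_scal_l|].
    intros x Hx eps. rewrite <- (is_filter_lim_locally_unique _ _ Hx).
    destruct (H eps (cond_pos eps)) as [d [Hd0 Hd]]; exists (mkposreal d Hd0); intros z' Hz'.
    specialize (Hd z' Hz').
    assert (E : (f z' - f z - l * (z' - z))%C =
      minus (minus (f z') (f z)) (scal (V := C_NormedModule) (minus (G := C_AbelianGroup) z' z) l)).
    { unfold minus, plus, opp, scal; simpl; unfold mult; simpl. ring. }
    rewrite E in Hd. exact Hd.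
Qed.

Lemma holo_at_ball (f : C -> C) (z : C) :
  holo_at f z <-> exists r, 0 < r /\ holo_ball f z r.
Proof.
  unfold holo_at; rewrite locally_Cmod; split; intros [r [Hr H]]; exists r; split; trivial;
    intros z' Hz'; destruct (H z' Hz') as [l Hl]; exists l; apply is_derive_has_cderiv; exact Hl.
Qed.

Lemma Cmod_minus_sym (x y : C) : Cmod (x - y) = Cmod (y - x).
Proof. rewrite <- Cmod_opp; f_equal; ring. Qed.

Lemma Cmod_tri3 (x y z : C) : Cmod (x - z) <= Cmod (x - y) + Cmod (y - z).
Proof. replace (x - z)%C with ((x - y) + (y - z))%C by ring; apply Cmod_triangle. Qed.

Lemma Cmod_minus_le (x y : C) : Cmod (x - y) <= Cmod x + Cmod y.
Proof. rewrite <- (Cmod_opp y); apply Cmod_triangle. Qed.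

Lemma Cmod_minus_ge (x y : C) : Cmod x - Cmod y <= Cmod (x - y).
Proof.
  assert (H := Cmod_triangle (x - y) y).
  replace (x - y + y)%C with x in H by ring; lra.
Qed.

Lemma Cmod_le_small (x : C) : (forall eps, 0 < eps -> Cmod x <= eps) -> x = 0.
Proof.
  intros H; apply Cmod_eq_0; apply Rle_antisym; [|apply Cmod_ge_0].
  apply le_epsilon; intros e He; rewrite Rplus_0_l; auto.
Qed.

Lemma Cminus_eq_0 (x y : C) : (x - y)%C = 0 -> x = y.
Proof. intros H; replace x with (x - y + y)%C by ring; rewrite H; ring. Qed.

Lemma has_cderiv_ccont (f : C -> C) (z l : C) : has_cderiv f z l -> ccont f z.
Proof.
  intros H eps Heps. destruct (H 1 Rlt_0_1) as [d [Hd Hf]].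
  assert (Hl := Cmod_ge_0 l).
  exists (Rmin d (eps / (2 + Cmod l))); split.
  { apply Rmin_pos; trivial; apply Rdiv_lt_0_compat; lra. }
  intros z' Hz'. specialize (Hf z' (Rlt_le_trans _ _ _ Hz' (Rmin_l _ _))).
  assert (Hz2 := Rlt_le_trans _ _ _ Hz' (Rmin_r _ _)).
  replace (f z' - f z)%C with ((f z' - f z - l * (z' - z)) + l * (z' - z))%C by ring.
  eapply Rle_lt_trans; [apply Cmod_triangle|]. rewrite Cmod_mult.
  assert (H2 : Cmod (z' - z) * (2 + Cmod l) < eps).
  { replace eps with (eps / (2 + Cmod l) * (2 + Cmod l)) by (field; lra).
    apply Rmult_lt_compat_r; lra. }
  assert (H3 := Cmod_ge_0 (z' - z)). lra.
Qed.

Lemma has_cderiv_locally_ext (f g : C -> C) (z l : C) (r : R) :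
  0 < r -> (forall z', Cmod (z' - z) < r -> f z' = g z') -> has_cderiv f z l -> has_cderiv g z l.
Proof.
  intros Hr E H eps Heps. destruct (H eps Heps) as [d [Hd Hf]].
  exists (Rmin d r); split; [apply Rmin_pos; trivial|]. intros z' Hz'.
  rewrite <- !E.
  - apply Hf; eapply Rlt_le_trans; [exact Hz'|apply Rmin_l].
  - replace (z - z)%C with (RtoC 0) by ring; rewrite Cmod_0; trivial.
  - eapply Rlt_le_trans; [exact Hz'|apply Rmin_r].
Qed.

Lemma has_cderiv_const (a z : C) : has_cderiv (fun _ => a) z 0.
Proof.
  intros eps He; exists 1; split; [lra|]; intros z' _.
  replace (a - a - 0 * (z' - z))%C with (RtoC 0) by ring; rewrite Cmod_0.
  apply Rmult_le_pos; [lra|apply Cmod_ge_0].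
Qed.

Lemma has_cderiv_id (z : C) : has_cderiv (fun x => x) z 1.
Proof.
  intros eps He; exists 1; split; [lra|]; intros z' _.
  replace (z' - z - 1 * (z' - z))%C with (RtoC 0) by ring; rewrite Cmod_0.
  apply Rmult_le_pos; [lra|apply Cmod_ge_0].
Qed.

Lemma has_cderiv_plus (f g : C -> C) (z l m : C) :
  has_cderiv f z l -> has_cderiv g z m -> has_cderiv (fun x => f x + g x)%C z (l + m).
Proof.
  rewrite <- !is_derive_has_cderiv; intros H1 H2.
  exact (is_derive_plus (K := C_AbsRing) (V := C_NormedModule) f g z l m H1 H2).
Qed.

Lemma has_cderiv_comp (f g : C -> C) (z l m : C) :
  has_cderiv f (g z) l -> has_cderiv g z m -> has_cderiv (fun x => f (g x)) z (m * l).
Proof.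
  intros H1 H2 eps Heps.
  assert (Hl := Cmod_ge_0 l). assert (Hm := Cmod_ge_0 m).
  (* The cap [1] gives [Cmod (g z' - g z) <= (1 + Cmod m) * D] near [z], which turns the error of
     [f] into a multiple of [D]. *)
  set (e2 := Rmin 1 (eps / (2 * (1 + Cmod l)))).
  assert (He2 : 0 < e2) by (apply Rmin_pos; [lra|apply Rdiv_lt_0_compat; lra]).
  set (e1 := eps / (2 * (1 + Cmod m))).
  assert (He1 : 0 < e1) by (apply Rdiv_lt_0_compat; lra).
  destruct (H1 e1 He1) as [d1 [Hd1 Hf]].
  destruct (has_cderiv_ccont _ _ _ H2 d1 Hd1) as [d2 [Hd2 Hg]].
  destruct (H2 e2 He2) as [d3 [Hd3 Hg']].
  exists (Rmin d2 d3); split; [apply Rmin_pos; trivial|]; intros z' Hz'.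
  specialize (Hg z' (Rlt_le_trans _ _ _ Hz' (Rmin_l _ _))).
  specialize (Hg' z' (Rlt_le_trans _ _ _ Hz' (Rmin_r _ _))).
  specialize (Hf (g z') Hg).
  set (D := Cmod (z' - z)) in *. assert (HD : 0 <= D) by apply Cmod_ge_0.
  assert (HgD : Cmod (g z' - g z) <= (1 + Cmod m) * D).
  { replace (g z' - g z)%C with ((g z' - g z - m * (z' - z)) + m * (z' - z))%C by ring.
    eapply Rle_trans; [apply Cmod_triangle|]. rewrite Cmod_mult; fold D.
    assert (e2 * D <= 1 * D) by (apply Rmult_le_compat_r; [trivial|apply Rmin_l]). lra. }
  replace (f (g z') - f (g z) - m * l * (z' - z))%C with
    ((f (g z') - f (g z) - l * (g z' - g z)) + l * (g z' - g z - m * (z' - z)))%C by ring.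
  eapply Rle_trans; [apply Cmod_triangle|]. rewrite Cmod_mult.
  assert (A1 : Cmod (f (g z') - f (g z) - l * (g z' - g z)) <= eps / 2 * D).
  { eapply Rle_trans; [exact Hf|].
    replace (eps / 2 * D) with (e1 * ((1 + Cmod m) * D)) by (unfold e1; field; lra).
    apply Rmult_le_compat_l; lra. }
  assert (A2 : Cmod l * Cmod (g z' - g z - m * (z' - z)) <= eps / 2 * D).
  { apply Rle_trans with (Cmod l * (e2 * D)); [apply Rmult_le_compat_l; trivial|].
    apply Rle_trans with (Cmod l * (eps / (2 * (1 + Cmod l)) * D)).
    - apply Rmult_le_compat_l; trivial; apply Rmult_le_compat_r; trivial; apply Rmin_r.
    - replace (Cmod l * (eps / (2 * (1 + Cmod l)) * D)) with
        ((Cmod l / (1 + Cmod l)) * (eps / 2 * D)) by (field; lra).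
      rewrite <- (Rmult_1_l (eps / 2 * D)) at 2. apply Rmult_le_compat_r.
      + apply Rmult_le_pos; lra.
      + apply Rmult_le_reg_r with (1 + Cmod l); [lra|].
        unfold Rdiv; rewrite Rmult_assoc, Rinv_l; lra. }
  lra.
Qed.

Lemma has_cderiv_mult (f g : C -> C) (z l m : C) :
  has_cderiv f z l -> has_cderiv g z m ->
  has_cderiv (fun x => f x * g x)%C z (l * g z + f z * m).
Proof.
  intros H1 H2 eps Heps.
  assert (Pl := Cmod_ge_0 l). assert (Pf := Cmod_ge_0 (f z)). assert (Pg := Cmod_ge_0 (g z)).
  set (e := Rmin 1 (eps / (3 * (1 + Cmod l + Cmod (f z) + Cmod (g z))))).
  assert (He : 0 < e) by (apply Rmin_pos; [lra|apply Rdiv_lt_0_compat; lra]).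
  assert (He2 : e * (1 + Cmod l + Cmod (f z) + Cmod (g z)) <= eps / 3).
  { apply Rle_trans with (eps / (3 * (1 + Cmod l + Cmod (f z) + Cmod (g z))) *
      (1 + Cmod l + Cmod (f z) + Cmod (g z))).
    - apply Rmult_le_compat_r; [lra|apply Rmin_r].
    - right; field; lra. }
  assert (He1 : e <= 1) by apply Rmin_l.
  destruct (H1 e He) as [d1 [Hd1 A1]]. destruct (H2 e He) as [d2 [Hd2 A2]].
  destruct (has_cderiv_ccont _ _ _ H2 e He) as [d3 [Hd3 A3]].
  exists (Rmin d1 (Rmin d2 d3)); split; [repeat apply Rmin_pos; trivial|]; intros z' Hz'.
  specialize (A1 z' (Rlt_le_trans _ _ _ Hz' (Rmin_l _ _))).
  assert (Hz2 := Rlt_le_trans _ _ _ Hz' (Rmin_r _ _)).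
  specialize (A2 z' (Rlt_le_trans _ _ _ Hz2 (Rmin_l _ _))).
  specialize (A3 z' (Rlt_le_trans _ _ _ Hz2 (Rmin_r _ _))).
  set (D := Cmod (z' - z)) in *. assert (HD : 0 <= D) by apply Cmod_ge_0.
  replace (f z' * g z' - f z * g z - (l * g z + f z * m) * (z' - z))%C with
    ((f z' - f z - l * (z' - z)) * g z' + (l * (z' - z) * (g z' - g z)
      + f z * (g z' - g z - m * (z' - z))))%C by ring.
  eapply Rle_trans; [apply Cmod_triangle|].
  eapply Rle_trans; [apply Rplus_le_compat_l, Cmod_triangle|].
  rewrite !Cmod_mult; fold D.
  assert (Hg' : Cmod (g z') <= 1 + Cmod (g z)).
  { replace (g z') with ((g z' - g z) + g z)%C by ring.
    eapply Rle_trans; [apply Cmod_triangle|]. lra. }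
  assert (B1 : Cmod (f z' - f z - l * (z' - z)) * Cmod (g z') <= (e * D) * (1 + Cmod (g z))).
  { apply Rmult_le_compat; trivial; apply Cmod_ge_0. }
  assert (B2 : Cmod l * D * Cmod (g z' - g z) <= Cmod l * D * e).
  { apply Rmult_le_compat_l; [apply Rmult_le_pos; trivial|lra]. }
  assert (B3 : Cmod (f z) * Cmod (g z' - g z - m * (z' - z)) <= Cmod (f z) * (e * D)).
  { apply Rmult_le_compat_l; trivial. }
  assert (B4 : e * (1 + Cmod l + Cmod (f z) + Cmod (g z)) * D <= eps / 3 * D).
  { apply Rmult_le_compat_r; trivial. }
  assert (0 <= eps * D) by (apply Rmult_le_pos; lra).
  lra.
Qed.

Lemma has_cderiv_inv (z : C) : z <> 0 -> has_cderiv Cinv z (- / (z * z)).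
Proof.
  intros Hz eps Heps.
  assert (Hm : 0 < Cmod z) by (apply Cmod_gt_0; trivial).
  (* The first bound keeps [Cmod z' >= Cmod z / 2]; the second pays for the denominator of the error
     term [(z' - z)^2 / (z' z^2)], whose modulus is then at least [Cmod z ^ 3 / 2]. *)
  exists (Rmin (Cmod z / 2) (eps * (Cmod z ^ 3) / 2)); split.
  { apply Rmin_pos; [lra|]. apply Rmult_lt_0_compat; [|lra].
    apply Rmult_lt_0_compat; [trivial|apply pow_lt; trivial]. }
  intros z' Hz'.
  assert (H1 := Rlt_le_trans _ _ _ Hz' (Rmin_l _ _)).
  assert (H2 := Rlt_le_trans _ _ _ Hz' (Rmin_r _ _)).
  assert (H3 : Cmod z / 2 <= Cmod z').
  { assert (H := Cmod_minus_ge z (z - z')). replace (z - (z - z'))%C with z' in H by ring.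
    rewrite Cmod_minus_sym in H1. lra. }
  assert (Hz'0 : z' <> 0) by (apply Cmod_gt_0; lra).
  replace (/ z' - / z - - / (z * z) * (z' - z))%C with
     ((z' - z) * ((z' - z) / (z' * (z * z))))%C by (field; auto).
  rewrite Cmod_mult, Rmult_comm. apply Rmult_le_compat_r; [apply Cmod_ge_0|].
  rewrite Cmod_div by (repeat apply Cmult_neq_0; trivial).
  rewrite !Cmod_mult.
  apply Rle_trans with (eps * Cmod z ^ 3 / 2 / (Cmod z / 2 * (Cmod z * Cmod z))).
  2: { right; field; lra. }
  assert (0 < Cmod z * Cmod z) by (apply Rmult_lt_0_compat; trivial).
  apply Rmult_le_compat.
  - apply Cmod_ge_0.
  - left; apply Rinv_0_lt_compat; apply Rmult_lt_0_compat; trivial; lra.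
  - lra.
  - apply Rinv_le_contravar; [apply Rmult_lt_0_compat; lra|].
    apply Rmult_le_compat_r; lra.
Qed.

Lemma has_cderiv_pow (n : nat) (z : C) : exists l, has_cderiv (fun x => Cpow x n) z l.
Proof.
  induction n as [|n [l IH]].
  - exists 0; exact (has_cderiv_const 1 z).
  - exists (1 * Cpow z n + z * l)%C. exact (has_cderiv_mult _ _ _ _ _ (has_cderiv_id z) IH).
Qed.

Definition deriv_at (f : C -> C) (z : C) : Prop := exists l, has_cderiv f z l.

Lemma deriv_at_mult (f g : C -> C) (z : C) :
  deriv_at f z -> deriv_at g z -> deriv_at (fun x => f x * g x)%C z.
Proof. intros [l Hl] [m Hm]; eexists; apply has_cderiv_mult; eassumption. Qed.
Lemma deriv_at_plus (f g : C -> C) (z : C) :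
  deriv_at f z -> deriv_at g z -> deriv_at (fun x => f x + g x)%C z.
Proof. intros [l Hl] [m Hm]; eexists; apply has_cderiv_plus; eassumption. Qed.
Lemma deriv_at_const (a z : C) : deriv_at (fun _ => a) z.
Proof. eexists; apply has_cderiv_const. Qed.
Lemma deriv_at_id (z : C) : deriv_at (fun x => x) z.
Proof. eexists; apply has_cderiv_id. Qed.
Lemma deriv_at_comp (f g : C -> C) (z : C) :
  deriv_at f (g z) -> deriv_at g z -> deriv_at (fun x => f (g x)) z.
Proof. intros [l Hl] [m Hm]; eexists; apply has_cderiv_comp; eassumption. Qed.
Lemma deriv_at_pow (n : nat) (z : C) : deriv_at (fun x => Cpow x n) z.
Proof. apply has_cderiv_pow. Qed.
Lemma deriv_at_inv (z : C) : z <> 0 -> deriv_at Cinv z.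
Proof. eexists; apply has_cderiv_inv; trivial. Qed.
Lemma deriv_at_ext (f g : C -> C) (z : C) (r : R) :
  0 < r -> (forall z', Cmod (z' - z) < r -> f z' = g z') -> deriv_at f z -> deriv_at g z.
Proof. intros Hr E [l Hl]; exists l; eapply has_cderiv_locally_ext; eassumption. Qed.
Lemma deriv_at_opp (f : C -> C) (z : C) : deriv_at f z -> deriv_at (fun x => - f x)%C z.
Proof.
  intros H. apply deriv_at_ext with (f := fun x => (- (1) * f x)%C) (r := 1); [lra| |].
  - intros; ring.
  - apply deriv_at_mult; [apply deriv_at_const|trivial].
Qed.
Lemma deriv_at_minus (f g : C -> C) (z : C) :
  deriv_at f z -> deriv_at g z -> deriv_at (fun x => f x - g x)%C z.
Proof. intros Hf Hg; apply deriv_at_plus; [trivial|apply deriv_at_opp; trivial]. Qed.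
Lemma deriv_at_ccont (f : C -> C) (z : C) : deriv_at f z -> ccont f z.
Proof. intros [l Hl]; eapply has_cderiv_ccont; eassumption. Qed.

(** * Integrals of complex-valued functions of a real variable *)

Notation is_CInt := (is_RInt (V := C_R_NormedModule)).
Definition CInt (u : R -> C) (a b : R) : C := RInt (V := C_R_CompleteNormedModule) u a b.
Notation ccurve_cont c := (continuous (U := C_UniformSpace) (c : R -> C)).

Lemma continuous_Cmod (c : R -> C) (t : R) :
  ccurve_cont c t <->
  forall eps, 0 < eps -> exists delta, 0 < delta /\
    forall s, Rabs (s - t) < delta -> Cmod (c s - c t) < eps.
Proof.
  split.
  - intros H eps Heps.
    destruct (H (fun z => Cmod (z - c t) < eps)) as [d Hd].
    + apply locally_Cmod. exists eps; split; trivial.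
    + exists d; split; [apply cond_pos|]. intros s Hs; apply Hd, Hs.
  - intros H P HP. apply locally_Cmod in HP; destruct HP as [r [Hr HP]].
    destruct (H r Hr) as [d [Hd H']]. exists (mkposreal d Hd). intros s Hs; apply HP, H', Hs.
Qed.

Lemma is_CInt_Re_Im (u : R -> C) (a b : R) (l : C) :
  is_CInt u a b l <->
  is_RInt (V := R_NormedModule) (fun t => Re (u t)) a b (Re l) /\
  is_RInt (V := R_NormedModule) (fun t => Im (u t)) a b (Im l).
Proof.
  split.
  - intros H; split.
    + exact (is_RInt_fct_extend_fst (U := R_NormedModule) (V := R_NormedModule) u a b l H).
    + exact (is_RInt_fct_extend_snd (U := R_NormedModule) (V := R_NormedModule) u a b l H).
  - intros [H1 H2]. destruct l as [l1 l2].
    exact (is_RInt_fct_extend_pair (U := R_NormedModule) (V := R_NormedModule) u a b l1 l2 H1 H2).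
Qed.

Lemma is_CInt_plus (u v : R -> C) (a b : R) (l m : C) :
  is_CInt u a b l -> is_CInt v a b m -> is_CInt (fun t => u t + v t)%C a b (l + m)%C.
Proof. apply (is_RInt_plus (V := C_R_NormedModule)). Qed.

Lemma is_CInt_minus (u v : R -> C) (a b : R) (l m : C) :
  is_CInt u a b l -> is_CInt v a b m -> is_CInt (fun t => u t - v t)%C a b (l - m)%C.
Proof. apply (is_RInt_minus (V := C_R_NormedModule)). Qed.

Lemma is_CInt_mult_l (k : C) (u : R -> C) (a b : R) (l : C) :
  is_CInt u a b l -> is_CInt (fun t => k * u t)%C a b (k * l)%C.
Proof.
  rewrite !is_CInt_Re_Im; intros [H1 H2]; split.
  - exact (is_RInt_minus (V := R_NormedModule) _ _ _ _ _ _
      (is_RInt_scal (V := R_NormedModule) _ _ _ (Re k) _ H1)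
      (is_RInt_scal (V := R_NormedModule) _ _ _ (Im k) _ H2)).
  - exact (is_RInt_plus (V := R_NormedModule) _ _ _ _ _ _
      (is_RInt_scal (V := R_NormedModule) _ _ _ (Re k) _ H2)
      (is_RInt_scal (V := R_NormedModule) _ _ _ (Im k) _ H1)).
Qed.

Lemma is_CInt_mult_r (k : C) (u : R -> C) (a b : R) (l : C) :
  is_CInt u a b l -> is_CInt (fun t => u t * k)%C a b (l * k)%C.
Proof.
  intros H. rewrite Cmult_comm.
  apply (is_RInt_ext (V := C_R_NormedModule)) with (fun t => k * u t)%C.
  - intros; apply Cmult_comm.
  - apply is_CInt_mult_l, H.
Qed.

Lemma is_CInt_ext (u v : R -> C) (a b : R) (l : C) :
  a <= b -> (forall t, a < t < b -> u t = v t) -> is_CInt u a b l -> is_CInt v a b l.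
Proof.
  intros Hab E. apply (is_RInt_ext (V := C_R_NormedModule)).
  rewrite Rmin_left, Rmax_right by trivial. exact E.
Qed.

Lemma is_CInt_const (k : C) (a b : R) : is_CInt (fun _ => k) a b (RtoC (b - a) * k)%C.
Proof.
  replace (RtoC (b - a) * k)%C with (scal (V := C_R_NormedModule) (b - a) k).
  - apply (is_RInt_const (V := C_R_NormedModule)).
  - apply injective_projections; unfold scal; simpl; unfold scal; simpl; unfold mult; simpl; ring.
Qed.

Lemma is_CInt_Chasles (u : R -> C) (a b c : R) (l m : C) :
  is_CInt u a b l -> is_CInt u b c m -> is_CInt u a c (l + m)%C.
Proof. apply (is_RInt_Chasles (V := C_R_NormedModule)). Qed.

Lemma is_CInt_unique2 (u : R -> C) (a b : R) (l m : C) :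
  is_CInt u a b l -> is_CInt u a b m -> l = m.
Proof.
  intros H1 H2.
  rewrite <- (is_RInt_unique (V := C_R_CompleteNormedModule) _ _ _ _ H1).
  exact (is_RInt_unique (V := C_R_CompleteNormedModule) _ _ _ _ H2).
Qed.

Lemma is_CInt_cont (u : R -> C) (a b : R) :
  a <= b -> (forall t, a <= t <= b -> ccurve_cont u t) -> is_CInt u a b (CInt u a b).
Proof.
  intros Hab H. apply (RInt_correct (V := C_R_CompleteNormedModule)).
  apply (ex_RInt_continuous (V := C_R_CompleteNormedModule)).
  rewrite Rmin_left, Rmax_right by trivial. exact H.
Qed.

Lemma is_CInt_Cmod_le (u : R -> C) (w : R -> R) (a b : R) (l : C) (m : R) :
  a <= b -> (forall t, a < t < b -> Cmod (u t) <= w t) ->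
  is_CInt u a b l -> is_RInt (V := R_NormedModule) w a b m -> Cmod l <= m.
Proof.
  intros Hab Hle Hu Hw. rewrite Cmod_norm.
  (* The majorization is known only inside the interval, whereas [norm_RInt_le] wants it at the ends
     too. Both integrands are set to [0] there, which changes neither integral. *)
  set (inn := fun t => if Rlt_dec a t then if Rlt_dec t b then true else false else false).
  set (u' := fun t => if inn t then u t else RtoC 0).
  set (w' := fun t => if inn t then w t else 0).
  assert (Hin : forall t, a < t < b -> inn t = true).
  { intros t [H1 H2]; unfold inn; destruct (Rlt_dec a t), (Rlt_dec t b); tauto. }
  apply (norm_RInt_le (V := C_R_NormedModule) u' w' a b l m Hab).
  - intros t _. eapply Rle_trans; [right; symmetry; apply Cmod_norm|]. unfold u', w', inn.
    destruct (Rlt_dec a t), (Rlt_dec t b); try (rewrite Cmod_0; lra). apply Hle; lra.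
  - apply is_CInt_ext with u; trivial. intros t Ht; unfold u'; rewrite Hin; trivial.
  - apply (is_RInt_ext (V := R_NormedModule)) with w; trivial.
    rewrite Rmin_left, Rmax_right by trivial. intros t Ht; unfold w'; rewrite Hin; trivial.
Qed.

Lemma is_CInt_Cmod_le_const (u : R -> C) (a b : R) (l : C) (M : R) :
  a <= b -> (forall t, a < t < b -> Cmod (u t) <= M) ->
  is_CInt u a b l -> Cmod l <= M * (b - a).
Proof.
  intros Hab Hle Hu. apply is_CInt_Cmod_le with u (fun _ => M) a b; trivial.
  rewrite Rmult_comm. apply (is_RInt_const (V := R_NormedModule) a b M).
Qed.

Lemma is_derive_C_eps (c : R -> C) (t : R) (v : C) :
  is_derive (K := R_AbsRing) (V := C_R_NormedModule) c t v <->
  forall eps, 0 < eps -> exists delta, 0 < delta /\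
    forall s, Rabs (s - t) < delta ->
      Cmod (c s - c t - v * RtoC (s - t)) <= eps * Rabs (s - t).
Proof.
  assert (E : forall s, (c s - c t - v * RtoC (s - t))%C =
      minus (G := C_R_NormedModule) (minus (G := C_R_NormedModule) (c s) (c t))
        (scal (V := C_R_NormedModule) (minus (G := R_AbelianGroup) s t) v)).
  { intros s. apply injective_projections; unfold minus, plus, opp, scal; simpl;
    unfold mult, plus, opp; simpl; unfold scal, plus, opp; simpl; unfold mult; simpl; ring. }
  split.
  - intros [_ H] eps Heps.
    destruct (H t (fun P HP => HP) (mkposreal eps Heps)) as [d Hd].
    exists d; split; [apply cond_pos|]; intros s Hs.
    specialize (Hd s Hs). rewrite E, Cmod_norm. exact Hd.
  - intros H; split; [apply is_linear_scal_l|].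
    intros x Hx eps. rewrite <- (is_filter_lim_locally_unique _ _ Hx).
    destruct (H eps (cond_pos eps)) as [d [Hd0 Hd]]; exists (mkposreal d Hd0); intros s Hs.
    specialize (Hd s Hs). rewrite E, Cmod_norm in Hd. exact Hd.
Qed.

Lemma is_derive_C_Re_Im (c : R -> C) (t : R) (v : C) :
  is_derive (K := R_AbsRing) (V := C_R_NormedModule) c t v ->
  is_derive (fun s => Re (c s)) t (Re v) /\ is_derive (fun s => Im (c s)) t (Im v).
Proof.
  rewrite is_derive_C_eps; intros H.
  (* Both coordinates are real-linear functionals bounded by the modulus, so one argument serves for
     [Re] and [Im]. *)
  assert (G : forall (q : C -> R), (forall x y, q (x - y)%C = q x - q y) ->
    (forall x (k : R), q (x * RtoC k)%C = q x * k) -> (forall x, Rabs (q x) <= Cmod x) ->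
     is_derive (fun x => q (c x)) t (q v)).
  { intros q Hq1 Hq2 Hq3. split; [apply is_linear_scal_l|].
    intros x Hx eps. rewrite <- (is_filter_lim_locally_unique _ _ Hx).
    destruct (H eps (cond_pos eps)) as [d [Hd0 Hd]]; exists (mkposreal d Hd0); intros s Hs.
    specialize (Hd s Hs). eapply Rle_trans; [|exact Hd].
    eapply Rle_trans; [|apply Hq3]. right. rewrite !Hq1, Hq2.
    change (Rabs (q (c s) - q (c t) - (s - t) * q v) = Rabs (q (c s) - q (c t) - q v * (s - t))).
    f_equal; ring. }
  split.
  - apply (G Re).
    + intros; reflexivity.
    + intros [x1 x2] k; simpl; ring.
    + apply re_le_Cmod.
  - apply (G Im).
    + intros; reflexivity.
    + intros [x1 x2] k; simpl; ring.
    + intros x. eapply Rle_trans; [|apply Rmax_Cmod]. apply Rmax_r.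
Qed.

Lemma is_derive_C_velocity (c : R -> C) (t : R) (v : C) :
  is_derive (K := R_AbsRing) (V := C_R_NormedModule) c t v -> velocity c t = v.
Proof.
  intros H. destruct (is_derive_C_Re_Im c t v H) as [H1 H2]. unfold velocity.
  destruct v as [v1 v2]. f_equal; apply is_derive_unique; assumption.
Qed.

Lemma ccont_curve (f : C -> C) (c : R -> C) (t : R) :
  ccont f (c t) -> ccurve_cont c t -> ccurve_cont (fun s => f (c s)) t.
Proof.
  rewrite !continuous_Cmod; intros Hf Hc eps Heps.
  destruct (Hf eps Heps) as [d [Hd Hf']]. destruct (Hc d Hd) as [d' [Hd' Hc']].
  exists d'; split; trivial; intros s Hs; apply Hf', Hc', Hs.
Qed.

Lemma ccurve_cont_mult (u v : R -> C) (t : R) :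
  ccurve_cont u t -> ccurve_cont v t -> ccurve_cont (fun s => u s * v s)%C t.
Proof.
  rewrite !continuous_Cmod; intros Hu Hv eps Heps.
  assert (P1 := Cmod_ge_0 (u t)). assert (P2 := Cmod_ge_0 (v t)).
  destruct (Hu (eps / (2 * (1 + Cmod (v t))))) as [d1 [Hd1 H1]].
  { apply Rdiv_lt_0_compat; lra. }
  destruct (Hv (Rmin 1 (eps / (2 * (1 + Cmod (u t)))))) as [d2 [Hd2 H2]].
  { apply Rmin_pos; [lra|]. apply Rdiv_lt_0_compat; lra. }
  exists (Rmin d1 d2); split; [apply Rmin_pos; trivial|]; intros s Hs.
  specialize (H1 s (Rlt_le_trans _ _ _ Hs (Rmin_l _ _))).
  specialize (H2 s (Rlt_le_trans _ _ _ Hs (Rmin_r _ _))).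
  assert (H3 := Rlt_le_trans _ _ _ H2 (Rmin_l _ _)).
  assert (H4 := Rlt_le_trans _ _ _ H2 (Rmin_r _ _)).
  replace (u s * v s - u t * v t)%C with ((u s - u t) * v s + u t * (v s - v t))%C by ring.
  eapply Rle_lt_trans; [apply Cmod_triangle|]; rewrite !Cmod_mult.
  assert (Hvs : Cmod (v s) <= 1 + Cmod (v t)).
  { replace (v s) with ((v s - v t) + v t)%C by ring.
    eapply Rle_trans; [apply Cmod_triangle|]. lra. }
  assert (Cmod (u s - u t) * Cmod (v s) < eps / 2).
  { apply Rle_lt_trans with (Cmod (u s - u t) * (1 + Cmod (v t))).
    - apply Rmult_le_compat_l; [apply Cmod_ge_0|trivial].
    - replace (eps / 2) with (eps / (2 * (1 + Cmod (v t))) * (1 + Cmod (v t))) by (field; lra).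
      apply Rmult_lt_compat_r; lra. }
  assert (Cmod (u t) * Cmod (v s - v t) <= eps / 2).
  { apply Rle_trans with ((1 + Cmod (u t)) * (eps / (2 * (1 + Cmod (u t))))).
    - apply Rmult_le_compat; try lra. apply Cmod_ge_0.
    - right; field; lra. }
  lra.
Qed.

(** * Goursat's lemma *)

Lemma C_filter_cauchy {T : Type} (F : (T -> Prop) -> Prop) (FF : ProperFilter F) (f : T -> C) :
  (forall eps, 0 < eps -> exists P, F P /\ forall u v, P u -> P v -> Cmod (f u - f v) < eps) ->
  exists y : C, forall eps, 0 < eps -> F (fun x => Cmod (f x - y) < eps).
Proof.
  intros H.
  destruct (proj1 (filterlim_locally_cauchy (U := C_R_CompleteNormedModule) (F := F) f)) as [y Hy].
  - intros eps. destruct (H eps (cond_pos eps)) as [P [HP H']]. exists P; split; trivial.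
    intros u v Hu Hv. apply (C_NormedModule_mixin_compat1 (f u) (f v)).
    unfold minus, plus, opp; simpl. apply (H' v u Hv Hu).
  - exists y. intros eps Heps.
    apply (Hy (fun z => Cmod (z - y) < eps)). apply locally_Cmod. exists eps; split; trivial.
Qed.

(** The explicit rate is what the two applications need: nested triangles in Goursat's lemma, and
    difference quotients along [r / 2 ^ n] in [two_point_deriv]. *)
Lemma C_seq_geometric (u : nat -> C) (K : R) :
  (forall n, Cmod (u (S n) - u n) <= K / 2 ^ n) ->
  exists z, forall n, Cmod (u n - z) <= 2 * K / 2 ^ n.
Proof.
  intros H.
  assert (P2 : forall n, 0 < 2 ^ n) by (intros; apply pow_lt; lra).
  assert (HK : 0 <= K).
  { assert (H0 := H 0%nat). assert (Hc := Cmod_ge_0 (u 1%nat - u 0%nat)). simpl in H0. lra. }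
  (* Subtracting [2 * K / 2 ^ (n + k)] makes the telescoping bound exactly inductive in [k]. *)
  assert (Hnk : forall n k, Cmod (u (n + k)%nat - u n) <= 2 * K / 2 ^ n - 2 * K / 2 ^ (n + k)).
  { intros n k; induction k as [|k IH].
    - rewrite Nat.add_0_r. replace (u n - u n)%C with (RtoC 0) by ring. rewrite Cmod_0; lra.
    - rewrite Nat.add_succ_r. eapply Rle_trans; [apply Cmod_tri3 with (y := u (n + k)%nat)|].
      assert (H1 := H (n + k)%nat). simpl.
      replace (2 * K / (2 * 2 ^ (n + k))) with (K / 2 ^ (n + k)) by (field; apply Rgt_not_eq, P2).
      replace (2 * K / 2 ^ (n + k)) with (K / 2 ^ (n + k) + K / 2 ^ (n + k)) in IH
        by (field; apply Rgt_not_eq, P2). lra. }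
  assert (Hnk' : forall n k, Cmod (u (n + k)%nat - u n) <= 2 * K / 2 ^ n).
  { intros n k. assert (H1 := Hnk n k).
    assert (0 <= 2 * K / 2 ^ (n + k)).
    { apply Rmult_le_pos; [lra|left; apply Rinv_0_lt_compat, P2]. } lra. }
  assert (Hlim : forall eps, 0 < eps -> exists N, forall n, (N <= n)%nat -> 2 * K / 2 ^ n < eps).
  { intros eps Heps.
    destruct (pow_lt_1_zero (/2) ltac:(rewrite Rabs_pos_eq; lra) (eps / (2 * K + 1))
      ltac:(apply Rdiv_lt_0_compat; lra)) as [N HN].
    exists N; intros n Hn. specialize (HN n Hn).
    rewrite Rabs_pos_eq in HN by (left; apply pow_lt; lra). rewrite pow_inv in HN.
    apply Rle_lt_trans with ((2 * K + 1) * / 2 ^ n).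
    - apply Rmult_le_compat_r; [left; apply Rinv_0_lt_compat, P2|lra].
    - replace eps with ((2 * K + 1) * (eps / (2 * K + 1))) by (field; lra).
      apply Rmult_lt_compat_l; lra. }
  destruct (C_filter_cauchy eventually _ u) as [z Hz].
  { intros eps Heps. destruct (Hlim (eps / 2)) as [N HN]; [lra|].
    exists (fun n => (N <= n)%nat); split; [exists N; trivial|].
    assert (HNN := HN N (le_n N)).
    intros n m Hn Hm. eapply Rle_lt_trans; [apply Cmod_tri3 with (y := u N)|].
    assert (A := Hnk' N (n - N)%nat). assert (B := Hnk' N (m - N)%nat).
    replace (N + (n - N))%nat with n in A by lia. replace (N + (m - N))%nat with m in B by lia.
    rewrite (Cmod_minus_sym (u N)). lra. }
  exists z; intros n. apply le_epsilon; intros eps Heps.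
  destruct (Hz eps Heps) as [N HN]. specialize (HN (n + N)%nat ltac:(lia)).
  eapply Rle_trans; [apply Cmod_tri3 with (y := u (n + N)%nat)|].
  rewrite (Cmod_minus_sym (u n)). assert (A := Hnk' n N). lra.
Qed.

Definition lin (a b : C) (u : R) : C := (a + RtoC u * (b - a))%C.

Definition seg (F : C -> C) (a b : C) : C :=
  (CInt (fun u => F (lin a b u)) 0 1 * (b - a))%C.

Lemma lin_dist (a b z : C) (u : R) (d : R) :
  0 <= u <= 1 -> Cmod (a - z) <= d -> Cmod (b - z) <= d -> Cmod (lin a b u - z) <= d.
Proof.
  intros Hu Ha Hb. unfold lin.
  replace (a + RtoC u * (b - a) - z)%C with (RtoC (1 - u) * (a - z) + RtoC u * (b - z))%C
    by (rewrite RtoC_minus; ring).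
  eapply Rle_trans; [apply Cmod_triangle|]. rewrite !Cmod_mult, !Cmod_R, !Rabs_pos_eq by lra.
  replace d with ((1 - u) * d + u * d) by ring.
  apply Rplus_le_compat; apply Rmult_le_compat_l; lra.
Qed.

Lemma lin_ball (a b z : C) (u : R) (d : R) :
  0 <= u <= 1 -> Cmod (a - z) < d -> Cmod (b - z) < d -> Cmod (lin a b u - z) < d.
Proof.
  intros Hu Ha Hb. eapply Rle_lt_trans; [apply lin_dist with (d := Rmax (Cmod (a - z)) (Cmod (b - z)))|].
  - trivial.
  - apply Rmax_l.
  - apply Rmax_r.
  - apply Rmax_case; trivial.
Qed.

Lemma lin_cont (a b : C) (t : R) : ccurve_cont (lin a b) t.
Proof.
  apply continuous_Cmod. intros eps Heps. assert (H := Cmod_ge_0 (b - a)).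
  exists (eps / (1 + Cmod (b - a))); split; [apply Rdiv_lt_0_compat; lra|]. intros s Hs.
  unfold lin. replace (a + RtoC s * (b - a) - (a + RtoC t * (b - a)))%C with (RtoC (s - t) * (b - a))%C
    by (rewrite RtoC_minus; ring).
  rewrite Cmod_mult, Cmod_R.
  apply Rle_lt_trans with (Rabs (s - t) * (1 + Cmod (b - a))).
  - apply Rmult_le_compat_l; [apply Rabs_pos|lra].
  - replace eps with (eps / (1 + Cmod (b - a)) * (1 + Cmod (b - a))) at 1 by (field; lra).
    apply Rmult_lt_compat_r; lra.
Qed.

Lemma lin_0 (a b : C) : lin a b 0 = a.
Proof. unfold lin; ring. Qed.
Lemma lin_1 (a b : C) : lin a b 1 = b.
Proof. unfold lin; ring. Qed.

Definition cont_ball (F : C -> C) (z : C) (r : R) : Prop :=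
  forall z', Cmod (z' - z) < r -> ccont F z'.

Lemma holo_cont_ball (F : C -> C) (z : C) (r : R) : holo_ball F z r -> cont_ball F z r.
Proof. intros H z' Hz'; destruct (H z' Hz') as [l Hl]; eapply has_cderiv_ccont; exact Hl. Qed.

Lemma is_CInt_lin (F : C -> C) (z : C) (r : R) (a b : C) (p q : R) :
  cont_ball F z r -> Cmod (a - z) < r -> Cmod (b - z) < r -> 0 <= p <= q -> q <= 1 ->
  is_CInt (fun u => F (lin a b u)) p q (CInt (fun u => F (lin a b u)) p q).
Proof.
  intros HF Ha Hb Hpq Hq. apply is_CInt_cont; [lra|].
  intros t Ht; apply ccont_curve; [apply HF, lin_ball; trivial; lra|apply lin_cont].
Qed.

Lemma is_CInt_seg (F : C -> C) (z : C) (r : R) (a b : C) :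
  cont_ball F z r -> Cmod (a - z) < r -> Cmod (b - z) < r ->
  is_CInt (fun u => F (lin a b u) * (b - a))%C 0 1 (seg F a b).
Proof.
  intros HF Ha Hb. apply is_CInt_mult_r. apply is_CInt_lin with z r; trivial; lra.
Qed.

(** Affine substitution. No order between [p] and [q] is imposed, so the lemma cuts segments and
    reverses them alike. *)
Lemma seg_reparam (F : C -> C) (a b : C) (p q : R) (l : C) :
  is_CInt (fun u => F (lin a b u) * (b - a))%C p q l ->
  is_CInt (fun u => F (lin (lin a b p) (lin a b q) u) * (lin a b q - lin a b p))%C 0 1 l.
Proof.
  intros H.
  assert (H' := is_RInt_comp_lin (V := C_R_NormedModule) (fun u => F (lin a b u) * (b - a))%C (q - p) p 0 1 l).
  replace ((q - p) * 0 + p) with p in H' by ring. replace ((q - p) * 1 + p) with q in H' by ring.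
  specialize (H' H). revert H'. apply is_CInt_ext; [lra|]. intros t _.
  replace (lin (lin a b p) (lin a b q) t) with (lin a b ((q - p) * t + p)).
  2: { unfold lin. rewrite RtoC_plus, RtoC_mult, RtoC_minus. ring. }
  replace (lin a b q - lin a b p)%C with (RtoC (q - p) * (b - a))%C
    by (unfold lin; rewrite RtoC_minus; ring).
  apply injective_projections; simpl; unfold scal; simpl; unfold mult; simpl; ring.
Qed.

Lemma seg_swap (F : C -> C) (z : C) (r : R) (a b : C) :
  cont_ball F z r -> Cmod (a - z) < r -> Cmod (b - z) < r -> seg F b a = (- seg F a b)%C.
Proof.
  intros HF Ha Hb.
  apply is_CInt_unique2 with (fun u => F (lin b a u) * (a - b))%C 0 1.
  - apply is_CInt_seg with z r; trivial.
  - assert (H := is_CInt_seg F z r a b HF Ha Hb).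
    apply (is_RInt_swap (V := C_R_NormedModule)) in H.
    apply seg_reparam in H. rewrite lin_0, lin_1 in H. exact H.
Qed.

Lemma seg_same (F : C -> C) (a : C) : seg F a a = 0.
Proof. unfold seg; ring. Qed.

Definition mid (a b : C) : C := ((a + b) / 2)%C.

Lemma lin_half (a b : C) : lin a b (1 / 2) = mid a b.
Proof. unfold lin, mid. rewrite RtoC_div by lra. field. Qed.

Lemma seg_mid (F : C -> C) (z : C) (r : R) (a b : C) :
  cont_ball F z r -> Cmod (a - z) < r -> Cmod (b - z) < r ->
  seg F a b = (seg F a (mid a b) + seg F (mid a b) b)%C.
Proof.
  intros HF Ha Hb. symmetry.
  assert (Hm : Cmod (mid a b - z) < r) by (rewrite <- lin_half; apply lin_ball; trivial; lra).
  apply is_CInt_unique2 with (fun u => F (lin a b u) * (b - a))%C 0 1.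
  2: { apply is_CInt_seg with z r; trivial. }
  assert (H1 : is_CInt (fun u => F (lin a b u) * (b - a))%C 0 (1/2) _) by
    (apply is_CInt_mult_r, (is_CInt_lin F z r); trivial; lra).
  assert (H2 : is_CInt (fun u => F (lin a b u) * (b - a))%C (1/2) 1 _) by
    (apply is_CInt_mult_r, (is_CInt_lin F z r); trivial; lra).
  assert (H3 := is_CInt_Chasles _ _ _ _ _ _ H1 H2).
  apply seg_reparam in H1, H2. rewrite lin_0, lin_half in H1. rewrite lin_1, lin_half in H2.
  rewrite (is_CInt_unique2 _ _ _ _ _ (is_CInt_seg F z r _ _ HF Ha Hm) H1).
  rewrite (is_CInt_unique2 _ _ _ _ _ (is_CInt_seg F z r _ _ HF Hm Hb) H2). exact H3.
Qed.

(** [al * (b - a) + be * (b * b - a * a) / 2] is the integral of [al + be * z] along the segment.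
    Around a triangle these terms cancel, so an affine approximation of [F] can be subtracted for
    free. *)
Lemma seg_affine_approx (F : C -> C) (z : C) (r : R) (a b al be : C) (M : R) :
  cont_ball F z r -> Cmod (a - z) < r -> Cmod (b - z) < r ->
  (forall u, 0 <= u <= 1 -> Cmod (F (lin a b u) - (al + be * lin a b u)) <= M) ->
  Cmod (seg F a b - (al * (b - a) + be * (b * b - a * a) / 2)) <= M * Cmod (b - a).
Proof.
  intros HF Ha Hb HM.
  assert (Hu : is_CInt RtoC 0 1 (RtoC (1 / 2))).
  { apply is_CInt_Re_Im; split.
    - assert (H := is_RInt_pow 0 1 1). simpl in H.
      replace (1 * (1 * 1) / (1 + 1) - 0 * (0 * 1) / (1 + 1)) with (1 / 2) in H by field.
      revert H. apply (is_RInt_ext (V := R_NormedModule)). intros; simpl; ring.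
    - assert (H : is_RInt (V := R_NormedModule) (fun _ => 0) 0 1 ((1 - 0) * 0))
        by apply (is_RInt_const (V := R_NormedModule)).
      rewrite Rmult_0_r in H. exact H. }
  assert (Hc : is_CInt (fun _ => al + be * a)%C 0 1 (al + be * a)%C).
  { assert (H := is_CInt_const (al + be * a)%C 0 1).
    replace (RtoC (1 - 0) * (al + be * a))%C with (al + be * a)%C in H; trivial.
    rewrite RtoC_minus; ring. }
  assert (H1 := is_CInt_plus _ _ _ _ _ _ Hc (is_CInt_mult_r (be * (b - a)) _ _ _ _ Hu)).
  assert (H2 := is_CInt_minus _ _ _ _ _ _
    (is_CInt_lin F z r a b 0 1 HF Ha Hb ltac:(lra) ltac:(lra)) H1).
  apply is_CInt_Cmod_le_const with (M := M) in H2; [|lra|].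
  2: { intros t Ht. eapply Rle_trans; [|apply (HM t); lra]. right. f_equal. unfold lin. ring. }
  unfold seg. set (I := CInt _ 0 1) in *.
  replace (I * (b - a) - (al * (b - a) + be * (b * b - a * a) / 2))%C with
   ((I - (al + be * a + RtoC (1 / 2) * (be * (b - a)))) * (b - a))%C.
  - rewrite Cmod_mult. apply Rmult_le_compat_r; [apply Cmod_ge_0|]. lra.
  - rewrite RtoC_div by lra. field.
Qed.

Lemma seg_bound (F : C -> C) (z : C) (r : R) (a b v : C) (M : R) :
  cont_ball F z r -> Cmod (a - z) < r -> Cmod (b - z) < r ->
  (forall u, 0 <= u <= 1 -> Cmod (F (lin a b u) - v) <= M) ->
  Cmod (seg F a b - v * (b - a)) <= M * Cmod (b - a).
Proof.
  intros HF Ha Hb HM.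
  replace (v * (b - a))%C with (v * (b - a) + 0 * (b * b - a * a) / 2)%C by field.
  apply (seg_affine_approx F z r); trivial. intros u Hu.
  replace (v + 0 * lin a b u)%C with v by ring. apply HM; trivial.
Qed.

Definition triangle : Type := (C * C * C)%type.

Definition tri (F : C -> C) (t : triangle) : C :=
  let '(a, b, c) := t in (seg F a b + seg F b c + seg F c a)%C.

Definition per (t : triangle) : R :=
  let '(a, b, c) := t in Cmod (a - b) + Cmod (b - c) + Cmod (c - a).

Definition tri_in (t : triangle) (z : C) (r : R) : Prop :=
  let '(a, b, c) := t in Cmod (a - z) <= r /\ Cmod (b - z) <= r /\ Cmod (c - z) <= r.

Definition vertex (t : triangle) : C := fst (fst t).

(** The four quarters cut out by the midpoints, oriented like the whole triangle: each inner edge is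
    traversed twice, in opposite directions. *)
Definition sub1 (t : triangle) : triangle := let '(a, b, c) := t in (a, mid a b, mid c a).
Definition sub2 (t : triangle) : triangle := let '(a, b, c) := t in (mid a b, b, mid b c).
Definition sub3 (t : triangle) : triangle := let '(a, b, c) := t in (mid c a, mid b c, c).
Definition sub4 (t : triangle) : triangle := let '(a, b, c) := t in (mid b c, mid c a, mid a b).

(** A quarter violating the bound [eps * per ^ 2], found by deciding inequalities so that no choice
    is made. If none of the first three violates it, the fourth has to. *)
Definition sub_next (F : C -> C) (eps : R) (t : triangle) : triangle :=
  if Rlt_dec (eps * per (sub1 t) ^ 2) (Cmod (tri F (sub1 t))) then sub1 t else
  if Rlt_dec (eps * per (sub2 t) ^ 2) (Cmod (tri F (sub2 t))) then sub2 t else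
  if Rlt_dec (eps * per (sub3 t) ^ 2) (Cmod (tri F (sub3 t))) then sub3 t else sub4 t.

Lemma Cmod_half (x : C) : Cmod (x / 2) = Cmod x / 2.
Proof.
  rewrite Cmod_div, Cmod_R, Rabs_pos_eq; try lra. intros H; apply RtoC_inj in H; lra.
Qed.

Lemma per_sub (t : triangle) :
  per (sub1 t) = per t / 2 /\ per (sub2 t) = per t / 2 /\
  per (sub3 t) = per t / 2 /\ per (sub4 t) = per t / 2.
Proof.
  destruct t as [[a b] c]; unfold per, sub1, sub2, sub3, sub4, mid.
  assert (A1 : (a - (a + b) / 2)%C = ((a - b) / 2)%C) by field.
  assert (A2 : ((a + b) / 2 - (c + a) / 2)%C = ((b - c) / 2)%C) by field.
  assert (A3 : ((c + a) / 2 - a)%C = ((c - a) / 2)%C) by field.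
  assert (A4 : ((a + b) / 2 - b)%C = ((a - b) / 2)%C) by field.
  assert (A5 : (b - (b + c) / 2)%C = ((b - c) / 2)%C) by field.
  assert (A6 : ((b + c) / 2 - (a + b) / 2)%C = ((c - a) / 2)%C) by field.
  assert (A7 : ((c + a) / 2 - (b + c) / 2)%C = ((a - b) / 2)%C) by field.
  assert (A8 : ((b + c) / 2 - c)%C = ((b - c) / 2)%C) by field.
  assert (A9 : (c - (c + a) / 2)%C = ((c - a) / 2)%C) by field.
  rewrite (Cmod_minus_sym ((b + c) / 2) ((c + a) / 2)).
  rewrite (Cmod_minus_sym ((a + b) / 2) ((b + c) / 2)).
  rewrite (Cmod_minus_sym ((c + a) / 2) ((a + b) / 2)).
  rewrite A1, A2, A3, A4, A5, A6, A7, A8, A9, !Cmod_half.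
  repeat split; field.
Qed.

Lemma mid_in (a b z : C) (r : R) :
  Cmod (a - z) <= r -> Cmod (b - z) <= r -> Cmod (mid a b - z) <= r.
Proof. intros; rewrite <- lin_half; apply lin_dist; trivial; lra. Qed.

Lemma tri_in_sub (t : triangle) (z : C) (r : R) : tri_in t z r ->
  tri_in (sub1 t) z r /\ tri_in (sub2 t) z r /\ tri_in (sub3 t) z r /\ tri_in (sub4 t) z r.
Proof.
  destruct t as [[a b] c]; intros [Ha [Hb Hc]]; simpl; repeat split; trivial; apply mid_in; trivial.
Qed.

Lemma tri_sub (F : C -> C) (t : triangle) (z : C) (r r' : R) :
  cont_ball F z r -> r' < r -> tri_in t z r' ->
  tri F t = (tri F (sub1 t) + tri F (sub2 t) + tri F (sub3 t) + tri F (sub4 t))%C.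
Proof.
  intros HF Hr Ht. destruct t as [[a b] c]; destruct Ht as [Ha [Hb Hc]]; simpl.
  assert (Ha' : Cmod (a - z) < r) by lra. assert (Hb' : Cmod (b - z) < r) by lra.
  assert (Hc' : Cmod (c - z) < r) by lra.
  assert (M1 : Cmod (mid a b - z) < r) by (eapply Rle_lt_trans; [apply mid_in|]; eassumption).
  assert (M2 : Cmod (mid b c - z) < r) by (eapply Rle_lt_trans; [apply mid_in|]; eassumption).
  assert (M3 : Cmod (mid c a - z) < r) by (eapply Rle_lt_trans; [apply mid_in|]; eassumption).
  rewrite (seg_mid F z r a b), (seg_mid F z r b c), (seg_mid F z r c a) by trivial.
  rewrite (seg_swap F z r (mid a b) (mid c a)) by trivial.
  rewrite (seg_swap F z r (mid a b) (mid b c)) by trivial.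
  rewrite (seg_swap F z r (mid b c) (mid c a)) by trivial.
  ring.
Qed.

(** Perimeters halve, so [per ^ 2] is divided by four: four quarters obeying the bound would add up
    to a triangle obeying it. *)
Lemma sub_next_bad (F : C -> C) (t : triangle) (z : C) (r r' eps : R) :
  cont_ball F z r -> r' < r -> tri_in t z r' -> eps * per t ^ 2 < Cmod (tri F t) ->
  eps * per (sub_next F eps t) ^ 2 < Cmod (tri F (sub_next F eps t)).
Proof.
  intros HF Hr Ht Hb. unfold sub_next.
  destruct (Rlt_dec (eps * per (sub1 t) ^ 2) _) as [|N1]; trivial.
  destruct (Rlt_dec (eps * per (sub2 t) ^ 2) _) as [|N2]; trivial.
  destruct (Rlt_dec (eps * per (sub3 t) ^ 2) _) as [|N3]; trivial.
  destruct (Rlt_dec (eps * per (sub4 t) ^ 2) (Cmod (tri F (sub4 t)))) as [|N4]; trivial.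
  exfalso. apply Rnot_lt_le in N1, N2, N3, N4.
  destruct (per_sub t) as [E1 [E2 [E3 E4]]]. rewrite E1 in N1; rewrite E2 in N2; rewrite E3 in N3; rewrite E4 in N4.
  rewrite (tri_sub F t z r r') in Hb by trivial.
  assert (T1 := Cmod_triangle (tri F (sub1 t) + tri F (sub2 t) + tri F (sub3 t)) (tri F (sub4 t))).
  assert (T2 := Cmod_triangle (tri F (sub1 t) + tri F (sub2 t)) (tri F (sub3 t))).
  assert (T3 := Cmod_triangle (tri F (sub1 t)) (tri F (sub2 t))).
  replace (eps * (per t / 2) ^ 2) with (eps * per t ^ 2 / 4) in * by field. lra.
Qed.

Lemma sub_next_geom (F : C -> C) (eps : R) (t : triangle) (z : C) (r : R) :
  per (sub_next F eps t) = per t / 2 /\ (tri_in t z r -> tri_in (sub_next F eps t) z r) /\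
  Cmod (vertex (sub_next F eps t) - vertex t) <= per t.
Proof.
  destruct (per_sub t) as [E1 [E2 [E3 E4]]].
  assert (V : forall s, In s (sub1 t :: sub2 t :: sub3 t :: sub4 t :: nil)%list -> Cmod (vertex s - vertex t) <= per t).
  { destruct t as [[a b] c]; unfold vertex, per; simpl.
    assert (P1 := Cmod_ge_0 (a - b)). assert (P2 := Cmod_ge_0 (b - c)). assert (P3 := Cmod_ge_0 (c - a)).
    intros s [<-|[<-|[<-|[<-|[]]]]]; simpl.
    - replace (a - a)%C with (RtoC 0) by ring. rewrite Cmod_0; lra.
    - replace (mid a b - a)%C with ((b - a) / 2)%C by (unfold mid; field).
      rewrite Cmod_half, Cmod_minus_sym. lra.
    - replace (mid c a - a)%C with ((c - a) / 2)%C by (unfold mid; field).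
      rewrite Cmod_half. lra.
    - replace (mid b c - a)%C with ((b - a) / 2 + (c - a) / 2)%C by (unfold mid; field).
      eapply Rle_trans; [apply Cmod_triangle|]. rewrite !Cmod_half, (Cmod_minus_sym b a). lra. }
  assert (S := tri_in_sub t z r).
  unfold sub_next; simpl in V.
  destruct (Rlt_dec _ _); [|destruct (Rlt_dec _ _); [|destruct (Rlt_dec _ _)]];
    (split; [trivial|split; [tauto|apply V; tauto]]).
Qed.

(** The points [w] that lie in every closed disc containing the three vertices stand in for the
    convex hull of the triangle. *)
Lemma tri_affine_bound (F : C -> C) (t : triangle) (z : C) (r r' : R) (al be : C) (M : R) :
  cont_ball F z r -> r' < r -> tri_in t z r' ->
  (forall w, (forall x d, tri_in t x d -> Cmod (w - x) <= d) ->
     Cmod (F w - (al + be * w)) <= M) ->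
  Cmod (tri F t) <= M * per t.
Proof.
  intros HF Hr Ht HM. destruct t as [[a b] c]; destruct Ht as [Ha [Hb Hc]].
  assert (Ha' : Cmod (a - z) < r) by lra. assert (Hb' : Cmod (b - z) < r) by lra.
  assert (Hc' : Cmod (c - z) < r) by lra.
  assert (S1 := seg_affine_approx F z r a b al be M HF Ha' Hb').
  assert (S2 := seg_affine_approx F z r b c al be M HF Hb' Hc').
  assert (S3 := seg_affine_approx F z r c a al be M HF Hc' Ha').
  unfold tri, per.
  set (A1 := (al * (b - a) + be * (b * b - a * a) / 2)%C) in *.
  set (A2 := (al * (c - b) + be * (c * c - b * b) / 2)%C) in *.
  set (A3 := (al * (a - c) + be * (a * a - c * c) / 2)%C) in *.
  replace (seg F a b + seg F b c + seg F c a)%C with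
    ((seg F a b - A1) + (seg F b c - A2) + (seg F c a - A3))%C by (unfold A1, A2, A3; field).
  eapply Rle_trans; [apply Cmod_triangle|]. eapply Rle_trans; [apply Rplus_le_compat_r, Cmod_triangle|].
  rewrite !Rmult_plus_distr_l.
  rewrite (Cmod_minus_sym a b), (Cmod_minus_sym b c), (Cmod_minus_sym c a).
  repeat apply Rplus_le_compat; [apply S1|apply S2|apply S3]; intros u Hu; apply HM;
    intros x d [X1 [X2 X3]]; apply lin_dist; trivial.
Qed.

(** The integral around the triangle is at most [eps * per t0 ^ 2] for every [eps]: a violation
    would be inherited by a quarter at each step, and differentiability at the limit of the vertices
    contradicts it. *)
Theorem Goursat (F : C -> C) (z0 : C) (r : R) (a b c : C) :
  holo_ball F z0 r -> Cmod (a - z0) < r -> Cmod (b - z0) < r -> Cmod (c - z0) < r ->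
  (seg F a b + seg F b c = seg F a c)%C.
Proof.
  intros HF Ha Hb Hc.
  assert (HC := holo_cont_ball _ _ _ HF).
  set (r' := Rmax (Cmod (a - z0)) (Rmax (Cmod (b - z0)) (Cmod (c - z0)))).
  assert (Hr' : r' < r) by (unfold r'; repeat apply Rmax_case; trivial).
  set (t0 := ((a, b), c) : triangle).
  assert (Ht0 : tri_in t0 z0 r').
  { unfold r'; simpl; repeat split.
    - apply Rmax_l.
    - eapply Rle_trans; [apply Rmax_l|apply Rmax_r].
    - eapply Rle_trans; [apply Rmax_r|apply Rmax_r]. }
  assert (Hsmall : forall eps, 0 < eps -> Cmod (tri F t0) <= eps * per t0 ^ 2).
  { intros eps Heps. destruct (Rle_lt_dec (Cmod (tri F t0)) (eps * per t0 ^ 2)) as [|Hbad]; trivial.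
    exfalso.
    set (T := fun n => Nat.iter n (sub_next F eps) t0).
    assert (HT : forall n, per (T n) = per t0 / 2 ^ n /\ tri_in (T n) z0 r' /\
       eps * per (T n) ^ 2 < Cmod (tri F (T n))).
    { intros n; induction n as [|n [I1 [I2 I3]]].
      - unfold T; simpl. repeat split; trivial. field. 1,2,3: apply Ht0.
      - change (T (S n)) with (sub_next F eps (T n)).
        destruct (sub_next_geom F eps (T n) z0 r') as [G1 [G2 _]].
        split; [|split].
        + rewrite G1, I1. simpl. field. apply pow_nonzero; lra.
        + apply G2; trivial.
        + apply sub_next_bad with z0 r r'; trivial. }
    destruct (C_seq_geometric (fun n => vertex (T n)) (per t0)) as [z Hz].
    { intros n. destruct (HT n) as [I1 _]. rewrite <- I1.
      apply (sub_next_geom F eps (T n) z0 r'). }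
    assert (Hzr : Cmod (z - z0) < r).
    { apply Rle_lt_trans with r'; trivial. apply le_epsilon; intros e He.
      destruct (pow_lt_1_zero (/2) ltac:(rewrite Rabs_pos_eq; lra) (e / (2 * Rabs (per t0) + 1))) as [N HN].
      { apply Rdiv_lt_0_compat; trivial. assert (H := Rabs_pos (per t0)); lra. }
      specialize (HN N (le_n N)). rewrite Rabs_pos_eq in HN by (left; apply pow_lt; lra).
      eapply Rle_trans; [apply Cmod_tri3 with (y := vertex (T N))|].
      rewrite Rplus_comm; apply Rplus_le_compat.
      - destruct (HT N) as [_ [I2 _]]. destruct (T N) as [[x y] w]; apply I2.
      - rewrite Cmod_minus_sym. eapply Rle_trans; [apply Hz|].
        unfold Rdiv; rewrite <- pow_inv.
        assert (H := Rle_abs (per t0)). assert (Hp := Rabs_pos (per t0)).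
        assert (0 < (/2) ^ N) by (apply pow_lt; lra).
        apply Rle_trans with ((2 * Rabs (per t0) + 1) * (/2) ^ N).
        + apply Rmult_le_compat_r; lra.
        + replace e with ((2 * Rabs (per t0) + 1) * (e / (2 * Rabs (per t0) + 1))) by (field; lra).
          apply Rmult_le_compat_l; lra. }
    (* The factor [1 / 3] matches [Hin] below: one vertex is within [2 * per t] of [z], so the whole
       triangle is within [3 * per t]. *)
    destruct (HF z Hzr) as [l Hl]. destruct (Hl (eps / 3) ltac:(lra)) as [d [Hd Hl']].
    assert (Hp0 : 0 <= per t0).
    { unfold per, t0. assert (P1 := Cmod_ge_0 (a - b)). assert (P2 := Cmod_ge_0 (b - c)).
      assert (P3 := Cmod_ge_0 (c - a)). lra. }
    destruct (pow_lt_1_zero (/2) ltac:(rewrite Rabs_pos_eq; lra) (d / (3 * per t0 + 1))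
      ltac:(apply Rdiv_lt_0_compat; lra)) as [N HN].
    specialize (HN N (le_n N)). rewrite Rabs_pos_eq in HN by (left; apply pow_lt; lra).
    rewrite pow_inv in HN.
    destruct (HT N) as [I1 [I2 I3]]. specialize (Hz N). set (t := T N) in *.
    assert (H3 : 3 * per t < d).
    { rewrite I1. apply Rle_lt_trans with ((3 * per t0 + 1) * / 2 ^ N).
      - assert (0 < / 2 ^ N) by (apply Rinv_0_lt_compat, pow_lt; lra).
        unfold Rdiv; rewrite <- Rmult_assoc; apply Rmult_le_compat_r; lra.
      - replace d with ((3 * per t0 + 1) * (d / (3 * per t0 + 1))) by (field; lra).
        apply Rmult_lt_compat_l; lra. }
    assert (Hz' : Cmod (vertex t - z) <= 2 * per t).
    { rewrite I1. unfold Rdiv; rewrite <- Rmult_assoc. exact Hz. }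
    assert (Hin : tri_in t z (3 * per t)).
    { clearbody t; clear - Hz'. destruct t as [[x y] w]; unfold vertex, per in *; simpl in *.
      assert (P1 := Cmod_ge_0 (x - y)). assert (P2 := Cmod_ge_0 (y - w)).
      assert (P3 := Cmod_ge_0 (w - x)).
      assert (T1 := Cmod_tri3 y x z). assert (T2 := Cmod_tri3 w x z).
      rewrite (Cmod_minus_sym y x) in T1. repeat split; lra. }
    assert (HB := tri_affine_bound F t z0 r r' (F z - l * z) l (eps * per t) HC Hr' I2).
    assert (Hp : 0 <= per t).
    { destruct t as [[x y] w]; simpl. assert (P1 := Cmod_ge_0 (x - y)). assert (P2 := Cmod_ge_0 (y - w)).
      assert (P3 := Cmod_ge_0 (w - x)). lra. }
    assert (Cmod (tri F t) <= eps * per t * per t); [apply HB|simpl in I3; lra].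
    intros w Hw. specialize (Hw z _ Hin).
    replace (F w - (F z - l * z + l * w))%C with (F w - F z - l * (w - z))%C by ring.
    eapply Rle_trans; [apply Hl'; lra|].
    replace (eps * per t) with (eps / 3 * (3 * per t)) by field.
    apply Rmult_le_compat_l; lra. }
  assert (Z : tri F t0 = 0).
  { apply Cmod_le_small. intros e He.
    assert (Hp : 0 <= per t0 ^ 2) by apply pow2_ge_0.
    eapply Rle_trans; [apply (Hsmall (e / (per t0 ^ 2 + 1)))|].
    - apply Rdiv_lt_0_compat; lra.
    - replace e with (e / (per t0 ^ 2 + 1) * (per t0 ^ 2 + 1)) at 2 by (field; lra).
      apply Rmult_le_compat_l; [|lra]. left; apply Rdiv_lt_0_compat; lra. }
  unfold tri, t0 in Z. rewrite (seg_swap F z0 r a c) in Z by trivial.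
  apply Cminus_eq_0. rewrite <- Z. ring.
Qed.

(** * Integration of holomorphic functions along continuous paths *)

(** Induction along a compact interval, by the supremum of the points reached from [a]. It takes the
    place of covering arguments throughout: an additive property that holds on short intervals
    around each point, on either side of it, holds on the whole interval. *)
Lemma interval_ind (Q : R -> R -> Prop) (a b : R) : a <= b ->
  (forall x y z, a <= x <= y -> y <= z <= b -> Q x y -> Q y z -> Q x z) ->
  (forall x, a <= x <= b -> exists d, 0 < d /\
     (forall y, a <= y <= x -> x - d < y -> Q y x) /\
     (forall y, x <= y <= b -> y < x + d -> Q x y)) ->
  Q a b.
Proof.
  intros Hab Hadd Hloc.
  set (E := fun y => a <= y <= b /\ Q a y).
  assert (Ea : E a).
  { split; [lra|]. destruct (Hloc a ltac:(lra)) as [d [Hd [_ H]]]; apply H; lra. }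
  destruct (completeness E) as [m [Hub Hlub]].
  { exists b; intros y [Hy _]; lra. }
  { exists a; trivial. }
  assert (Ham : a <= m) by (apply Hub; trivial).
  assert (Hmb : m <= b) by (apply Hlub; intros y [Hy _]; lra).
  destruct (Hloc m ltac:(lra)) as [d [Hd [HL HR]]].
  assert (Em : Q a m).
  { destruct (Classical_Prop.classic (exists y, E y /\ m - d < y)) as [[y [[Hy Qy] Hmy]]|N].
    - assert (y <= m) by (apply Hub; split; trivial).
      apply Hadd with y; try lra; trivial. apply HL; lra.
    - exfalso. assert (m <= m - d); [|lra]. apply Hlub. intros y Hy.
      destruct (Rle_lt_dec y (m - d)) as [|H]; trivial. exfalso; apply N; exists y; split; trivial. }
  destruct (Req_dec m b) as [->|Hne]; trivial.
  exfalso. set (y := Rmin (m + d / 2) b).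
  assert (Hy : m < y <= b).
  { split; [apply Rmin_case; lra|apply Rmin_r]. }
  assert (Hy2 : y <= m + d / 2) by apply Rmin_l.
  assert (E y); [|assert (y <= m) by (apply Hub; trivial); lra].
  split; [lra|]. apply Hadd with m; try lra; trivial. apply HR; lra.
Qed.

(* [path_int F c a b v]: [v] is the integral of the locally holomorphic [F] along the
   merely continuous path [c] restricted to [[a, b]]. *)
Inductive path_int (F : C -> C) (c : R -> C) : R -> R -> C -> Prop :=
| path_int_seg a b z r : a <= b -> holo_ball F z r ->
    (forall t, a <= t <= b -> Cmod (c t - z) < r) ->
    path_int F c a b (seg F (c a) (c b))
| path_int_app a b e u v : path_int F c a b u -> path_int F c b e v ->
    path_int F c a e (u + v)%C.

Lemma path_int_le F c a b v : path_int F c a b v -> a <= b.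
Proof. induction 1; lra. Qed.

(** A disc containing a piece of the path contains both of its parts, and Goursat's lemma makes the
    chords additive. *)
Lemma path_int_split F c a e v : path_int F c a e v -> forall b, a <= b <= e ->
  exists v1 v2, path_int F c a b v1 /\ path_int F c b e v2 /\ v = (v1 + v2)%C.
Proof.
  induction 1 as [a e z r Hae HF Hc|a m e u v H1 IH1 H2 IH2]; intros b Hb.
  - exists (seg F (c a) (c b)), (seg F (c b) (c e)). split; [|split].
    + apply path_int_seg with z r; trivial; try lra. intros; apply Hc; lra.
    + apply path_int_seg with z r; trivial; try lra. intros; apply Hc; lra.
    + symmetry; apply Goursat with z r; trivial; apply Hc; lra.
  - destruct (Rle_lt_dec b m) as [Hbm|Hbm].
    + destruct (IH1 b ltac:(lra)) as [v1 [v2 [A1 [A2 ->]]]].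
      exists v1, (v2 + v)%C. split; [trivial|split; [|ring]]. apply path_int_app with m; trivial.
    + destruct (IH2 b ltac:(lra)) as [v1 [v2 [A1 [A2 ->]]]].
      exists (u + v1)%C, v2. split; [|split; [trivial|ring]]. apply path_int_app with m; trivial.
Qed.

(** Independence of subdivision and discs: the second derivation is cut at the break points of the
    first, until it lies in a single disc, where it telescopes by Goursat's lemma. *)
Lemma path_int_unique F c a b v : path_int F c a b v -> forall v', path_int F c a b v' -> v = v'.
Proof.
  induction 1 as [a e z r Hae HF Hc|a m e u v H1 IH1 H2 IH2]; intros v' H'.
  - revert HF Hc. induction H' as [a e z' r' Hae' HF' Hc'|a m e u v H1 IH1 H2 IH2]; intros HF Hc; trivial.
    assert (L1 := path_int_le _ _ _ _ _ H1). assert (L2 := path_int_le _ _ _ _ _ H2).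
    rewrite <- IH1, <- IH2; trivial; try (intros; apply Hc; lra).
    symmetry; apply Goursat with z r; trivial; apply Hc; lra.
  - assert (L1 := path_int_le _ _ _ _ _ H1). assert (L2 := path_int_le _ _ _ _ _ H2).
    destruct (path_int_split _ _ _ _ _ H' m) as [v1 [v2 [A1 [A2 ->]]]]; [lra|].
    rewrite (IH1 _ A1), (IH2 _ A2); trivial.
Qed.

Lemma path_int_ext F c c' a b v : (forall t, a <= t <= b -> c t = c' t) ->
  path_int F c a b v -> path_int F c' a b v.
Proof.
  intros E H; induction H as [a e z r Hae HF Hc|a m e u v H1 IH1 H2 IH2].
  - rewrite !E by lra. apply path_int_seg with z r; trivial. intros t Ht; rewrite <- E; auto.
  - assert (L1 := path_int_le _ _ _ _ _ H1). assert (L2 := path_int_le _ _ _ _ _ H2).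
    apply path_int_app with m; [apply IH1|apply IH2]; intros; apply E; lra.
Qed.

Lemma path_int_const F c a b v : (forall t s, a <= t <= b -> a <= s <= b -> c t = c s) ->
  path_int F c a b v -> v = 0.
Proof.
  intros E H; induction H as [a e z r Hae HF Hc|a m e u v H1 IH1 H2 IH2].
  - rewrite (E e a) by lra. apply seg_same.
  - assert (L1 := path_int_le _ _ _ _ _ H1). assert (L2 := path_int_le _ _ _ _ _ H2).
    rewrite IH1, IH2; [ring| |]; intros; apply E; lra.
Qed.

(** A local condition with a C^1 model on each side of every parameter. In contrast to a list of
    break points it combines directly with [interval_ind]. *)
Definition piecewise_C1 (c : R -> C) (a b : R) : Prop :=
  forall t, a <= t <= b -> exists d, 0 < d /\
    (t < b -> exists p dp, C1_curve p dp /\ forall s, t <= s <= b -> s < t + d -> c s = p s) /\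
    (a < t -> exists p dp, C1_curve p dp /\ forall s, a <= s <= t -> t - d < s -> c s = p s).

(** By Goursat's lemma the increment of [seg F z] from [w] to [w'] is [seg F w w'], whose integrand
    is close to [F w]. *)
Lemma seg_primitive (F : C -> C) (z w : C) (r : R) :
  holo_ball F z r -> Cmod (w - z) < r -> has_cderiv (seg F z) w (F w).
Proof.
  intros HF Hw eps Heps.
  assert (HC := holo_cont_ball _ _ _ HF).
  assert (Hr : 0 < r) by (eapply Rle_lt_trans; [apply Cmod_ge_0|exact Hw]).
  assert (Hz : Cmod (z - z) < r) by (replace (z - z)%C with (RtoC 0) by ring; rewrite Cmod_0; trivial).
  destruct (HC w Hw eps Heps) as [d [Hd Hc]].
  exists (Rmin d (r - Cmod (w - z))); split; [apply Rmin_pos; lra|]. intros w' Hw'.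
  assert (H1 := Rlt_le_trans _ _ _ Hw' (Rmin_l _ _)).
  assert (H2 := Rlt_le_trans _ _ _ Hw' (Rmin_r _ _)).
  assert (Hw'r : Cmod (w' - z) < r).
  { eapply Rle_lt_trans; [apply Cmod_tri3 with (y := w)|]. lra. }
  rewrite <- (Goursat F z r z w w') by trivial.
  replace (seg F z w + seg F w w' - seg F z w - F w * (w' - w))%C with (seg F w w' - F w * (w' - w))%C by ring.
  apply (seg_bound F z r); trivial. intros u Hu. left. apply Hc.
  apply Rle_lt_trans with (Cmod (w' - w)); trivial.
  apply lin_dist; trivial; [|lra]. replace (w - w)%C with (RtoC 0) by ring. rewrite Cmod_0; apply Cmod_ge_0.
Qed.

Lemma is_derive_cderiv_comp (G : C -> C) (p : R -> C) (t : R) (l v : C) :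
  has_cderiv G (p t) l -> is_derive (K := R_AbsRing) (V := C_R_NormedModule) p t v ->
  is_derive (K := R_AbsRing) (V := C_R_NormedModule) (fun s => G (p s)) t (l * v)%C.
Proof.
  rewrite !is_derive_C_eps. intros HG Hp eps Heps.
  assert (Pl := Cmod_ge_0 l). assert (Pv := Cmod_ge_0 v).
  destruct (HG (eps / (2 * (1 + Cmod v)))) as [d1 [Hd1 A1]]; [apply Rdiv_lt_0_compat; lra|].
  destruct (Hp (Rmin 1 (eps / (2 * (1 + Cmod l))))) as [d2 [Hd2 A2]].
  { apply Rmin_pos; [lra|apply Rdiv_lt_0_compat; lra]. }
  exists (Rmin d2 (d1 / (2 + Cmod v))); split.
  { apply Rmin_pos; trivial; apply Rdiv_lt_0_compat; lra. }
  intros s Hs. specialize (A2 s (Rlt_le_trans _ _ _ Hs (Rmin_l _ _))).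
  assert (Hs2 := Rlt_le_trans _ _ _ Hs (Rmin_r _ _)).
  set (D := Rabs (s - t)) in *. assert (HD : 0 <= D) by apply Rabs_pos.
  assert (Hps : Cmod (p s - p t) <= (1 + Cmod v) * D).
  { replace (p s - p t)%C with ((p s - p t - v * RtoC (s - t)) + v * RtoC (s - t))%C by ring.
    eapply Rle_trans; [apply Cmod_triangle|]. rewrite Cmod_mult, Cmod_R; fold D.
    assert (Rmin 1 (eps / (2 * (1 + Cmod l))) * D <= 1 * D) by
      (apply Rmult_le_compat_r; [trivial|apply Rmin_l]). lra. }
  assert (Hps2 : Cmod (p s - p t) < d1).
  { apply Rle_lt_trans with ((2 + Cmod v) * D).
    - eapply Rle_trans; [exact Hps|]. apply Rmult_le_compat_r; lra.
    - replace d1 with ((2 + Cmod v) * (d1 / (2 + Cmod v))) by (field; lra).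
      apply Rmult_lt_compat_l; lra. }
  specialize (A1 (p s) Hps2).
  replace (G (p s) - G (p t) - l * v * RtoC (s - t))%C with
    ((G (p s) - G (p t) - l * (p s - p t)) + l * (p s - p t - v * RtoC (s - t)))%C by ring.
  eapply Rle_trans; [apply Cmod_triangle|]. rewrite Cmod_mult.
  assert (B1 : Cmod (G (p s) - G (p t) - l * (p s - p t)) <= eps / 2 * D).
  { eapply Rle_trans; [exact A1|].
    replace (eps / 2 * D) with (eps / (2 * (1 + Cmod v)) * ((1 + Cmod v) * D)) by (field; lra).
    apply Rmult_le_compat_l; trivial. left; apply Rdiv_lt_0_compat; lra. }
  assert (B2 : Cmod l * Cmod (p s - p t - v * RtoC (s - t)) <= eps / 2 * D).
  { replace (eps / 2 * D) with ((1 + Cmod l) * (eps / (2 * (1 + Cmod l)) * D)) by (field; lra).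
    apply Rmult_le_compat; try lra; [apply Cmod_ge_0|].
    eapply Rle_trans; [exact A2|]. apply Rmult_le_compat_r; trivial. apply Rmin_r. }
  lra.
Qed.

Lemma C1_curve_cont (p dp : R -> C) (t : R) : C1_curve p dp -> ccurve_cont p t.
Proof.
  intros H. apply (ex_derive_continuous (K := R_AbsRing) (V := C_R_NormedModule) p t).
  exists (dp t); apply H.
Qed.

Lemma is_CInt_derive (G dG : R -> C) (a b : R) : a <= b ->
  (forall t, a <= t <= b -> is_derive (K := R_AbsRing) (V := C_R_NormedModule) G t (dG t)) ->
  (forall t, a <= t <= b -> ccurve_cont dG t) ->
  is_CInt dG a b (G b - G a)%C.
Proof.
  intros Hab H1 H2.
  apply (is_RInt_derive (V := C_R_CompleteNormedModule) G dG a b);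
    rewrite Rmin_left, Rmax_right by trivial; trivial.
Qed.

Lemma is_CInt_C1_seg (F : C -> C) (z : C) (r : R) (p dp : R -> C) (a b : R) :
  a <= b -> holo_ball F z r -> C1_curve p dp ->
  (forall t, a <= t <= b -> Cmod (p t - z) < r) ->
  is_CInt (fun t => F (p t) * dp t)%C a b (seg F (p a) (p b)).
Proof.
  intros Hab HF Hp Hin.
  assert (HC := holo_cont_ball _ _ _ HF).
  assert (Hz : Cmod (z - z) < r).
  { replace (z - z)%C with (RtoC 0) by ring; rewrite Cmod_0.
    eapply Rle_lt_trans; [apply Cmod_ge_0|apply (Hin a); lra]. }
  replace (seg F (p a) (p b)) with (seg F z (p b) - seg F z (p a))%C.
  - apply (is_CInt_derive (fun t => seg F z (p t))); trivial.
    + intros t Ht. apply is_derive_cderiv_comp; [|apply Hp].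
      apply seg_primitive with r; trivial. apply Hin; trivial.
    + intros t Ht. apply ccurve_cont_mult; [|apply Hp].
      apply ccont_curve; [apply HC, Hin; trivial|eapply C1_curve_cont; exact Hp].
  - rewrite <- (Goursat F z r z (p a) (p b)) by (trivial; apply Hin; lra). ring.
Qed.

Lemma velocity_C1 (c p dp : R -> C) (a b t : R) :
  C1_curve p dp -> (forall s, a < s < b -> c s = p s) -> a < t < b -> velocity c t = dp t.
Proof.
  intros Hp E Ht. apply is_derive_C_velocity.
  assert (Hd : 0 < Rmin (t - a) (b - t)) by (apply Rmin_pos; lra).
  apply (is_derive_ext_loc (K := R_AbsRing) (V := C_R_NormedModule) p); [|apply Hp].
  exists (mkposreal _ Hd). intros s Hs.
  assert (Hs' : Rabs (s - t) < Rmin (t - a) (b - t)) by exact Hs.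
  assert (H1 := Rlt_le_trans _ _ _ Hs' (Rmin_l _ _)).
  assert (H2 := Rlt_le_trans _ _ _ Hs' (Rmin_r _ _)).
  symmetry; apply E. apply Rabs_def2 in H1, H2. lra.
Qed.

Definition loc_holo (F : C -> C) (z : C) : Prop := exists r, 0 < r /\ holo_ball F z r.

Lemma is_CInt_C1_piece (F : C -> C) (z : C) (r : R) (c p dp : R -> C) (a b : R) :
  a <= b -> holo_ball F z r -> C1_curve p dp -> (forall t, a <= t <= b -> c t = p t) ->
  (forall t, a <= t <= b -> Cmod (p t - z) < r) ->
  path_int F c a b (seg F (c a) (c b)) /\
  is_CInt (fun t => F (c t) * velocity c t)%C a b (seg F (c a) (c b)).
Proof.
  intros Hab HF Hp E Hin; split.
  - apply path_int_seg with z r; trivial. intros t Ht; rewrite E; auto.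
  - rewrite !E by lra. apply is_CInt_ext with (fun t => F (p t) * dp t)%C; trivial.
    + intros t Ht. rewrite (velocity_C1 c p dp a b t); trivial; [rewrite E by lra; trivial|].
      intros s Hs; apply E; lra.
    + apply is_CInt_C1_seg with z r; trivial.
Qed.

Lemma is_CInt_point (u : R -> C) (a : R) : is_CInt u a a (RtoC 0).
Proof. apply (is_RInt_point (V := C_R_NormedModule) u a). Qed.

(** On a short piece inside a disc the primitive evaluates both integrals to the same chord
    integral, so one induction produces them together with their equality. *)
Lemma path_int_piecewise_C1 (F : C -> C) (c : R -> C) (a b : R) :
  a <= b -> piecewise_C1 c a b -> (forall t, a <= t <= b -> loc_holo F (c t)) ->
  exists v, path_int F c a b v /\ is_CInt (fun t => F (c t) * velocity c t)%C a b v.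
Proof.
  intros Hab Hc HF.
  apply (interval_ind (fun x y => exists v, path_int F c x y v /\
     is_CInt (fun t => F (c t) * velocity c t)%C x y v)); trivial.
  - intros x y z _ _ [u [U1 U2]] [v [V1 V2]]. exists (u + v)%C; split.
    + apply path_int_app with y; trivial.
    + apply is_CInt_Chasles with y; trivial.
  - intros x Hx. destruct (Hc x Hx) as [d [Hd [HR HL]]]. destruct (HF x Hx) as [r [Hr HFx]].
    assert (P0 : exists v, path_int F c x x v /\ is_CInt (fun t => F (c t) * velocity c t)%C x x v).
    { exists (seg F (c x) (c x)); split.
      - apply path_int_seg with (c x) r; trivial; try lra. intros t Ht. replace t with x by lra.
        replace (c x - c x)%C with (RtoC 0) by ring. rewrite Cmod_0; trivial.
      - rewrite seg_same. apply is_CInt_point. }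
    assert (HL' : exists d', 0 < d' /\ forall y, a <= y <= x -> x - d' < y ->
       exists v, path_int F c y x v /\ is_CInt (fun t => F (c t) * velocity c t)%C y x v).
    { destruct (Rle_lt_dec x a) as [Hxa|Hxa].
      - exists 1; split; [lra|]; intros y Hy _. replace y with x by lra. exact P0.
      - destruct (HL Hxa) as [p [dp [Hp E]]].
        destruct (proj1 (continuous_Cmod p x) (C1_curve_cont _ _ _ Hp) r Hr) as [d2 [Hd2 Hpc]].
        exists (Rmin d d2); split; [apply Rmin_pos; trivial|]; intros y Hy Hyx.
        assert (L1 := Rmin_l d d2). assert (L2 := Rmin_r d d2).
        eexists; apply is_CInt_C1_piece with (c x) r p dp; trivial; try lra.
        + intros t Ht; apply E; lra.
        + intros t Ht. rewrite (E x) by lra. apply Hpc. apply Rabs_def1; lra. }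
    assert (HR' : exists d', 0 < d' /\ forall y, x <= y <= b -> y < x + d' ->
       exists v, path_int F c x y v /\ is_CInt (fun t => F (c t) * velocity c t)%C x y v).
    { destruct (Rle_lt_dec b x) as [Hxb|Hxb].
      - exists 1; split; [lra|]; intros y Hy _. replace y with x by lra. exact P0.
      - destruct (HR Hxb) as [p [dp [Hp E]]].
        destruct (proj1 (continuous_Cmod p x) (C1_curve_cont _ _ _ Hp) r Hr) as [d2 [Hd2 Hpc]].
        exists (Rmin d d2); split; [apply Rmin_pos; trivial|]; intros y Hy Hyx.
        assert (L1 := Rmin_l d d2). assert (L2 := Rmin_r d d2).
        eexists; apply is_CInt_C1_piece with (c x) r p dp; trivial; try lra.
        + intros t Ht; apply E; lra.
        + intros t Ht. rewrite (E x) by lra. apply Hpc. apply Rabs_def1; lra. }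
    destruct HL' as [d1 [Hd1 HL']]. destruct HR' as [d2 [Hd2 HR']].
    exists (Rmin d1 d2); split; [apply Rmin_pos; trivial|].
    assert (L1 := Rmin_l d1 d2). assert (L2 := Rmin_r d1 d2).
    split; intros y Hy Hyx; [apply HL'|apply HR']; lra.
Qed.

Lemma path_int_is_CInt (F : C -> C) (c : R -> C) (a b : R) (v : C) :
  path_int F c a b v -> piecewise_C1 c a b -> (forall t, a <= t <= b -> loc_holo F (c t)) ->
  is_CInt (fun t => F (c t) * velocity c t)%C a b v.
Proof.
  intros H Hc HF.
  destruct (path_int_piecewise_C1 F c a b (path_int_le _ _ _ _ _ H) Hc HF) as [v' [H1 H2]].
  rewrite (path_int_unique _ _ _ _ _ H _ H1). exact H2.
Qed.

Definition rect_cont (H : R -> R -> C) (a b c d : R) : Prop :=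
  forall s t, a <= s <= b -> c <= t <= d -> forall eps, 0 < eps ->
    exists delta, 0 < delta /\ forall s' t', a <= s' <= b -> c <= t' <= d ->
      Rabs (s' - s) < delta -> Rabs (t' - t) < delta -> Cmod (H s' t' - H s t) < eps.

(** The two ways from the corner [(a, c)] to the corner [(b, d)] along the boundary of the parameter
    rectangle give the same integral. *)
Definition boundary_null (F : C -> C) (H : R -> R -> C) (a b c d : R) : Prop :=
  exists va vb vc vd,
    path_int F (fun t => H a t) c d va /\ path_int F (fun t => H b t) c d vb /\
    path_int F (fun s => H s c) a b vc /\ path_int F (fun s => H s d) a b vd /\
    (va + vd = vc + vb)%C.

Lemma boundary_null_glue_t F H a b c m d :
  boundary_null F H a b c m -> boundary_null F H a b m d -> boundary_null F H a b c d.
Proof.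
  intros [a1 [b1 [c1 [d1 [A1 [B1 [C1 [D1 E1]]]]]]]] [a2 [b2 [c2 [d2 [A2 [B2 [C2 [D2 E2]]]]]]]].
  rewrite (path_int_unique _ _ _ _ _ C2 _ D1) in E2.
  exists (a1 + a2)%C, (b1 + b2)%C, c1, d2.
  split; [|split; [|split; [|split]]]; trivial; try (apply path_int_app with m; trivial).
  replace (a1 + a2 + d2)%C with (a1 + (a2 + d2))%C by ring. rewrite E2.
  replace (a1 + (d1 + b2))%C with (a1 + d1 + b2)%C by ring. rewrite E1. ring.
Qed.

Lemma boundary_null_glue_s F H a m b c d :
  boundary_null F H a m c d -> boundary_null F H m b c d -> boundary_null F H a b c d.
Proof.
  intros [a1 [b1 [c1 [d1 [A1 [B1 [C1 [D1 E1]]]]]]]] [a2 [b2 [c2 [d2 [A2 [B2 [C2 [D2 E2]]]]]]]].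
  rewrite (path_int_unique _ _ _ _ _ A2 _ B1) in E2.
  exists a1, b2, (c1 + c2)%C, (d1 + d2)%C.
  split; [|split; [|split; [|split]]]; trivial; try (apply path_int_app with m; trivial).
  replace (a1 + (d1 + d2))%C with (a1 + d1 + d2)%C by ring. rewrite E1.
  replace (c1 + b1 + d2)%C with (c1 + (b1 + d2))%C by ring. rewrite E2. ring.
Qed.

(** Small rectangles are mapped into discs of holomorphy. Induction in [t] glues them to strips
    [[x, y] * [c, d]], the admissible thickness being the minimum of those of the parts; induction
    in [s] then glues the strips. *)
Theorem homotopy_boundary_null (F : C -> C) (H : R -> R -> C) (a b c d : R) :
  a <= b -> c <= d -> rect_cont H a b c d ->
  (forall s t, a <= s <= b -> c <= t <= d -> loc_holo F (H s t)) ->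
  boundary_null F H a b c d.
Proof.
  intros Hab Hcd HH HF.
  assert (Hloc : forall s t, a <= s <= b -> c <= t <= d -> exists delta, 0 < delta /\
    forall x y u v, a <= x <= y -> y <= b -> c <= u <= v -> v <= d ->
      Rabs (x - s) < delta -> Rabs (y - s) < delta -> Rabs (u - t) < delta -> Rabs (v - t) < delta ->
      boundary_null F H x y u v).
  { intros s t Hs Ht. destruct (HF s t Hs Ht) as [r [Hr HFr]].
    destruct (HH s t Hs Ht r Hr) as [dl [Hdl Hc]]. exists dl; split; trivial.
    intros x y u v Hx Hy Hu Hv X Y U V.
    assert (Hin : forall s' t', x <= s' <= y -> u <= t' <= v -> Cmod (H s' t' - H s t) < r).
    { intros s' t' Hs' Ht'. apply Rabs_def2 in X, Y, U, V. apply Hc; try lra; apply Rabs_def1; lra. }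
    exists (seg F (H x u) (H x v)), (seg F (H y u) (H y v)), (seg F (H x u) (H y u)), (seg F (H x v) (H y v)).
    split; [|split; [|split; [|split]]].
    - apply (path_int_seg F (fun t => H x t)) with (H s t) r; trivial; try lra. intros; apply Hin; lra.
    - apply (path_int_seg F (fun t => H y t)) with (H s t) r; trivial; try lra. intros; apply Hin; lra.
    - apply (path_int_seg F (fun s => H s u)) with (H s t) r; trivial; try lra. intros; apply Hin; lra.
    - apply (path_int_seg F (fun s => H s v)) with (H s t) r; trivial; try lra. intros; apply Hin; lra.
    - rewrite !(Goursat F (H s t) r); trivial; apply Hin; lra. }
  assert (Hstrip : forall s, a <= s <= b -> exists delta, 0 < delta /\
    forall x y, a <= x <= y -> y <= b -> Rabs (x - s) < delta -> Rabs (y - s) < delta ->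
      boundary_null F H x y c d).
  { intros s Hs.
    apply (interval_ind (fun u v => exists delta, 0 < delta /\
      forall x y, a <= x <= y -> y <= b -> Rabs (x - s) < delta -> Rabs (y - s) < delta ->
      boundary_null F H x y u v)); trivial.
    - intros x y z _ _ [d1 [Hd1 H1]] [d2 [Hd2 H2]].
      exists (Rmin d1 d2); split; [apply Rmin_pos; trivial|]. intros u v Hu Hv HU HV.
      assert (L1 := Rmin_l d1 d2). assert (L2 := Rmin_r d1 d2).
      apply boundary_null_glue_t with y; [apply H1|apply H2]; trivial; lra.
    - intros t Ht. destruct (Hloc s t Hs Ht) as [dl [Hdl Hl]].
      exists dl; split; trivial; split; intros t' Ht' Hd'; exists dl; split; trivial; intros x y Hx Hy X Y;
        apply Hl; trivial; try lra; apply Rabs_def1; lra. }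
  apply (interval_ind (fun x y => boundary_null F H x y c d)); trivial.
  - intros x y z _ _; apply boundary_null_glue_s.
  - intros s Hs. destruct (Hstrip s Hs) as [dl [Hdl Hl]].
    exists dl; split; trivial; split; intros y Hy Hd; apply Hl; try lra; apply Rabs_def1; lra.
Qed.

(** * Deformation of contours *)

Global Instance end_filter_proper (e : Rbar) : ProperFilter (end_filter e).
Proof.
  destruct e; simpl; [apply at_point_filter| |].
  - apply (Rbar_locally_filter p_infty).
  - apply (Rbar_locally_filter m_infty).
Qed.

Lemma ends_eventually (lo hi : Rbar) : Rbar_lt lo hi ->
  filter_prod (end_filter lo) (end_filter hi)
    (fun ab => in_itv lo hi (fst ab) /\ in_itv lo hi (snd ab) /\ fst ab < snd ab).
Proof.
  intros Hlh. unfold in_itv.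
  destruct lo as [a| |], hi as [b| |]; try (simpl in Hlh; tauto).
  - apply Filter_prod with (fun x => x = a) (fun y => y = b); try reflexivity.
    intros x y -> ->; simpl in *. lra.
  - apply Filter_prod with (fun x => x = a) (fun y => a < y); try reflexivity.
    + exists a; trivial.
    + intros x y -> Hy; simpl in *. lra.
  - apply Filter_prod with (fun x => x < b) (fun y => y = b); try reflexivity.
    + exists b; trivial.
    + intros x y Hx ->; simpl in *. lra.
  - apply Filter_prod with (fun x => x < 0) (fun y => 0 < y).
    + exists 0; trivial.
    + exists 0; trivial.
    + intros x y Hx Hy; simpl in *. repeat split; lra.
Qed.

Lemma is_contour_int_eps (lo hi : Rbar) (c : R -> C) (F : C -> C) (l : C) :
  is_contour_int lo hi c F l <->
  forall eps, 0 < eps -> filter_prod (end_filter lo) (end_filter hi)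
    (fun ab => exists y, is_CInt (fun t => F (c t) * velocity c t)%C (fst ab) (snd ab) y /\
       Cmod (y - l) < eps).
Proof.
  split.
  - intros H eps Heps. apply (H (fun y => Cmod (y - l) < eps)).
    apply locally_Cmod. exists eps; split; trivial.
  - intros H P HP. apply locally_Cmod in HP. destruct HP as [r [Hr HP]].
    unfold filtermapi. eapply filter_imp; [|exact (H r Hr)]. intros [a b] [y [Hy1 Hy2]].
    exists y; split; trivial. apply HP; trivial.
Qed.

(** A break point is assigned to the arc on its right here, and to the arc on its left in
    [subdivision_find_l]; this yields the two one-sided models of [piecewise_C1]. *)
Lemma subdivision_find_r (d : nat) (tau : nat -> Rbar) (lo hi : Rbar) (t : R) :
  Defs.subdivision d tau lo hi -> Rbar_le lo t -> Rbar_lt t hi ->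
  exists i, (i < d)%nat /\ Rbar_le (tau i) t /\ Rbar_lt t (tau (S i)).
Proof.
  intros [<- [<- _]] Hlo Hhi. induction d as [|d IH].
  - exfalso. exact (Rbar_lt_not_le _ _ Hhi Hlo).
  - destruct (Rbar_lt_le_dec t (tau d)) as [H|H].
    + destruct (IH H) as [i [Hi Ht]]. exists i; split; [lia|trivial].
    + exists d; split; [lia|split; trivial].
Qed.

Lemma subdivision_find_l (d : nat) (tau : nat -> Rbar) (lo hi : Rbar) (t : R) :
  Defs.subdivision d tau lo hi -> Rbar_lt lo t -> Rbar_le t hi ->
  exists i, (i < d)%nat /\ Rbar_lt (tau i) t /\ Rbar_le t (tau (S i)).
Proof.
  intros [<- [<- _]] Hlo Hhi. induction d as [|d IH].
  - exfalso. exact (Rbar_lt_not_le _ _ Hlo Hhi).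
  - destruct (Rbar_lt_le_dec (tau d) t) as [H|H].
    + exists d; split; [lia|split; trivial].
    + destruct (IH H) as [i [Hi Ht]]. exists i; split; [lia|trivial].
Qed.

Lemma subdivision_piecewise_C1 (d : nat) (tau : nat -> Rbar) (lo hi : Rbar) (c : R -> C) (x y : R) :
  Defs.subdivision d tau lo hi -> (forall i, (i < d)%nat -> smooth_arc (tau i) (tau (S i)) c) ->
  in_itv lo hi x -> in_itv lo hi y -> piecewise_C1 c x y.
Proof.
  intros Hs Ha [Hx1 Hx2] [Hy1 Hy2] t Ht.
  assert (HR : exists d0, 0 < d0 /\ (t < y -> exists p dp, C1_curve p dp /\
     forall s, t <= s <= y -> s < t + d0 -> c s = p s)).
  { destruct (Rlt_dec t y) as [Hty|Hty]; [|exists 1; split; [lra|tauto]].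
    destruct (subdivision_find_r d tau lo hi t Hs) as [i [Hi [H1 H2]]].
    { eapply Rbar_le_trans; [exact Hx1|]. simpl; lra. }
    { eapply Rbar_lt_le_trans; [|exact Hy2]. simpl; lra. }
    destruct (Ha i Hi) as [p [dp [Hp E]]].
    assert (Hd : exists d0, 0 < d0 /\ forall s, s < t + d0 -> Rbar_le s (tau (S i))).
    { destruct (tau (S i)) as [u| |]; simpl in *.
      - exists (u - t); split; [lra|intros; lra].
      - exists 1; split; [lra|trivial].
      - tauto. }
    destruct Hd as [d0 [Hd0 Hd]]. exists d0; split; trivial. intros _.
    exists p, dp; split; trivial. intros s Hs1 Hs2. apply E. split; auto.
    eapply Rbar_le_trans; [exact H1|]. simpl; lra. }
  assert (HL : exists d0, 0 < d0 /\ (x < t -> exists p dp, C1_curve p dp /\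
     forall s, x <= s <= t -> t - d0 < s -> c s = p s)).
  { destruct (Rlt_dec x t) as [Hty|Hty]; [|exists 1; split; [lra|tauto]].
    destruct (subdivision_find_l d tau lo hi t Hs) as [i [Hi [H1 H2]]].
    { eapply Rbar_le_lt_trans; [exact Hx1|]. simpl; lra. }
    { eapply Rbar_le_trans; [|exact Hy2]. simpl; lra. }
    destruct (Ha i Hi) as [p [dp [Hp E]]].
    assert (Hd : exists d0, 0 < d0 /\ forall s, t - d0 < s -> Rbar_le (tau i) s).
    { destruct (tau i) as [u| |]; simpl in *.
      - exists (t - u); split; [lra|intros; lra].
      - tauto.
      - exists 1; split; [lra|trivial]. }
    destruct Hd as [d0 [Hd0 Hd]]. exists d0; split; trivial. intros _.
    exists p, dp; split; trivial. intros s Hs1 Hs2. apply E. split; auto.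
    eapply Rbar_le_trans; [|exact H2]. simpl; lra. }
  destruct HR as [d1 [Hd1 HR]]. destruct HL as [d2 [Hd2 HL]].
  assert (L1 := Rmin_l d1 d2). assert (L2 := Rmin_r d1 d2).
  exists (Rmin d1 d2); split; [apply Rmin_pos; trivial|]. split; intros H.
  - destruct (HR H) as [p [dp [Hp E]]]. exists p, dp; split; trivial. intros; apply E; lra.
  - destruct (HL H) as [p [dp [Hp E]]]. exists p, dp; split; trivial. intros; apply E; lra.
Qed.

Lemma contour_piecewise_C1 (d : nat) (lo hi : Rbar) (c : R -> C) (x y : R) :
  contour d lo hi c -> in_itv lo hi x -> in_itv lo hi y -> piecewise_C1 c x y.
Proof.
  intros [_ [_ [tau [Hs Ha]]]]. apply subdivision_piecewise_C1 with d tau; trivial.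
  intros i Hi; apply Ha; trivial.
Qed.

Lemma piecewise_smooth_curve_C1 (lo hi : Rbar) (c : R -> C) (x y : R) :
  piecewise_smooth_curve lo hi c -> in_itv lo hi x -> in_itv lo hi y -> piecewise_C1 c x y.
Proof.
  intros [_ [_ H]] Hx Hy. destruct (Rlt_dec x y) as [Hxy|Hxy].
  - destruct (H x y Hx Hy Hxy) as [d [tau [Hs Ha]]].
    apply subdivision_piecewise_C1 with d tau x y; trivial; split; simpl; lra.
  - intros t Ht. exists 1; split; [lra|]. split; intros; lra.
Qed.

Lemma in_itv_between (lo hi : Rbar) (x y t : R) :
  in_itv lo hi x -> in_itv lo hi y -> x <= t <= y -> in_itv lo hi t.
Proof.
  intros [H1 _] [_ H2] Ht; split.
  - eapply Rbar_le_trans; [exact H1|]; simpl; lra.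
  - eapply Rbar_le_trans; [|exact H2]; simpl; lra.
Qed.

(** * Invariance of contour integrals under deformation *)

Definition C1_on (lo hi : Rbar) (c : R -> C) : Prop :=
  forall x y, in_itv lo hi x -> in_itv lo hi y -> piecewise_C1 c x y.

(* [lin_span_ext] disregards the value at [0], where the removable singularities of
   the integrands have to be filled in before Cauchy's theorem applies. *)
Inductive lin_span (FF : (C -> C) -> Prop) : (C -> C) -> Prop :=
| lin_span_base (F : C -> C) : FF F -> lin_span FF F
| lin_span_plus (F G : C -> C) : lin_span FF F -> lin_span FF G -> lin_span FF (fun z => F z + G z)%C
| lin_span_scal (k : C) (F : C -> C) : lin_span FF F -> lin_span FF (fun z => k * F z)%C
| lin_span_ext (F G : C -> C) : (forall z : C, z <> 0 -> F z = G z) -> lin_span FF F -> lin_span FF G.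

Lemma ccont_plus (F G : C -> C) (z : C) :
  ccont F z -> ccont G z -> ccont (fun x => F x + G x)%C z.
Proof.
  intros HF HG eps He. destruct (HF (eps / 2)) as [d1 [Hd1 H1]]; [lra|].
  destruct (HG (eps / 2)) as [d2 [Hd2 H2]]; [lra|].
  exists (Rmin d1 d2); split; [apply Rmin_pos; trivial|]; intros z' Hz'.
  specialize (H1 z' (Rlt_le_trans _ _ _ Hz' (Rmin_l _ _))).
  specialize (H2 z' (Rlt_le_trans _ _ _ Hz' (Rmin_r _ _))).
  replace (F z' + G z' - (F z + G z))%C with ((F z' - F z) + (G z' - G z))%C by ring.
  eapply Rle_lt_trans; [apply Cmod_triangle|]; lra.
Qed.

Lemma ccont_scal (k : C) (F : C -> C) (z : C) :
  ccont F z -> ccont (fun x => k * F x)%C z.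
Proof.
  intros HF eps He. assert (P := Cmod_ge_0 k).
  destruct (HF (eps / (1 + Cmod k))) as [d1 [Hd1 H1]]; [apply Rdiv_lt_0_compat; lra|].
  exists d1; split; trivial; intros z' Hz'. specialize (H1 z' Hz').
  replace (k * F z' - k * F z)%C with (k * (F z' - F z))%C by ring.
  rewrite Cmod_mult. apply Rle_lt_trans with ((1 + Cmod k) * Cmod (F z' - F z)).
  - apply Rmult_le_compat_r; [apply Cmod_ge_0|lra].
  - replace eps with ((1 + Cmod k) * (eps / (1 + Cmod k))) by (field; lra).
    apply Rmult_lt_compat_l; lra.
Qed.

Lemma ccont_locally_ext (F G : C -> C) (z : C) (r : R) :
  0 < r -> (forall z', Cmod (z' - z) < r -> F z' = G z') -> ccont F z -> ccont G z.
Proof.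
  intros Hr E HF eps He. destruct (HF eps He) as [d [Hd H]].
  exists (Rmin d r); split; [apply Rmin_pos; trivial|]; intros z' Hz'.
  rewrite <- !E.
  - apply H. eapply Rlt_le_trans; [exact Hz'|apply Rmin_l].
  - replace (z - z)%C with (RtoC 0) by ring. rewrite Cmod_0; trivial.
  - eapply Rlt_le_trans; [exact Hz'|apply Rmin_r].
Qed.

Lemma lin_span_ccont (FF : (C -> C) -> Prop) (z : C) : z <> 0 ->
  (forall F, FF F -> ccont F z) -> forall F, lin_span FF F -> ccont F z.
Proof.
  intros Hz H F HF. induction HF as [F HF|F G H1 IH1 H2 IH2|k F HF IH|F G E HF IH].
  - auto.
  - apply ccont_plus; trivial.
  - apply ccont_scal; trivial.
  - apply ccont_locally_ext with F (Cmod z); trivial; [apply Cmod_gt_0; trivial|].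
    intros z' Hz'. apply E. intros ->. revert Hz'.
    replace (0 - z)%C with (- z)%C by ring. rewrite Cmod_opp. lra.
Qed.

Lemma C_lim_eps {T : Type} (F : (T -> Prop) -> Prop) {FF : Filter F} (f : T -> C) (l : C) :
  filterlim f F (locally (l : C_UniformSpace)) <->
  forall eps, 0 < eps -> F (fun x => Cmod (f x - l) < eps).
Proof.
  split.
  - intros H eps He. apply (H (fun y => Cmod (y - l) < eps)). apply locally_Cmod. exists eps; split; trivial.
  - intros H P HP. apply locally_Cmod in HP. destruct HP as [r [Hr HP]].
    unfold filtermap. eapply filter_imp; [|exact (H r Hr)]; auto.
Qed.

Lemma C1_curve_CInt_01 (H : R -> C) (F : C -> C) (p dp : R -> C) :
  C1_curve p dp -> (forall s, 0 <= s <= 1 -> H s = p s) ->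
  (forall s, 0 <= s <= 1 -> ccont F (H s)) ->
  is_CInt (fun s => F (H s) * velocity H s)%C 0 1 (CInt (fun s => F (H s) * velocity H s)%C 0 1).
Proof.
  intros Hp E HF. apply (RInt_correct (V := C_R_CompleteNormedModule)).
  apply (ex_RInt_ext (V := C_R_CompleteNormedModule)) with (fun s => F (p s) * dp s)%C.
  - rewrite Rmin_left, Rmax_right by lra. intros s Hs. rewrite E by lra.
    rewrite (velocity_C1 H p dp 0 1 s); trivial. intros; apply E; lra.
  - apply (ex_RInt_continuous (V := C_R_CompleteNormedModule)).
    rewrite Rmin_left, Rmax_right by lra. intros s Hs. apply ccurve_cont_mult; [|apply Hp].
    apply ccont_curve; [rewrite <- E by lra; apply HF; lra|eapply C1_curve_cont; exact Hp].
Qed.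

Lemma end_in_itv (lo hi e : Rbar) : Rbar_lt lo hi -> is_end lo hi e -> end_filter e (in_itv lo hi).
Proof.
  unfold in_itv. intros Hlh [-> | ->].
  - destruct lo as [a| |]; simpl in *.
    + split; [lra|]. destruct hi; simpl in *; trivial; lra.
    + tauto.
    + destruct hi as [b| |]; simpl in *; try tauto.
      * exists b; intros; split; trivial; lra.
      * exists 0; intros; split; trivial.
  - destruct hi as [b| |]; simpl in *.
    + split; [|lra]. destruct lo; simpl in *; trivial; lra.
    + destruct lo as [a| |]; simpl in *; try tauto.
      * exists a; intros; split; trivial; lra.
      * exists 0; intros; split; trivial.
    + destruct lo; simpl in *; tauto.
Qed.

Lemma end_filter_infinite (e : Rbar) (P : R -> Prop) :
  ~ is_finite e -> end_filter e P <-> Rbar_locally e P.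
Proof. destruct e; simpl; intros H; try tauto. exfalso; apply H; reflexivity. Qed.

(** The condition at non-compact ends is linear in the integrand, but [RInt] is additive only on
    integrable functions; integrability is derived from continuity away from [0]. *)
Lemma deforms_lin_span (O : C -> Prop) (FF : (C -> C) -> Prop) (lo hi : Rbar) (c0 c1 : R -> C) :
  Rbar_lt lo hi ->
  (forall F, FF F -> forall z, O z -> z <> 0 -> ccont F z) ->
  deforms O FF lo hi c0 c1 -> deforms O (lin_span FF) lo hi c0 c1.
Proof.
  intros Hlh HFF [H [H1 [H2 [H3 [H4 [H5 H6]]]]]]. exists H.
  split; [|split; [|split; [|split; [|split]]]]; trivial.
  intros e He Hinf. destruct (H6 e He Hinf) as [Hfar [HC1 Hnull]].
  split; [|split]; trivial.
  assert (FE : ProperFilter (Rbar_locally e)) by apply Rbar_locally_filter.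
  assert (And : forall P Q, Rbar_locally e P -> Rbar_locally e Q -> Rbar_locally e (fun t => P t /\ Q t))
    by (intros; apply filter_and; trivial).
  (* [Hfar 0] keeps the transversal curves away from the origin, the one point of [O] where
     continuity is not assumed. *)
  assert (Hev : Rbar_locally e (fun t => (exists p dp, C1_curve p dp /\
      forall s, 0 <= s <= 1 -> H s t = p s) /\
      (forall s, 0 <= s <= 1 -> O (H s t) /\ H s t <> 0))).
  { assert (E1 := proj1 (end_filter_infinite e _ Hinf) (end_in_itv lo hi e Hlh He)).
    generalize (And _ _ E1 (And _ _ HC1 (Hfar 0))). apply filter_imp.
    intros t [T1 [T2 T3]]. split; trivial. intros s Hs; split; [apply H3; trivial|].
    apply Cmod_gt_0; auto. }
  set (I := fun F t => CInt (fun s => F (H s t) * velocity (fun x => H x t) s)%C 0 1).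
  intros F HF. change (filterlim (I F) (Rbar_locally e) (locally (RtoC 0 : C_UniformSpace))).
  assert (Hint : forall F, lin_span FF F -> Rbar_locally e (fun t =>
    is_CInt (fun s => F (H s t) * velocity (fun x => H x t) s)%C 0 1 (I F t))).
  { clear F HF; intros F HF. generalize Hev; apply filter_imp.
    intros t [[p [dp [Hp E]]] Hs]. apply (C1_curve_CInt_01 (fun s => H s t) F p dp); trivial.
    intros s Hs'. destruct (Hs s Hs'). apply (lin_span_ccont FF); auto. }
  induction HF as [F HF|F G HF IHF HG IHG|k F HF IHF|F G E HF IHF].
  - apply Hnull; trivial.
  - rewrite C_lim_eps in * by apply FE. intros eps Heps.
    generalize (And _ _ (And _ _ (IHF (eps / 2) ltac:(lra)) (IHG (eps / 2) ltac:(lra)))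
      (And _ _ (And _ _ (Hint F HF) (Hint G HG)) (Hint _ (lin_span_plus _ _ _ HF HG)))).
    apply filter_imp. intros t [[T1 T2] [[T3 T4] T5]].
    assert (E : I (fun z => F z + G z)%C t = (I F t + I G t)%C).
    { eapply is_CInt_unique2; [exact T5|]. assert (T6 := is_CInt_plus _ _ _ _ _ _ T3 T4).
      revert T6; apply is_CInt_ext; [lra|]. intros; ring. }
    rewrite E. replace (I F t + I G t - 0)%C with ((I F t - 0) + (I G t - 0))%C by ring.
    eapply Rle_lt_trans; [apply Cmod_triangle|]; lra.
  - rewrite C_lim_eps in * by apply FE. intros eps Heps.
    assert (P := Cmod_ge_0 k).
    generalize (And _ _ (IHF (eps / (1 + Cmod k)) ltac:(apply Rdiv_lt_0_compat; lra))
      (And _ _ (Hint F HF) (Hint _ (lin_span_scal _ k _ HF)))).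
    apply filter_imp. intros t [T1 [T3 T5]].
    assert (E : I (fun z => k * F z)%C t = (k * I F t)%C).
    { eapply is_CInt_unique2; [exact T5|]. assert (T6 := is_CInt_mult_l k _ _ _ _ T3).
      revert T6; apply is_CInt_ext; [lra|]. intros; ring. }
    rewrite E. replace (k * I F t - 0)%C with (k * (I F t - 0))%C by ring.
    rewrite Cmod_mult. apply Rle_lt_trans with ((1 + Cmod k) * Cmod (I F t - 0)).
    + apply Rmult_le_compat_r; [apply Cmod_ge_0|lra].
    + replace eps with ((1 + Cmod k) * (eps / (1 + Cmod k))) by (field; lra).
      apply Rmult_lt_compat_l; lra.
  - rewrite C_lim_eps in * by apply FE. intros eps Heps.
    generalize (And _ _ (IHF eps Heps) (And _ _ Hev
      (And _ _ (Hint F HF) (Hint _ (lin_span_ext _ _ _ E HF))))).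
    apply filter_imp. intros t [T1 [[_ T2] [T3 T5]]].
    replace (I G t) with (I F t); trivial.
    eapply is_CInt_unique2; [|exact T5]. revert T3; apply is_CInt_ext; [lra|].
    intros s Hs. rewrite E; trivial. apply T2; lra.
Qed.

(** For cut-off parameters [x], [y] the two integrals differ by the integrals along the transversals
    at [x] and [y]. These coincide for a closed curve; otherwise each is [0] at a fixed end point
    and tends to [0] at a non-compact end. *)
Theorem deforms_contour_int (O : C -> Prop) (FF : (C -> C) -> Prop) (lo hi : Rbar)
    (c0 c1 : R -> C) (F : C -> C) (l : C) :
  Rbar_lt lo hi -> C1_on lo hi c0 -> C1_on lo hi c1 ->
  (forall z, O z -> loc_holo F z) -> FF F -> deforms O FF lo hi c0 c1 ->
  is_contour_int lo hi c0 F l -> is_contour_int lo hi c1 F l.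
Proof.
  intros Hlh Hc0 Hc1 HF HFF [H [H1 [H2 [H3 [H4 [H5 H6]]]]]] Hl.
  assert (Hrc : forall x y, in_itv lo hi x -> in_itv lo hi y -> rect_cont H 0 1 x y).
  { intros x y Hx Hy s t Hs Ht eps Heps.
    assert (Hp : 0 <= fst (s, t) <= 1 /\ in_itv lo hi (snd (s, t))).
    { split; trivial. apply in_itv_between with x y; trivial. }
    destruct (H1 (s, t) Hp (fun z => Cmod (z - H s t) < eps)) as [d Hd].
    { apply locally_Cmod. exists eps; split; trivial. }
    exists d; split; [apply cond_pos|]. intros s' t' Hs' Ht' Ds Dt.
    apply (Hd (s', t')); [split; trivial|]. split; trivial. apply in_itv_between with x y; trivial. }
  assert (Hnull : forall x y, in_itv lo hi x -> in_itv lo hi y -> x <= y ->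
     boundary_null F H 0 1 x y).
  { intros x y Hx Hy Hxy. apply homotopy_boundary_null; auto; [lra|].
    intros s t Hs Ht. apply HF, H3; trivial. apply in_itv_between with x y; trivial. }
  assert (Hpair : forall eps, 0 < eps -> filter_prod (end_filter lo) (end_filter hi) (fun ab =>
     forall u v, path_int F (fun s => H s (fst ab)) 0 1 u -> path_int F (fun s => H s (snd ab)) 0 1 v ->
       Cmod (u - v) < eps)).
  { intros eps Heps.
    destruct (Classical_Prop.classic (closed_curve lo hi c0)) as [Hcl|Hncl].
    - assert (H4' := H4 Hcl). destruct Hcl as [F1 [F2 _]].
      rewrite <- F1, <- F2. rewrite <- F1, <- F2 in H4'. simpl in H4' |- *.
      apply Filter_prod with (fun x => x = real lo) (fun y => y = real hi); try reflexivity.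
      intros x y -> -> u v Hu Hv; simpl in *.
      apply (path_int_ext F _ (fun s => H s (real hi))) in Hu; [|intros; apply H4'; trivial].
      rewrite (path_int_unique _ _ _ _ _ Hu _ Hv).
      replace (v - v)%C with (RtoC 0) by ring. rewrite Cmod_0; trivial.
    - assert (Hend : forall e, is_end lo hi e -> end_filter e (fun x =>
        forall u, path_int F (fun s => H s x) 0 1 u -> Cmod u < eps / 2)).
      { intros e He. destruct (Classical_Prop.classic (is_finite e)) as [Hfin|Hinf].
        - assert (H5' := H5 Hncl e He Hfin). rewrite <- Hfin; simpl. unfold at_point.
          intros u Hu. apply path_int_const in Hu; [subst u|intros t s Ht Hs; rewrite !H5'; trivial].
          rewrite Cmod_0; lra.
        - destruct (H6 e He Hinf) as [_ [HC1 Hn]]. specialize (Hn F HFF).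
          apply end_filter_infinite; trivial.
          assert (FE : ProperFilter (Rbar_locally e)) by apply Rbar_locally_filter.
          rewrite C_lim_eps in Hn by apply FE.
          assert (E1 := proj1 (end_filter_infinite e _ Hinf) (end_in_itv lo hi e Hlh He)).
          assert (E2 := Hn (eps / 2) ltac:(lra)).
          generalize (filter_and _ _ E1 (filter_and _ _ HC1 E2)).
          apply filter_imp. intros t [T1 [[p [dp [Hp E]]] T3]] u Hu.
          apply path_int_is_CInt in Hu.
          + rewrite <- (is_RInt_unique (V := C_R_CompleteNormedModule) _ _ _ _ Hu).
            replace (CInt _ 0 1) with (CInt (fun s => F (H s t) * velocity (fun x => H x t) s)%C 0 1 - 0)%C
              by ring. exact T3.
          + intros s Hs. exists 1; split; [lra|]; split; intros; exists p, dp; split; trivial;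
              intros; apply E; lra.
          + intros s Hs. apply HF, H3; trivial. }
      apply Filter_prod with (1 := Hend lo (or_introl eq_refl)) (2 := Hend hi (or_intror eq_refl)).
      intros x y Hx Hy u v Hu Hv; simpl in *. specialize (Hx u Hu). specialize (Hy v Hv).
      eapply Rle_lt_trans; [apply Cmod_minus_le|]; lra. }
  rewrite is_contour_int_eps in *. intros eps Heps.
  assert (E1 := Hl (eps / 2) ltac:(lra)). assert (E2 := Hpair (eps / 2) ltac:(lra)).
  generalize (filter_and _ _ (ends_eventually lo hi Hlh) (filter_and _ _ E1 E2)). clear E1 E2.
  apply filter_imp. intros [x y] [[Hx [Hy Hxy]] [[w [Hw Hwl]] Huv]]; simpl in *.
  destruct (Hnull x y Hx Hy ltac:(lra)) as [va [vb [vc [vd [A [B [Cc [D E]]]]]]]].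
  specialize (Huv vc vd Cc D).
  assert (Hit : forall t, x <= t <= y -> in_itv lo hi t) by (intros; apply in_itv_between with x y; trivial).
  apply (path_int_ext F _ c0) in A; [|intros t Ht; apply H2; auto].
  apply (path_int_ext F _ c1) in B; [|intros t Ht; apply H2; auto].
  apply path_int_is_CInt in A; auto.
  2: { intros t Ht. destruct (H2 t (Hit t Ht)) as [<- _]. apply HF, H3; auto; lra. }
  apply path_int_is_CInt in B; auto.
  2: { intros t Ht. destruct (H2 t (Hit t Ht)) as [_ <-]. apply HF, H3; auto; lra. }
  exists vb; split; trivial.
  rewrite (is_CInt_unique2 _ _ _ _ _ Hw A) in Hwl.
  replace (vb - l)%C with ((va - l) + (vb - va))%C by ring.
  replace (vb - va)%C with (vd - vc)%C.
  2: { replace vd with (va + vd - va)%C by ring. rewrite E. ring. }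
  rewrite (Cmod_minus_sym vc vd) in Huv.
  eapply Rle_lt_trans; [apply Cmod_triangle|]; lra.
Qed.

(** * Cauchy's integral formula *)

Lemma Cmod_pair_le (x y : R) : Cmod (x, y) <= Rabs x + Rabs y.
Proof.
  replace (x, y) with (RtoC x + RtoC y * Ci)%C.
  - eapply Rle_trans; [apply Cmod_triangle|]. rewrite Cmod_mult, Cmod_Ci, !Cmod_R. lra.
  - apply injective_projections; simpl; ring.
Qed.

Lemma is_derive_R_eps (f : R -> R) (t v : R) : is_derive f t v ->
  forall eps, 0 < eps -> exists delta, 0 < delta /\
    forall s, Rabs (s - t) < delta -> Rabs (f s - f t - (s - t) * v) <= eps * Rabs (s - t).
Proof.
  intros [_ H] eps Heps.
  destruct (H t (fun P HP => HP) (mkposreal eps Heps)) as [d Hd].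
  exists d; split; [apply cond_pos|]; intros s Hs. exact (Hd s Hs).
Qed.

Lemma is_derive_C_pair (f g : R -> R) (t u v : R) :
  is_derive f t u -> is_derive g t v ->
  is_derive (K := R_AbsRing) (V := C_R_NormedModule) (fun s => (f s, g s) : C) t (u, v).
Proof.
  intros Hf Hg. apply is_derive_C_eps. intros eps He.
  destruct (is_derive_R_eps _ _ _ Hf (eps / 2) ltac:(lra)) as [d1 [Hd1 H1]].
  destruct (is_derive_R_eps _ _ _ Hg (eps / 2) ltac:(lra)) as [d2 [Hd2 H2]].
  exists (Rmin d1 d2); split; [apply Rmin_pos; trivial|]; intros s Hs.
  specialize (H1 s (Rlt_le_trans _ _ _ Hs (Rmin_l _ _))).
  specialize (H2 s (Rlt_le_trans _ _ _ Hs (Rmin_r _ _))).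
  replace (((f s, g s) : C) - (f t, g t) - (u, v) * RtoC (s - t))%C with
    ((f s - f t - (s - t) * u, g s - g t - (s - t) * v) : C).
  - eapply Rle_trans; [apply Cmod_pair_le|]. lra.
  - apply injective_projections; simpl; ring.
Qed.

Lemma is_derive_cis (t : R) :
  is_derive (K := R_AbsRing) (V := C_R_NormedModule) cis t (Ci * cis t)%C.
Proof.
  replace (Ci * cis t)%C with ((- sin t, cos t) : C).
  - apply is_derive_C_pair; [apply is_derive_cos|apply is_derive_sin].
  - apply injective_projections; simpl; ring.
Qed.

Lemma Cmod_cis (t : R) : Cmod (cis t) = 1.
Proof.
  unfold Cmod, cis; simpl. replace (cos t * (cos t * 1) + sin t * (sin t * 1)) with 1; [apply sqrt_1|].
  assert (H := sin2_cos2 t). unfold Rsqr in H. lra.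
Qed.

Lemma cis_neq_0 (t : R) : cis t <> 0.
Proof. apply Cmod_gt_0. rewrite Cmod_cis. lra. Qed.

Lemma has_cderiv_affine (a k z : C) : has_cderiv (fun x => a + k * x)%C z k.
Proof.
  intros eps He; exists 1; split; [lra|]; intros z' _.
  replace (a + k * z' - (a + k * z) - k * (z' - z))%C with (RtoC 0) by ring.
  rewrite Cmod_0. apply Rmult_le_pos; [lra|apply Cmod_ge_0].
Qed.

Lemma C1_circle (z k : C) : C1_curve (fun t => z + k * cis t)%C (fun t => k * (Ci * cis t))%C.
Proof.
  intros t; split.
  - apply (is_derive_cderiv_comp (fun x => z + k * x)%C cis); [apply has_cderiv_affine|apply is_derive_cis].
  - apply (ccont_curve (fun x => k * (Ci * x))%C cis).
    + apply deriv_at_ccont. apply deriv_at_mult; [apply deriv_at_const|].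
      apply deriv_at_mult; [apply deriv_at_const|apply deriv_at_id].
    + apply (ex_derive_continuous (K := R_AbsRing) (V := C_R_NormedModule) cis t).
      eexists; apply is_derive_cis.
Qed.

Lemma cis_0 : cis 0 = RtoC 1.
Proof. unfold cis. rewrite cos_0, sin_0. reflexivity. Qed.
Lemma cis_2PI : cis (2 * PI) = RtoC 1.
Proof. unfold cis. rewrite cos_2PI, sin_2PI. reflexivity. Qed.

Lemma ccurve_cont_circle (z k : C) (t : R) : ccurve_cont (fun t => z + k * cis t)%C t.
Proof. eapply C1_curve_cont; apply C1_circle. Qed.

Lemma deriv_at_Cdiv (f g : C -> C) (z : C) :
  deriv_at f z -> deriv_at g z -> g z <> 0 -> deriv_at (fun x => f x / g x)%C z.
Proof.
  intros Hf Hg Hz. apply deriv_at_mult; trivial.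
  apply (deriv_at_comp Cinv g); trivial. apply deriv_at_inv; trivial.
Qed.

(** With [w = z0 + rho e^(it)] one has [dw / (w - z) = i rho e^(it) / (w - z) dt]; the factor [i] is
    divided out. The circle is moved through circles to a small one around [z], whose radius then
    tends to [0]. *)
Lemma Cauchy_formula (f : C -> C) (z0 z : C) (R0 rho : R) :
  holo_ball f z0 R0 -> rho < R0 -> Cmod (z - z0) < rho ->
  is_CInt (fun t => f (z0 + RtoC rho * cis t) * (RtoC rho * cis t / (z0 + RtoC rho * cis t - z)))%C
    0 (2 * PI) (RtoC (2 * PI) * f z)%C.
Proof.
  intros Hf Hrho Hz.
  assert (HPI := PI_RGT_0).
  assert (Hr0 : 0 < rho) by (eapply Rle_lt_trans; [apply Cmod_ge_0|exact Hz]).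
  set (F := fun w => (f w / (w - z))%C).
  assert (HF : forall w, Cmod (w - z0) < R0 -> w <> z -> loc_holo F w).
  { intros w Hw Hwz. assert (Hwz' : 0 < Cmod (w - z)) by (apply Cmod_gt_0; intros E; apply Hwz, Cminus_eq_0, E).
    exists (Rmin (R0 - Cmod (w - z0)) (Cmod (w - z))); split; [apply Rmin_pos; lra|].
    intros x Hx. assert (H1 := Rlt_le_trans _ _ _ Hx (Rmin_l _ _)).
    assert (H2 := Rlt_le_trans _ _ _ Hx (Rmin_r _ _)).
    apply (deriv_at_Cdiv f (fun y => y - z)%C).
    - apply Hf. eapply Rle_lt_trans; [apply Cmod_tri3 with (y := w)|]. lra.
    - apply deriv_at_minus; [apply deriv_at_id|apply deriv_at_const].
    - intros E. apply Cminus_eq_0 in E. subst x. rewrite Cmod_minus_sym in H2. lra. }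
  (* The centre travels from [z0] to [z] while the radius changes linearly from [rho] to [e]. *)
  set (ct := fun s => (RtoC (1 - s) * z0 + RtoC s * z)%C).
  set (rad := fun e s => (1 - s) * rho + s * e).
  set (H := fun e s t => (ct s + RtoC (rad e s) * cis t)%C).
  (* [e <= rho - Cmod (z - z0)] keeps every circle in the closed disc of radius [rho];
     [Cmod (z - z0) < rho] and [0 < e] make the radius exceed the distance from the moving centre to
     [z]. *)
  assert (Hin : forall e s t, 0 < e -> e <= rho - Cmod (z - z0) -> 0 <= s <= 1 ->
     Cmod (H e s t - z0) < R0 /\ H e s t <> z).
  { intros e s t He1 He2 Hs. unfold H, ct, rad. split.
    - replace (RtoC (1 - s) * z0 + RtoC s * z + RtoC ((1 - s) * rho + s * e) * cis t - z0)%C with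
        (RtoC s * (z - z0) + RtoC ((1 - s) * rho + s * e) * cis t)%C by (rewrite RtoC_minus; ring).
      eapply Rle_lt_trans; [apply Cmod_triangle|].
      rewrite !Cmod_mult, Cmod_cis, !Cmod_R, !Rabs_pos_eq by (try nra).
      apply Rle_lt_trans with rho; trivial. nra.
    - intros E.
      assert (E' : Cmod (RtoC ((1 - s) * rho + s * e) * cis t) = Cmod (RtoC (1 - s) * (z - z0))).
      { f_equal. rewrite <- E at 1. rewrite RtoC_minus.
        replace (RtoC ((1 - s) * rho + s * e) * cis t)%C with
          (((RtoC 1 - RtoC s) * z0 + RtoC s * z + RtoC ((1 - s) * rho + s * e) * cis t)
           - ((RtoC 1 - RtoC s) * z0 + RtoC s * z))%C by ring.
        rewrite RtoC_minus in E. rewrite E. ring. }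
      rewrite !Cmod_mult, Cmod_cis, !Cmod_R, !Rabs_pos_eq in E' by nra.
      assert ((1 - s) * Cmod (z - z0) <= (1 - s) * rho) by (apply Rmult_le_compat_l; lra).
      destruct (Req_dec s 0) as [->|Hs0]; [nra|]. assert (0 < s * e) by (apply Rmult_lt_0_compat; lra). lra. }
  assert (Hcont : forall e, rect_cont (H e) 0 1 0 (2 * PI)).
  { intros e s t Hs Ht eps Heps.
    set (A := Cmod (z - z0) + Rabs (e - rho) + Rabs rho + Rabs e + 1).
    assert (P1 := Cmod_ge_0 (z - z0)). assert (P2 := Rabs_pos (e - rho)). assert (P3 := Rabs_pos rho).
    assert (P4 := Rabs_pos e).
    assert (HA : 1 <= A) by (unfold A; lra).
    destruct (proj1 (continuous_Cmod cis t)
       (ex_derive_continuous (K := R_AbsRing) (V := C_R_NormedModule) cis t (ex_intro _ _ (is_derive_cis t)))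
       (eps / (2 * A)) ltac:(apply Rdiv_lt_0_compat; lra)) as [d [Hd Hc]].
    exists (Rmin d (eps / (2 * A))); split; [apply Rmin_pos; trivial; apply Rdiv_lt_0_compat; lra|].
    intros s' t' Hs' Ht' Ds Dt.
    specialize (Hc t' (Rlt_le_trans _ _ _ Dt (Rmin_l _ _))).
    assert (Ds2 := Rlt_le_trans _ _ _ Ds (Rmin_r _ _)).
    replace (H e s' t' - H e s t)%C with
      (RtoC (s' - s) * ((z - z0) + RtoC (e - rho) * cis t) + RtoC (rad e s') * (cis t' - cis t))%C.
    2: { unfold H, ct, rad. rewrite !RtoC_plus, !RtoC_mult, !RtoC_minus. ring. }
    eapply Rle_lt_trans; [apply Cmod_triangle|]. rewrite !Cmod_mult, !Cmod_R.
    assert (B1 : Rabs (s' - s) * Cmod (z - z0 + RtoC (e - rho) * cis t) <= Rabs (s' - s) * A).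
    { apply Rmult_le_compat_l; [apply Rabs_pos|]. eapply Rle_trans; [apply Cmod_triangle|].
      rewrite Cmod_mult, Cmod_cis, Cmod_R. unfold A. lra. }
    assert (B2 : Rabs (rad e s') <= A).
    { unfold rad. eapply Rle_trans; [apply Rabs_triang|]. rewrite !Rabs_mult, !(Rabs_pos_eq (1 - s')), !(Rabs_pos_eq s') by lra.
      unfold A. nra. }
    assert (B3 : Rabs (rad e s') * Cmod (cis t' - cis t) <= A * Cmod (cis t' - cis t)).
    { apply Rmult_le_compat_r; [apply Cmod_ge_0|trivial]. }
    assert (B4 : A * Cmod (cis t' - cis t) < eps / 2).
    { replace (eps / 2) with (A * (eps / (2 * A))) by (field; lra). apply Rmult_lt_compat_l; lra. }
    assert (B5 : Rabs (s' - s) * A < eps / 2).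
    { replace (eps / 2) with (eps / (2 * A) * A) by (field; lra). apply Rmult_lt_compat_r; lra. }
    lra. }
  assert (Hcirc : forall e, 0 < e -> e <= rho - Cmod (z - z0) -> exists v,
     is_CInt (fun t => F (z0 + RtoC rho * cis t) * (RtoC rho * (Ci * cis t)))%C 0 (2 * PI) v /\
     is_CInt (fun t => F (z + RtoC e * cis t) * (RtoC e * (Ci * cis t)))%C 0 (2 * PI) v).
  { intros e He1 He2.
    destruct (homotopy_boundary_null F (H e) 0 1 0 (2 * PI)) as [va [vb [vc [vd [A [B [Cc [D E]]]]]]]];
      try lra; trivial.
    { intros s t Hs Ht. destruct (Hin e s t He1 He2 Hs) as [I1 I2]. apply HF; trivial. }
    assert (Ecd : vc = vd).
    { apply (path_int_unique F (fun s => H e s (2 * PI)) 0 1); trivial.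
      apply path_int_ext with (2 := Cc). intros s Hs. unfold H. rewrite cis_0, cis_2PI. reflexivity. }
    assert (Eab : va = vb).
    { replace va with (va + vd - vd)%C by ring. rewrite E, Ecd. ring. }
    assert (G : forall s v (w : C) (x : R), 0 <= s <= 1 -> path_int F (fun t => H e s t) 0 (2 * PI) v ->
      (forall t, H e s t = w + RtoC x * cis t)%C ->
      is_CInt (fun t => F (w + RtoC x * cis t) * (RtoC x * (Ci * cis t)))%C 0 (2 * PI) v).
    { intros s v w x Hs Hv Ht.
      apply (path_int_ext F _ (fun t => w + RtoC x * cis t)%C) in Hv; [|intros; apply Ht].
      apply path_int_is_CInt in Hv.
      - revert Hv; apply is_CInt_ext; [lra|]. intros t _. do 2 f_equal.
        apply is_derive_C_velocity. apply C1_circle.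
      - intros t _; exists 1; split; [lra|]; split; intros _;
          exists (fun t => w + RtoC x * cis t)%C, (fun t => RtoC x * (Ci * cis t))%C; split; trivial; apply C1_circle.
      - intros t _. destruct (Hin e s t He1 He2 Hs) as [I1 I2]. rewrite <- Ht. apply HF; trivial. }
    exists va; split.
    - apply (G 0); trivial; [lra|]. intros t. unfold H, ct, rad.
      replace (1 - 0) with 1 by ring. replace (1 * rho + 0 * e) with rho by ring. ring.
    - rewrite Eab. apply (G 1); trivial; [lra|]. intros t. unfold H, ct, rad.
      replace (1 - 1) with 0 by ring. replace (0 * rho + 1 * e) with e by ring. ring. }
  destruct (Hcirc (rho - Cmod (z - z0)) ltac:(lra) ltac:(lra)) as [v [Hv _]].
  (* The value [v] is the same for all small radii [e], so it can be computed from the continuity of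
     [f] at [z]. *)
  assert (Hvf : v = (Ci * (RtoC (2 * PI) * f z))%C).
  { apply Cminus_eq_0, Cmod_le_small. intros eps Heps.
    destruct (deriv_at_ccont f z (Hf z ltac:(lra)) (eps / (2 * PI))) as [d [Hd Hc]].
    { apply Rdiv_lt_0_compat; lra. }
    set (e := Rmin (d / 2) (rho - Cmod (z - z0))).
    assert (He : 0 < e) by (apply Rmin_pos; lra).
    assert (He1 : e <= d / 2) by apply Rmin_l. assert (He2 : e <= rho - Cmod (z - z0)) by apply Rmin_r.
    destruct (Hcirc e He He2) as [v' [Hv' Hv2]].
    rewrite <- (is_CInt_unique2 _ _ _ _ _ Hv Hv') in Hv2.
    assert (Hc2 := is_CInt_minus _ _ _ _ _ _ Hv2 (is_CInt_const (Ci * f z)%C 0 (2 * PI))).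
    apply is_CInt_Cmod_le_const with (M := eps / (2 * PI)) in Hc2; [|lra|].
    - rewrite Rminus_0_r in Hc2.
      replace (v - Ci * (RtoC (2 * PI) * f z))%C with (v - RtoC (2 * PI) * (Ci * f z))%C by ring.
      eapply Rle_trans; [exact Hc2|]. right; field; lra.
    - intros t _. unfold F.
      assert (Hne : (RtoC e <> 0)%C) by (intros E; apply RtoC_inj in E; lra).
      replace (f (z + RtoC e * cis t) / (z + RtoC e * cis t - z) * (RtoC e * (Ci * cis t)) - Ci * f z)%C
        with (Ci * (f (z + RtoC e * cis t) - f z))%C.
      + rewrite Cmod_mult, Cmod_Ci, Rmult_1_l. left. apply Hc.
        replace (z + RtoC e * cis t - z)%C with (RtoC e * cis t)%C by ring.
        rewrite Cmod_mult, Cmod_cis, Cmod_R, Rabs_pos_eq; lra.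
      + replace (z + RtoC e * cis t - z)%C with (RtoC e * cis t)%C by ring.
        field. split; [apply cis_neq_0|trivial]. }
  apply is_CInt_mult_l with (k := (- Ci)%C) in Hv. rewrite Hvf in Hv.
  replace (- Ci * (Ci * (RtoC (2 * PI) * f z)))%C with (RtoC (2 * PI) * f z)%C in Hv.
  - revert Hv; apply is_CInt_ext; [lra|]. intros t _. unfold F, Cdiv.
    replace (- Ci * (f (z0 + RtoC rho * cis t) * / (z0 + RtoC rho * cis t - z) * (RtoC rho * (Ci * cis t))))%C
     with (- (Ci * Ci) * (f (z0 + RtoC rho * cis t) * / (z0 + RtoC rho * cis t - z) * (RtoC rho * cis t)))%C by ring.
    replace (Ci * Ci)%C with (- (1))%C by (apply injective_projections; simpl; ring). ring.
  - replace (- Ci * (Ci * (RtoC (2 * PI) * f z)))%C with (- (Ci * Ci) * (RtoC (2 * PI) * f z))%C by ring.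
    replace (Ci * Ci)%C with (- (1))%C by (apply injective_projections; simpl; ring). ring.
Qed.

(** * Taylor expansions *)

Lemma Csum_0 (u : nat -> C) : Csum 0 u = 0.
Proof. reflexivity. Qed.

Lemma Csum_S (n : nat) (u : nat -> C) : Csum (S n) u = (Csum n u + u n)%C.
Proof.
  unfold Csum. rewrite seq_S, map_app, fold_right_app. simpl.
  set (l := map u (seq 0 n)). generalize (u n) as x. intros x.
  induction l as [|y l IH]; simpl; [ring|]. rewrite IH. ring.
Qed.

Lemma Csum_ext (n : nat) (u v : nat -> C) :
  (forall i, (i < n)%nat -> u i = v i) -> Csum n u = Csum n v.
Proof.
  induction n as [|n IH]; intros H; trivial.
  rewrite !Csum_S, IH, H by (auto; lia). reflexivity.
Qed.

Lemma Csum_mult_l (k : C) (n : nat) (u : nat -> C) : Csum n (fun i => k * u i)%C = (k * Csum n u)%C.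
Proof. induction n as [|n IH]; [rewrite !Csum_0; ring|]. rewrite !Csum_S, IH. ring. Qed.

Lemma Csum_minus (n : nat) (u v : nat -> C) :
  Csum n (fun i => u i - v i)%C = (Csum n u - Csum n v)%C.
Proof. induction n as [|n IH]; [rewrite !Csum_0; ring|]. rewrite !Csum_S, IH. ring. Qed.

Lemma Csum_add (n m : nat) (u : nat -> C) :
  Csum (n + m) u = (Csum n u + Csum m (fun i => u (n + i)%nat)%C)%C.
Proof.
  induction m as [|m IH]; [rewrite Nat.add_0_r, Csum_0; ring|].
  rewrite Nat.add_succ_r, !Csum_S, IH. ring.
Qed.

Lemma Csum_const_0 (n : nat) (u : nat -> C) : (forall i, (i < n)%nat -> u i = 0) -> Csum n u = 0.
Proof.
  induction n as [|n IH]; intros H; trivial.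
  rewrite Csum_S, IH, H by (auto; lia). ring.
Qed.

Lemma is_CInt_Csum (n : nat) (u : nat -> R -> C) (l : nat -> C) (a b : R) :
  (forall i, (i < n)%nat -> is_CInt (u i) a b (l i)) ->
  is_CInt (fun t => Csum n (fun i => u i t)%C) a b (Csum n l).
Proof.
  induction n as [|n IH]; intros H.
  - assert (H0 := is_CInt_const 0 a b). replace (RtoC (b - a) * 0)%C with (RtoC 0) in H0 by ring. exact H0.
  - rewrite Csum_S. apply (is_RInt_ext (V := C_R_NormedModule)) with (fun t => Csum n (fun i => u i t)%C + u n t)%C.
    + intros t _. symmetry; apply Csum_S.
    + apply is_CInt_plus; [apply IH|apply H]; auto.
Qed.

Lemma Csum_geom (q : C) (n : nat) : ((1 - q) * Csum n (Cpow q) = 1 - Cpow q n)%C.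
Proof.
  induction n as [|n IH]; [rewrite Csum_0; simpl; ring|].
  rewrite Csum_S, Cmult_plus_distr_l, IH. simpl. ring.
Qed.

(** Cauchy's kernel is expanded as a finite geometric sum. The explicit remainder, with constants
    depending only on [M] and [rho], is what makes later estimates uniform along an unbounded
    contour. *)
Lemma Taylor (f : C -> C) (z0 : C) (R0 rho M : R) :
  holo_ball f z0 R0 -> 0 < rho < R0 ->
  (forall z, Cmod (z - z0)%C < R0 -> Cmod (f z)%C <= M) ->
  exists c : nat -> C, (forall n, Cmod (c n)%C <= M / rho ^ n) /\
    forall z N, Cmod (z - z0)%C < rho ->
      Cmod (f z - Csum N (fun n => c n * Cpow (z - z0) n)%C)%C
        <= M * (Cmod (z - z0)%C / rho) ^ N / (1 - Cmod (z - z0)%C / rho).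
Proof.
  intros Hf Hrho HM. assert (HPI := PI_RGT_0).
  set (xi := fun t => (RtoC rho * cis t)%C).
  assert (Hxi : forall t, xi t <> 0).
  { intros t. apply Cmult_neq_0; [|apply cis_neq_0]. intros E; apply RtoC_inj in E; lra. }
  assert (Hmxi : forall t, Cmod (xi t)%C = rho).
  { intros t. unfold xi. rewrite Cmod_mult, Cmod_cis, Cmod_R, Rabs_pos_eq; lra. }
  assert (Hin : forall t, Cmod (z0 + xi t - z0)%C < R0).
  { intros t. replace (z0 + xi t - z0)%C with (xi t) by ring. rewrite Hmxi. lra. }
  set (u := fun n t => (f (z0 + xi t) * Cpow (/ xi t) n)%C).
  assert (Hu : forall n, is_CInt (u n) 0 (2 * PI) (CInt (u n) 0 (2 * PI))).
  { intros n. apply is_CInt_cont; [lra|]. intros t _. apply ccurve_cont_mult.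
    - apply (ccont_curve f (fun t => z0 + RtoC rho * cis t)%C); [|apply ccurve_cont_circle].
      apply deriv_at_ccont, Hf, Hin.
    - apply (ccont_curve (fun w => Cpow (/ w) n) xi).
      + apply deriv_at_ccont. apply (deriv_at_comp (fun w => Cpow w n) Cinv); [apply deriv_at_pow|].
        apply deriv_at_inv, Hxi.
      + assert (H := ccurve_cont_circle 0 (RtoC rho) t). revert H. apply continuous_ext.
        intros s. change ((0 + RtoC rho * cis s)%C = (RtoC rho * cis s)%C). ring. }
  assert (H2PI : RtoC (2 * PI) <> 0) by (intros E; apply RtoC_inj in E; lra).
  exists (fun n => (CInt (u n) 0 (2 * PI) / RtoC (2 * PI))%C); split.
  - intros n. rewrite Cmod_div, Cmod_R, Rabs_pos_eq by (trivial; lra).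
    apply Rle_trans with (M / rho ^ n * (2 * PI) / (2 * PI)); [|right; field; repeat split; try lra; apply pow_nonzero; lra].
    apply Rmult_le_compat_r; [left; apply Rinv_0_lt_compat; lra|].
    replace (2 * PI) with (2 * PI - 0) at 2 by ring.
    apply is_CInt_Cmod_le_const with (u n); [lra| |apply Hu].
    intros t _. unfold u. rewrite Cmod_mult, Cmod_pow, Cmod_inv, Hmxi by apply Hxi.
    unfold Rdiv. rewrite pow_inv. apply Rmult_le_compat_r; [|apply HM, Hin].
    left; apply Rinv_0_lt_compat, pow_lt; lra.
  - intros z N Hz. set (w := (z - z0)%C) in *. set (q := Cmod w / rho).
    assert (Hq : 0 <= q < 1).
    { split; [apply Rmult_le_pos; [apply Cmod_ge_0|left; apply Rinv_0_lt_compat; lra]|].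
      apply Rmult_lt_reg_r with rho; [lra|]. unfold q. field_simplify; lra. }
    assert (HC := Cauchy_formula f z0 z R0 rho Hf ltac:(lra) Hz). fold xi in HC.
    assert (HS := is_CInt_Csum N (fun n t => u n t * Cpow w n)%C (fun n => CInt (u n) 0 (2 * PI) * Cpow w n)%C
      0 (2 * PI) (fun n _ => is_CInt_mult_r _ _ _ _ _ (Hu n))).
    assert (HD := is_CInt_minus _ _ _ _ _ _ HC HS).
    apply is_CInt_Cmod_le_const with (M := M * q ^ N / (1 - q)) in HD; [|lra|].
    + replace (f z - Csum N (fun n => CInt (u n) 0 (2 * PI) / RtoC (2 * PI) * Cpow w n)%C)%C
       with ((RtoC (2 * PI) * f z - Csum N (fun n => CInt (u n) 0 (2 * PI) * Cpow w n)%C) / RtoC (2 * PI))%C.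
      * rewrite Cmod_div, Cmod_R, Rabs_pos_eq by (trivial; lra).
        apply Rmult_le_reg_r with (2 * PI); [lra|]. unfold Rdiv at 1. rewrite Rmult_assoc, Rinv_l, Rmult_1_r by lra.
        rewrite Rminus_0_r in HD. exact HD.
      * rewrite (Csum_ext N (fun n => CInt (u n) 0 (2 * PI) / RtoC (2 * PI) * Cpow w n)%C
          (fun n => / RtoC (2 * PI) * (CInt (u n) 0 (2 * PI) * Cpow w n))%C)
          by (intros; unfold Cdiv; ring).
        rewrite Csum_mult_l. field. trivial.
    + intros t _. change (RtoC rho * cis t)%C with (xi t).
      assert (Hxw : (xi t - w)%C <> 0).
      { intros E. apply Cminus_eq_0 in E. rewrite <- E, Hmxi in Hz. lra. }
      replace (z0 + xi t - z)%C with (xi t - w)%C by (unfold w; ring).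
      (* With [q = w / xi], the kernel [1 / (1 - q)] minus its first [N] geometric terms is
         [q ^ N / (1 - q)]. *)
      replace (f (z0 + xi t) * (xi t / (xi t - w)) - Csum N (fun n => u n t * Cpow w n)%C)%C
        with (f (z0 + xi t) * (Cpow (w / xi t) N / (1 - w / xi t)))%C.
      * assert (Hm : Cmod (w / xi t)%C = q) by (rewrite Cmod_div, Hmxi by apply Hxi; reflexivity).
        assert (H1 := Cmod_minus_ge 1 (w / xi t)). rewrite Cmod_1, Hm in H1.
        assert (H1' : (1 - w / xi t)%C <> 0) by (apply Cmod_gt_0; lra).
        rewrite Cmod_mult, Cmod_div, Cmod_pow, Hm by trivial.
        unfold Rdiv. rewrite Rmult_assoc. apply Rmult_le_compat.
        -- apply Cmod_ge_0.
        -- apply Rmult_le_pos; [apply pow_le; lra|left; apply Rinv_0_lt_compat; lra].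
        -- apply HM, Hin.
        -- apply Rmult_le_compat_l; [apply pow_le; lra|]. apply Rinv_le_contravar; lra.
      * rewrite (Csum_ext N (fun n => u n t * Cpow w n)%C (fun n => f (z0 + xi t) * Cpow (w / xi t) n)%C).
        2: { intros n _. unfold u, Cdiv. rewrite (Cpow_mult_l w (/ xi t)). ring. }
        rewrite Csum_mult_l. set (q' := (w / xi t)%C). assert (G := Csum_geom q' N).
        assert (Hq' : (1 - q')%C <> 0).
        { unfold q'. intros E. apply Hxw. replace (xi t - w)%C with (xi t * (1 - w / xi t))%C by (field; apply Hxi).
          rewrite E; ring. }
        replace (xi t / (xi t - w))%C with (1 / (1 - q'))%C.
        2: { unfold q'. field. repeat split; trivial. }
        replace (Cpow q' N) with (1 - (1 - q') * Csum N (Cpow q'))%C by (rewrite G; ring).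
        field. trivial.
Qed.

(* An estimate equivalent to holomorphy that passes to pointwise limits, hence to
   sums and parametric integrals. *)
Definition two_point (f : C -> C) (z : C) (K r : R) : Prop :=
  forall h k : C, Cmod h <= r -> Cmod k <= r ->
    Cmod (k * (f (z + h) - f z) - h * (f (z + k) - f z))%C <= K * (Cmod h * Cmod k * (Cmod h + Cmod k)).

(** Taylor's formula of order two with radius [R0 / 2] gives [Cmod (f (z + x) - f z - c1 x) <= 8 M /
    R0^2 Cmod x ^ 2] for [Cmod x <= R0 / 4]; in the combination with [h] and [k] the unknown
    coefficient [c1] cancels. *)
Lemma holo_two_point (f : C -> C) (z : C) (R0 M : R) :
  0 < R0 -> holo_ball f z R0 -> (forall w, Cmod (w - z)%C < R0 -> Cmod (f w)%C <= M) ->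
  two_point f z (8 * M / R0 ^ 2) (R0 / 4).
Proof.
  intros HR Hf HM h k Hh Hk.
  assert (HM0 : 0 <= M).
  { eapply Rle_trans; [apply Cmod_ge_0|apply (HM z)].
    replace (z - z)%C with (RtoC 0) by ring. rewrite Cmod_0; trivial. }
  destruct (Taylor f z R0 (R0 / 2) M Hf ltac:(lra) HM) as [c [_ Hc]].
  assert (G : forall x, Cmod x <= R0 / 4 -> Cmod (f (z + x) - f z - c 1%nat * x)%C <= 8 * M / R0 ^ 2 * Cmod x ^ 2).
  { intros x Hx.
    assert (H0 := Hc z 1%nat). assert (H1 := Hc (z + x)%C 2%nat).
    replace (z - z)%C with (RtoC 0) in H0 by ring. replace (z + x - z)%C with x in H1 by ring.
    specialize (H1 ltac:(lra)). rewrite Cmod_0 in H0. specialize (H0 ltac:(lra)).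
    unfold Csum in H0, H1; simpl in H0, H1.
    assert (E0 : f z = c 0%nat).
    { apply Cminus_eq_0, Cmod_le_small. intros e He.
      replace (f z - c 0%nat)%C with (f z - (c 0%nat * 1 + 0))%C by ring.
      eapply Rle_trans; [exact H0|]. unfold Rdiv. rewrite !Rmult_0_l, Rmult_0_r, Rmult_0_l. lra. }
    replace (f (z + x) - f z - c 1%nat * x)%C with (f (z + x) - (c 0%nat * 1 + (c 1%nat * (x * 1) + 0)))%C
      by (rewrite E0; ring).
    eapply Rle_trans; [exact H1|].
    assert (Hq : Cmod x / (R0 / 2) <= 1 / 2).
    { apply Rmult_le_reg_r with (R0 / 2); [lra|]. unfold Rdiv at 1. rewrite Rmult_assoc, Rinv_l; lra. }
    apply Rle_trans with (M * (Cmod x / (R0 / 2)) ^ 2 / (1 / 2)).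
    - apply Rmult_le_compat_l; [apply Rmult_le_pos; [trivial|apply pow2_ge_0]|].
      apply Rinv_le_contravar; lra.
    - right. field. lra. }
  assert (Gh := G h Hh). assert (Gk := G k Hk).
  replace (k * (f (z + h) - f z) - h * (f (z + k) - f z))%C with
    (k * (f (z + h) - f z - c 1%nat * h) - h * (f (z + k) - f z - c 1%nat * k))%C by ring.
  eapply Rle_trans; [apply Cmod_minus_le|]. rewrite !Cmod_mult.
  apply (Rmult_le_compat_l _ _ _ (Cmod_ge_0 k)) in Gh.
  apply (Rmult_le_compat_l _ _ _ (Cmod_ge_0 h)) in Gk.
  eapply Rle_trans; [apply Rplus_le_compat; [exact Gh|exact Gk]|]. right. ring.
Qed.

(** With [k = r / 2 ^ n] the inequality compares consecutive difference quotients, which therefore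
    form a geometrically Cauchy sequence; its limit is the derivative. *)
Lemma two_point_deriv (f : C -> C) (z : C) (K r : R) : 0 < r -> two_point f z K r ->
  exists l, forall h, Cmod h <= r -> Cmod (f (z + h) - f z - l * h)%C <= K * Cmod h ^ 2.
Proof.
  intros Hr H.
  assert (P2 : forall n, 0 < 2 ^ n) by (intros; apply pow_lt; lra).
  set (e := fun n => r / 2 ^ n).
  assert (He : forall n, 0 < e n <= r).
  { intros n. assert (1 <= 2 ^ n) by (apply pow_R1_Rle; lra). unfold e. split.
    - apply Rdiv_lt_0_compat; trivial.
    - apply Rmult_le_reg_r with (2 ^ n); trivial. unfold Rdiv. rewrite Rmult_assoc, Rinv_l by lra. nra. }
  assert (Hne : forall n, RtoC (e n) <> 0).
  { intros n E; apply RtoC_inj in E. specialize (He n); lra. }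
  assert (Hme : forall n, Cmod (RtoC (e n))%C = e n).
  { intros n. rewrite Cmod_R, Rabs_pos_eq; trivial. specialize (He n); lra. }
  set (q := fun n => ((f (z + RtoC (e n)) - f z) / RtoC (e n))%C).
  assert (Hq : forall n h, Cmod h <= r -> Cmod (f (z + h) - f z - q n * h)%C <= K * Cmod h * (Cmod h + e n)).
  { intros n h Hh. assert (H' := H h (RtoC (e n)) Hh). rewrite Hme in H'. specialize (H' (proj2 (He n))).
    replace (f (z + h) - f z - q n * h)%C with
      ((RtoC (e n) * (f (z + h) - f z) - h * (f (z + RtoC (e n)) - f z)) / RtoC (e n))%C
      by (unfold q; field; apply Hne).
    rewrite Cmod_div, Hme by apply Hne. specialize (He n).
    apply Rmult_le_reg_r with (e n); [lra|]. unfold Rdiv. rewrite Rmult_assoc, Rinv_l, Rmult_1_r by lra.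
    eapply Rle_trans; [exact H'|]. right; ring. }
  destruct (C_seq_geometric q (2 * K * r)) as [l Hl].
  { intros n. assert (H' := Hq n (RtoC (e (S n)))). rewrite Hme in H'. specialize (H' (proj2 (He (S n)))).
    replace (f (z + RtoC (e (S n))) - f z - q n * RtoC (e (S n)))%C with ((q (S n) - q n) * RtoC (e (S n)))%C in H'
      by (unfold q at 1; field; apply Hne).
    rewrite Cmod_mult, Hme in H'. assert (He1 := He (S n)).
    assert (Ee : e (S n) = e n / 2) by (unfold e; simpl; field; apply Rgt_not_eq, P2).
    apply Rmult_le_reg_r with (e (S n)); [lra|]. eapply Rle_trans; [exact H'|].
    assert (HK : 0 <= K * e n).
    { assert (H2 := H (RtoC r) (RtoC r)). rewrite Cmod_R, Rabs_pos_eq in H2 by lra.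
      specialize (H2 (Rle_refl _) (Rle_refl _)).
      match type of H2 with Cmod ?x <= _ => assert (H3 := Cmod_ge_0 x) end.
      assert (0 < r * r * (r + r)) by (repeat apply Rmult_lt_0_compat; lra).
      assert (0 <= K). { destruct (Rle_lt_dec 0 K); trivial. nra. }
      apply Rmult_le_pos; trivial. specialize (He n); lra. }
    rewrite Ee. replace (2 * K * r / 2 ^ n) with (2 * (K * e n)) by (unfold e; field; apply Rgt_not_eq, P2).
    specialize (He n). nra. }
  exists l. intros h Hh. apply le_epsilon; intros eps Heps.
  assert (PK : 0 <= Rabs K) by apply Rabs_pos.
  set (A := Rabs K * Cmod h * r + Cmod h * (2 * (2 * Rabs K * r)) + 1).
  assert (Ph := Cmod_ge_0 h).
  assert (HA2 : 0 <= Cmod h * (2 * (2 * Rabs K * r))).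
  { apply Rmult_le_pos; trivial. apply Rmult_le_pos; [lra|]. apply Rmult_le_pos; lra. }
  destruct (pow_lt_1_zero (/2) ltac:(rewrite Rabs_pos_eq; lra) (eps / A)) as [N HN].
  { apply Rdiv_lt_0_compat; unfold A; lra. }
  specialize (HN N (le_n N)). rewrite Rabs_pos_eq in HN by (left; apply pow_lt; lra).
  assert (H1 := Hq N h Hh). specialize (Hl N).
  replace (f (z + h) - f z - l * h)%C with ((f (z + h) - f z - q N * h) + (q N - l) * h)%C by ring.
  eapply Rle_trans; [apply Cmod_triangle|]. rewrite Cmod_mult.
  assert (H2 : Cmod (q N - l)%C * Cmod h <= 2 * (2 * Rabs K * r) / 2 ^ N * Cmod h).
  { apply Rmult_le_compat_r; trivial. eapply Rle_trans; [exact Hl|].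
    apply Rmult_le_compat_r; [left; apply Rinv_0_lt_compat, P2|].
    assert (K <= Rabs K) by apply Rle_abs. nra. }
  assert (H3 : K * Cmod h * (Cmod h + e N) <= K * Cmod h ^ 2 + Rabs K * Cmod h * r * (/ 2) ^ N).
  { replace (K * Cmod h * (Cmod h + e N)) with (K * Cmod h ^ 2 + K * (Cmod h * r * (/2) ^ N))
      by (unfold e, Rdiv; rewrite pow_inv; ring).
    apply Rplus_le_compat_l. rewrite !Rmult_assoc. apply Rmult_le_compat_r; [|apply Rle_abs].
    repeat apply Rmult_le_pos; try lra. left; apply pow_lt; lra. }
  assert (H4 : A * (/2) ^ N <= eps).
  { replace eps with (A * (eps / A)) by (field; unfold A; lra). apply Rmult_le_compat_l; [unfold A|]; lra. }
  unfold A in H4. unfold Rdiv in H2. rewrite <- pow_inv in H2. nra.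
Qed.

Lemma two_point_deriv_at (f : C -> C) (z : C) (K r : R) : 0 < r -> two_point f z K r -> deriv_at f z.
Proof.
  intros Hr H. destruct (two_point_deriv f z K r Hr H) as [l Hl]. exists l. intros eps Heps.
  assert (PK : 0 <= Rabs K) by apply Rabs_pos.
  exists (Rmin r (eps / (Rabs K + 1))); split; [apply Rmin_pos; trivial; apply Rdiv_lt_0_compat; lra|].
  intros z' Hz'. assert (H1 := Rlt_le_trans _ _ _ Hz' (Rmin_l _ _)).
  assert (H2 := Rlt_le_trans _ _ _ Hz' (Rmin_r _ _)).
  assert (H3 := Hl (z' - z)%C ltac:(lra)). replace (z + (z' - z))%C with z' in H3 by ring.
  eapply Rle_trans; [exact H3|]. assert (P := Cmod_ge_0 (z' - z)).
  simpl; rewrite Rmult_1_r, <- Rmult_assoc. apply Rmult_le_compat_r; trivial.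
  assert (K <= Rabs K) by apply Rle_abs.
  apply Rle_trans with ((Rabs K + 1) * (eps / (Rabs K + 1))); [|right; field; lra].
  apply Rle_trans with ((Rabs K + 1) * Cmod (z' - z)%C); [apply Rmult_le_compat_r; lra|].
  apply Rmult_le_compat_l; lra.
Qed.

(** The inequality involves three values of the function and a constant depending on the common
    bound [M], so pointwise convergence is enough. *)
Lemma limit_two_point (f : nat -> C -> C) (g : C -> C) (z : C) (R0 M : R) :
  0 < R0 -> (forall n, holo_ball (f n) z R0) -> (forall n w, Cmod (w - z)%C < R0 -> Cmod (f n w)%C <= M) ->
  (forall w, Cmod (w - z)%C < R0 -> forall eps, 0 < eps ->
     exists N, forall n, (N <= n)%nat -> Cmod (f n w - g w)%C < eps) ->
  two_point g z (8 * M / R0 ^ 2) (R0 / 4).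
Proof.
  intros HR Hf HM Hlim h k Hh Hk. apply le_epsilon; intros eps Heps.
  assert (Ph := Cmod_ge_0 h). assert (Pk := Cmod_ge_0 k).
  set (A := 2 * (Cmod h + Cmod k) + 1).
  assert (HA : 0 < eps / A) by (apply Rdiv_lt_0_compat; unfold A; lra).
  assert (Z : Cmod (z - z)%C < R0) by (replace (z - z)%C with (RtoC 0) by ring; rewrite Cmod_0; trivial).
  assert (Zh : Cmod (z + h - z)%C < R0) by (replace (z + h - z)%C with h by ring; lra).
  assert (Zk : Cmod (z + k - z)%C < R0) by (replace (z + k - z)%C with k by ring; lra).
  destruct (Hlim z Z _ HA) as [N1 H1]. destruct (Hlim _ Zh _ HA) as [N2 H2]. destruct (Hlim _ Zk _ HA) as [N3 H3].
  set (n := (N1 + N2 + N3)%nat). specialize (H1 n ltac:(unfold n; lia)). specialize (H2 n ltac:(unfold n; lia)).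
  specialize (H3 n ltac:(unfold n; lia)).
  assert (T := holo_two_point (f n) z R0 M HR (Hf n) (HM n) h k Hh Hk).
  replace (k * (g (z + h) - g z) - h * (g (z + k) - g z))%C with
    ((k * (f n (z + h) - f n z) - h * (f n (z + k) - f n z)) +
     (k * ((f n z - g z) - (f n (z + h) - g (z + h))) - h * ((f n z - g z) - (f n (z + k) - g (z + k)))))%C by ring.
  eapply Rle_trans; [apply Cmod_triangle|]. apply Rplus_le_compat; trivial.
  eapply Rle_trans; [apply Cmod_minus_le|]. rewrite !Cmod_mult.
  assert (B1 : Cmod ((f n z - g z) - (f n (z + h) - g (z + h)))%C <= 2 * (eps / A)).
  { eapply Rle_trans; [apply Cmod_minus_le|]. lra. }
  assert (B2 : Cmod ((f n z - g z) - (f n (z + k) - g (z + k)))%C <= 2 * (eps / A)).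
  { eapply Rle_trans; [apply Cmod_minus_le|]. lra. }
  apply (Rmult_le_compat_l _ _ _ Pk) in B1. apply (Rmult_le_compat_l _ _ _ Ph) in B2.
  assert (B3 : A * (eps / A) = eps) by (field; unfold A; lra). unfold A in B3 at 1. lra.
Qed.

Lemma loc_holo_bounded (f : C -> C) (z : C) : loc_holo f z ->
  exists r M, 0 < r /\ holo_ball f z r /\ forall w, Cmod (w - z)%C < r -> Cmod (f w)%C <= M.
Proof.
  intros [r [Hr Hf]].
  assert (Z : Cmod (z - z)%C < r) by (replace (z - z)%C with (RtoC 0) by ring; rewrite Cmod_0; trivial).
  destruct (deriv_at_ccont f z (Hf z Z) 1 Rlt_0_1) as [d [Hd Hc]].
  exists (Rmin r d), (Cmod (f z)%C + 1). split; [apply Rmin_pos; trivial|]. split.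
  - intros w Hw. apply Hf. eapply Rlt_le_trans; [exact Hw|apply Rmin_l].
  - intros w Hw. specialize (Hc w (Rlt_le_trans _ _ _ Hw (Rmin_r _ _))).
    replace (f w) with (f z + (f w - f z))%C by ring. eapply Rle_trans; [apply Cmod_triangle|]. lra.
Qed.

(** Either all Taylor coefficients vanish, or the first non-zero one dominates the remainder near
    [z]. *)
Lemma isolated_zeros (f : C -> C) (z : C) : loc_holo f z ->
  exists r, 0 < r /\ ((forall w, Cmod (w - z)%C < r -> f w = 0) \/
    (forall w, Cmod (w - z)%C < r -> w <> z -> f w <> 0)).
Proof.
  intros Hf. destruct (loc_holo_bounded f z Hf) as [R0 [M [HR [HfR HM]]]].
  destruct (Taylor f z R0 (R0 / 2) M HfR ltac:(lra) HM) as [c [_ Hc]].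
  assert (HM0 : 0 <= M).
  { eapply Rle_trans; [apply Cmod_ge_0|apply (HM z)].
    replace (z - z)%C with (RtoC 0) by ring. rewrite Cmod_0; trivial. }
  assert (Hq : forall w, Cmod (w - z)%C < R0 / 4 -> 0 <= Cmod (w - z)%C / (R0 / 2) < 1 / 2).
  { intros w Hw. split.
    - apply Rmult_le_pos; [apply Cmod_ge_0|left; apply Rinv_0_lt_compat; lra].
    - apply Rmult_lt_reg_r with (R0 / 2); [lra|]. unfold Rdiv at 1. rewrite Rmult_assoc, Rinv_l; lra. }
  assert (Hc2 : forall w N, Cmod (w - z)%C < R0 / 4 ->
    Cmod (f w - Csum N (fun n => c n * Cpow (w - z) n)%C)%C <= 2 * M * (Cmod (w - z)%C / (R0 / 2)) ^ N).
  { intros w N Hw. eapply Rle_trans; [apply Hc; lra|]. specialize (Hq w Hw).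
    replace (2 * M * (Cmod (w - z)%C / (R0 / 2)) ^ N) with (M * (Cmod (w - z)%C / (R0 / 2)) ^ N * 2) by ring.
    apply Rmult_le_compat_l; [apply Rmult_le_pos; trivial; apply pow_le; lra|].
    apply Rle_trans with (/ / 2); [apply Rinv_le_contravar; lra|rewrite Rinv_inv; lra]. }
  destruct (Classical_Prop.classic (forall n, c n = 0)) as [H0|H0].
  - exists (R0 / 4). split; [lra|left]. intros w Hw. apply Cmod_le_small. intros eps Heps.
    destruct (pow_lt_1_zero (/2) ltac:(rewrite Rabs_pos_eq; lra) (eps / (2 * M + 1))
      ltac:(apply Rdiv_lt_0_compat; lra)) as [N HN].
    specialize (HN N (le_n N)). rewrite Rabs_pos_eq in HN by (left; apply pow_lt; lra).
    assert (H1 := Hc2 w N Hw). rewrite Csum_const_0 in H1 by (intros; rewrite H0; ring).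
    replace (f w - 0)%C with (f w) in H1 by ring. specialize (Hq w Hw).
    assert (H2 : (Cmod (w - z)%C / (R0 / 2)) ^ N <= (/2) ^ N) by (apply pow_incr; lra).
    eapply Rle_trans; [exact H1|].
    apply Rle_trans with ((2 * M + 1) * (/2) ^ N).
    + apply Rmult_le_compat; try lra. apply pow_le; lra.
    + replace eps with ((2 * M + 1) * (eps / (2 * M + 1))) by (field; lra). apply Rmult_le_compat_l; lra.
  - assert (Hk : exists k, c k <> 0 /\ forall i, (i < k)%nat -> c i = 0).
    { apply Classical_Pred_Type.not_all_ex_not in H0. destruct H0 as [n Hn].
      induction n as [n IH] using (well_founded_induction lt_wf).
      destruct (Classical_Prop.classic (exists m, (m < n)%nat /\ c m <> 0)) as [[m [Hm Hcm]]|N].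
      - apply (IH m Hm Hcm).
      - exists n; split; trivial. intros i Hi. destruct (Ceq_dec (c i) 0) as [|Hci]; trivial.
        exfalso; apply N; exists i; split; trivial. }
    destruct Hk as [k [Hck Hlt]]. assert (Pck : 0 < Cmod (c k)%C) by (apply Cmod_gt_0; trivial).
    (* With [c k] the first non-zero coefficient, the remainder after it is at most
       [B * Cmod (w - z) ^ (S k)]; the radius chosen next makes this smaller than the term of order
       [k]. *)
    set (B := 2 * M * (/ (R0 / 2)) ^ (S k)).
    assert (HB : 0 <= B).
    { apply Rmult_le_pos; [lra|]. apply pow_le; left; apply Rinv_0_lt_compat; lra. }
    exists (Rmin (R0 / 4) (Cmod (c k)%C / (B + 1))). split; [apply Rmin_pos; [lra|apply Rdiv_lt_0_compat; lra]|].
    right. intros w Hw Hne E.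
    assert (H1 := Rlt_le_trans _ _ _ Hw (Rmin_l _ _)). assert (H2 := Rlt_le_trans _ _ _ Hw (Rmin_r _ _)).
    assert (H3 := Hc2 w (S k) H1). rewrite E, Csum_S, Csum_const_0 in H3 by (intros; rewrite Hlt by trivial; ring).
    replace (0 - (0 + c k * Cpow (w - z) k))%C with (- (c k * Cpow (w - z) k))%C in H3 by ring.
    rewrite Cmod_opp, Cmod_mult, Cmod_pow in H3.
    assert (Pw : 0 < Cmod (w - z)%C) by (apply Cmod_gt_0; intros E'; apply Hne, Cminus_eq_0, E').
    assert (Pwk : 0 < Cmod (w - z)%C ^ k) by (apply pow_lt; trivial).
    replace (2 * M * (Cmod (w - z)%C / (R0 / 2)) ^ S k) with (B * Cmod (w - z)%C * Cmod (w - z)%C ^ k) in H3.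
    2: { unfold B, Rdiv at 2. rewrite Rpow_mult_distr. simpl. ring. }
    apply Rmult_le_reg_r in H3; trivial.
    assert ((B + 1) * Cmod (w - z)%C < Cmod (c k)%C).
    { replace (Cmod (c k)%C) with ((B + 1) * (Cmod (c k)%C / (B + 1))) by (field; lra).
      apply Rmult_lt_compat_l; lra. }
    nra.
Qed.

(** * Power series and the exponential *)

Definition Csum_lim (u : nat -> C) (l : C) : Prop :=
  forall eps, 0 < eps -> exists N, forall n, (N <= n)%nat -> Cmod (Csum n u - l)%C < eps.

Lemma Csum_lim_unique (u : nat -> C) (l m : C) : Csum_lim u l -> Csum_lim u m -> l = m.
Proof.
  intros H1 H2. apply Cminus_eq_0, Cmod_le_small. intros eps Heps.
  destruct (H1 (eps / 2)) as [N1 A1]; [lra|]. destruct (H2 (eps / 2)) as [N2 A2]; [lra|].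
  specialize (A1 (N1 + N2)%nat ltac:(lia)). specialize (A2 (N1 + N2)%nat ltac:(lia)).
  rewrite Cmod_minus_sym in A1. eapply Rle_trans; [apply Cmod_tri3|]. left.
  apply Rlt_le_trans with (eps / 2 + eps / 2); [apply Rplus_lt_compat; eassumption|lra].
Qed.

Lemma sum_n_Csum (u : nat -> C) (n : nat) :
  sum_n (G := C_NormedModule) u n = Csum (S n) u.
Proof.
  induction n as [|n IH].
  - rewrite sum_O, Csum_S, Csum_0. symmetry. apply Cplus_0_l.
  - rewrite sum_Sn, IH, (Csum_S (S n)). reflexivity.
Qed.

Lemma is_series_Csum_lim (u : nat -> C) (l : C) :
  is_series (K := C_AbsRing) (V := C_NormedModule) u l <-> Csum_lim u l.
Proof.
  split.
  - intros H eps Heps.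
    destruct (H (fun z => Cmod (z - l)%C < eps)) as [N HN].
    { apply locally_Cmod. exists eps; split; trivial. }
    exists (S N). intros [|n] Hn; [lia|]. rewrite <- sum_n_Csum. apply HN. lia.
  - intros H P HP. apply locally_Cmod in HP. destruct HP as [r [Hr HP]].
    destruct (H r Hr) as [N HN]. exists N. intros n Hn. apply HP. rewrite sum_n_Csum. apply HN. lia.
Qed.

(** A total sum by coordinates, so that [pseries] is a function before its convergence is known. *)
Definition CSeries (u : nat -> C) : C :=
  (Series (fun n => Re (u n)), Series (fun n => Im (u n))).

Lemma CSeries_eq (u : nat -> C) (l : C) : Csum_lim u l -> CSeries u = l.
Proof.
  intros H.
  assert (G : forall q : C -> R, (forall x y, q (x + y)%C = q x + q y) -> q 0 = 0 ->
     (forall x y, q (x - y)%C = q x - q y) -> (forall x, Rabs (q x) <= Cmod x) ->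
     Series (fun n => q (u n)) = q l).
  { intros q Hq Hq0 Hqm Hqa. apply is_series_unique. intros P [e HP].
    destruct (H e (cond_pos e)) as [N HN]. exists N. intros n Hn. apply HP.
    assert (E : sum_n (fun n => q (u n)) n = q (Csum (S n) u)).
    { clear - Hq Hq0. induction n as [|n IH].
      - rewrite sum_O, Csum_S, Csum_0, Hq, Hq0. symmetry. apply Rplus_0_l.
      - rewrite sum_Sn, IH, (Csum_S (S n)), Hq. reflexivity. }
    change (Rabs (sum_n (fun n => q (u n)) n - q l) < e). rewrite E, <- Hqm.
    eapply Rle_lt_trans; [apply Hqa|]. apply HN. lia. }
  unfold CSeries. rewrite (G Re), (G Im).
  - destruct l; reflexivity.
  - reflexivity.
  - reflexivity.
  - reflexivity.
  - intros x. eapply Rle_trans; [|apply Rmax_Cmod]. apply Rmax_r.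
  - reflexivity.
  - reflexivity.
  - reflexivity.
  - apply re_le_Cmod.
Qed.

Lemma geom_lim (M q eps : R) : 0 <= q < 1 -> 0 < eps ->
  exists N, forall n, (N <= n)%nat -> M * q ^ n < eps.
Proof.
  intros Hq Heps. assert (P := Rabs_pos M).
  destruct (pow_lt_1_zero q ltac:(rewrite Rabs_pos_eq; lra) (eps / (Rabs M + 1))
    ltac:(apply Rdiv_lt_0_compat; lra)) as [N HN].
  exists N; intros n Hn. specialize (HN n Hn). rewrite Rabs_pos_eq in HN by (apply pow_le; lra).
  assert (Pq : 0 <= q ^ n) by (apply pow_le; lra).
  apply Rle_lt_trans with ((Rabs M + 1) * q ^ n).
  - apply Rmult_le_compat_r; trivial. assert (H := Rle_abs M). lra.
  - replace eps with ((Rabs M + 1) * (eps / (Rabs M + 1))) by (field; lra).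
    apply Rmult_lt_compat_l; lra.
Qed.

Lemma Csum_tail_geom (u : nat -> C) (M q : R) (n k : nat) :
  0 <= q < 1 -> (forall i, Cmod (u i)%C <= M * q ^ i) ->
  Cmod (Csum (n + k) u - Csum n u)%C <= M * q ^ n / (1 - q).
Proof.
  intros Hq Hu.
  assert (HM : 0 <= M) by (eapply Rle_trans; [apply Cmod_ge_0|]; generalize (Hu 0%nat); simpl; rewrite Rmult_1_r; trivial; intros; eassumption).
  assert (H : Cmod (Csum (n + k) u - Csum n u)%C <= M * q ^ n / (1 - q) - M * q ^ (n + k) / (1 - q)).
  { induction k as [|k IH].
    - rewrite Nat.add_0_r. replace (Csum n u - Csum n u)%C with (RtoC 0) by ring. rewrite Cmod_0; lra.
    - rewrite Nat.add_succ_r, Csum_S.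
      replace (Csum (n + k) u + u (n + k)%nat - Csum n u)%C with ((Csum (n + k) u - Csum n u) + u (n + k)%nat)%C by ring.
      eapply Rle_trans; [apply Cmod_triangle|]. specialize (Hu (n + k)%nat).
      replace (M * q ^ S (n + k) / (1 - q)) with (M * q ^ (n + k) / (1 - q) - M * q ^ (n + k)).
      + lra.
      + simpl. field. lra. }
  assert (0 <= M * q ^ (n + k) / (1 - q)); [|lra].
  apply Rmult_le_pos; [apply Rmult_le_pos; trivial; apply pow_le; lra|left; apply Rinv_0_lt_compat; lra].
Qed.

Lemma Csum_lim_geom (u : nat -> C) (M q : R) :
  0 <= q < 1 -> (forall i, Cmod (u i)%C <= M * q ^ i) ->
  Csum_lim u (CSeries u) /\
  forall n, Cmod (CSeries u - Csum n u)%C <= M * q ^ n / (1 - q).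
Proof.
  intros Hq Hu.
  destruct (C_filter_cauchy eventually _ (fun n => Csum n u)) as [l Hl].
  { intros eps Heps. destruct (geom_lim (M / (1 - q)) q (eps / 2) Hq ltac:(lra)) as [N HN].
    specialize (HN N (le_n N)).
    exists (fun n => (N <= n)%nat). split; [exists N; trivial|]. intros n m Hn Hm.
    assert (A := Csum_tail_geom u M q N (n - N) Hq Hu). assert (B := Csum_tail_geom u M q N (m - N) Hq Hu).
    replace (N + (n - N))%nat with n in A by lia. replace (N + (m - N))%nat with m in B by lia.
    eapply Rle_lt_trans; [apply Cmod_tri3 with (y := Csum N u)|].
    rewrite (Cmod_minus_sym (Csum N u)).
    replace (M * q ^ N / (1 - q)) with (M / (1 - q) * q ^ N) in A, B by (field; lra). lra. }
  assert (HL : Csum_lim u l) by (intros eps Heps; destruct (Hl eps Heps) as [N HN]; exists N; exact HN).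
  rewrite (CSeries_eq _ _ HL). split; trivial.
  intros n. apply le_epsilon; intros eps Heps. destruct (HL eps Heps) as [N HN].
  specialize (HN (n + N)%nat ltac:(lia)). assert (A := Csum_tail_geom u M q n N Hq Hu).
  eapply Rle_trans; [apply Cmod_tri3 with (y := Csum (n + N) u)|].
  rewrite (Cmod_minus_sym l). lra.
Qed.

Lemma deriv_at_Csum (n : nat) (u : nat -> C -> C) (z : C) :
  (forall i, deriv_at (u i) z) -> deriv_at (fun x => Csum n (fun i => u i x)%C) z.
Proof.
  intros H. induction n as [|n IH].
  - apply (deriv_at_const 0).
  - destruct (deriv_at_plus _ _ _ IH (H n)) as [l Hl]. exists l.
    exact (has_cderiv_locally_ext _ _ _ _ 1 Rlt_0_1 (fun z' _ => eq_sym (Csum_S n (fun i => u i z'))) Hl).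
Qed.

Definition pseries (b : nat -> C) (u : C) : C := CSeries (fun n => b n * Cpow u n)%C.

Lemma pseries_lim (b : nat -> C) (M rho : R) (u : C) :
  0 <= rho -> (forall n, Cmod (b n)%C <= M * rho ^ n) -> rho * Cmod u < 1 ->
  Csum_lim (fun n => b n * Cpow u n)%C (pseries b u) /\
  forall n, Cmod (pseries b u - Csum n (fun n => b n * Cpow u n)%C)%C <= M * (rho * Cmod u) ^ n / (1 - rho * Cmod u).
Proof.
  intros Hrho Hb Hu. apply Csum_lim_geom.
  - split; trivial. apply Rmult_le_pos; [trivial|apply Cmod_ge_0].
  - intros i. rewrite Cmod_mult, Cmod_pow, Rpow_mult_distr, <- Rmult_assoc.
    apply Rmult_le_compat_r; [apply pow_le, Cmod_ge_0|apply Hb].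
Qed.

(** The partial sums are bounded by [M / (1 - q)] on a disc whose radius is half the distance to the
    circle of radius [/ rho], so [limit_two_point] applies to them. *)
Lemma pseries_deriv_at (b : nat -> C) (M rho : R) (u : C) :
  0 < rho -> (forall n, Cmod (b n)%C <= M * rho ^ n) -> rho * Cmod u < 1 ->
  deriv_at (pseries b) u.
Proof.
  intros Hrho Hb Hu.
  assert (HM : 0 <= M).
  { eapply Rle_trans; [apply Cmod_ge_0|]. specialize (Hb 0%nat). simpl in Hb. rewrite Rmult_1_r in Hb. exact Hb. }
  set (r := (/ rho - Cmod u) / 2).
  assert (Hr : 0 < r).
  { unfold r. assert (Cmod u < / rho); [|lra]. apply Rmult_lt_reg_l with rho; trivial. rewrite Rinv_r; lra. }
  set (q := rho * (Cmod u + r)).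
  assert (Hq : q < 1).
  { unfold q, r. replace (rho * (Cmod u + (/ rho - Cmod u) / 2)) with ((rho * Cmod u + 1) / 2) by (field; lra). lra. }
  assert (Pu := Cmod_ge_0 u).
  assert (Hin : forall w, Cmod (w - u)%C < r -> 0 <= rho * Cmod w <= q).
  { intros w Hw. split; [apply Rmult_le_pos; [lra|apply Cmod_ge_0]|]. apply Rmult_le_compat_l; [lra|].
    replace w with (u + (w - u))%C by ring. eapply Rle_trans; [apply Cmod_triangle|]. lra. }
  apply two_point_deriv_at with (8 * (2 * (M / (1 - q))) / r ^ 2) (r / 4); [lra|].
  apply limit_two_point with (fun n x => Csum n (fun i => b i * Cpow x i)%C); trivial.
  - intros n w _. apply deriv_at_Csum. intros i. apply deriv_at_mult; [apply deriv_at_const|apply deriv_at_pow].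
  - intros n w Hw. specialize (Hin w Hw).
    assert (A := Csum_tail_geom (fun i => b i * Cpow w i)%C M q 0 n ltac:(lra)).
    rewrite Csum_0 in A. simpl in A.
    replace (Csum n (fun i => b i * Cpow w i)%C - 0)%C with (Csum n (fun i => b i * Cpow w i)%C) in A by ring.
    assert (0 <= M / (1 - q)) by (apply Rmult_le_pos; [trivial|left; apply Rinv_0_lt_compat; lra]).
    rewrite Rmult_1_r in A. eapply Rle_trans; [apply A|lra].
    intros i. rewrite Cmod_mult, Cmod_pow. apply Rle_trans with (M * rho ^ i * Cmod w ^ i).
    + apply Rmult_le_compat_r; [apply pow_le, Cmod_ge_0|apply Hb].
    + rewrite Rmult_assoc, <- Rpow_mult_distr. apply Rmult_le_compat_l; trivial. apply pow_incr; lra.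
  - intros w Hw eps Heps. specialize (Hin w Hw).
    apply (proj1 (pseries_lim b M rho w ltac:(lra) Hb ltac:(lra))); trivial.
Qed.

Lemma pow_fact_le_exp (x : R) (n : nat) : 0 <= x -> x ^ n / INR (fact n) <= exp x.
Proof.
  intros Hx. eapply Rle_trans; [|apply (exp_ge_taylor x n Hx)].
  assert (Hp : forall k, 0 <= x ^ k / INR (fact k)).
  { intros k. apply Rmult_le_pos; [apply pow_le; trivial|left; apply Rinv_0_lt_compat, INR_fact_lt_0]. }
  assert (Hs : forall m, 0 <= sum_f_R0 (fun k => x ^ k / INR (fact k)) m).
  { intros m; induction m as [|m IH]; [exact (Hp 0%nat)|]. rewrite tech5.
    apply Rplus_le_le_0_compat; [exact IH|apply Hp]. }
  destruct n as [|n]; [simpl; lra|]. rewrite tech5. specialize (Hs n). lra.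
Qed.

Lemma Csum_S_first (n : nat) (u : nat -> C) : Csum (S n) u = (u 0%nat + Csum n (fun i => u (S i))%C)%C.
Proof. rewrite (Csum_add 1 n). rewrite Csum_S, Csum_0. simpl. ring. Qed.

Lemma Csum_poly_bound (n : nat) (d : nat -> C) : exists B, 0 <= B /\
  forall x : R, 0 <= x <= 1 -> Cmod (Csum n (fun i => d i * Cpow (RtoC x) i)%C)%C <= B.
Proof.
  induction n as [|n [B [HB IH]]].
  - exists 0; split; [lra|]. intros. rewrite Csum_0, Cmod_0; lra.
  - exists (B + Cmod (d n)%C). assert (P := Cmod_ge_0 (d n)). split; [lra|]. intros x Hx.
    rewrite Csum_S. eapply Rle_trans; [apply Cmod_triangle|]. apply Rplus_le_compat; [auto|].
    rewrite Cmod_mult, Cmod_pow, Cmod_R, Rabs_pos_eq by lra.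
    rewrite <- (Rmult_1_r (Cmod (d n)%C)) at 2. apply Rmult_le_compat_l; trivial.
    rewrite <- (pow1 n). apply pow_incr; trivial.
Qed.

(** The constant coefficient is arbitrarily small, hence [0]; then one divides by [x]. The estimate
    is asked only at some arbitrarily small positive [x], which is what continuation past poles
    delivers. *)
Lemma small_polynomial_zero (N : nat) (d : nat -> C) (K : R) :
  (forall A, 0 < A -> exists x, 0 < x < A /\ Cmod (Csum N (fun i => d i * Cpow (RtoC x) i)%C)%C <= K * x ^ N) ->
  forall i, (i < N)%nat -> d i = 0.
Proof.
  revert d; induction N as [|N IH]; intros d H i Hi; [lia|].
  destruct (Csum_poly_bound N (fun i => d (S i))) as [B [HB HBx]].
  assert (Hfac : forall x, Csum (S N) (fun i => d i * Cpow (RtoC x) i)%C =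
     (d 0%nat + RtoC x * Csum N (fun i => d (S i) * Cpow (RtoC x) i)%C)%C).
  { intros x. rewrite Csum_S_first, <- Csum_mult_l. simpl. f_equal; [ring|].
    apply Csum_ext; intros; ring. }
  assert (D0 : d 0%nat = 0).
  { apply Cmod_le_small. intros eps Heps. assert (PK := Rabs_pos K).
    destruct (H (Rmin 1 (eps / (Rabs K + B + 1)))) as [x [Hx Hle]].
    { apply Rmin_pos; [lra|]. apply Rdiv_lt_0_compat; lra. }
    assert (H1 := Rmin_l 1 (eps / (Rabs K + B + 1))). assert (H2 := Rmin_r 1 (eps / (Rabs K + B + 1))).
    rewrite Hfac in Hle. specialize (HBx x ltac:(lra)).
    replace (d 0%nat) with ((d 0%nat + RtoC x * Csum N (fun i => d (S i) * Cpow (RtoC x) i)%C)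
      - RtoC x * Csum N (fun i => d (S i) * Cpow (RtoC x) i)%C)%C by ring.
    eapply Rle_trans; [apply Cmod_minus_le|]. rewrite (Cmod_mult (RtoC x)), Cmod_R, Rabs_pos_eq by lra.
    assert (H3 : K * x ^ S N <= Rabs K * x).
    { simpl. replace (K * (x * x ^ N)) with (K * x ^ N * x) by ring. apply Rmult_le_compat_r; [lra|].
      assert (0 <= x ^ N <= 1).
      { split; [apply pow_le; lra|]. rewrite <- (pow1 N). apply pow_incr; lra. }
      assert (K <= Rabs K) by apply Rle_abs. nra. }
    assert (H4 : x * Cmod (Csum N (fun i => d (S i) * Cpow (RtoC x) i)%C)%C <= x * B) by (apply Rmult_le_compat_l; lra).
    assert (H5 : x * (Rabs K + B + 1) <= eps).
    { apply Rle_trans with (eps / (Rabs K + B + 1) * (Rabs K + B + 1)); [apply Rmult_le_compat_r; lra|].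
      right; field; lra. }
    lra. }
  destruct i as [|i]; trivial.
  apply (IH (fun i => d (S i))); [|lia].
  intros A HA. destruct (H A HA) as [x [Hx Hle]]. exists x; split; trivial.
  rewrite Hfac, D0 in Hle.
  replace (0 + RtoC x * Csum N (fun i => d (S i) * Cpow (RtoC x) i)%C)%C with
    (RtoC x * Csum N (fun i => d (S i) * Cpow (RtoC x) i)%C)%C in Hle by ring.
  rewrite Cmod_mult, Cmod_R, Rabs_pos_eq in Hle by lra.
  apply Rmult_le_reg_l with x; [lra|]. simpl in Hle. lra.
Qed.

(** * The complex exponential and polar coordinates *)

Lemma Cexp_cis (z : C) : Cexp z = (RtoC (exp (Re z)) * cis (Im z))%C.
Proof. apply injective_projections; simpl; ring. Qed.

Lemma Cexp_plus (z w : C) : Cexp (z + w)%C = (Cexp z * Cexp w)%C.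
Proof.
  destruct z as [x y], w as [x' y']. apply injective_projections; simpl;
    rewrite exp_plus, ?cos_plus, ?sin_plus; ring.
Qed.

Lemma Cexp_0 : Cexp 0 = RtoC 1.
Proof. unfold Cexp; simpl. rewrite exp_0, cos_0, sin_0. apply injective_projections; simpl; ring. Qed.

Lemma Cmod_Cexp (z : C) : Cmod (Cexp z)%C = exp (Re z).
Proof.
  rewrite Cexp_cis, Cmod_mult, Cmod_cis, Cmod_R, Rabs_pos_eq; [ring|]. left; apply exp_pos.
Qed.

Lemma has_cderiv_Cexp_0 : has_cderiv Cexp 0 1.
Proof.
  intros eps Heps.
  destruct (is_derive_R_eps exp 0 (exp 0) (is_derive_exp 0) (Rmin 1 (eps / 3))) as [d1 [Hd1 H1]].
  { apply Rmin_pos; lra. }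
  destruct (proj1 (is_derive_C_eps cis 0 _) (is_derive_cis 0) (Rmin 1 (eps / 3))) as [d2 [Hd2 H2]].
  { apply Rmin_pos; lra. }
  exists (Rmin (Rmin d1 d2) (Rmin 1 (eps / 6))); split; [repeat apply Rmin_pos; lra|].
  intros [x y] Hz. replace ((x, y) - 0)%C with ((x, y) : C) in * by (apply injective_projections; simpl; ring).
  assert (L1 := Rlt_le_trans _ _ _ Hz (Rmin_l _ _)). assert (L2 := Rlt_le_trans _ _ _ Hz (Rmin_r _ _)).
  assert (L3 := Rlt_le_trans _ _ _ L1 (Rmin_l _ _)). assert (L4 := Rlt_le_trans _ _ _ L1 (Rmin_r _ _)).
  assert (L6 := Rlt_le_trans _ _ _ L2 (Rmin_r _ _)).
  assert (Hx : Rabs x <= Cmod (x, y)%C) by apply (re_le_Cmod (x, y)).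
  assert (Hy : Rabs y <= Cmod (x, y)%C).
  { eapply Rle_trans; [|apply (Rmax_Cmod (x, y))]. apply Rmax_r. }
  set (D := Cmod (x, y)%C) in *.
  specialize (H1 x). specialize (H2 y). rewrite Rminus_0_r in H1, H2. rewrite exp_0 in H1. rewrite cis_0 in H2.
  specialize (H1 ltac:(lra)). specialize (H2 ltac:(lra)).
  rewrite Cexp_0, Cexp_cis; simpl.
  (* The outer two terms are the linearization errors of [exp] and [cis]; the middle one,
     [x (cis y - 1)], is of second order. *)
  replace (RtoC (exp x) * cis y - 1 - 1 * (x, y))%C with
    (RtoC (exp x - 1 - x * 1) * cis y + (RtoC x * (cis y - 1) + (cis y - 1 - Ci * 1 * RtoC y)))%C.
  2: { rewrite !RtoC_minus, RtoC_mult. replace ((x, y) : C) with (RtoC x + RtoC y * Ci)%C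
        by (apply injective_projections; simpl; ring). ring. }
  assert (Pe1 := Rmin_l 1 (eps / 3)). assert (Pe2 := Rmin_r 1 (eps / 3)).
  assert (Hc : Cmod (cis y - 1)%C <= 2 * D).
  { replace (cis y - 1)%C with ((cis y - 1 - Ci * 1 * RtoC y) + Ci * RtoC y)%C by ring.
    eapply Rle_trans; [apply Cmod_triangle|]. rewrite (Cmod_mult Ci), Cmod_Ci, Cmod_R.
    assert (Py := Rabs_pos y). nra. }
  eapply Rle_trans; [apply Cmod_triangle|].
  eapply Rle_trans; [apply Rplus_le_compat_l, Cmod_triangle|].
  rewrite !Cmod_mult, Cmod_cis, !Cmod_R in *.
  assert (Px := Rabs_pos x). assert (Py := Rabs_pos y).
  assert (B1 : Rmin 1 (eps / 3) * Rabs x <= eps / 3 * D) by (apply Rmult_le_compat; lra || (apply Rmin_case; lra)).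
  assert (B2 : Rmin 1 (eps / 3) * Rabs y <= eps / 3 * D) by (apply Rmult_le_compat; lra || (apply Rmin_case; lra)).
  assert (B3 : Rabs x * Cmod (cis y - 1)%C <= eps / 3 * D).
  { apply Rle_trans with (D * (2 * D)).
    - apply Rmult_le_compat; trivial. apply Cmod_ge_0.
    - replace (D * (2 * D)) with ((2 * D) * D) by ring. apply Rmult_le_compat_r; lra. }
  rewrite Cmod_mult, Cmod_Ci, Cmod_R in H2 || idtac.
  lra.
Qed.

Lemma has_cderiv_Cexp (z : C) : has_cderiv Cexp z (Cexp z).
Proof.
  apply has_cderiv_locally_ext with (fun w => Cexp z * Cexp (w - z))%C 1; [lra| |].
  - intros w _. rewrite <- Cexp_plus. f_equal. ring.
  - assert (H1 : has_cderiv (fun w => Cexp (w - z)%C) z (1 * 1)).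
    { apply (has_cderiv_comp Cexp (fun w => w - z)%C).
      + replace (z - z)%C with (RtoC 0) by ring. apply has_cderiv_Cexp_0.
      + apply has_cderiv_locally_ext with (fun w => - z + 1 * w)%C 1; [lra|intros; ring|apply has_cderiv_affine]. }
    assert (H2 := has_cderiv_mult _ _ _ _ _ (has_cderiv_const (Cexp z) z) H1).
    cbv beta in H2. replace (0 * Cexp (z - z) + Cexp z * (1 * 1))%C with (Cexp z) in H2 by ring. exact H2.
Qed.

Lemma polar_form (z : C) : z <> 0 -> exists t, - PI < t <= PI /\ z = (RtoC (Cmod z) * cis t)%C.
Proof.
  intros Hz. assert (Hm : 0 < Cmod z) by (apply Cmod_gt_0; trivial).
  assert (HPI := PI_RGT_0).
  set (x := Re z / Cmod z). set (y := Im z / Cmod z).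
  assert (Hxy : x * x + y * y = 1).
  { unfold x, y. assert (H := Cmod2_alt z). replace (Re z / Cmod z * (Re z / Cmod z) + Im z / Cmod z * (Im z / Cmod z))
     with ((Re z ^ 2 + Im z ^ 2) / Cmod z ^ 2) by (field; lra). rewrite <- H. field. lra. }
  assert (Hx : -1 <= x <= 1) by (split; nra).
  assert (Hz' : forall t, cos t = x -> sin t = y -> z = (RtoC (Cmod z) * cis t)%C).
  { intros t Hc Hs. unfold cis. rewrite Hc, Hs. unfold x, y. apply injective_projections; simpl.
    - unfold Re. field. lra.
    - unfold Im. field. lra. }
  assert (Hac := acos_bound x).
  assert (Hs : sin (acos x) = Rabs y).
  { rewrite sin_acos by trivial. replace (1 - x²) with (y²) by (unfold Rsqr; lra). apply sqrt_Rsqr_abs. }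
  destruct (Rle_lt_dec 0 y) as [Hy|Hy].
  - exists (acos x). split; [lra|]. apply Hz'; [apply cos_acos; trivial|].
    rewrite Hs, Rabs_pos_eq; trivial.
  - exists (- acos x). split.
    (* [- PI] is excluded: [acos x = PI] would force [y = 0], while here [y < 0]. *)
    + split; [|lra]. assert (acos x <> PI); [|lra]. intros E. rewrite E, sin_PI in Hs.
      rewrite Rabs_left in Hs; lra.
    + apply Hz'; [rewrite cos_neg; apply cos_acos; trivial|]. rewrite sin_neg, Hs, Rabs_left by trivial. ring.
Qed.

(** * Improper integrals with an integrable majorant *)

Definition gint (lo hi : Rbar) (u : R -> C) (l : C) : Prop :=
  is_RInt_gen (V := C_R_NormedModule) u (end_filter lo) (end_filter hi) l.

Lemma gint_eps (lo hi : Rbar) (u : R -> C) (l : C) :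
  gint lo hi u l <->
  forall eps, 0 < eps -> filter_prod (end_filter lo) (end_filter hi)
    (fun ab => exists y, is_CInt u (fst ab) (snd ab) y /\ Cmod (y - l) < eps).
Proof.
  split.
  - intros H eps Heps. apply (H (fun y => Cmod (y - l) < eps)).
    apply locally_Cmod. exists eps; split; trivial.
  - intros H P HP. apply locally_Cmod in HP. destruct HP as [r [Hr HP]].
    unfold filtermapi. eapply filter_imp; [|exact (H r Hr)]. intros [a b] [y [Hy1 Hy2]].
    exists y; split; trivial. apply HP; trivial.
Qed.

Lemma gint_plus (lo hi : Rbar) (u v : R -> C) (l m : C) :
  gint lo hi u l -> gint lo hi v m -> gint lo hi (fun t => u t + v t)%C (l + m)%C.
Proof. apply (is_RInt_gen_plus (V := C_R_NormedModule)); apply end_filter_proper. Qed.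

Lemma gint_minus (lo hi : Rbar) (u v : R -> C) (l m : C) :
  gint lo hi u l -> gint lo hi v m -> gint lo hi (fun t => u t - v t)%C (l - m)%C.
Proof. apply (is_RInt_gen_minus (V := C_R_NormedModule)); apply end_filter_proper. Qed.

Lemma gint_mult_l (lo hi : Rbar) (k : C) (u : R -> C) (l : C) :
  gint lo hi u l -> gint lo hi (fun t => k * u t)%C (k * l)%C.
Proof.
  rewrite !gint_eps. intros H eps Heps. assert (P := Cmod_ge_0 k).
  assert (H' := H (eps / (1 + Cmod k)) ltac:(apply Rdiv_lt_0_compat; lra)).
  revert H'; apply filter_imp. intros [a b] [y [Hy1 Hy2]]. exists (k * y)%C; split.
  - apply is_CInt_mult_l; trivial.
  - replace (k * y - k * l)%C with (k * (y - l))%C by ring. rewrite Cmod_mult.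
    apply Rle_lt_trans with ((1 + Cmod k) * Cmod (y - l)).
    + apply Rmult_le_compat_r; [apply Cmod_ge_0|lra].
    + replace eps with ((1 + Cmod k) * (eps / (1 + Cmod k))) by (field; lra).
      apply Rmult_lt_compat_l; lra.
Qed.

Lemma gint_ext (lo hi : Rbar) (u v : R -> C) (l : C) : Rbar_lt lo hi ->
  (forall t, in_open_itv lo hi t -> u t = v t) -> gint lo hi u l -> gint lo hi v l.
Proof.
  intros Hlh E. apply (is_RInt_gen_ext (V := C_R_NormedModule)); try apply end_filter_proper.
  generalize (ends_eventually lo hi Hlh). apply filter_imp. intros [a b] [Ha [Hb Hab]]; simpl in *.
  rewrite Rmin_left, Rmax_right by lra. intros t Ht. apply E. split.
  - eapply Rbar_le_lt_trans; [apply Ha|]; simpl; lra.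
  - eapply Rbar_lt_le_trans; [|apply Hb]; simpl; lra.
Qed.

Lemma in_open_itv_itv (lo hi : Rbar) (t : R) : in_open_itv lo hi t -> in_itv lo hi t.
Proof. intros [H1 H2]; split; apply Rbar_lt_le; trivial. Qed.

Lemma in_open_itv_between (lo hi : Rbar) (x y t : R) :
  in_itv lo hi x -> in_itv lo hi y -> x < t < y -> in_open_itv lo hi t.
Proof.
  intros Hx Hy Ht; split.
  - eapply Rbar_le_lt_trans; [apply Hx|]; simpl; lra.
  - eapply Rbar_lt_le_trans; [|apply Hy]; simpl; lra.
Qed.

Lemma gint_Csum (lo hi : Rbar) (n : nat) (u : nat -> R -> C) (l : nat -> C) : Rbar_lt lo hi ->
  (forall i, (i < n)%nat -> gint lo hi (u i) (l i)) ->
  gint lo hi (fun t => Csum n (fun i => u i t)) (Csum n l).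
Proof.
  intros Hlh. induction n as [|n IH]; intros H.
  - rewrite gint_eps. intros eps Heps. generalize (ends_eventually lo hi Hlh). apply filter_imp.
    intros [a b] _. exists (RtoC 0); simpl; split.
    + assert (H0 := is_CInt_const 0 a b). replace (RtoC (b - a) * 0)%C with (RtoC 0) in H0 by ring. exact H0.
    + rewrite Csum_0. replace (0 - 0)%C with (RtoC 0) by ring. rewrite Cmod_0; trivial.
  - rewrite Csum_S. apply gint_ext with (fun t => Csum n (fun i => u i t) + u n t)%C; trivial.
    + intros t _. symmetry. apply Csum_S.
    + apply gint_plus; [apply IH|apply H]; auto.
Qed.

(** An integrable majorant, described through its proper integrals only. It serves for decaying
    exponentials on the half-line and for the mass of the kernel on a contour. At a finite end
    [end_filter] is a point filter and [dom_tail] concerns the empty range. *)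
Record dominating (lo hi : Rbar) (w : R -> R) (M : R) : Prop := {
  dom_int : forall x y, in_itv lo hi x -> in_itv lo hi y -> x <= y ->
    is_RInt (V := R_NormedModule) w x y (RInt w x y);
  dom_nonneg : forall t, in_open_itv lo hi t -> 0 <= w t;
  dom_tail : forall e eps, is_end lo hi e -> 0 < eps -> exists Q, end_filter e Q /\
    forall x y, Q x -> Q y -> in_itv lo hi x -> in_itv lo hi y -> x <= y -> RInt w x y <= eps;
  dom_bound : forall x y, in_itv lo hi x -> in_itv lo hi y -> x <= y -> RInt w x y <= M }.

Definition loc_integrable (lo hi : Rbar) (u : R -> C) : Prop :=
  forall x y, in_itv lo hi x -> in_itv lo hi y -> x <= y -> is_CInt u x y (CInt u x y).

Lemma dom_CInt_le (lo hi : Rbar) (w : R -> R) (M : R) (u : R -> C) (k x y : R) (l : C) :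
  dominating lo hi w M -> (forall t, in_open_itv lo hi t -> Cmod (u t) <= k * w t) ->
  in_itv lo hi x -> in_itv lo hi y -> x <= y -> is_CInt u x y l -> Cmod l <= k * RInt w x y.
Proof.
  intros Hw Hu Hx Hy Hxy Hl.
  apply is_CInt_Cmod_le with (4 := is_RInt_scal (V := R_NormedModule) w x y k _ (dom_int _ _ _ _ Hw x y Hx Hy Hxy))
    (u := u); trivial.
  intros t Ht. apply Hu. apply in_open_itv_between with x y; trivial.
Qed.

Lemma gint_bound (lo hi : Rbar) (w : R -> R) (M : R) (u : R -> C) (k : R) (l : C) :
  Rbar_lt lo hi -> 0 <= k -> dominating lo hi w M ->
  (forall t, in_open_itv lo hi t -> Cmod (u t) <= k * w t) -> gint lo hi u l -> Cmod l <= k * M.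
Proof.
  intros Hlh Hk Hw Hu Hl. rewrite gint_eps in Hl. apply le_epsilon; intros eps Heps.
  destruct (filter_ex _ (filter_and _ _ (ends_eventually lo hi Hlh) (Hl eps Heps)))
    as [[a b] [[Ha [Hb Hab]] [y [Hy1 Hy2]]]]; simpl in *.
  assert (H1 := dom_CInt_le _ _ _ _ _ _ _ _ _ Hw Hu Ha Hb ltac:(lra) Hy1).
  assert (H2 := dom_bound _ _ _ _ Hw a b Ha Hb ltac:(lra)).
  apply (Rmult_le_compat_l _ _ _ Hk) in H2.
  replace l with (y - (y - l))%C by ring. eapply Rle_trans; [apply Cmod_minus_le|]. lra.
Qed.

(** Cauchy's criterion for both ends at once; the ends are moved one at a time, and each move costs
    at most [k] times a tail of the majorant. *)
Lemma gint_exists (lo hi : Rbar) (w : R -> R) (M : R) (u : R -> C) (k : R) :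
  Rbar_lt lo hi -> 0 <= k -> dominating lo hi w M -> loc_integrable lo hi u ->
  (forall t, in_open_itv lo hi t -> Cmod (u t) <= k * w t) ->
  exists l, gint lo hi u l /\ Cmod l <= k * M.
Proof.
  intros Hlh Hk Hw Hui Hu.
  destruct (C_filter_cauchy (filter_prod (end_filter lo) (end_filter hi)) _
    (fun ab => CInt u (fst ab) (snd ab))) as [l Hl].
  { intros eps Heps. set (e := eps / (4 * (k + 1))).
    assert (He : 0 < e) by (apply Rdiv_lt_0_compat; lra).
    destruct (dom_tail _ _ _ _ Hw lo e (or_introl eq_refl) He) as [Q1 [HQ1 T1]].
    destruct (dom_tail _ _ _ _ Hw hi e (or_intror eq_refl) He) as [Q2 [HQ2 T2]].
    destruct (ends_eventually lo hi Hlh) as [A B HA HB HAB].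
    exists (fun ab => (Q1 (fst ab) /\ A (fst ab)) /\ (Q2 (snd ab) /\ B (snd ab))). split.
    { apply Filter_prod with (fun x => Q1 x /\ A x) (fun y => Q2 y /\ B y); try (apply filter_and; trivial).
      intros x y H1 H2; split; trivial. }
    assert (Ke : k * e <= eps / 4).
    { apply Rle_trans with ((k + 1) * e); [apply Rmult_le_compat_r; lra|].
      right; unfold e; field; lra. }
    assert (HL : forall x x' y, Q1 x -> Q1 x' -> A x -> A x' -> B y -> x <= x' ->
      Cmod (CInt u x y - CInt u x' y) <= eps / 4).
    { intros x x' y q q' a a' b Hxx.
      destruct (HAB x y a b) as [I1 [I2 I3]]. destruct (HAB x' y a' b) as [J1 [J2 J3]]; simpl in *.
      assert (C1 := Hui x x' I1 J1 Hxx). assert (C2 := Hui x' y J1 J2 ltac:(lra)).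
      assert (C3 := Hui x y I1 I2 ltac:(lra)).
      rewrite (is_CInt_unique2 _ _ _ _ _ C3 (is_CInt_Chasles _ _ _ _ _ _ C1 C2)).
      replace (CInt u x x' + CInt u x' y - CInt u x' y)%C with (CInt u x x') by ring.
      eapply Rle_trans; [exact (dom_CInt_le _ _ _ _ _ _ _ _ _ Hw Hu I1 J1 Hxx C1)|].
      assert (T := T1 x x' q q' I1 J1 Hxx). apply (Rmult_le_compat_l _ _ _ Hk) in T. lra. }
    assert (HR : forall x y y', Q2 y -> Q2 y' -> A x -> B y -> B y' -> y <= y' ->
      Cmod (CInt u x y - CInt u x y') <= eps / 4).
    { intros x y y' q q' a b b' Hyy.
      destruct (HAB x y a b) as [I1 [I2 I3]]. destruct (HAB x y' a b') as [J1 [J2 J3]]; simpl in *.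
      assert (C1 := Hui x y I1 I2 ltac:(lra)). assert (C2 := Hui y y' I2 J2 Hyy).
      assert (C3 := Hui x y' I1 J2 ltac:(lra)).
      rewrite (is_CInt_unique2 _ _ _ _ _ C3 (is_CInt_Chasles _ _ _ _ _ _ C1 C2)).
      replace (CInt u x y - (CInt u x y + CInt u y y'))%C with (- CInt u y y')%C by ring.
      rewrite Cmod_opp.
      eapply Rle_trans; [exact (dom_CInt_le _ _ _ _ _ _ _ _ _ Hw Hu I2 J2 Hyy C2)|].
      assert (T := T2 y y' q q' I2 J2 Hyy). apply (Rmult_le_compat_l _ _ _ Hk) in T. lra. }
    intros [x y] [x' y'] [[q1 a] [q2 b]] [[q1' a'] [q2' b']]; simpl in *.
    assert (L1 : Cmod (CInt u x y - CInt u x' y) <= eps / 4).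
    { destruct (Rle_lt_dec x x'); [auto|]. rewrite Cmod_minus_sym. apply HL; trivial; lra. }
    assert (L2 : Cmod (CInt u x' y - CInt u x' y') <= eps / 4).
    { destruct (Rle_lt_dec y y'); [auto|]. rewrite Cmod_minus_sym. apply HR; trivial; lra. }
    eapply Rle_lt_trans; [apply Cmod_tri3 with (y := CInt u x' y)|]. lra. }
  assert (G : gint lo hi u l).
  { apply gint_eps. intros eps Heps. generalize (filter_and _ _ (ends_eventually lo hi Hlh) (Hl eps Heps)).
    apply filter_imp. intros [a b] [[Ha [Hb Hab]] H]; simpl in *.
    exists (CInt u a b); split; trivial. apply Hui; trivial; lra. }
  exists l; split; trivial. apply gint_bound with lo hi w u; trivial.
Qed.

(** One-sided continuous models as in [piecewise_C1], with the value at the break point left free,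
    because [velocity] carries no information there. *)
Definition piecewise_cont {V : UniformSpace} (u : R -> V) (a b : R) : Prop :=
  forall t, a <= t <= b -> exists d, 0 < d /\
    (t < b -> exists v, (forall s, t <= s <= b -> s < t + d -> continuous (v : R -> V) s) /\
       forall s, t < s < b -> s < t + d -> u s = v s) /\
    (a < t -> exists v, (forall s, a <= s <= t -> t - d < s -> continuous (v : R -> V) s) /\
       forall s, a < s < t -> t - d < s -> u s = v s).

Lemma piecewise_cont_ex_RInt (V : CompleteNormedModule R_AbsRing) (u : R -> V) (a b : R) :
  a <= b -> piecewise_cont u a b -> ex_RInt u a b.
Proof.
  intros Hab H. apply (interval_ind (fun x y => ex_RInt u x y)); trivial.
  - intros x y z _ _ H1 H2. apply ex_RInt_Chasles with y; trivial.
  - intros t Ht. destruct (H t Ht) as [d [Hd [HR HL]]]. exists d; split; trivial; split; intros y Hy Hyd.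
    + destruct (Req_dec y t) as [->|Hne]; [apply ex_RInt_point|].
      destruct HL as [v [Hv E]]; [lra|].
      apply ex_RInt_ext with v.
      * rewrite Rmin_left, Rmax_right by lra. intros s Hs. symmetry; apply E; lra.
      * apply (ex_RInt_continuous (V := V)). rewrite Rmin_left, Rmax_right by lra. intros; apply Hv; lra.
    + destruct (Req_dec y t) as [->|Hne]; [apply ex_RInt_point|].
      destruct HR as [v [Hv E]]; [lra|].
      apply ex_RInt_ext with v.
      * rewrite Rmin_left, Rmax_right by lra. intros s Hs. symmetry; apply E; lra.
      * apply (ex_RInt_continuous (V := V)). rewrite Rmin_left, Rmax_right by lra. intros; apply Hv; lra.
Qed.

Lemma continuous_Cmod_comp (u : R -> C) (t : R) : ccurve_cont u t -> continuous (fun s => Cmod (u s)) t.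
Proof.
  intros H. apply (continuous_ext (fun s => norm (K := R_AbsRing) (V := C_R_NormedModule) (u s))).
  - intros s. symmetry; apply Cmod_norm.
  - apply (continuous_comp u (fun z => norm (K := R_AbsRing) (V := C_R_NormedModule) z)); trivial.
    apply (filterlim_norm (K := R_AbsRing) (V := C_R_NormedModule)).
Qed.

(** The parameter [q] lets one proof cover the complex integrand and its modulus. *)
Lemma contour_piecewise_cont (V : UniformSpace) (F : C -> C) (q : C -> V) (c : R -> C) (a b : R) :
  (forall u t, ccurve_cont u t -> continuous (fun s => q (u s)) t) ->
  piecewise_C1 c a b -> (forall t, a <= t <= b -> ccont F (c t)) ->
  piecewise_cont (fun t => q (F (c t) * velocity c t)%C) a b.
Proof.
  intros Hq Hc HF t Ht. destruct (Hc t Ht) as [d [Hd [HR HL]]]. exists d; split; trivial; split; intros Hb.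
  - destruct (HR Hb) as [p [dp [Hp E]]]. exists (fun s => q (F (p s) * dp s)%C). split.
    + intros s Hs1 Hs2. apply (Hq (fun s => F (p s) * dp s)%C). apply ccurve_cont_mult; [|apply Hp].
      apply ccont_curve; [rewrite <- E by lra; apply HF; lra|eapply C1_curve_cont; exact Hp].
    + intros s Hs1 Hs2. rewrite E by lra. rewrite (velocity_C1 c p dp t (Rmin b (t + d)) s); trivial.
      * intros x Hx. assert (A := Rmin_l b (t + d)). assert (B := Rmin_r b (t + d)). apply E; lra.
      * split; [lra|apply Rmin_case; lra].
  - destruct (HL Hb) as [p [dp [Hp E]]]. exists (fun s => q (F (p s) * dp s)%C). split.
    + intros s Hs1 Hs2. apply (Hq (fun s => F (p s) * dp s)%C). apply ccurve_cont_mult; [|apply Hp].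
      apply ccont_curve; [rewrite <- E by lra; apply HF; lra|eapply C1_curve_cont; exact Hp].
    + intros s Hs1 Hs2. rewrite E by lra. rewrite (velocity_C1 c p dp (Rmax a (t - d)) t s); trivial.
      * intros x Hx. assert (A := Rmax_l a (t - d)). assert (B := Rmax_r a (t - d)). apply E; lra.
      * split; [apply Rmax_case; lra|lra].
Qed.

Lemma contour_loc_integrable (lo hi : Rbar) (c : R -> C) (F : C -> C) :
  C1_on lo hi c -> (forall t, in_itv lo hi t -> ccont F (c t)) ->
  loc_integrable lo hi (fun t => F (c t) * velocity c t)%C.
Proof.
  intros Hc HF x y Hx Hy Hxy. apply (RInt_correct (V := C_R_CompleteNormedModule)).
  apply (piecewise_cont_ex_RInt C_R_CompleteNormedModule); trivial.
  apply (contour_piecewise_cont C_UniformSpace F (fun z => z)); auto.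
  intros t Ht. apply HF. apply in_itv_between with x y; trivial.
Qed.

Lemma contour_Cmod_integrable (lo hi : Rbar) (c : R -> C) (F : C -> C) (x y : R) :
  C1_on lo hi c -> (forall t, in_itv lo hi t -> ccont F (c t)) ->
  in_itv lo hi x -> in_itv lo hi y -> x <= y ->
  is_RInt (V := R_NormedModule) (fun t => Cmod (F (c t) * velocity c t)) x y
    (RInt (fun t => Cmod (F (c t) * velocity c t)) x y).
Proof.
  intros Hc HF Hx Hy Hxy. apply (RInt_correct (V := R_CompleteNormedModule)).
  apply (piecewise_cont_ex_RInt R_CompleteNormedModule); trivial.
  apply (contour_piecewise_cont R_UniformSpace F Cmod); auto.
  - intros u t; apply continuous_Cmod_comp.
  - intros t Ht. apply HF. apply in_itv_between with x y; trivial.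
Qed.

Lemma in_itv_0_oo (t : R) : in_itv 0 p_infty t <-> 0 <= t.
Proof. unfold in_itv; simpl; tauto. Qed.

Lemma in_open_itv_0_oo (t : R) : in_open_itv 0 p_infty t <-> 0 < t.
Proof. unfold in_open_itv; simpl; tauto. Qed.

Lemma is_RInt_exp_decay (kap x y : R) : 0 < kap -> x <= y ->
  is_RInt (V := R_NormedModule) (fun t => exp (- kap * t)) x y ((exp (- kap * x) - exp (- kap * y)) / kap).
Proof.
  intros Hk Hxy.
  replace ((exp (- kap * x) - exp (- kap * y)) / kap) with
    (minus (G := R_AbelianGroup) (- exp (- kap * y) / kap) (- exp (- kap * x) / kap)).
  2: { unfold minus, plus, opp; simpl. field. lra. }
  apply (is_RInt_derive (V := R_CompleteNormedModule) (fun t => - exp (- kap * t) / kap) (fun t => exp (- kap * t))).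
  - intros t _. auto_derive; trivial. field. lra.
  - intros t _. apply (ex_derive_continuous (K := R_AbsRing) (V := R_NormedModule) (fun t => exp (- kap * t))).
    auto_derive; trivial.
Qed.

Lemma RInt_exp_decay (kap x y : R) : 0 < kap -> x <= y ->
  RInt (fun t => exp (- kap * t)) x y = (exp (- kap * x) - exp (- kap * y)) / kap.
Proof.
  intros Hk Hxy. exact (is_RInt_unique (V := R_CompleteNormedModule) _ _ _ _ (is_RInt_exp_decay kap x y Hk Hxy)).
Qed.

Lemma exp_decay_small (kap eps : R) : 0 < kap -> 0 < eps -> exists T, 0 <= T /\ forall x, T < x -> exp (- kap * x) <= eps.
Proof.
  intros Hk He. exists (Rmax 0 (- ln eps / kap)); split; [apply Rmax_l|]. intros x Hx.
  assert (H := Rle_lt_trans _ _ _ (Rmax_r _ _) Hx).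
  apply (Rmult_lt_compat_l kap) in H; trivial.
  replace (kap * (- ln eps / kap)) with (- ln eps) in H by (field; lra).
  rewrite <- (exp_ln eps) by trivial. left; apply exp_increasing. lra.
Qed.

Lemma dominating_exp (kap : R) : 0 < kap -> dominating 0 p_infty (fun t => exp (- kap * t)) (/ kap).
Proof.
  intros Hk. split.
  - intros x y Hx Hy Hxy. rewrite RInt_exp_decay by trivial. apply is_RInt_exp_decay; trivial.
  - intros t _. left; apply exp_pos.
  - intros e eps [-> | ->] Heps.
    + exists (fun x => x = 0). split; [reflexivity|]. intros x y -> -> _ _ _.
      rewrite (RInt_point (V := R_CompleteNormedModule)). unfold zero; simpl; lra.
    + destruct (exp_decay_small kap (eps * kap) Hk) as [T [HT H]]; [apply Rmult_lt_0_compat; trivial|].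
      exists (fun x => T < x). split; [exists T; trivial|]. intros x y Hx Hy _ _ Hxy.
      rewrite RInt_exp_decay by trivial. specialize (H x Hx). assert (P := exp_pos (- kap * y)).
      apply Rmult_le_reg_r with kap; trivial. unfold Rdiv. rewrite Rmult_assoc, Rinv_l by lra. lra.
  - intros x y Hx Hy Hxy. apply in_itv_0_oo in Hx. rewrite RInt_exp_decay by trivial.
    assert (P := exp_pos (- kap * y)).
    assert (exp (- kap * x) <= 1).
    { rewrite <- exp_0. destruct (Req_dec x 0) as [->|]; [right; f_equal; ring|].
      left; apply exp_increasing. assert (0 < kap * x) by (apply Rmult_lt_0_compat; lra). lra. }
    unfold Rdiv. rewrite <- (Rmult_1_l (/ kap)) at 2. apply Rmult_le_compat_r; [left; apply Rinv_0_lt_compat|]; lra.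
Qed.

(** * Laplace transforms *)

(** [s] plays the part of [cis theta / gam] and [G t] that of [psi (t * cis theta) * cis theta]; in
    the variable [s] the transform is holomorphic on a half-plane. *)
Definition laplace (G : R -> C) (s : C) : C :=
  RInt_gen (V := C_R_CompleteNormedModule) (fun t => Cexp (- (RtoC t * s)) * G t)%C
    (end_filter 0) (end_filter p_infty).

Lemma ccurve_cont_RtoC (t : R) : ccurve_cont RtoC t.
Proof.
  apply continuous_Cmod. intros eps He; exists eps; split; trivial. intros s Hs.
  rewrite <- RtoC_minus, Cmod_R. exact Hs.
Qed.

Lemma ccurve_cont_exp (s : C) (t : R) : ccurve_cont (fun t => Cexp (- (RtoC t * s))%C) t.
Proof.
  apply (ccont_curve (fun x => Cexp (- (x * s))%C) RtoC); [|apply ccurve_cont_RtoC].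
  apply deriv_at_ccont. apply (deriv_at_comp Cexp); [eexists; apply has_cderiv_Cexp|].
  apply deriv_at_opp, deriv_at_mult; [apply deriv_at_id|apply deriv_at_const].
Qed.

Lemma Cmod_exp_line (s : C) (t : R) : Cmod (Cexp (- (RtoC t * s)))%C = exp (- Re s * t).
Proof. rewrite Cmod_Cexp. f_equal. destruct s; simpl. ring. Qed.

Lemma loc_integrable_cont (u : R -> C) : (forall t, 0 <= t -> ccurve_cont u t) ->
  loc_integrable 0 p_infty u.
Proof.
  intros H x y Hx Hy Hxy. apply in_itv_0_oo in Hx. apply is_CInt_cont; trivial. intros; apply H; lra.
Qed.

Lemma gint_exp_bounded (u : R -> C) (P kap : R) : 0 < kap ->
  (forall t, 0 <= t -> ccurve_cont u t) -> (forall t, 0 <= t -> Cmod (u t) <= P * exp (- kap * t)) ->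
  exists l, gint 0 p_infty u l /\ Cmod l <= P / kap.
Proof.
  intros Hk Hc Hu.
  assert (HP : 0 <= P).
  { specialize (Hu 0 (Rle_refl _)). rewrite Rmult_0_r, exp_0, Rmult_1_r in Hu.
    eapply Rle_trans; [apply Cmod_ge_0|exact Hu]. }
  apply gint_exists with (fun t => exp (- kap * t)); trivial.
  - exact I.
  - apply dominating_exp; trivial.
  - apply loc_integrable_cont; trivial.
  - intros t Ht. apply Hu. apply in_open_itv_0_oo in Ht. lra.
Qed.

Lemma gint_exp_bound (u : R -> C) (P kap : R) (l : C) : 0 < kap -> 0 <= P ->
  (forall t, 0 < t -> Cmod (u t) <= P * exp (- kap * t)) -> gint 0 p_infty u l -> Cmod l <= P / kap.
Proof.
  intros Hk HP Hu Hl.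
  apply gint_bound with 0 p_infty (fun t => exp (- kap * t)) u; trivial; [exact I|apply dominating_exp; trivial|].
  intros t Ht. apply Hu. exact (proj1 (in_open_itv_0_oo t) Ht).
Qed.

Lemma gint_correct (lo hi : Rbar) (u : R -> C) (l : C) : gint lo hi u l ->
  gint lo hi u (RInt_gen (V := C_R_CompleteNormedModule) u (end_filter lo) (end_filter hi)).
Proof.
  intros H. rewrite (is_RInt_gen_unique (V := C_R_CompleteNormedModule) _ _ H). exact H.
Qed.

Lemma laplace_gint (G : R -> C) (P beta : R) (s : C) :
  (forall t, 0 <= t -> ccurve_cont G t) -> (forall t, 0 <= t -> Cmod (G t) <= P * exp (beta * t)) ->
  beta < Re s -> gint 0 p_infty (fun t => Cexp (- (RtoC t * s)) * G t)%C (laplace G s).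
Proof.
  intros Hc HG Hs.
  destruct (gint_exp_bounded (fun t => Cexp (- (RtoC t * s)) * G t)%C P (Re s - beta)) as [l [Hl _]]; [lra| | |].
  - intros t Ht. apply ccurve_cont_mult; [apply ccurve_cont_exp|auto].
  - intros t Ht. rewrite Cmod_mult, Cmod_exp_line.
    replace (- (Re s - beta) * t) with (- Re s * t + beta * t) by ring. rewrite exp_plus.
    specialize (HG t Ht). assert (E := exp_pos (- Re s * t)). nra.
  - eapply gint_correct; exact Hl.
Qed.

Lemma Re_le_Cmod_minus (x y : C) : Re y - Cmod (x - y)%C <= Re x.
Proof.
  assert (H := re_le_Cmod (x - y)%C). apply Rabs_le_between in H.
  destruct x, y; simpl in *. lra.
Qed.

(** The two-point inequality for [s |-> exp (- t s)] is integrated against [G]. With [R0] half the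
    distance to the line [Re s = beta], its constant grows like [exp (- (Re s - R0) t)], which
    leaves the decay [exp (- R0 t)]. *)
Lemma laplace_deriv_at (G : R -> C) (P beta : R) (s : C) :
  (forall t, 0 <= t -> ccurve_cont G t) -> (forall t, 0 <= t -> Cmod (G t) <= P * exp (beta * t)) ->
  beta < Re s -> deriv_at (laplace G) s.
Proof.
  intros Hc HG Hs. set (R0 := (Re s - beta) / 2). assert (HR : 0 < R0) by (unfold R0; lra).
  assert (HP : 0 <= P).
  { specialize (HG 0 (Rle_refl _)). rewrite Rmult_0_r, exp_0, Rmult_1_r in HG.
    eapply Rle_trans; [apply Cmod_ge_0|exact HG]. }
  apply two_point_deriv_at with (8 * 1 / R0 ^ 2 * P / R0) (R0 / 4); [lra|].
  intros h k Hh Hk.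
  assert (Hsh : forall x, Cmod x <= R0 / 4 -> beta < Re (s + x)%C).
  { intros x Hx. assert (H := Re_le_Cmod_minus (s + x) s). replace (s + x - s)%C with x in H by ring. unfold R0 in *. lra. }
  assert (G0 := laplace_gint G P beta s Hc HG Hs).
  assert (Gh := laplace_gint G P beta _ Hc HG (Hsh h Hh)).
  assert (Gk := laplace_gint G P beta _ Hc HG (Hsh k Hk)).
  assert (GG := gint_minus _ _ _ _ _ _ (gint_mult_l _ _ k _ _ (gint_minus _ _ _ _ _ _ Gh G0))
    (gint_mult_l _ _ h _ _ (gint_minus _ _ _ _ _ _ Gk G0))).
  set (Q := Cmod h * Cmod k * (Cmod h + Cmod k)).
  assert (HQ : 0 <= Q).
  { assert (A := Cmod_ge_0 h). assert (B := Cmod_ge_0 k). unfold Q. repeat apply Rmult_le_pos; lra. }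
  replace (8 * 1 / R0 ^ 2 * P / R0 * Q) with (8 * 1 / R0 ^ 2 * P * Q / R0) by (field; lra).
  assert (H8 : 0 <= 8 * 1 / R0 ^ 2).
  { apply Rmult_le_pos; [lra|]. left; apply Rinv_0_lt_compat. apply pow_lt; trivial. }
  apply (gint_exp_bound _ _ _ _ HR) with (3 := GG).
  { apply Rmult_le_pos; trivial. apply Rmult_le_pos; trivial. }
  intros t Ht.
  replace (k * (Cexp (- (RtoC t * (s + h))) * G t - Cexp (- (RtoC t * s)) * G t) -
     h * (Cexp (- (RtoC t * (s + k))) * G t - Cexp (- (RtoC t * s)) * G t))%C
   with ((k * (Cexp (- (RtoC t * (s + h))) - Cexp (- (RtoC t * s))) -
     h * (Cexp (- (RtoC t * (s + k))) - Cexp (- (RtoC t * s)))) * G t)%C by ring.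
  rewrite Cmod_mult.
  assert (H2 := holo_two_point (fun x => Cexp (- (RtoC t * x))%C) s R0 (exp (- (Re s - R0) * t)) HR).
  assert (H3 := fun A B => H2 A B h k Hh Hk). cbv beta in H3. fold Q in H3.
  apply Rle_trans with ((8 * exp (- (Re s - R0) * t) / R0 ^ 2 * Q) * (P * exp (beta * t))).
  - apply Rmult_le_compat; try apply Cmod_ge_0; [|apply HG; lra]. apply H3.
    + intros w _. apply (deriv_at_comp Cexp); [eexists; apply has_cderiv_Cexp|].
      apply deriv_at_opp, deriv_at_mult; [apply deriv_at_const|apply deriv_at_id].
    + intros w Hw. rewrite Cmod_exp_line. assert (H := Re_le_Cmod_minus w s).
      destruct (Req_dec (- Re w * t) (- (Re s - R0) * t)) as [->|Hne]; [lra|].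
      left; apply exp_increasing. assert ((Re s - R0) * t <= Re w * t) by (apply Rmult_le_compat_r; lra). lra.
  - right. replace (- R0 * t) with (- (Re s - R0) * t + beta * t).
    + rewrite exp_plus. field. lra.
    + unfold R0. field.
Qed.

Lemma pow_exp_le (N : nat) (kap t : R) : 0 < kap -> 0 <= t ->
  t ^ N <= INR (fact N) / kap ^ N * exp (kap * t).
Proof.
  intros Hk Ht. assert (H := pow_fact_le_exp (kap * t) N ltac:(apply Rmult_le_pos; lra)).
  assert (Pf := INR_fact_lt_0 N). assert (Pk := pow_lt kap N Hk).
  apply Rmult_le_reg_r with (kap ^ N / INR (fact N)); [apply Rdiv_lt_0_compat; trivial|].
  replace (INR (fact N) / kap ^ N * exp (kap * t) * (kap ^ N / INR (fact N))) with (exp (kap * t)) by (field; lra).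
  eapply Rle_trans; [|exact H]. right. rewrite Rpow_mult_distr. field. lra.
Qed.

(** Half of the gap [sigma - beta] absorbs [t ^ N], the other half makes the integral converge;
    hence the factor [2 / (sigma - beta)]. *)
Lemma laplace_bound (G : R -> C) (Q : R) (N : nat) (beta sigma : R) (l : C) :
  0 <= Q -> beta < sigma -> (forall t, 0 < t -> Cmod (G t) <= Q * t ^ N * exp (beta * t)) ->
  gint 0 p_infty (fun t => Cexp (- (RtoC t * RtoC sigma)) * G t)%C l ->
  Cmod l <= Q * INR (fact N) * (2 / (sigma - beta)) ^ (S N).
Proof.
  intros HQ Hs HG Hl. set (kap := (sigma - beta) / 2).
  assert (Hk : 0 < kap) by (unfold kap; lra). assert (Pk := pow_lt kap N Hk). assert (Pf := INR_fact_lt_0 N).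
  replace (Q * INR (fact N) * (2 / (sigma - beta)) ^ S N) with (Q * (INR (fact N) / kap ^ N) / kap).
  2: { replace (2 / (sigma - beta)) with (/ kap) by (unfold kap; field; lra). rewrite pow_inv. simpl. field. lra. }
  apply (gint_exp_bound _ _ _ _ Hk) with (3 := Hl).
  { apply Rmult_le_pos; trivial. left; apply Rdiv_lt_0_compat; trivial. }
  intros t Ht. rewrite Cmod_mult, Cmod_exp_line. simpl.
  assert (H1 := pow_exp_le N kap t Hk ltac:(lra)).
  specialize (HG t Ht). assert (E := exp_pos (- sigma * t)).
  apply Rle_trans with (exp (- sigma * t) * (Q * (INR (fact N) / kap ^ N * exp (kap * t)) * exp (beta * t))).
  - apply Rmult_le_compat_l; [lra|]. eapply Rle_trans; [exact HG|].
    apply Rmult_le_compat_r; [left; apply exp_pos|]. apply Rmult_le_compat_l; trivial.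
  - right. replace (- kap * t) with (- sigma * t + (kap * t + beta * t)) by (unfold kap; field).
    rewrite !exp_plus. ring.
Qed.

Lemma is_derive_RtoC (F : R -> R) (t v : R) : is_derive F t v ->
  is_derive (K := R_AbsRing) (V := C_R_NormedModule) (fun t => RtoC (F t)) t (RtoC v).
Proof. intros H. apply (is_derive_C_pair F (fun _ => 0) t v 0 H). apply (is_derive_const (V := R_NormedModule) 0 t). Qed.

Lemma Cexp_RtoC (x : R) : Cexp (RtoC x) = RtoC (exp x).
Proof. unfold Cexp; simpl. rewrite cos_0, sin_0. apply injective_projections; simpl; ring. Qed.

Lemma laplace_pow (n : nat) (sigma : R) : 0 < sigma ->
  gint 0 p_infty (fun t => Cexp (- (RtoC t * RtoC sigma)) * Cpow (RtoC t) n)%C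
    (RtoC (INR (fact n) / sigma ^ S n)).
Proof.
  intros Hs.
  assert (Hreal : forall n t, (Cexp (- (RtoC t * RtoC sigma)) * Cpow (RtoC t) n)%C = RtoC (exp (- sigma * t) * t ^ n)).
  { intros m t. rewrite RtoC_mult, RtoC_pow, <- Cexp_RtoC. do 2 f_equal.
    rewrite RtoC_mult, RtoC_opp. ring. }
  assert (Hder : forall (F f : R -> R) (v : R), (forall t, is_derive F t (f t)) -> (forall t, continuous f t) ->
     (forall eps, 0 < eps -> exists T, 0 <= T /\ forall y, T < y -> Rabs (F y - F 0 - v) < eps) ->
     gint 0 p_infty (fun t => RtoC (f t)) (RtoC v)).
  { intros F f v HF Hf Hv. apply gint_eps. intros eps Heps. destruct (Hv eps Heps) as [T [HT H]].
    apply Filter_prod with (fun x => x = 0) (fun y => T < y); [reflexivity|exists T; trivial|].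
    intros x y -> Hy; simpl. exists (RtoC (F y) - RtoC (F 0))%C; split.
    - apply (is_CInt_derive (fun t => RtoC (F t)) (fun t => RtoC (f t))); [lra| |].
      + intros t _. apply is_derive_RtoC, HF.
      + intros t _. apply continuous_Cmod. intros e He.
        destruct (Hf t (fun z => Rabs (z - f t) < e)) as [d Hd]; [exists (mkposreal e He); trivial|].
        exists d; split; [apply cond_pos|]. intros s' Hs'. rewrite <- RtoC_minus, Cmod_R. apply Hd. exact Hs'.
    - rewrite <- !RtoC_minus, Cmod_R. auto. }
  induction n as [|n IH].
  - apply gint_ext with (fun t => RtoC (exp (- sigma * t))); [exact I|intros t _; rewrite Hreal; simpl; f_equal; ring|].
    apply (Hder (fun t => - exp (- sigma * t) / sigma)).
    + intros t. auto_derive; trivial. field. lra.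
    + intros t. apply (ex_derive_continuous (K := R_AbsRing) (V := R_NormedModule) (fun t => exp (- sigma * t))). auto_derive; trivial.
    + intros eps Heps. destruct (exp_decay_small sigma (eps * sigma / 2) Hs) as [T [HT H]].
      { assert (0 < eps * sigma) by (apply Rmult_lt_0_compat; trivial). lra. }
      exists T; split; trivial. intros y Hy. specialize (H y Hy).
      replace (- exp (- sigma * y) / sigma - - exp (- sigma * 0) / sigma - INR (fact 0) / sigma ^ 1) with (- (exp (- sigma * y) / sigma)).
      2: { rewrite Rmult_0_r, exp_0. simpl. field. lra. }
      rewrite Rabs_Ropp, Rabs_pos_eq.
      * apply Rle_lt_trans with (eps * sigma / 2 / sigma); [|replace (eps * sigma / 2 / sigma) with (eps / 2) by (field; lra); lra].
        apply Rmult_le_compat_r; [left; apply Rinv_0_lt_compat|]; trivial.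
      * left; apply Rdiv_lt_0_compat; trivial; apply exp_pos.
  (* [- t^(n+1) e^(- sigma t) / sigma] vanishes at [0] and at infinity, so its derivative has
     integral [0]; this relates the transforms of consecutive powers. *)
  - assert (HD : gint 0 p_infty (fun t => RtoC (t ^ S n * exp (- sigma * t) - INR (S n) / sigma * (exp (- sigma * t) * t ^ n))) (RtoC 0)).
    { apply (Hder (fun t => - t ^ S n * exp (- sigma * t) / sigma)).
      - intros t. auto_derive; trivial. simpl pred. simpl (t ^ S n). rewrite !S_INR. simpl.
        replace (match n with 0%nat => 1 | S _ => INR n + 1 end) with (INR n + 1) by (destruct n; simpl; ring).
        field. lra.
      - intros t. apply (ex_derive_continuous (K := R_AbsRing) (V := R_NormedModule)
           (fun t => t ^ S n * exp (- sigma * t) - INR (S n) / sigma * (exp (- sigma * t) * t ^ n))). auto_derive; trivial.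
      - intros eps Heps. set (A := INR (fact (S n)) / (sigma / 2) ^ S n / sigma).
        assert (HA : 0 < A).
        { unfold A. apply Rdiv_lt_0_compat; trivial. apply Rdiv_lt_0_compat; [apply INR_fact_lt_0|apply pow_lt; lra]. }
        destruct (exp_decay_small (sigma / 2) (eps / (2 * A)) ltac:(lra)) as [T [HT H]].
        { apply Rdiv_lt_0_compat; lra. }
        exists T; split; trivial. intros y Hy. specialize (H y Hy).
        replace (- y ^ S n * exp (- sigma * y) / sigma - - 0 ^ S n * exp (- sigma * 0) / sigma - 0)
          with (- (y ^ S n * exp (- sigma * y) / sigma)) by (simpl; field; lra).
        rewrite Rabs_Ropp, Rabs_pos_eq.
        2: { apply Rmult_le_pos; [|left; apply Rinv_0_lt_compat; trivial].
             apply Rmult_le_pos; [apply pow_le; lra|left; apply exp_pos]. }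
        assert (B := pow_exp_le (S n) (sigma / 2) y ltac:(lra) ltac:(lra)).
        apply Rle_lt_trans with (A * exp (- (sigma / 2) * y)).
        + apply Rle_trans with (INR (fact (S n)) / (sigma / 2) ^ S n * exp (sigma / 2 * y) * exp (- sigma * y) / sigma).
          * apply Rmult_le_compat_r; [left; apply Rinv_0_lt_compat; trivial|].
            apply Rmult_le_compat_r; [left; apply exp_pos|exact B].
          * right. unfold A. replace (- (sigma / 2) * y) with (sigma / 2 * y + - sigma * y) by field.
            rewrite exp_plus. field. repeat split; try lra; apply pow_nonzero; lra.
        + apply Rle_lt_trans with (A * (eps / (2 * A))); [apply Rmult_le_compat_l; lra|].
          replace (A * (eps / (2 * A))) with (eps / 2) by (field; lra). lra. }
    apply gint_mult_l with (k := RtoC (INR (S n) / sigma)) in IH.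
    assert (HS := gint_plus _ _ _ _ _ _ HD IH).
    replace (RtoC 0 + RtoC (INR (S n) / sigma) * RtoC (INR (fact n) / sigma ^ S n))%C with
      (RtoC (INR (fact (S n)) / sigma ^ S (S n))) in HS.
    + revert HS. apply gint_ext; [exact I|]. intros t _. rewrite !Hreal, <- RtoC_mult, <- RtoC_plus. f_equal. simpl. ring.
    + rewrite <- RtoC_mult, Cplus_0_l. f_equal. change (fact (S n)) with (S n * fact n)%nat.
      rewrite mult_INR. replace (sigma ^ S (S n)) with (sigma * sigma ^ S n) by reflexivity. field. repeat split; try lra; apply pow_nonzero; lra.
Qed.

(** * Laurent expansions and analytic continuation *)

Lemma locally'_Cmod (z : C) (P : C -> Prop) :
  locally' (T := C_UniformSpace) z P <->
  exists r, 0 < r /\ forall z', Cmod (z' - z)%C < r -> z' <> z -> P z'.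
Proof. unfold locally', within. apply locally_Cmod. Qed.

Lemma Cinv_0 : Cinv 0 = 0.
Proof. unfold Cinv, Rdiv; simpl. apply injective_projections; simpl; ring. Qed.

(** As the total inverse sends [0] to [0], multiplicativity needs no side condition. Hence
    [Czpow_mult] holds at [0] as well, and integrands can be rewritten at every point of a
    contour. *)
Lemma Cinv_mult (x y : C) : Cinv (x * y) = (Cinv x * Cinv y)%C.
Proof.
  destruct (Ceq_dec x 0) as [->|Hx].
  - replace (0 * y)%C with (RtoC 0) by ring. rewrite Cinv_0. ring.
  - destruct (Ceq_dec y 0) as [->|Hy].
    + replace (x * 0)%C with (RtoC 0) by ring. rewrite Cinv_0. ring.
    + field; auto.
Qed.

Lemma Czpow_mult (x y : C) (m : Z) : Czpow (x * y) m = (Czpow x m * Czpow y m)%C.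
Proof.
  destruct m as [|p|p]; simpl.
  - ring.
  - apply Cpow_mult_l.
  - rewrite Cpow_mult_l. apply Cinv_mult.
Qed.

Lemma Czpow_nat (z : C) (n : nat) : Czpow z (Z.of_nat n) = Cpow z n.
Proof. destruct n as [|n]; [reflexivity|]. simpl. rewrite SuccNat2Pos.id_succ. reflexivity. Qed.

Lemma deriv_at_Czpow (m : Z) (z : C) : z <> 0 -> deriv_at (fun x => Czpow x m) z.
Proof.
  intros Hz. destruct m as [|p|p]; simpl.
  - apply (deriv_at_const 1).
  - apply deriv_at_pow.
  - apply (deriv_at_comp Cinv (fun x => Cpow x (Pos.to_nat p))); [|apply deriv_at_pow].
    apply deriv_at_inv, Cpow_nz, Hz.
Qed.

(** The Taylor coefficients of [phi] at [0], padded with zeros below [k0]. *)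
Definition acoef (k0 : nat) (a : Z -> C) (n : nat) : C :=
  if (k0 <=? n)%nat then a (Z.of_nat n) else 0.

Lemma Csum_lim_bounded (u : nat -> C) (l : C) : Csum_lim u l -> exists B, 0 <= B /\ forall n, Cmod (u n)%C <= B.
Proof.
  intros H. destruct (H 1 Rlt_0_1) as [N HN].
  assert (H0 : exists B, 0 <= B /\ forall n, (n < N)%nat -> Cmod (u n)%C <= B).
  { clear. induction N as [|N [B [HB IH]]]; [exists 0; split; [lra|lia]|].
    exists (Rmax B (Cmod (u N)%C)). split; [eapply Rle_trans; [exact HB|apply Rmax_l]|].
    intros n Hn. destruct (Nat.eq_dec n N) as [->|]; [apply Rmax_r|].
    eapply Rle_trans; [apply IH; lia|apply Rmax_l]. }
  destruct H0 as [B [HB HBn]]. exists (B + 2). split; [lra|]. intros n.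
  destruct (lt_dec n N) as [Hn|Hn]; [specialize (HBn n Hn); lra|].
  assert (A1 := HN n ltac:(lia)). assert (A2 := HN (S n) ltac:(lia)). rewrite Csum_S in A2.
  replace (u n) with ((Csum n u + u n - l) - (Csum n u - l))%C by ring.
  eapply Rle_trans; [apply Cmod_minus_le|]. lra.
Qed.

(** Convergence at the point [r0 / 2] bounds the terms there, whence [a n = O((2 / r0)^n)]. The
    first [n0 + k0] terms of the Laurent series are those that [phi] subtracts; the rest is a power
    series of ratio at most [1 / 2] on the disc of radius [r0 / 4]. *)
Lemma phi_pseries (f : C -> C) (n0 k0 : nat) (a : Z -> C) : laurent_at0 f n0 a ->
  exists M rho r, 0 < rho /\ 0 < r /\ rho * r < 1 /\ (forall n, Cmod (acoef k0 a n)%C <= M * rho ^ n) /\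
    forall u : C, u <> 0 -> Cmod u < r -> phi f n0 k0 a u = pseries (acoef k0 a) u.
Proof.
  intros H. apply locally'_Cmod in H. destruct H as [r0 [Hr0 H]].
  assert (Hs : forall u : C, u <> 0 -> Cmod u < r0 ->
    Csum_lim (fun j => a (Z.of_nat j - Z.of_nat n0)%Z * Czpow u (Z.of_nat j - Z.of_nat n0)%Z)%C (f u)).
  { intros u Hu Hur. apply is_series_Csum_lim. apply H; trivial.
    replace (u - 0)%C with u by ring. trivial. }
  set (rho := 2 / r0). assert (Hrho : 0 < rho) by (apply Rdiv_lt_0_compat; lra).
  assert (Hx : RtoC (r0 / 2) <> 0) by (intros E; apply RtoC_inj in E; lra).
  assert (Hxm : Cmod (RtoC (r0 / 2))%C = r0 / 2) by (rewrite Cmod_R, Rabs_pos_eq; lra).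
  destruct (Csum_lim_bounded _ _ (Hs (RtoC (r0 / 2)) Hx ltac:(lra))) as [M [HM HMn]].
  assert (Hb : forall n, Cmod (acoef k0 a n)%C <= M * rho ^ n).
  { intros n. unfold acoef. destruct (k0 <=? n)%nat.
    2: { rewrite Cmod_0. apply Rmult_le_pos; trivial. apply pow_le; lra. }
    specialize (HMn (n + n0)%nat).
    replace (Z.of_nat (n + n0) - Z.of_nat n0)%Z with (Z.of_nat n) in HMn by lia.
    rewrite Czpow_nat, Cmod_mult, Cmod_pow, Hxm in HMn.
    assert (P := pow_lt (r0 / 2) n ltac:(lra)).
    apply Rmult_le_reg_r with ((r0 / 2) ^ n); trivial. eapply Rle_trans; [exact HMn|]. right.
    rewrite Rmult_assoc, <- Rpow_mult_distr. replace (rho * (r0 / 2)) with 1 by (unfold rho; field; lra).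
    rewrite pow1; ring. }
  exists M, rho, (r0 / 4). split; [trivial|]. split; [lra|].
  split; [unfold rho; replace (2 / r0 * (r0 / 4)) with (1 / 2) by (field; lra); lra|]. split; trivial.
  intros u Hu Hur. symmetry.
  apply Csum_lim_unique with (fun n => acoef k0 a n * Cpow u n)%C.
  { apply (pseries_lim _ M rho); trivial; [lra|].
    apply Rlt_trans with (rho * (r0 / 4)); [apply Rmult_lt_compat_l; lra|].
    unfold rho; replace (2 / r0 * (r0 / 4)) with (1 / 2) by (field; lra); lra. }
  intros eps Heps. destruct (Hs u Hu ltac:(lra) eps Heps) as [N HN].
  exists (k0 + N)%nat. intros n Hn. set (m := (n - k0)%nat). replace n with (k0 + m)%nat by lia.
  specialize (HN (n0 + k0 + m)%nat ltac:(unfold m; lia)).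
  rewrite Csum_add in HN |- *. rewrite Csum_const_0.
  2: { intros i Hi. unfold acoef. rewrite (proj2 (Nat.leb_gt k0 i) Hi). ring. }
  unfold phi. set (S0 := Csum (n0 + k0) _) in *.
  rewrite (Csum_ext m _ (fun i => a (Z.of_nat (n0 + k0 + i) - Z.of_nat n0)%Z *
     Czpow u (Z.of_nat (n0 + k0 + i) - Z.of_nat n0)%Z)%C).
  - set (S1 := Csum m _) in *. replace (0 + S1 - (f u - S0))%C with (S0 + S1 - f u)%C by ring. exact HN.
  - intros i _. replace (Z.of_nat (n0 + k0 + i) - Z.of_nat n0)%Z with (Z.of_nat (k0 + i)) by lia.
    rewrite Czpow_nat. unfold acoef. rewrite (proj2 (Nat.leb_le k0 (k0 + i)) ltac:(lia)). reflexivity.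
Qed.

(** * Propagation of an identity with a meromorphic function *)

Lemma meromorphic_quotient (f : C -> C) (u0 : C) : meromorphic f ->
  exists n g r, 0 < r /\ holo_ball g u0 r /\
    forall u, u <> u0 -> Cmod (u - u0)%C < r -> f u = (g u / Cpow (u - u0) n)%C.
Proof.
  intros Hf. destruct (Hf u0) as [H|[n [_ [g [Hg [_ H]]]]]].
  - apply holo_at_ball in H. destruct H as [r [Hr H]]. exists 0%nat, f, r. split; [|split]; trivial.
    intros u _ _. simpl. field.
  - apply holo_at_ball in Hg. destruct Hg as [r1 [Hr1 Hg]].
    apply locally'_Cmod in H. destruct H as [r2 [Hr2 H]].
    exists n, g, (Rmin r1 r2). split; [apply Rmin_pos; trivial|]. split.
    + intros u Hu. apply Hg. eapply Rlt_le_trans; [exact Hu|apply Rmin_l].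
    + intros u Hu Hur. apply H; trivial. eapply Rlt_le_trans; [exact Hur|apply Rmin_r].
Qed.

(** In spite of the name this is all that [phi] subtracts, including the powers [0] to [k0 - 1]. *)
Definition principal_part (n0 k0 : nat) (a : Z -> C) (u : C) : C :=
  Csum (n0 + k0) (fun j => a (Z.of_nat j - Z.of_nat n0)%Z * Czpow u (Z.of_nat j - Z.of_nat n0)%Z)%C.

Lemma deriv_at_principal_part (n0 k0 : nat) (a : Z -> C) (u : C) : u <> 0 ->
  deriv_at (principal_part n0 k0 a) u.
Proof.
  intros Hu. unfold principal_part.
  apply (deriv_at_Csum (n0 + k0) (fun j u => a (Z.of_nat j - Z.of_nat n0)%Z * Czpow u (Z.of_nat j - Z.of_nat n0)%Z)%C).
  intros i. apply deriv_at_mult; [apply deriv_at_const|apply deriv_at_Czpow; trivial].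
Qed.

(** The value at [s] is left free, since the value of a total function at a pole means nothing; off
    [s] the denominator does not vanish. *)
Definition meromorphic_at (T : C -> C) (s : C) : Prop :=
  exists num den r, 0 < r /\ holo_ball num s r /\ holo_ball den s r /\
    forall x, x <> s -> Cmod (x - s)%C < r -> den x <> 0 /\ T x = (num x / den x)%C.

Lemma meromorphic_at_phi (f : C -> C) (n0 k0 : nat) (a : Z -> C) (w s : C) :
  meromorphic f -> w <> 0 -> s <> 0 -> meromorphic_at (fun s => phi f n0 k0 a (w / s)) s.
Proof.
  intros Hf Hw Hs.
  destruct (meromorphic_quotient f (w / s) Hf) as [n [g [r [Hr [Hg H]]]]].
  assert (Ms : 0 < Cmod s) by (apply Cmod_gt_0; trivial).
  destruct (deriv_at_ccont (fun x => w / x)%C s) with (eps := r) as [d [Hd Hc]]; trivial.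
  { apply deriv_at_Cdiv; trivial; [apply deriv_at_const|apply deriv_at_id]. }
  set (den := fun x => Cpow (w / x - w / s) n).
  assert (Hx0 : forall x, Cmod (x - s)%C < Rmin d (Cmod s) -> x <> 0).
  { intros x Hx ->. assert (H1 := Rlt_le_trans _ _ _ Hx (Rmin_r _ _)). revert H1.
    replace (0 - s)%C with (- s)%C by ring. rewrite Cmod_opp. lra. }
  assert (Hdiv : forall x, Cmod (x - s)%C < Rmin d (Cmod s) -> deriv_at (fun x => w / x)%C x).
  { intros x Hx. apply deriv_at_Cdiv; [apply deriv_at_const|apply deriv_at_id|apply Hx0; trivial]. }
  assert (Hden : holo_ball den s (Rmin d (Cmod s))).
  { intros x Hx. apply (deriv_at_comp (fun y => Cpow y n) (fun x => w / x - w / s)%C); [apply deriv_at_pow|].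
    apply deriv_at_minus; [auto|apply deriv_at_const]. }
  exists (fun x => g (w / x) - principal_part n0 k0 a (w / x) * den x)%C, den, (Rmin d (Cmod s)).
  split; [apply Rmin_pos; trivial|]. split; [|split]; trivial.
  - intros x Hx. apply deriv_at_minus.
    + apply (deriv_at_comp g (fun x => w / x)%C); [|auto]. apply Hg, Hc.
      eapply Rlt_le_trans; [exact Hx|apply Rmin_l].
    + apply deriv_at_mult; [|apply Hden; trivial].
      apply (deriv_at_comp (principal_part n0 k0 a) (fun x => w / x)%C); [|auto].
      apply deriv_at_principal_part. apply Cmult_neq_0; trivial.
      apply Cmod_gt_0. rewrite Cmod_inv by auto. apply Rinv_0_lt_compat, Cmod_gt_0; auto.
  - intros x Hxs Hx.
    assert (Hne : (w / x)%C <> (w / s)%C).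
    { intros E. apply Hxs. replace x with (w / (w / x))%C by (field; auto).
      rewrite E. field; auto. }
    assert (Hdx : den x <> 0).
    { unfold den. apply Cpow_nz. intros E. apply Hne, Cminus_eq_0, E. }
    split; trivial. unfold phi. fold (principal_part n0 k0 a (w / x)).
    rewrite (H (w / x)%C Hne). 2: { apply Hc. eapply Rlt_le_trans; [exact Hx|apply Rmin_l]. }
    fold (den x). field. trivial.
Qed.

(** Agreement on a punctured disc, the only form that can be carried across a pole of [G]. *)
Definition agree_near (F G : C -> C) (s : C) : Prop :=
  exists r, 0 < r /\ forall x, x <> s -> Cmod (x - s)%C < r -> F x = G x.

Lemma ex_punctured (s : C) (r : R) : 0 < r -> exists x, x <> s /\ Cmod (x - s)%C < r.
Proof.
  intros Hr. exists (s + RtoC (r / 2))%C.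
  assert (E : (s + RtoC (r / 2) - s)%C = RtoC (r / 2)) by ring. split.
  - intros H. rewrite H in E. replace (s - s)%C with (RtoC 0) in E by ring. apply RtoC_inj in E. lra.
  - rewrite E, Cmod_R, Rabs_pos_eq; lra.
Qed.

(** Off [s] the equation [F = num / den] says that the holomorphic function [F * den - num]
    vanishes, and its zeros are isolated or fill a disc. *)
Lemma agree_near_dichotomy (F T : C -> C) (s : C) : loc_holo F s -> meromorphic_at T s ->
  exists r, 0 < r /\ ((forall x, x <> s -> Cmod (x - s)%C < r -> F x = T x) \/
    (forall x, x <> s -> Cmod (x - s)%C < r -> F x <> T x)).
Proof.
  intros [r1 [Hr1 HF]] [num [den [r2 [Hr2 [Hn [Hd HT]]]]]].
  destruct (isolated_zeros (fun x => F x * den x - num x)%C s) as [r [Hr H]].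
  { exists (Rmin r1 r2). split; [apply Rmin_pos; trivial|]. intros x Hx.
    assert (H1 := Rlt_le_trans _ _ _ Hx (Rmin_l _ _)). assert (H2 := Rlt_le_trans _ _ _ Hx (Rmin_r _ _)).
    apply deriv_at_minus; [apply deriv_at_mult|]; [apply HF|apply Hd|apply Hn]; trivial. }
  exists (Rmin r r2). split; [apply Rmin_pos; trivial|].
  assert (Hr' : forall x, Cmod (x - s)%C < Rmin r r2 -> Cmod (x - s)%C < r /\ Cmod (x - s)%C < r2).
  { intros x Hx; split; eapply Rlt_le_trans; try exact Hx; [apply Rmin_l|apply Rmin_r]. }
  destruct H as [H|H]; [left|right]; intros x Hxs Hx; destruct (Hr' x Hx) as [A B];
    destruct (HT x Hxs B) as [Hdx ->].
  - specialize (H x A). apply Cminus_eq_0 in H. rewrite <- H. field. trivial.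
  - intros E. apply (H x A Hxs). rewrite E. field. trivial.
Qed.

(** Agreement near any [x] of the disc excludes the second case of the dichotomy at [s], so it holds
    on the whole punctured disc and thus near every [y]. *)
Lemma agree_near_spread (F T : C -> C) (s : C) : loc_holo F s -> meromorphic_at T s ->
  exists r, 0 < r /\ forall x y, Cmod (x - s)%C < r -> Cmod (y - s)%C < r ->
    agree_near F T x -> agree_near F T y.
Proof.
  intros HF HT. destruct (agree_near_dichotomy F T s HF HT) as [r [Hr H]].
  exists r; split; trivial. intros x y Hx Hy [r' [Hr' Hag]].
  assert (Heq : forall x, x <> s -> Cmod (x - s)%C < r -> F x = T x).
  { destruct H as [H|H]; trivial. exfalso.
    assert (Hex : exists p, p <> x /\ p <> s /\ Cmod (p - x)%C < Rmin r' (r - Cmod (x - s)%C)).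
    { assert (Hm : 0 < Rmin r' (r - Cmod (x - s)%C)) by (apply Rmin_pos; lra). set (m := Rmin _ _) in *.
      destruct (ex_punctured x m Hm) as [p [Hp1 Hp2]].
      destruct (Ceq_dec p s) as [->|Hps]; [|exists p; auto].
      assert (Hm' : 0 < Cmod (s - x)%C) by (apply Cmod_gt_0; intros E; apply Hp1, Cminus_eq_0, E).
      destruct (ex_punctured x (Cmod (s - x)%C) Hm') as [p' [Hp1' Hp2']].
      exists p'. split; [trivial|]. split; [intros ->; lra|lra]. }
    destruct Hex as [p [P1 [P2 P3]]].
    assert (P4 := Rlt_le_trans _ _ _ P3 (Rmin_l _ _)). assert (P5 := Rlt_le_trans _ _ _ P3 (Rmin_r _ _)).
    apply (H p P2).
    - eapply Rle_lt_trans; [apply Cmod_tri3 with (y := x)|]. lra.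
    - apply Hag; trivial. }
  destruct (Ceq_dec y s) as [->|Hys].
  - exists r; split; trivial.
  - assert (Hm : 0 < Cmod (y - s)%C) by (apply Cmod_gt_0; intros E; apply Hys, Cminus_eq_0, E).
    exists (Rmin (Cmod (y - s)%C) (r - Cmod (y - s)%C)). split; [apply Rmin_pos; lra|].
    intros p _ Hp. assert (P4 := Rlt_le_trans _ _ _ Hp (Rmin_l _ _)). assert (P5 := Rlt_le_trans _ _ _ Hp (Rmin_r _ _)).
    apply Heq.
    + intros ->. rewrite Cmod_minus_sym in P4. lra.
    + eapply Rle_lt_trans; [apply Cmod_tri3 with (y := y)|]. lra.
Qed.

(** [interval_ind] is applied to an implication, which is additive because implications compose. *)
Lemma agree_near_segment (F T : C -> C) (s1 s2 : C) :
  (forall u, 0 <= u <= 1 -> loc_holo F (lin s1 s2 u) /\ meromorphic_at T (lin s1 s2 u)) ->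
  agree_near F T s1 -> agree_near F T s2.
Proof.
  intros H H1.
  assert (Q : agree_near F T (lin s1 s2 0) -> agree_near F T (lin s1 s2 1)).
  { apply (interval_ind (fun u v => agree_near F T (lin s1 s2 u) -> agree_near F T (lin s1 s2 v))); [lra|auto|].
    intros u Hu. destruct (H u Hu) as [HF HT].
    destruct (agree_near_spread F T _ HF HT) as [r [Hr Hs]].
    destruct (proj1 (continuous_Cmod _ _) (lin_cont s1 s2 u) r Hr) as [d [Hd Hc]].
    exists d; split; trivial; split; intros v Hv Hvd; apply Hs; trivial; apply Hc; apply Rabs_def1; lra. }
  rewrite lin_0, lin_1 in Q. auto.
Qed.

(** For [t] the argument of [gam] one has [Re (cis theta / gam) = cos (theta - t) / Cmod gam]: the
    condition on [gam] is a half-plane in the variable [s]. *)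
Lemma Usec_iff (U : C -> Prop) (theta al : R) (gam : C) : gam <> 0 ->
  (Usec U theta al gam <-> U gam /\ al < Re (cis theta / gam)%C).
Proof.
  intros Hg. assert (Hm : 0 < Cmod gam) by (apply Cmod_gt_0; trivial).
  assert (HRe : forall t, gam = (RtoC (Cmod gam) * cis t)%C -> Re (cis theta / gam)%C = cos (theta - t) / Cmod gam).
  { intros t Ht.
    assert (E : (cis theta / gam)%C = (RtoC (/ Cmod gam) * cis (theta - t))%C).
    { replace (cis theta) with (cis (theta - t) * cis t)%C.
      - rewrite Ht at 1. rewrite RtoC_inv by lra. field. split; [intros E; apply RtoC_inj in E; lra|apply cis_neq_0].
      - unfold cis. replace theta with ((theta - t) + t) at 3 4 by ring.
        apply injective_projections; simpl; rewrite ?cos_plus, ?sin_plus; ring. }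
    rewrite E. simpl. field. lra. }
  split.
  - intros [HU [t [[_ [_ Ht]] Hc]]]. split; trivial. rewrite (HRe t Ht).
    apply Rmult_lt_reg_r with (Cmod gam); trivial. unfold Rdiv. rewrite Rmult_assoc, Rinv_l; lra.
  - intros [HU Hc]. split; trivial. destruct (polar_form gam Hg) as [t [Ht1 Ht2]].
    exists t. split; [split; [|split]; trivial|]. rewrite (HRe t Ht2) in Hc.
    apply (Rmult_lt_compat_r (Cmod gam)) in Hc; trivial. unfold Rdiv in Hc. rewrite Rmult_assoc, Rinv_l in Hc; lra.
Qed.

Lemma poly_bound_exp (L : list (R * nat)) (eta : R) : 0 < eta ->
  exists P, 0 <= P /\ forall x, 0 <= x -> poly_bound L x <= P * exp (eta * x).
Proof.
  intros He. induction L as [|[c m] L [P [HP IH]]].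
  - exists 0; split; [lra|]. intros x _. unfold poly_bound; simpl. lra.
  - assert (Pf := INR_fact_lt_0 m). assert (Pe := pow_lt eta m He). assert (Pc := Rabs_pos c).
    assert (P1 : 0 < INR (fact m) / eta ^ m) by (apply Rdiv_lt_0_compat; trivial).
    exists (Rabs c * (INR (fact m) / eta ^ m) + P).
    split; [nra|]. intros x Hx. specialize (IH x Hx). unfold poly_bound in *; simpl.
    rewrite Rmult_plus_distr_r. apply Rplus_le_compat; trivial.
    assert (H := pow_exp_le m eta x He Hx). assert (Px := pow_le x m Hx).
    rewrite Rmult_assoc. apply Rle_trans with (Rabs c * x ^ m).
    + apply Rmult_le_compat_r; trivial. apply Rle_abs.
    + apply Rmult_le_compat_l; trivial.
Qed.

(** * Watson's lemma *)

Lemma Csum_Cmod_le (n : nat) (u : nat -> C) (B : R) :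
  (forall i, (i < n)%nat -> Cmod (u i) <= B) -> Cmod (Csum n u) <= INR n * B.
Proof.
  induction n as [|n IH]; intros H.
  - rewrite Csum_0, Cmod_0. simpl. lra.
  - rewrite Csum_S, S_INR. eapply Rle_trans; [apply Cmod_triangle|].
    specialize (H n (Nat.lt_succ_diag_r n)) as Hn. assert (IH' := IH (fun i Hi => H i (Nat.lt_lt_succ_r _ _ Hi))). lra.
Qed.

(** Below [rho / 2] this is Taylor's remainder. Beyond, [(2 t / rho) ^ N >= 1], so the crude growth
    of [psi] and the size of the polynomial are already of the required form. *)
Lemma Watson_remainder (psi : C -> C) (e : C) (c : nat -> C) (M rho P beta : R) (N : nat) :
  Cmod e = 1 -> 0 < rho -> 0 <= M -> 0 <= beta ->
  (forall n, Cmod (c n) <= M / rho ^ n) ->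
  (forall z N, Cmod (z - 0)%C < rho -> Cmod (psi z - Csum N (fun n => c n * Cpow (z - 0) n)%C)%C
      <= M * (Cmod (z - 0)%C / rho) ^ N / (1 - Cmod (z - 0)%C / rho)) ->
  (forall t, 0 <= t -> Cmod (psi (RtoC t * e) * e)%C <= P * exp (beta * t)) ->
  exists Q, 0 <= Q /\ forall t, 0 < t ->
    Cmod (psi (RtoC t * e) * e - Csum N (fun n => c n * Cpow e (S n) * Cpow (RtoC t) n)%C)%C
      <= Q * t ^ N * exp (beta * t).
Proof.
  intros He Hrho HM Hb Hc HT HP.
  assert (HP0 : 0 <= P).
  { specialize (HP 0 (Rle_refl _)). rewrite Rmult_0_r, exp_0, Rmult_1_r in HP.
    eapply Rle_trans; [apply Cmod_ge_0|exact HP]. }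
  (* [2 * M] serves the range near [0]; [P] and [INR N * M] bound [psi] and the polynomial on the
     far range. *)
  set (Q := (2 * M + P + INR N * M)).
  assert (PN := pos_INR N). assert (HNM : 0 <= INR N * M) by (apply Rmult_le_pos; trivial).
  assert (P2 : 0 < 2 / rho) by (apply Rdiv_lt_0_compat; lra).
  exists (Q * (2 / rho) ^ N). split.
  { apply Rmult_le_pos; [unfold Q; lra|apply pow_le; lra]. }
  intros t Ht. rewrite Rmult_assoc, Rmult_assoc, <- (Rmult_assoc ((2 / rho) ^ N)), <- Rpow_mult_distr.
  set (q := 2 / rho * t). assert (Hq : 0 <= q) by (apply Rmult_le_pos; lra).
  assert (Hexp : 1 <= exp (beta * t)).
  { rewrite <- exp_0. destruct (Req_dec (beta * t) 0) as [->|Hne]; [lra|]. left; apply exp_increasing.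
    assert (0 <= beta * t) by (apply Rmult_le_pos; lra). lra. }
  assert (PqN : 0 <= q ^ N) by (apply pow_le; trivial).
  assert (Htm : Cmod (RtoC t * e)%C = t) by (rewrite Cmod_mult, He, Cmod_R, Rabs_pos_eq; lra).
  assert (Hqr : t / rho = q / 2) by (unfold q; field; lra).
  destruct (Rlt_le_dec t (rho / 2)) as [Hlt|Hge].
  - specialize (HT (RtoC t * e)%C N). replace (RtoC t * e - 0)%C with (RtoC t * e)%C in HT by ring.
    rewrite Htm, Hqr in HT. specialize (HT ltac:(lra)).
    assert (Hq1 : q < 1).
    { unfold q. apply Rmult_lt_reg_l with (rho / 2); [lra|]. replace (rho / 2 * (2 / rho * t)) with t by (field; lra). lra. }
    replace (psi (RtoC t * e) * e - Csum N (fun n => c n * Cpow e (S n) * Cpow (RtoC t) n)%C)%C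
      with ((psi (RtoC t * e) - Csum N (fun n => c n * Cpow (RtoC t * e) n)%C) * e)%C.
    2: { rewrite (Csum_ext N (fun n => c n * Cpow e (S n) * Cpow (RtoC t) n)%C (fun n => e * (c n * Cpow (RtoC t * e) n))%C).
         - rewrite Csum_mult_l. ring.
         - intros i _. rewrite Cpow_mult_l. simpl. ring. }
    rewrite Cmod_mult, He, Rmult_1_r. eapply Rle_trans; [exact HT|].
    assert (H1 : (q / 2) ^ N <= q ^ N) by (apply pow_incr; lra).
    assert (H2 : / (1 - q / 2) <= 2).
    { apply Rle_trans with (/ (/ 2)); [apply Rinv_le_contravar; lra|rewrite Rinv_inv; lra]. }
    apply Rle_trans with (M * q ^ N * 2).
    + apply Rmult_le_compat; trivial.
      * apply Rmult_le_pos; trivial. apply pow_le; lra.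
      * left; apply Rinv_0_lt_compat; lra.
      * apply Rmult_le_compat_l; trivial.
    + assert (H3 : q ^ N * 1 <= q ^ N * exp (beta * t)) by (apply Rmult_le_compat_l; trivial).
      apply Rle_trans with (2 * M * (q ^ N * exp (beta * t))); [nra|].
      apply Rmult_le_compat_r; [nra|unfold Q; lra].
  - assert (Hq1 : 1 <= q).
    { unfold q. apply Rmult_le_reg_l with (rho / 2); [lra|]. replace (rho / 2 * (2 / rho * t)) with t by (field; lra). lra. }
    assert (HqN : 1 <= q ^ N) by (apply pow_R1_Rle; trivial).
    eapply Rle_trans; [apply Cmod_minus_le|].
    assert (H1 : Cmod (Csum N (fun n => c n * Cpow e (S n) * Cpow (RtoC t) n)%C) <= INR N * (M * q ^ N)).
    { apply Csum_Cmod_le. intros i Hi. rewrite !Cmod_mult, !Cmod_pow, He, pow1, Cmod_R, Rabs_pos_eq by lra.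
      rewrite Rmult_1_r. apply Rle_trans with (M / rho ^ i * t ^ i).
      - apply Rmult_le_compat_r; [apply pow_le; lra|apply Hc].
      - replace (M / rho ^ i * t ^ i) with (M * (t / rho) ^ i).
        2: { unfold Rdiv at 1. rewrite Rpow_mult_distr, pow_inv. field. apply pow_nonzero; lra. }
        apply Rmult_le_compat_l; trivial. apply Rle_trans with (q ^ i).
        + apply pow_incr. rewrite Hqr. lra.
        + apply Rle_pow; trivial. lia. }
    specialize (HP t ltac:(lra)).
    assert (H2 : P * exp (beta * t) <= P * (q ^ N * exp (beta * t))).
    { apply Rmult_le_compat_l; trivial. rewrite <- (Rmult_1_l (exp (beta * t))) at 1. apply Rmult_le_compat_r; lra. }
    assert (H3 : INR N * (M * q ^ N) <= INR N * M * (q ^ N * exp (beta * t))).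
    { rewrite <- Rmult_assoc. apply Rmult_le_compat_l; trivial. rewrite <- (Rmult_1_r (q ^ N)) at 1.
      apply Rmult_le_compat_l; trivial. }
    assert (H4 : 0 <= q ^ N * exp (beta * t)) by (apply Rmult_le_pos; lra).
    assert (H5 : 0 <= M * (q ^ N * exp (beta * t))) by (apply Rmult_le_pos; lra).
    replace (Q * (q ^ N * exp (beta * t))) with (2 * (M * (q ^ N * exp (beta * t))) + P * (q ^ N * exp (beta * t)) +
      INR N * M * (q ^ N * exp (beta * t))) by (unfold Q; ring). lra.
Qed.

Lemma laplace_expansion (G : R -> C) (gc : nat -> C) (P beta Q sigma : R) (N : nat) :
  (forall t, 0 <= t -> ccurve_cont G t) -> (forall t, 0 <= t -> Cmod (G t) <= P * exp (beta * t)) ->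
  0 <= Q -> 0 <= beta < sigma ->
  (forall t, 0 < t -> Cmod (G t - Csum N (fun n => gc n * Cpow (RtoC t) n)%C)%C <= Q * t ^ N * exp (beta * t)) ->
  Cmod (laplace G (RtoC sigma) - Csum N (fun n => gc n * RtoC (INR (fact n) / sigma ^ S n))%C)%C
    <= Q * INR (fact N) * (2 / (sigma - beta)) ^ (S N).
Proof.
  intros Hc HG HQ Hs HR.
  assert (H1 := laplace_gint G P beta (RtoC sigma) Hc HG (proj2 Hs)).
  assert (H2 := gint_Csum 0 p_infty N (fun n t => gc n * (Cexp (- (RtoC t * RtoC sigma)) * Cpow (RtoC t) n))%C
    (fun n => gc n * RtoC (INR (fact n) / sigma ^ S n))%C I (fun n _ => gint_mult_l _ _ _ _ _ (laplace_pow n sigma ltac:(lra)))).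
  assert (H3 := gint_minus _ _ _ _ _ _ H1 H2).
  apply laplace_bound with (fun t => G t - Csum N (fun n => gc n * Cpow (RtoC t) n)%C)%C; trivial; [lra|].
  revert H3. apply gint_ext; [exact I|]. intros t _.
  rewrite (Csum_ext N (fun n => gc n * (Cexp (- (RtoC t * RtoC sigma)) * Cpow (RtoC t) n))%C
    (fun n => Cexp (- (RtoC t * RtoC sigma)) * (gc n * Cpow (RtoC t) n))%C) by (intros; ring).
  rewrite Csum_mult_l. ring.
Qed.

(** In [x = / sigma] the transform has the expansion with terms [gc n * n! * x ^ (S n)], which
    starts at order one. Comparison with the terms [al n * x ^ n] explains the shift of index and
    the vanishing of [al 0]. *)
Lemma asymptotic_coefficients (G : R -> C) (gc al : nat -> C) (P beta M rho : R) :
  (forall t, 0 <= t -> ccurve_cont G t) -> (forall t, 0 <= t -> Cmod (G t) <= P * exp (beta * t)) ->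
  0 <= beta -> 0 <= rho ->
  (forall N, exists Q, 0 <= Q /\ forall t, 0 < t ->
     Cmod (G t - Csum N (fun n => gc n * Cpow (RtoC t) n)%C)%C <= Q * t ^ N * exp (beta * t)) ->
  (forall n, Cmod (al n) <= M * rho ^ n) ->
  (forall A, exists sigma, A < sigma /\ laplace G (RtoC sigma) = pseries al (RtoC (/ sigma))) ->
  al 0%nat = 0 /\ forall n, al (S n) = (gc n * RtoC (INR (fact n)))%C.
Proof.
  intros Hc HG Hb Hrho HR Hal Heq.
  set (d := fun m => match m with 0%nat => al 0%nat | S n => (al (S n) - gc n * RtoC (INR (fact n)))%C end).
  assert (Hd : forall N i, (i < S N)%nat -> d i = 0).
  { intros N. destruct (HR N) as [Q [HQ HRN]].
    (* The first summand is the tail of the power series for [rho * x <= 1 / 2]. The [4] comes from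
       [sigma - beta >= sigma / 2], so that [2 / (sigma - beta) <= 4 * x]. *)
    apply (small_polynomial_zero (S N) d (2 * M * rho ^ S N + Q * INR (fact N) * 4 ^ S N)).
    intros A HA. destruct (Heq (Rmax (/ A) (Rmax (2 * beta + 1) (2 * rho + 1)))) as [sigma [Hsg E]].
    assert (S1 := Rle_lt_trans _ _ _ (Rmax_l _ _) Hsg).
    assert (S23 := Rle_lt_trans _ _ _ (Rmax_r _ _) Hsg).
    assert (S2 := Rle_lt_trans _ _ _ (Rmax_l _ _) S23). assert (S3 := Rle_lt_trans _ _ _ (Rmax_r _ _) S23).
    assert (Hs0 : 0 < sigma) by lra. set (x := / sigma) in *.
    assert (Hx : 0 < x) by (apply Rinv_0_lt_compat; trivial).
    exists x. split.
    { split; trivial. unfold x. rewrite <- (Rinv_inv A). apply Rinv_lt_contravar; trivial.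
      apply Rmult_lt_0_compat; trivial. apply Rinv_0_lt_compat; trivial. }
    assert (Hxm : Cmod (RtoC x) = x) by (rewrite Cmod_R, Rabs_pos_eq; lra).
    assert (Hrx : rho * x <= 1 / 2).
    { apply Rmult_le_reg_r with sigma; trivial. unfold x. rewrite Rmult_assoc, Rinv_l by lra. lra. }
    destruct (pseries_lim al M rho (RtoC x) Hrho Hal ltac:(rewrite Hxm; lra)) as [_ HT].
    specialize (HT (S N)). rewrite Hxm in HT.
    assert (HL := laplace_expansion G gc P beta Q sigma N Hc HG HQ ltac:(lra) HRN).
    assert (Hfac : Csum (S N) (fun i => d i * Cpow (RtoC x) i)%C =
      (Csum (S N) (fun i => al i * Cpow (RtoC x) i)%C - Csum N (fun n => gc n * RtoC (INR (fact n) / sigma ^ S n))%C)%C).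
    { rewrite !Csum_S_first. simpl.
      replace (al 0%nat * 1 + Csum N (fun i => al (S i) * (RtoC x * Cpow (RtoC x) i))%C - Csum N (fun n => gc n * RtoC (INR (fact n) / (sigma * sigma ^ n)))%C)%C
       with (al 0%nat * 1 + (Csum N (fun i => al (S i) * (RtoC x * Cpow (RtoC x) i))%C - Csum N (fun n => gc n * RtoC (INR (fact n) / (sigma * sigma ^ n)))%C))%C by ring.
      f_equal. rewrite <- Csum_minus. apply Csum_ext. intros i _.
      replace (INR (fact i) / (sigma * sigma ^ i)) with (INR (fact i) * (x * x ^ i)).
      - rewrite !RtoC_mult, RtoC_pow. ring.
      - unfold x. rewrite pow_inv. field. repeat split; try lra; apply pow_nonzero; lra. }
    rewrite Hfac. rewrite E in HL.
    set (A1 := Csum (S N) _) in *. set (A2 := Csum N _) in *. set (A3 := pseries al _) in *.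
    replace (A1 - A2)%C with ((A3 - A2) - (A3 - A1))%C by ring.
    eapply Rle_trans; [apply Cmod_minus_le|].
    assert (B1 : Q * INR (fact N) * (2 / (sigma - beta)) ^ S N <= Q * INR (fact N) * 4 ^ S N * x ^ S N).
    { rewrite (Rmult_assoc _ (4 ^ S N)), <- Rpow_mult_distr. apply Rmult_le_compat_l.
      - apply Rmult_le_pos; trivial. left; apply INR_fact_lt_0.
      - apply pow_incr. split; [left; apply Rdiv_lt_0_compat; lra|].
        unfold x. apply Rmult_le_reg_r with ((sigma - beta) * sigma); [apply Rmult_lt_0_compat; lra|].
        replace (2 / (sigma - beta) * ((sigma - beta) * sigma)) with (2 * sigma) by (field; lra).
        replace (4 * / sigma * ((sigma - beta) * sigma)) with (4 * (sigma - beta)) by (field; lra). lra. }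
    assert (HM : 0 <= M) by (eapply Rle_trans; [apply Cmod_ge_0|]; specialize (Hal 0%nat); simpl in Hal; rewrite Rmult_1_r in Hal; exact Hal).
    assert (B2 : M * (rho * x) ^ S N / (1 - rho * x) <= 2 * M * rho ^ S N * x ^ S N).
    { replace (2 * M * rho ^ S N * x ^ S N) with (M * (rho * x) ^ S N * 2) by (rewrite Rpow_mult_distr; ring).
      apply Rmult_le_compat_l; [apply Rmult_le_pos; trivial; apply pow_le; apply Rmult_le_pos; lra|].
      apply Rle_trans with (/ (/ 2)); [apply Rinv_le_contravar; lra|rewrite Rinv_inv; lra]. }
    lra. }
  split; [exact (Hd 0%nat 0%nat ltac:(lia))|].
  intros n. apply Cminus_eq_0. exact (Hd (S n) (S n) ltac:(lia)).
Qed.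

Definition bcoef (k0 : nat) (a : Z -> C) (n : nat) : C :=
  (acoef k0 a (S n) / RtoC (INR (fact n)))%C.

Lemma RtoC_fact_neq_0 (n : nat) : RtoC (INR (fact n)) <> 0.
Proof. intros E. apply RtoC_inj in E. exact (INR_fact_neq_0 n E). Qed.

(** The ratio [rho'] is arbitrary: [(rho / rho') ^ n / n!] is one term of the series of
    [exp (rho / rho')]. Thus division by [n!] makes the function entire. *)
Lemma bcoef_bound (f : C -> C) (n0 k0 : nat) (a : Z -> C) (rho' : R) : laurent_at0 f n0 a -> 0 < rho' ->
  exists M, forall n, Cmod (bcoef k0 a n) <= M * rho' ^ n.
Proof.
  intros Ha Hr'. destruct (phi_pseries f n0 k0 a Ha) as [M [rho [r [Hrho [_ [_ [Hb _]]]]]]].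
  assert (HM : 0 <= M) by (eapply Rle_trans; [apply Cmod_ge_0|]; specialize (Hb 0%nat); simpl in Hb; rewrite Rmult_1_r in Hb; exact Hb).
  exists (M * rho * exp (rho / rho')). intros n. unfold bcoef.
  assert (Pf := INR_fact_lt_0 n).
  rewrite Cmod_div, Cmod_R, Rabs_pos_eq by (try apply RtoC_fact_neq_0; lra).
  apply Rle_trans with (M * rho ^ S n / INR (fact n)).
  - apply Rmult_le_compat_r; [left; apply Rinv_0_lt_compat; trivial|apply Hb].
  - assert (H := pow_fact_le_exp (rho / rho') n ltac:(left; apply Rdiv_lt_0_compat; trivial)).
    assert (Pp := pow_lt rho' n Hr').
    apply (Rmult_le_compat_l (M * rho * rho' ^ n)) in H.
    2: { repeat apply Rmult_le_pos; lra. }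
    replace (M * rho ^ S n / INR (fact n)) with (M * rho * rho' ^ n * ((rho / rho') ^ n / INR (fact n))).
    + eapply Rle_trans; [exact H|]. right; ring.
    + unfold Rdiv at 2. rewrite Rpow_mult_distr, pow_inv. simpl. field. lra.
Qed.

(** The set of admissible [gam] need not approach [0], so the germ of [phi] at [0] is reached only
    through continuation in [s]. The first conclusion has content for [k0 = 0]: a function with
    non-zero value at [gam = 0] is not a Laplace transform. *)
Theorem inverse_laplace_germ (f : C -> C) (n0 k0 : nat) (a : Z -> C) (U V : C -> Prop) (theta al : R)
    (L : list (R * nat)) (z gam0 : C) (psi : C -> C) :
  meromorphic f -> laurent_at0 f n0 a -> z <> 0 -> open U -> ray_domain theta V ->
  is_inverse_laplace theta (Usec U theta al) V (fun gam => phi f n0 k0 a (gam * z)%C) psi ->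
  (forall xi, V xi -> Cmod (psi xi) <= exp (al * Cmod xi) * poly_bound L (Cmod xi)) ->
  Usec U theta al gam0 ->
  acoef k0 a 0 = 0 /\ exists r, 0 < r /\ forall xi, Cmod xi < r -> psi xi = (z * pseries (bcoef k0 a) (z * xi))%C.
Proof.
  intros Hf Ha Hz HU [HVo [_ HVr]] [Hpsi HL] Hbd Hg0.
  assert (Hg0' : gam0 <> 0) by (destruct Hg0 as [_ [t [[H _] _]]]; exact H).
  set (e := cis theta). assert (He : Cmod e = 1) by apply Cmod_cis. assert (He0 : e <> 0) by apply cis_neq_0.
  set (G := fun t => (psi (RtoC t * e) * e)%C).
  assert (Hray : forall t, 0 <= t -> V (RtoC t * e)%C) by (intros t Ht; apply HVr; exists t; split; trivial).
  assert (Hder : forall xi, V xi -> deriv_at psi xi).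
  { intros xi Hxi. destruct (proj1 (holo_at_ball _ _) (Hpsi xi Hxi)) as [r [Hr H]]. apply H.
    replace (xi - xi)%C with (RtoC 0) by ring. rewrite Cmod_0; trivial. }
  assert (HGc : forall t, 0 <= t -> ccurve_cont G t).
  { intros t Ht. apply (ccont_curve (fun x => psi (x * e) * e)%C RtoC); [|apply ccurve_cont_RtoC].
    apply deriv_at_ccont. apply deriv_at_mult; [|apply deriv_at_const].
    apply (deriv_at_comp psi (fun x => x * e)%C); [apply Hder, Hray; trivial|].
    apply deriv_at_mult; [apply deriv_at_id|apply deriv_at_const]. }
  assert (HGm : forall t, 0 <= t -> Cmod (G t) <= exp (al * t) * poly_bound L t).
  { intros t Ht. unfold G. rewrite Cmod_mult, He, Rmult_1_r. specialize (Hbd _ (Hray t Ht)).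
    rewrite Cmod_mult, He, Cmod_R, Rmult_1_r, Rabs_pos_eq in Hbd by trivial. exact Hbd. }
  assert (HGP : forall beta, al < beta -> exists P, forall t, 0 <= t -> Cmod (G t) <= P * exp (beta * t)).
  { intros beta Hbe. destruct (poly_bound_exp L (beta - al) ltac:(lra)) as [P [HP H]]. exists P.
    intros t Ht. eapply Rle_trans; [apply HGm; trivial|].
    apply Rle_trans with (exp (al * t) * (P * exp ((beta - al) * t))).
    - apply Rmult_le_compat_l; [left; apply exp_pos|auto].
    - right. replace (beta * t) with (al * t + (beta - al) * t) by ring. rewrite exp_plus. ring. }
  set (s0 := (e / gam0)%C).
  assert (Hs0 : al < Re s0) by (apply (proj1 (Usec_iff U theta al gam0 Hg0') Hg0)).
  (* Halfway: [al < beta] absorbs the polynomial factor of the growth bound, and [beta < Re s0]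
     keeps [s0] inside the half-plane where the transform is holomorphic. *)
  set (beta := (al + Re s0) / 2).
  destruct (HGP beta ltac:(unfold beta; lra)) as [P HP].
  set (T := fun s => phi f n0 k0 a ((z * e) / s)%C).
  assert (Hs00 : s0 <> 0).
  { intros E. apply He0. replace e with (s0 * gam0)%C by (unfold s0; field; trivial). rewrite E; ring. }
  (* For [s] near [s0] the point [e / s] is near [gam0], hence in the open set [U], and [Re s] still
     exceeds [al]; so the hypothesis on [psi] applies on a whole disc. *)
  assert (Hagree0 : exists r, 0 < r /\ forall s, Cmod (s - s0)%C < r -> beta < Re s /\ laplace G s = T s).
  { destruct (deriv_at_ccont (fun x => e / x)%C s0
      (deriv_at_Cdiv _ _ _ (deriv_at_const e s0) (deriv_at_id s0) Hs00)) with (eps := 1) as [_ _]; [lra|].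
    assert (Hes0 : (e / s0)%C = gam0) by (unfold s0; field; auto).
    assert (HUg : locally (T := C_UniformSpace) gam0 U) by (apply HU; apply Hg0).
    apply locally_Cmod in HUg. destruct HUg as [ru [Hru HUg]].
    destruct (deriv_at_ccont (fun x => e / x)%C s0
      (deriv_at_Cdiv _ _ _ (deriv_at_const e s0) (deriv_at_id s0) Hs00) ru Hru) as [d [Hd Hc]].
    assert (Ms0 : 0 < Cmod s0) by (apply Cmod_gt_0; trivial).
    exists (Rmin d (Rmin (Cmod s0) (Re s0 - beta))). split.
    { repeat apply Rmin_pos; trivial. unfold beta; lra. }
    intros s Hs. assert (A1 := Rlt_le_trans _ _ _ Hs (Rmin_l _ _)).
    assert (A23 := Rlt_le_trans _ _ _ Hs (Rmin_r _ _)).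
    assert (A2 := Rlt_le_trans _ _ _ A23 (Rmin_l _ _)). assert (A3 := Rlt_le_trans _ _ _ A23 (Rmin_r _ _)).
    assert (HRe := Re_le_Cmod_minus s s0).
    assert (Hs' : s <> 0).
    { intros ->. revert A2. replace (0 - s0)%C with (- s0)%C by ring. rewrite Cmod_opp. lra. }
    split; [lra|].
    set (gam := (e / s)%C).
    assert (Hgam : gam <> 0).
    { intros E. apply He0. replace e with (gam * s)%C by (unfold gam; field; trivial). rewrite E; ring. }
    assert (Hegs : (e / gam)%C = s) by (unfold gam; field; auto).
    assert (HUs : Usec U theta al gam).
    { apply Usec_iff; trivial. split.
      - apply HUg. rewrite <- Hes0. apply Hc; trivial.
      - fold e. rewrite Hegs. unfold beta in A3. lra. }
    specialize (HL gam HUs). unfold T.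
    replace (z * e / s)%C with (gam * z)%C by (unfold gam; field; trivial).
    assert (HL' : gint 0 p_infty (fun t => Cexp (- (RtoC t * s)) * G t)%C (phi f n0 k0 a (gam * z)%C)).
    { apply gint_ext with (3 := HL); [exact I|]. intros t _. cbv zeta. fold e. unfold G.
      replace (RtoC t * e / gam)%C with (RtoC t * s)%C by (rewrite <- Hegs; unfold Cdiv; ring). ring. }
    exact (is_RInt_gen_unique (V := C_R_CompleteNormedModule) _ _ HL'). }
  destruct Hagree0 as [r0 [Hr0 Hag0]].
  assert (Hs1 : exists s1, Im s1 <> 0 /\ beta < Re s1 /\ agree_near (laplace G) T s1).
  { set (x := if Req_EM_T (Im s0) (- (r0 / 2)) then r0 / 4 else r0 / 2).
    assert (Hx : 0 < x <= r0 / 2 /\ Im s0 + x <> 0).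
    { unfold x; destruct (Req_EM_T (Im s0) (- (r0 / 2))); lra. }
    set (s1 := (s0 + (0, x))%C).
    assert (Hd : Cmod (s1 - s0)%C <= r0 / 2).
    { replace (s1 - s0)%C with ((0, x) : C) by (unfold s1; apply injective_projections; simpl; ring).
      eapply Rle_trans; [apply Cmod_pair_le|]. rewrite Rabs_R0, Rabs_pos_eq; lra. }
    exists s1. split; [|split].
    - change (Im s0 + x <> 0). apply Hx.
    - apply Hag0. lra.
    - exists (r0 / 2). split; [lra|]. intros s _ Hs. apply Hag0.
      eapply Rle_lt_trans; [apply Cmod_tri3 with (y := s1)|]. lra. }
  destruct Hs1 as [s1 [HIm [HRe1 Hag1]]].
  assert (Hbig : forall A, exists sigma, A < sigma /\ laplace G (RtoC sigma) = T (RtoC sigma)).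
  { intros A. set (s2 := Rmax A (Rmax 0 beta) + 1).
    assert (B1 : A < s2) by (unfold s2; assert (H := Rmax_l A (Rmax 0 beta)); lra).
    assert (B2 : Rmax 0 beta < s2) by (unfold s2; assert (H := Rmax_r A (Rmax 0 beta)); lra).
    assert (B3 := Rle_lt_trans _ _ _ (Rmax_l _ _) B2). assert (B4 := Rle_lt_trans _ _ _ (Rmax_r _ _) B2).
    destruct (agree_near_segment (laplace G) T s1 (RtoC s2)) as [r [Hr H]]; trivial.
    { intros u Hu.
      assert (HRu : Re (lin s1 (RtoC s2) u) = (1 - u) * Re s1 + u * s2).
      { unfold lin. destruct s1 as [x1 y1]; simpl. ring. }
      assert (HIu : Im (lin s1 (RtoC s2) u) = (1 - u) * Im s1).
      { unfold lin. destruct s1 as [x1 y1]; simpl. ring. }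
      assert (HRu' : beta < Re (lin s1 (RtoC s2) u)) by (rewrite HRu; clearbody beta s2; clear - HRe1 B4 Hu; destruct (Req_dec u 0) as [->|];
          [lra|assert (0 < u * (s2 - beta)) by (apply Rmult_lt_0_compat; lra);
           assert (0 <= (1 - u) * (Re s1 - beta)) by (apply Rmult_le_pos; lra); lra]).
      split.
      - exists (Re (lin s1 (RtoC s2) u) - beta). split; [lra|]. intros s Hs.
        apply laplace_deriv_at with P beta; trivial.
        assert (H := Re_le_Cmod_minus s (lin s1 (RtoC s2) u)). lra.
      - apply meromorphic_at_phi; trivial; [apply Cmult_neq_0; trivial|]. intros E.
        rewrite E in HRu, HIu. simpl in HRu, HIu.
        destruct (Req_dec u 1) as [->|Hu1]; [lra|].
        symmetry in HIu. apply Rmult_integral in HIu. destruct HIu; [lra|tauto]. }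
    (* Agreement is known only off [s2], so a nearby larger real point is taken. *)
    exists (s2 + r / 2). split; [lra|]. apply H.
    - intros E. apply RtoC_inj in E. lra.
    - rewrite <- RtoC_minus, Cmod_R, Rabs_pos_eq; lra. }
  destruct (phi_pseries f n0 k0 a Ha) as [M [rho [r1 [Hrho [Hr1 [Hrr1 [Hb Hphi]]]]]]].
  set (al' := fun n => (acoef k0 a n * Cpow (z * e) n)%C).
  assert (Mz : 0 < Cmod z) by (apply Cmod_gt_0; trivial).
  assert (Hze : Cmod (z * e)%C = Cmod z) by (rewrite Cmod_mult, He; ring).
  assert (Hal' : forall n, Cmod (al' n) <= M * (rho * Cmod z) ^ n).
  { intros n. unfold al'. rewrite Cmod_mult, Cmod_pow, Hze, Rpow_mult_distr, <- Rmult_assoc.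
    apply Rmult_le_compat_r; [apply pow_le; lra|apply Hb]. }
  assert (HTs : forall sigma, Cmod z / r1 < sigma -> T (RtoC sigma) = pseries al' (RtoC (/ sigma))).
  { intros sigma Hsig.
    assert (H0 : 0 < Cmod z / r1) by (apply Rdiv_lt_0_compat; trivial).
    assert (Hsn : RtoC sigma <> 0) by (intros E; apply RtoC_inj in E; lra).
    unfold T. rewrite Hphi.
    - unfold pseries. f_equal. apply FunctionalExtensionality.functional_extensionality. intros n.
      unfold al', Cdiv. rewrite (Cpow_mult_l (z * e)), RtoC_inv by lra. ring.
    - apply Cmult_neq_0; [apply Cmult_neq_0; trivial|]. apply Cmod_gt_0. rewrite Cmod_inv by trivial.
      apply Rinv_0_lt_compat, Cmod_gt_0; trivial.
    - rewrite Cmod_div, Hze, Cmod_R, Rabs_pos_eq by (trivial; lra).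
      apply Rmult_lt_reg_r with (sigma / r1); [apply Rdiv_lt_0_compat; lra|].
      replace (Cmod z / sigma * (sigma / r1)) with (Cmod z / r1) by (field; lra).
      replace (r1 * (sigma / r1)) with sigma by (field; lra). trivial. }
  assert (HV0 : V 0).
  { replace (RtoC 0) with (RtoC 0 * e)%C by ring. apply Hray. lra. }
  destruct (loc_holo_bounded psi 0 (proj1 (holo_at_ball _ _) (Hpsi 0 HV0))) as [R0 [M0 [HR0 [Hh HM0]]]].
  assert (HM00 : 0 <= M0).
  { eapply Rle_trans; [apply Cmod_ge_0|apply (HM0 0)]. replace (0 - 0)%C with (RtoC 0) by ring. rewrite Cmod_0; trivial. }
  destruct (Taylor psi 0 R0 (R0 / 2) M0 Hh ltac:(lra) HM0) as [c [Hc1 Hc2]].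
  (* The remainder estimates use [1 <= exp (beta' * t)] and so want a non-negative exponent. *)
  set (beta' := Rmax beta 0).
  assert (Hb1 : beta <= beta') by apply Rmax_l. assert (Hb2 : 0 <= beta') by apply Rmax_r.
  assert (HP' : forall t, 0 <= t -> Cmod (G t) <= P * exp (beta' * t)).
  { intros t Ht. eapply Rle_trans; [apply HP; trivial|]. apply Rmult_le_compat_l.
    - specialize (HP 0 (Rle_refl _)). rewrite Rmult_0_r, exp_0, Rmult_1_r in HP.
      eapply Rle_trans; [apply Cmod_ge_0|exact HP].
    - destruct (Req_dec (beta * t) (beta' * t)) as [->|Hne]; [lra|]. left; apply exp_increasing.
      assert (beta * t <= beta' * t) by (apply Rmult_le_compat_r; trivial). lra. }
  destruct (asymptotic_coefficients G (fun n => c n * Cpow e (S n))%C al' P beta' M (rho * Cmod z)) as [E0 En]; trivial.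
  { apply Rmult_le_pos; lra. }
  { intros N. apply (Watson_remainder psi e c M0 (R0 / 2) P beta' N); trivial; lra. }
  { intros A. destruct (Hbig (Rmax A (Cmod z / r1))) as [sigma [Hs E]]. exists sigma. split.
    - eapply Rle_lt_trans; [apply Rmax_l|exact Hs].
    - rewrite E. apply HTs. eapply Rle_lt_trans; [apply Rmax_r|exact Hs]. }
  split.
  { unfold al' in E0. simpl in E0. rewrite Cmult_1_r in E0. exact E0. }
  assert (Hcn : forall n, c n = (bcoef k0 a n * Cpow z (S n))%C).
  { intros n. specialize (En n). unfold al' in En. rewrite Cpow_mult_l in En.
    assert (Hen : Cpow e (S n) <> 0) by (apply Cpow_nz; trivial).
    assert (Hfn := RtoC_fact_neq_0 n). unfold bcoef.
    replace (c n) with (c n * Cpow e (S n) * RtoC (INR (fact n)) / (Cpow e (S n) * RtoC (INR (fact n))))%C by (field; auto).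
    rewrite <- En. field. auto. }
  exists (R0 / 4). split; [lra|]. intros xi Hxi.
  (* The ratio is chosen such that the series at [z * xi] converges geometrically on the whole disc
     [Cmod xi < R0 / 4]. *)
  destruct (bcoef_bound f n0 k0 a (/ (2 * (Cmod z * R0))) Ha) as [Mb HMb].
  { apply Rinv_0_lt_compat. assert (0 < Cmod z * R0) by (apply Rmult_lt_0_compat; trivial). lra. }
  assert (Hlt : / (2 * (Cmod z * R0)) * Cmod (z * xi)%C < 1).
  { rewrite Cmod_mult. assert (0 < Cmod z * R0) by (apply Rmult_lt_0_compat; trivial).
    apply Rmult_lt_reg_l with (2 * (Cmod z * R0)); [lra|]. rewrite <- Rmult_assoc, Rinv_r by lra.
    assert (Cmod z * Cmod xi < Cmod z * R0) by (apply Rmult_lt_compat_l; lra). lra. }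
  destruct (pseries_lim (bcoef k0 a) Mb (/ (2 * (Cmod z * R0))) (z * xi)%C) as [Hlim _]; trivial.
  { left; apply Rinv_0_lt_compat. assert (0 < Cmod z * R0) by (apply Rmult_lt_0_compat; trivial). lra. }
  apply Csum_lim_unique with (fun n => c n * Cpow xi n)%C.
  - intros eps Heps. set (q := Cmod xi / (R0 / 2)).
    assert (Hq : 0 <= q < 1).
    { unfold q. split; [apply Rmult_le_pos; [apply Cmod_ge_0|left; apply Rinv_0_lt_compat; lra]|].
      apply Rmult_lt_reg_r with (R0 / 2); [lra|]. unfold Rdiv at 1. rewrite Rmult_assoc, Rinv_l; lra. }
    destruct (geom_lim (M0 / (1 - q)) q eps Hq Heps) as [N HN]. exists N. intros n Hn. specialize (HN n Hn).
    specialize (Hc2 xi n). replace (xi - 0)%C with xi in Hc2 by ring. specialize (Hc2 ltac:(lra)). fold q in Hc2.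
    rewrite Cmod_minus_sym. eapply Rle_lt_trans; [exact Hc2|].
    replace (M0 * q ^ n / (1 - q)) with (M0 / (1 - q) * q ^ n) by (field; lra). exact HN.
  - intros eps Heps. destruct (Hlim (eps / Cmod z) ltac:(apply Rdiv_lt_0_compat; trivial)) as [N HN].
    exists N. intros n Hn. specialize (HN n Hn).
    rewrite (Csum_ext n _ (fun n => z * (bcoef k0 a n * Cpow (z * xi) n))%C).
    2: { intros i _. rewrite Hcn, Cpow_mult_l. simpl. ring. }
    rewrite Csum_mult_l. set (S0 := Csum n _) in *. set (S1 := pseries _ _) in *.
    replace (z * S0 - z * S1)%C with (z * (S0 - S1))%C by ring. rewrite Cmod_mult.
    replace eps with (Cmod z * (eps / Cmod z)) by (field; lra). apply Rmult_lt_compat_l; trivial.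
Qed.

(** * Integrability of the kernel *)

(** The set [A] of points near which the functions agree and the set [B] of points with a punctured
    neighbourhood of disagreement are open, cover [V] and are disjoint. *)
Lemma identity_connected (V : C -> Prop) (F G : C -> C) (z0 : C) (r0 : R) :
  connected_set V -> (forall z, V z -> loc_holo F z) -> (forall z, V z -> loc_holo G z) ->
  V z0 -> 0 < r0 -> (forall z, Cmod (z - z0)%C < r0 -> F z = G z) ->
  forall z, V z -> F z = G z.
Proof.
  intros HV HF HG Hz0 Hr0 H0 z Hz.
  set (A := fun x => exists r, 0 < r /\ forall y, Cmod (y - x)%C < r -> F y = G y).
  set (B := fun x => exists r, 0 < r /\ forall y, Cmod (y - x)%C < r -> y <> x -> F y <> G y).
  assert (HA : open (T := C_UniformSpace) A).
  { intros x [r [Hr H]]. apply locally_Cmod. exists r; split; trivial. intros x' Hx'.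
    exists (r - Cmod (x' - x)%C). split; [lra|]. intros y Hy. apply H.
    eapply Rle_lt_trans; [apply Cmod_tri3 with (y := x')|]. lra. }
  assert (HB : open (T := C_UniformSpace) B).
  { intros x [r [Hr H]]. apply locally_Cmod. exists r; split; trivial. intros x' Hx'.
    destruct (Ceq_dec x' x) as [->|Hne]; [exists r; split; trivial|].
    assert (Hm : 0 < Cmod (x' - x)%C) by (apply Cmod_gt_0; intros E; apply Hne, Cminus_eq_0, E).
    exists (Rmin (r - Cmod (x' - x)%C) (Cmod (x' - x)%C)). split; [apply Rmin_pos; lra|].
    intros y Hy _. assert (P1 := Rlt_le_trans _ _ _ Hy (Rmin_l _ _)). assert (P2 := Rlt_le_trans _ _ _ Hy (Rmin_r _ _)).
    apply H.
    - eapply Rle_lt_trans; [apply Cmod_tri3 with (y := x')|]. lra.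
    - intros ->. rewrite Cmod_minus_sym in P2. lra. }
  assert (HAB : forall x, V x -> A x \/ B x).
  { intros x Hx. destruct (HF x Hx) as [r1 [Hr1 F1]]. destruct (HG x Hx) as [r2 [Hr2 G2]].
    destruct (isolated_zeros (fun y => F y - G y)%C x) as [r [Hr [H|H]]].
    - exists (Rmin r1 r2); split; [apply Rmin_pos; trivial|]. intros y Hy.
      apply deriv_at_minus; [apply F1|apply G2]; eapply Rlt_le_trans; try exact Hy; [apply Rmin_l|apply Rmin_r].
    - left. exists r; split; trivial. intros y Hy. apply Cminus_eq_0, H; trivial.
    - right. exists r; split; trivial. intros y Hy Hne E. apply (H y Hy Hne). rewrite E. ring. }
  destruct (HAB z Hz) as [[r [Hr H]]|HBz].
  - apply H. replace (z - z)%C with (RtoC 0) by ring. rewrite Cmod_0; trivial.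
  - exfalso. destruct (HV A B HA HB HAB) as [x [_ [[r1 [Hr1 H1]] [r2 [Hr2 H2]]]]].
    + exists z0; split; trivial. exists r0; split; trivial.
    + exists z; split; trivial.
    + destruct (ex_punctured x (Rmin r1 r2)) as [y [Hy1 Hy2]]; [apply Rmin_pos; trivial|].
      apply (H2 y (Rlt_le_trans _ _ _ Hy2 (Rmin_r _ _)) Hy1). apply H1.
      eapply Rlt_le_trans; [exact Hy2|apply Rmin_l].
Qed.

(** * Arcs under the angle condition and the mass of the kernel *)

Definition radial_speed (p dp : R -> C) (t : R) : R :=
  (Re (p t) * Re (dp t) + Im (p t) * Im (dp t)) / Cmod (p t).

Lemma is_derive_Cmod (p dp : R -> C) (t : R) : C1_curve p dp -> p t <> 0 ->
  is_derive (fun s => Cmod (p s)) t (radial_speed p dp t).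
Proof.
  intros Hp Hne. destruct (is_derive_C_Re_Im p t (dp t) (proj1 (Hp t))) as [H1 H2].
  assert (Hm : 0 < Cmod (p t)) by (apply Cmod_gt_0; trivial).
  assert (H : is_derive (fun s => Re (p s) * Re (p s) + Im (p s) * Im (p s)) t
     (Re (dp t) * Re (p t) + Re (p t) * Re (dp t) + (Im (dp t) * Im (p t) + Im (p t) * Im (dp t)))).
  { apply (is_derive_plus (K := R_AbsRing) (V := R_NormedModule)).
    - apply (is_derive_mult (K := R_AbsRing) (fun s => Re (p s)) (fun s => Re (p s))); trivial. apply Rmult_comm.
    - apply (is_derive_mult (K := R_AbsRing) (fun s => Im (p s)) (fun s => Im (p s))); trivial. apply Rmult_comm. }
  assert (E : forall s, sqrt (Re (p s) * Re (p s) + Im (p s) * Im (p s)) = Cmod (p s)).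
  { intros s. unfold Cmod. f_equal. unfold Re, Im. ring. }
  apply is_derive_sqrt in H.
  - rewrite E in H. unfold radial_speed.
    replace ((Re (p t) * Re (dp t) + Im (p t) * Im (dp t)) / Cmod (p t)) with
      ((Re (dp t) * Re (p t) + Re (p t) * Re (dp t) + (Im (dp t) * Im (p t) + Im (p t) * Im (dp t))) / (2 * Cmod (p t)))
      by (field; lra).
    revert H. apply is_derive_ext. exact E.
  - assert (H0 := Cmod2_alt (p t)). nra.
Qed.

Lemma ccurve_cont_Re (u : R -> C) (t : R) : ccurve_cont u t -> continuous (fun s => Re (u s)) t.
Proof.
  intros H. apply (continuous_comp u (fst : C_UniformSpace -> R_UniformSpace)); trivial.
  destruct (u t). apply (continuous_fst (U := R_UniformSpace) (V := R_UniformSpace)).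
Qed.

Lemma ccurve_cont_Im (u : R -> C) (t : R) : ccurve_cont u t -> continuous (fun s => Im (u s)) t.
Proof.
  intros H. apply (continuous_comp u (snd : C_UniformSpace -> R_UniformSpace)); trivial.
  destruct (u t). apply (continuous_snd (U := R_UniformSpace) (V := R_UniformSpace)).
Qed.

Lemma continuous_radial_speed (p dp : R -> C) (t : R) : C1_curve p dp -> p t <> 0 ->
  continuous (radial_speed p dp) t.
Proof.
  intros Hp Hne. assert (Hm : 0 < Cmod (p t)) by (apply Cmod_gt_0; trivial).
  assert (Cp : ccurve_cont p t) by (eapply C1_curve_cont; exact Hp).
  assert (Cd : ccurve_cont dp t) by apply Hp.
  unfold radial_speed, Rdiv. apply (continuous_mult (K := R_AbsRing)).
  - apply (continuous_plus (K := R_AbsRing) (V := R_NormedModule) (fun t => Re (p t) * Re (dp t)) (fun t => Im (p t) * Im (dp t))).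
    + apply (continuous_mult (K := R_AbsRing) (fun t => Re (p t)) (fun t => Re (dp t))); apply ccurve_cont_Re; trivial.
    + apply (continuous_mult (K := R_AbsRing) (fun t => Im (p t)) (fun t => Im (dp t))); apply ccurve_cont_Im; trivial.
  - apply continuous_Rinv_comp; [apply continuous_Cmod_comp; trivial|lra].
Qed.

Lemma cos_angle_radial_speed (p dp : R -> C) (t : R) : p t <> 0 -> dp t <> 0 ->
  radial_speed p dp t = cos_angle (p t) (dp t) * Cmod (dp t).
Proof.
  intros Hp Hd. unfold radial_speed, cos_angle. apply Cmod_gt_0 in Hp, Hd.
  destruct (p t) as [x y], (dp t) as [x' y']; simpl in *. field. split; lra.
Qed.

Lemma sign_constant (f : R -> R) (x y : R) : x <= y ->
  (forall t, x <= t <= y -> continuous f t /\ f t <> 0) ->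
  (forall t, x <= t <= y -> 0 < f t) \/ (forall t, x <= t <= y -> f t < 0).
Proof.
  intros Hxy H.
  apply (interval_ind (fun a b => (forall t, a <= t <= b -> 0 < f t) \/ (forall t, a <= t <= b -> f t < 0))); trivial.
  - intros a m b Ha Hb [H1|H1] [H2|H2].
    + left. intros t Ht. destruct (Rle_lt_dec t m); [apply H1|apply H2]; lra.
    + assert (A1 := H1 m ltac:(lra)). assert (A2 := H2 m ltac:(lra)). lra.
    + assert (A1 := H1 m ltac:(lra)). assert (A2 := H2 m ltac:(lra)). lra.
    + right. intros t Ht. destruct (Rle_lt_dec t m); [apply H1|apply H2]; lra.
  - intros t Ht. destruct (H t Ht) as [Hc Hne].
    destruct (Hc (fun z => Rabs (z - f t) < Rabs (f t))) as [d Hd].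
    { exists (mkposreal _ (Rabs_pos_lt _ Hne)). trivial. }
    assert (G : forall s, Rabs (s - t) < d -> 0 < f t * f s).
    { intros s Hs. specialize (Hd s Hs). apply Rabs_def2 in Hd. unfold Rabs in Hd. destruct (Rcase_abs (f t)); nra. }
    exists d; split; [apply cond_pos|].
    destruct (Rlt_le_dec 0 (f t)) as [Hp|Hn].
    + split; intros v Hv Hvd; left; intros s Hs; assert (K := G s ltac:(apply Rabs_def1; lra)); nra.
    + split; intros v Hv Hvd; right; intros s Hs; assert (K := G s ltac:(apply Rabs_def1; lra)); nra.
Qed.

(* The angle condition bounds [|dp|] by the radial speed over [b], so that the integral of an
   exponentially decaying function along the arc is controlled by its end points. *)
Lemma arc_decay_bound (w : R -> R) (p dp : R -> C) (x y b C0 delta r : R) (k : nat) (I : R) :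
  x <= y -> 0 < b -> 0 < delta -> 0 < r -> 0 <= C0 -> C1_curve p dp ->
  (forall t, x <= t <= y -> dp t <> 0 /\ r <= Cmod (p t) /\ b <= Rabs (cos_angle (p t) (dp t))) ->
  (forall t, x < t < y -> w t <= C0 * exp (- delta * Cmod (p t)) / Cmod (p t) ^ k * Cmod (dp t)) ->
  is_RInt (V := R_NormedModule) w x y I ->
  I <= C0 / (b * delta * r ^ k) * (exp (- delta * Cmod (p x)) + exp (- delta * Cmod (p y))).
Proof.
  intros Hxy Hb Hd Hr HC0 Hp Hg Hw HI.
  assert (Pr := pow_lt r k Hr).
  assert (Hne : forall t, x <= t <= y -> p t <> 0).
  { intros t Ht. apply Cmod_gt_0. destruct (Hg t Ht) as [_ [H _]]. lra. }
  assert (Hdb : forall t, x <= t <= y -> b * Cmod (dp t) <= Rabs (radial_speed p dp t)).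
  { intros t Ht. destruct (Hg t Ht) as [H1 [_ H2]]. rewrite cos_angle_radial_speed by auto.
    rewrite Rabs_mult, (Rabs_pos_eq (Cmod _)) by apply Cmod_ge_0. apply Rmult_le_compat_r; [apply Cmod_ge_0|trivial]. }
  (* The radial speed is continuous and nowhere [0], so the arc moves steadily outwards or steadily
     inwards; [s] is its sign. *)
  assert (Hs : exists s, (s = 1 \/ s = -1) /\ forall t, x <= t <= y -> Rabs (radial_speed p dp t) = s * radial_speed p dp t).
  { destruct (sign_constant (radial_speed p dp) x y Hxy) as [H|H].
    - intros t Ht. split; [apply continuous_radial_speed; auto|]. intros E.
      specialize (Hdb t Ht). rewrite E, Rabs_R0 in Hdb. destruct (Hg t Ht) as [H1 _]. apply Cmod_gt_0 in H1. nra.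
    - exists 1. split; [left; trivial|]. intros t Ht. rewrite Rabs_pos_eq; [ring|]. left; auto.
    - exists (-1). split; [right; trivial|]. intros t Ht. rewrite Rabs_left; [ring|auto]. }
  destruct Hs as [s [Hs1 Hs]].
  set (K := C0 / (b * r ^ k)).
  assert (HK : 0 <= K).
  { apply Rmult_le_pos; trivial. left; apply Rinv_0_lt_compat, Rmult_lt_0_compat; trivial. }
  (* An antiderivative of the majorant [f]. As the direction [s] is not known, the final bound takes
     the exponentials at both ends. *)
  set (F := fun t => - s * K / delta * exp (- delta * Cmod (p t))).
  set (f := fun t => s * K * (exp (- delta * Cmod (p t)) * radial_speed p dp t)).
  assert (HF : is_RInt (V := R_NormedModule) f x y (F y - F x)).
  { apply (is_RInt_derive (V := R_CompleteNormedModule) F f); rewrite Rmin_left, Rmax_right by trivial.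
    - intros t Ht. assert (H := is_derive_Cmod p dp t Hp (Hne t Ht)).
      assert (H' : is_derive (fun u => - s * K / delta * exp (- delta * u)) (Cmod (p t)) (s * K * exp (- delta * Cmod (p t)))).
      { auto_derive; trivial. field. lra. }
      assert (H2 := is_derive_comp (K := R_AbsRing) (V := R_NormedModule) _ (fun t => Cmod (p t)) t _ _ H' H).
      replace (f t) with (scal (V := R_NormedModule) (radial_speed p dp t) (s * K * exp (- delta * Cmod (p t)))); [exact H2|].
      unfold f, scal; simpl; unfold mult; simpl. ring.
    - intros t Ht. apply (continuous_mult (K := R_AbsRing) (fun _ => s * K)); [apply continuous_const|].
      apply (continuous_mult (K := R_AbsRing)); [|apply continuous_radial_speed; auto].
      apply (continuous_comp (fun t => Cmod (p t)) (fun u => exp (- delta * u))).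
      + apply continuous_Cmod_comp. eapply C1_curve_cont; exact Hp.
      + apply (ex_derive_continuous (K := R_AbsRing) (V := R_NormedModule)). auto_derive; trivial. }
  assert (HIF : I <= F y - F x).
  { apply (is_RInt_le w f x y); trivial. intros t Ht.
    specialize (Hw t Ht). destruct (Hg t ltac:(lra)) as [_ [Hrt _]]. specialize (Hdb t ltac:(lra)). specialize (Hs t ltac:(lra)).
    assert (PE := exp_pos (- delta * Cmod (p t))).
    eapply Rle_trans; [exact Hw|]. unfold f.
    replace (s * K * (exp (- delta * Cmod (p t)) * radial_speed p dp t)) with
      (C0 * exp (- delta * Cmod (p t)) / r ^ k * (s * radial_speed p dp t / b)) by (unfold K; field; lra).
    rewrite <- Hs. apply Rmult_le_compat.
    - apply Rmult_le_pos; [apply Rmult_le_pos; lra|]. left; apply Rinv_0_lt_compat, pow_lt; lra.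
    - apply Cmod_ge_0.
    - apply Rmult_le_compat_l; [apply Rmult_le_pos; lra|]. apply Rinv_le_contravar; trivial. apply pow_incr; lra.
    - apply Rmult_le_reg_r with b; trivial. unfold Rdiv. rewrite Rmult_assoc, Rinv_l by lra. lra. }
  eapply Rle_trans; [exact HIF|]. unfold F.
  replace (C0 / (b * delta * r ^ k)) with (K / delta) by (unfold K; field; lra).
  assert (HKd : 0 <= K / delta) by (apply Rmult_le_pos; trivial; left; apply Rinv_0_lt_compat; trivial).
  assert (E1 := exp_pos (- delta * Cmod (p x))). assert (E2 := exp_pos (- delta * Cmod (p y))).
  assert (0 <= K / delta * exp (- delta * Cmod (p x))) by (apply Rmult_le_pos; lra).
  assert (0 <= K / delta * exp (- delta * Cmod (p y))) by (apply Rmult_le_pos; lra).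
  destruct Hs1 as [-> | ->]; unfold Rdiv in *; lra.
Qed.

(** A subdivision is finite, so a non-compact end belongs to a single arc, the first or the last
    one. *)
Lemma contour_infinite_arc (d : nat) (lo hi : Rbar) (c : R -> C) (e : Rbar) :
  Rbar_lt lo hi -> contour d lo hi c -> is_end lo hi e -> ~ is_finite e ->
  exists p dp, C1_curve p dp /\
    Rbar_locally e (fun t => in_open_itv lo hi t /\ c t = p t /\ dp t <> 0).
Proof.
  intros Hlh [_ [_ [tau [[H0 [Hd Ht]] Harc]]]] He Hinf.
  destruct d as [|d]; [exfalso; rewrite <- H0, <- Hd in Hlh; revert Hlh; destruct (tau 0%nat); simpl; try tauto; apply Rlt_irrefl|].
  assert (Hnf : forall x : R, e <> Finite x) by (intros x ->; apply Hinf; reflexivity).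
  destruct He as [-> | ->].
  - destruct (Harc 0%nat ltac:(lia)) as [[p [dp [Hp E]]] _]. rewrite H0 in E.
    destruct lo as [x| |]; [exfalso; apply (Hnf x); reflexivity|simpl in Hlh; tauto|].
    exists p, dp; split; trivial.
    assert (H1 := Ht 0%nat ltac:(lia)). rewrite H0 in H1.
    assert (L1 : exists B, forall t, t < B -> Rbar_le t (tau 1%nat)).
    { destruct (tau 1%nat) as [u| |]; simpl in *; try tauto; [exists u; intros; lra|exists 0; trivial]. }
    assert (L2 : exists B, forall t, t < B -> Rbar_lt t hi).
    { destruct hi as [u| |]; simpl in *; try tauto; [exists u; intros; lra|exists 0; trivial]. }
    destruct L1 as [B1 L1], L2 as [B2 L2]. exists (Rmin B1 B2). intros t Htt.
    assert (A1 := Rlt_le_trans _ _ _ Htt (Rmin_l _ _)). assert (A2 := Rlt_le_trans _ _ _ Htt (Rmin_r _ _)).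
    split; [split; [exact I|auto]|]. apply E. split; [exact I|auto].
  - destruct (Harc d ltac:(lia)) as [[p [dp [Hp E]]] _]. rewrite Hd in E.
    destruct hi as [x| |]; [exfalso; apply (Hnf x); reflexivity| |destruct lo; simpl in Hlh; tauto].
    exists p, dp; split; trivial.
    assert (H1 := Ht d ltac:(lia)). rewrite Hd in H1.
    assert (L1 : exists B, forall t, B < t -> Rbar_le (tau d) t).
    { destruct (tau d) as [u| |]; simpl in *; try tauto; [exists u; intros; lra|exists 0; trivial]. }
    assert (L2 : exists B, forall t, B < t -> Rbar_lt lo t).
    { destruct lo as [u| |]; simpl in *; try tauto; [exists u; intros; lra|exists 0; trivial]. }
    destruct L1 as [B1 L1], L2 as [B2 L2]. exists (Rmax B1 B2). intros t Htt.
    assert (A1 := Rle_lt_trans _ _ _ (Rmax_l _ _) Htt). assert (A2 := Rle_lt_trans _ _ _ (Rmax_r _ _) Htt).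
    split; [split; [auto|exact I]|]. apply E. split; [auto|exact I].
Qed.

Lemma is_derive_on_open (c p dp : R -> C) (P : R -> Prop) (t : R) :
  C1_curve p dp -> (forall s, P s -> c s = p s) -> locally t P ->
  is_derive (K := R_AbsRing) (V := C_R_NormedModule) c t (dp t).
Proof.
  intros Hp E HP. apply (is_derive_ext_loc (K := R_AbsRing) (V := C_R_NormedModule) p); [|apply Hp].
  generalize HP; apply filter_imp. intros s Hs. symmetry; auto.
Qed.

(** Near a non-compact end the curve is one regular arc, as far out as desired. [arc_decay_bound]
    controls its mass by exponentials at the two ends alone, whatever its length. *)
Lemma kernel_tail (d : nat) (lo hi : Rbar) (c : R -> C) (K1 : C -> C) (b C0 delta r : R) (k : nat)
    (e : Rbar) (eps : R) :
  Rbar_lt lo hi -> contour d lo hi c -> (forall t, in_itv lo hi t -> ccont K1 (c t)) ->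
  0 < b -> 0 < delta -> 0 < r -> 0 <= C0 ->
  (forall t v, in_open_itv lo hi t -> ~ Cmod (c t) < r -> c t <> 0 ->
     is_derive (K := R_AbsRing) (V := C_R_NormedModule) (c) t v -> b <= Rabs (cos_angle (c t) v)) ->
  (forall t, in_itv lo hi t -> ~ Cmod (c t) < r -> c t <> 0 ->
     Cmod (K1 (c t)) <= C0 * exp (- delta * Cmod (c t)) / Cmod (c t) ^ k) ->
  is_end lo hi e -> ~ is_finite e -> 0 < eps ->
  exists Q, Rbar_locally e Q /\ forall x y, (forall t, x <= t <= y -> Q t) -> x <= y ->
    RInt (fun t => Cmod (K1 (c t) * velocity c t)%C) x y <= eps.
Proof.
  intros Hlh Hc HK Hb Hd Hr HC0 Hang Hdec He Hinf Heps.
  destruct (contour_infinite_arc d lo hi c e Hlh Hc He Hinf) as [p [dp [Hp HE]]].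
  assert (Hprop := proj1 (proj2 Hc) e He Hinf).
  set (A := C0 / (b * delta * r ^ k)).
  assert (Pr := pow_lt r k Hr).
  assert (HA : 0 <= A).
  { apply Rmult_le_pos; trivial. left; apply Rinv_0_lt_compat. repeat apply Rmult_lt_0_compat; trivial. }
  destruct (exp_decay_small delta (eps / (2 * (A + 1))) Hd ltac:(apply Rdiv_lt_0_compat; lra)) as [T [HT HTe]].
  assert (Hfar : Rbar_locally e (fun t => Rmax r T < Cmod (c t))).
  { apply Hprop. exists (Rmax r T). trivial. }
  set (Q := fun t => (in_open_itv lo hi t /\ c t = p t /\ dp t <> 0) /\ Rmax r T < Cmod (c t)).
  assert (HQ : Rbar_locally e Q) by (apply filter_and; trivial).
  (* The angle condition speaks of the derivative of [c] itself, so [c = p] is needed on a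
     neighbourhood of each parameter; an open half-line provides it. *)
  assert (HQo : exists Q', Rbar_locally e Q' /\ (forall t, Q' t -> locally t Q) /\ forall t, Q' t -> Q t).
  { destruct e as [z| |]; [exfalso; apply Hinf; reflexivity| |]; destruct HQ as [B HB].
    - exists (fun t => B < t). split; [exists B; trivial|]. split; trivial.
      intros t Ht. assert (P : 0 < t - B) by lra. exists (mkposreal _ P). intros s Hs.
      assert (Hs' : Rabs (s - t) < t - B) by exact Hs. apply HB. apply Rabs_def2 in Hs'. lra.
    - exists (fun t => t < B). split; [exists B; trivial|]. split; trivial.
      intros t Ht. assert (P : 0 < B - t) by lra. exists (mkposreal _ P). intros s Hs.
      assert (Hs' : Rabs (s - t) < B - t) by exact Hs. apply HB. apply Rabs_def2 in Hs'. lra. }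
  destruct HQo as [Q' [HQ' [HQo HQ'Q]]].
  exists Q'. split; trivial. intros x y Hxy Hle.
  assert (Hf : forall t, x <= t <= y -> in_open_itv lo hi t /\ c t = p t /\ dp t <> 0 /\ r <= Cmod (p t) /\ T < Cmod (p t) /\
     is_derive (K := R_AbsRing) (V := C_R_NormedModule) c t (dp t)).
  { intros t Ht. destruct (HQ'Q t (Hxy t Ht)) as [[H1 [H2 H3]] H4].
    assert (Hr1 := Rle_lt_trans _ _ _ (Rmax_l _ _) H4). assert (Hr2 := Rle_lt_trans _ _ _ (Rmax_r _ _) H4).
    rewrite H2 in Hr1, Hr2.
    split; [exact H1|]. split; [exact H2|]. split; [exact H3|]. split; [lra|]. split; [lra|].
    apply (is_derive_on_open c p dp Q t Hp); [|apply HQo, Hxy; trivial]. intros s [[_ [H _]] _]; trivial. }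
  assert (Hit : forall t, x <= t <= y -> in_itv lo hi t) by (intros; apply in_open_itv_itv, Hf; trivial).
  assert (HI := contour_Cmod_integrable lo hi c K1 x y
    (fun x y => contour_piecewise_C1 d lo hi c x y Hc) HK (Hit x ltac:(lra)) (Hit y ltac:(lra)) Hle).
  assert (HB := fun A1 A2 => arc_decay_bound _ p dp x y b C0 delta r k _ Hle Hb Hd Hr HC0 Hp A1 A2 HI).
  assert (Hc0 : forall t, x <= t <= y -> c t <> 0 /\ ~ Cmod (c t) < r).
  { intros t Ht. destruct (Hf t Ht) as [_ [E [_ [H4 _]]]]. rewrite E. split; [apply Cmod_gt_0|]; lra. }
  eapply Rle_trans; [apply HB|].
  - intros t Ht. destruct (Hf t Ht) as [H1 [H2 [H3 [H4 [H5 H6]]]]]. split; [|split]; trivial.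
    destruct (Hc0 t Ht) as [N1 N2]. assert (H := Hang t (dp t) H1 N2 N1 H6). rewrite H2 in H. exact H.
  - intros t Ht. destruct (Hf t ltac:(lra)) as [H1 [H2 [H3 [H4 [H5 H6]]]]].
    destruct (Hc0 t ltac:(lra)) as [N1 N2].
    rewrite Cmod_mult, (is_derive_C_velocity _ _ _ H6). apply Rmult_le_compat_r; [apply Cmod_ge_0|].
    assert (H := Hdec t (Hit t ltac:(lra)) N2 N1). rewrite H2 in H |- *. exact H.
  - fold A. destruct (Hf x ltac:(lra)) as [_ [_ [_ [_ [H5 _]]]]]. destruct (Hf y ltac:(lra)) as [_ [_ [_ [_ [H6 _]]]]].
    assert (B1 := HTe _ H5). assert (B2 := HTe _ H6).
    apply Rle_trans with (A * (eps / (2 * (A + 1)) + eps / (2 * (A + 1)))).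
    + apply Rmult_le_compat_l; trivial. lra.
    + replace (A * (eps / (2 * (A + 1)) + eps / (2 * (A + 1)))) with (eps * (A / (A + 1))) by (field; lra).
      rewrite <- (Rmult_1_r eps) at 2. apply Rmult_le_compat_l; [lra|].
      apply Rmult_le_reg_r with (A + 1); [lra|]. unfold Rdiv. rewrite Rmult_assoc, Rinv_l; lra.
Qed.

(** Conditions (E) make the tails small; between them the integrand is piecewise continuous on a
    compact interval. *)
Theorem kernel_dominating (d : nat) (lo hi : Rbar) (c : R -> C) (K1 : C -> C) (b C0 delta r : R) (k : nat) :
  Rbar_lt lo hi -> contour d lo hi c -> (forall t, in_itv lo hi t -> ccont K1 (c t)) ->
  0 < b -> 0 < delta -> 0 < r -> 0 <= C0 ->
  (forall t v, in_open_itv lo hi t -> ~ Cmod (c t) < r -> c t <> 0 ->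
     is_derive (K := R_AbsRing) (V := C_R_NormedModule) (c) t v -> b <= Rabs (cos_angle (c t) v)) ->
  (forall t, in_itv lo hi t -> ~ Cmod (c t) < r -> c t <> 0 ->
     Cmod (K1 (c t)) <= C0 * exp (- delta * Cmod (c t)) / Cmod (c t) ^ k) ->
  exists M, dominating lo hi (fun t => Cmod (K1 (c t) * velocity c t)%C) M.
Proof.
  intros Hlh Hc HK Hb Hd Hr HC0 Hang Hdec.
  set (w := fun t => Cmod (K1 (c t) * velocity c t)%C).
  assert (Hint : forall x y, in_itv lo hi x -> in_itv lo hi y -> x <= y ->
    is_RInt (V := R_NormedModule) w x y (RInt w x y)).
  { intros x y. apply contour_Cmod_integrable; trivial. intros u v. apply contour_piecewise_C1 with d; trivial. }
  assert (Hpos : forall x y, in_itv lo hi x -> in_itv lo hi y -> x <= y -> 0 <= RInt w x y).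
  { intros x y Hx Hy Hxy. apply (is_RInt_ge_0 w x y); auto. intros; apply Cmod_ge_0. }
  assert (Hch : forall x y z, in_itv lo hi x -> in_itv lo hi z -> x <= y <= z ->
    RInt w x z = RInt w x y + RInt w y z).
  { intros x y z Hx Hz Hxyz. assert (Hy : in_itv lo hi y) by (apply in_itv_between with x z; trivial).
    apply (is_RInt_unique (V := R_CompleteNormedModule)).
    apply (is_RInt_Chasles (V := R_NormedModule) w x y z); apply Hint; trivial; lra. }
  assert (Hpt : forall x, RInt w x x = 0) by (intros x; apply (RInt_point (V := R_CompleteNormedModule))).
  assert (Hhi : forall eps, 0 < eps -> exists Q, end_filter hi Q /\ forall x y, Q x -> in_itv lo hi x -> in_itv lo hi y ->
     x <= y -> RInt w x y <= eps).
  { intros eps Heps. destruct (Classical_Prop.classic (is_finite hi)) as [Hf|Hf].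
    - exists (fun x => x = real hi). split; [rewrite <- Hf; reflexivity|]. intros x y -> _ [_ Hy] Hxy.
      rewrite <- Hf in Hy. simpl in Hy. replace y with (real hi) by lra. rewrite Hpt. lra.
    - destruct (kernel_tail d lo hi c K1 b C0 delta r k hi eps Hlh Hc HK Hb Hd Hr HC0 Hang Hdec (or_intror eq_refl) Hf Heps)
        as [Q [HQ H]].
      destruct hi as [z| |]; [exfalso; apply Hf; reflexivity| |destruct lo; simpl in Hlh; tauto].
      destruct HQ as [B HB]. exists (fun x => B < x). split; [exists B; trivial|]. intros x y Hx _ _ Hxy.
      apply H; trivial. intros t Ht; apply HB; lra. }
  assert (Hlo : forall eps, 0 < eps -> exists Q, end_filter lo Q /\ forall x y, Q y -> in_itv lo hi x -> in_itv lo hi y ->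
     x <= y -> RInt w x y <= eps).
  { intros eps Heps. destruct (Classical_Prop.classic (is_finite lo)) as [Hf|Hf].
    - exists (fun x => x = real lo). split; [rewrite <- Hf; reflexivity|]. intros x y -> [Hx _] _ Hxy.
      rewrite <- Hf in Hx. simpl in Hx. replace x with (real lo) by lra. rewrite Hpt. lra.
    - destruct (kernel_tail d lo hi c K1 b C0 delta r k lo eps Hlh Hc HK Hb Hd Hr HC0 Hang Hdec (or_introl eq_refl) Hf Heps)
        as [Q [HQ H]].
      destruct lo as [z| |]; [exfalso; apply Hf; reflexivity|simpl in Hlh; tauto|].
      destruct HQ as [B HB]. exists (fun x => x < B). split; [exists B; trivial|]. intros x y Hy _ _ Hxy.
      apply H; trivial. intros t Ht; apply HB; lra. }
  destruct (Hlo 1 Rlt_0_1) as [Q1 [HQ1 T1]]. destruct (Hhi 1 Rlt_0_1) as [Q2 [HQ2 T2]].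
  assert (Hex : exists x0 y0, Q1 x0 /\ Q2 y0 /\ in_itv lo hi x0 /\ in_itv lo hi y0 /\ x0 < y0).
  { destruct (ends_eventually lo hi Hlh) as [A1 A2 HA1 HA2 HA].
    destruct (filter_ex _ (filter_and _ _ HQ1 HA1)) as [x0 [X1 X2]].
    destruct (filter_ex _ (filter_and _ _ HQ2 HA2)) as [y0 [Y1 Y2]].
    exists x0, y0. destruct (HA x0 y0 X2 Y2) as [I1 [I2 I3]]. repeat split; trivial; try apply I1; apply I2. }
  destruct Hex as [x0 [y0 [X1 [Y1 [X2 [Y2 XY]]]]]].
  (* Any [[x, y]] is enlarged to contain [[x0, y0]]; each of the two pieces outside [[x0, y0]] has
     mass at most [1]. *)
  exists (RInt w x0 y0 + 2). split; trivial.
  - intros; apply Cmod_ge_0.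
  - intros e eps [-> | ->] Heps.
    + destruct (Hlo eps Heps) as [Q [HQ H]]. exists Q; split; trivial. intros; apply H; trivial.
    + destruct (Hhi eps Heps) as [Q [HQ H]]. exists Q; split; trivial. intros; apply H; trivial.
  - intros x y Hx Hy Hxy.
    set (x' := Rmin x x0). set (y' := Rmax y y0).
    assert (A1 : x' <= x) by apply Rmin_l. assert (A2 : x' <= x0) by apply Rmin_r.
    assert (A3 : y <= y') by apply Rmax_l. assert (A4 : y0 <= y') by apply Rmax_r.
    assert (Hx' : in_itv lo hi x') by (unfold x'; apply Rmin_case; trivial).
    assert (Hy' : in_itv lo hi y') by (unfold y'; apply Rmax_case; trivial).
    assert (B1 := Hch x' x y' Hx' Hy' ltac:(lra)). assert (B2 := Hch x y y' Hx Hy' ltac:(lra)).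
    assert (B3 := Hch x' x0 y' Hx' Hy' ltac:(lra)). assert (B4 := Hch x0 y0 y' X2 Hy' ltac:(lra)).
    assert (P1 := Hpos x' x Hx' Hx A1). assert (P2 := Hpos y y' Hy Hy' A3).
    assert (D1 := T1 x' x0 X1 Hx' X2 A2). assert (D2 := T2 y0 y' Y1 Y2 Hy' A4). lra.
Qed.

(** * Transfer to the contour that avoids the origin *)

Lemma loc_holo_deriv_at (f : C -> C) (z : C) : loc_holo f z -> deriv_at f z.
Proof.
  intros [r [Hr H]]. apply H. replace (z - z)%C with (RtoC 0) by ring. rewrite Cmod_0; trivial.
Qed.

Lemma loc_holo_ext (f g : C -> C) (z : C) (r : R) : 0 < r ->
  (forall x, Cmod (x - z)%C < r -> f x = g x) -> loc_holo f z -> loc_holo g z.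
Proof.
  intros Hr E [r' [Hr' H]]. exists (Rmin r r'). split; [apply Rmin_pos; trivial|]. intros x Hx.
  assert (P1 := Rlt_le_trans _ _ _ Hx (Rmin_l _ _)). assert (P2 := Rlt_le_trans _ _ _ Hx (Rmin_r _ _)).
  apply deriv_at_ext with f (r - Cmod (x - z)%C); [lra| |apply H; trivial].
  intros y Hy. apply E. eapply Rle_lt_trans; [apply Cmod_tri3 with (y := x)|]. lra.
Qed.

Lemma loc_holo_mult (f g : C -> C) (z : C) :
  loc_holo f z -> loc_holo g z -> loc_holo (fun x => f x * g x)%C z.
Proof.
  intros [r1 [Hr1 H1]] [r2 [Hr2 H2]]. exists (Rmin r1 r2). split; [apply Rmin_pos; trivial|]. intros x Hx.
  apply deriv_at_mult; [apply H1|apply H2]; eapply Rlt_le_trans; try exact Hx; [apply Rmin_l|apply Rmin_r].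
Qed.

Lemma loc_holo_minus (f g : C -> C) (z : C) :
  loc_holo f z -> loc_holo g z -> loc_holo (fun x => f x - g x)%C z.
Proof.
  intros [r1 [Hr1 H1]] [r2 [Hr2 H2]]. exists (Rmin r1 r2). split; [apply Rmin_pos; trivial|]. intros x Hx.
  apply deriv_at_minus; [apply H1|apply H2]; eapply Rlt_le_trans; try exact Hx; [apply Rmin_l|apply Rmin_r].
Qed.

Lemma loc_holo_entire (f : C -> C) (z : C) : (forall x, deriv_at f x) -> loc_holo f z.
Proof. intros H. exists 1; split; [lra|]. intros x _. apply H. Qed.

Lemma loc_holo_nonzero (f : C -> C) (z : C) : z <> 0 -> (forall x : C, x <> 0 -> deriv_at f x) -> loc_holo f z.
Proof.
  intros Hz H. exists (Cmod z). split; [apply Cmod_gt_0; trivial|]. intros x Hx. apply H. intros ->.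
  revert Hx. replace (0 - z)%C with (- z)%C by ring. rewrite Cmod_opp. lra.
Qed.

Lemma loc_holo_dil (f : C -> C) (gam z : C) : loc_holo f (gam * z)%C -> loc_holo (fun x => f (gam * x)%C) z.
Proof.
  intros [r [Hr H]].
  destruct (deriv_at_ccont (fun x => gam * x)%C z (deriv_at_mult _ _ _ (deriv_at_const gam z) (deriv_at_id z)) r Hr)
    as [d [Hd Hc]].
  exists d; split; trivial. intros x Hx.
  apply (deriv_at_comp f (fun x => gam * x)%C); [apply H, Hc; trivial|].
  apply deriv_at_mult; [apply deriv_at_const|apply deriv_at_id].
Qed.

Lemma not_pole_loc_holo (f : C -> C) (z : C) : meromorphic f -> ~ pole f z -> loc_holo f z.
Proof. intros Hf Hp. apply holo_at_ball. destruct (Hf z) as [H|H]; trivial. contradiction. Qed.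

Lemma pole_of_order_dil (f : C -> C) (gam z : C) (n : nat) : gam <> 0 ->
  pole_of_order f (gam * z)%C n -> pole_of_order (dil f gam) z n.
Proof.
  intros Hg [Hn [g [Hgh [Hgn H]]]]. split; trivial.
  exists (fun x => g (gam * x) / Cpow gam n)%C.
  assert (Hgn' : Cpow gam n <> 0) by (apply Cpow_nz; trivial).
  split; [|split].
  - apply holo_at_ball. apply holo_at_ball in Hgh. apply (loc_holo_mult (fun x => g (gam * x)%C)).
    + apply loc_holo_dil; trivial.
    + apply loc_holo_entire. intros; apply deriv_at_const.
  - apply Cmult_neq_0; trivial. intros E. apply Hgn'.
    replace (Cpow gam n) with (Cpow gam n * Cpow gam n * / Cpow gam n)%C by (field; trivial). rewrite E. ring.
  - apply locally'_Cmod in H. destruct H as [r [Hr H]]. apply locally'_Cmod.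
    assert (Mg : 0 < Cmod gam) by (apply Cmod_gt_0; trivial).
    exists (r / Cmod gam). split; [apply Rdiv_lt_0_compat; trivial|]. intros x Hx Hxz. unfold dil.
    assert (Hne : (x - z)%C <> 0) by (intros E; apply Hxz, Cminus_eq_0, E).
    rewrite H.
    + replace (gam * x - gam * z)%C with (gam * (x - z))%C by ring. rewrite Cpow_mult_l. field.
      split; trivial. apply Cpow_nz; trivial.
    + replace (gam * x - gam * z)%C with (gam * (x - z))%C by ring. rewrite Cmod_mult.
      replace r with (Cmod gam * (r / Cmod gam)) by (field; lra). apply Rmult_lt_compat_l; trivial.
    + intros E. apply Hne. replace (x - z)%C with ((gam * x - gam * z) / gam)%C by (field; trivial). rewrite E.
      field; trivial.
Qed.

Lemma dil_loc_holo (f : C -> C) (gam z : C) : meromorphic f -> gam <> 0 -> ~ pole (dil f gam) z ->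
  loc_holo (dil f gam) z.
Proof.
  intros Hf Hg Hp. destruct (Hf (gam * z)%C) as [H|[n H]].
  - apply (loc_holo_dil f). apply holo_at_ball; trivial.
  - exfalso. apply Hp. exists n. apply pole_of_order_dil; trivial.
Qed.

(** By the last clause the numerator takes the value [f 0] when [0] is no pole; this makes filling
    in the singularity harmless for a contour through [0]. *)
Lemma pole_order_quotient (f : C -> C) (k0 : nat) : pole_order f 0 k0 ->
  exists g, loc_holo g 0 /\ (exists r, 0 < r /\ forall x : C, x <> 0 -> Cmod x < r -> f x = (g x / Cpow x k0)%C) /\
    (~ pole f 0 -> k0 = 0%nat /\ g 0 = f 0).
Proof.
  intros [[-> H]|Hpo].
  - exists f. split; [apply holo_at_ball; trivial|]. split; [|auto].
    exists 1; split; [lra|]. intros x _ _. simpl. field.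
  - assert (Hpo' := Hpo). destruct Hpo as [Hn [g [Hg [_ H]]]].
    exists g. split; [apply holo_at_ball; trivial|]. split.
    + apply locally'_Cmod in H. destruct H as [r [Hr H]]. exists r; split; trivial. intros x Hx Hxr.
      assert (E : (x - 0)%C = x) by ring.
      rewrite H; trivial; rewrite E; trivial.
    + intros Hp. exfalso. apply Hp. exists k0; trivial.
Qed.

Definition patch (F : C -> C) (v : C) (z : C) : C := if Ceq_dec z 0 then v else F z.

Lemma patch_neq (F : C -> C) (v z : C) : z <> 0 -> patch F v z = F z.
Proof. intros H. unfold patch. destruct (Ceq_dec z 0); tauto. Qed.

Lemma patch_loc_holo (F G : C -> C) (z : C) (r : R) :
  (z <> 0 -> loc_holo F z) -> loc_holo G 0 -> 0 < r -> (forall x : C, x <> 0 -> Cmod x < r -> F x = G x) ->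
  loc_holo (patch F (G 0)) z.
Proof.
  intros HF HG Hr E. destruct (Ceq_dec z 0) as [->|Hz].
  - apply loc_holo_ext with G r; trivial. intros x Hx. replace (x - 0)%C with x in Hx by ring.
    unfold patch. destruct (Ceq_dec x 0) as [->|Hx0]; trivial. symmetry; auto.
  - apply loc_holo_ext with F (Cmod z); auto; [apply Cmod_gt_0; trivial|]. intros x Hx. symmetry. apply patch_neq.
    intros ->. revert Hx. replace (0 - z)%C with (- z)%C by ring. rewrite Cmod_opp. lra.
Qed.

Lemma continuous_extension_unique (F G : C -> C) (r : R) : ccont F 0 -> ccont G 0 -> 0 < r ->
  (forall x : C, x <> 0 -> Cmod x < r -> F x = G x) -> F 0 = G 0.
Proof.
  intros HF HG Hr E. apply Cminus_eq_0, Cmod_le_small. intros eps Heps.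
  destruct (HF (eps / 2) ltac:(lra)) as [d1 [Hd1 H1]]. destruct (HG (eps / 2) ltac:(lra)) as [d2 [Hd2 H2]].
  destruct (ex_punctured 0 (Rmin r (Rmin d1 d2))) as [x [Hx Hxr]]; [repeat apply Rmin_pos; trivial|].
  assert (P1 := Rlt_le_trans _ _ _ Hxr (Rmin_l _ _)). assert (P23 := Rlt_le_trans _ _ _ Hxr (Rmin_r _ _)).
  specialize (H1 x (Rlt_le_trans _ _ _ P23 (Rmin_l _ _))). specialize (H2 x (Rlt_le_trans _ _ _ P23 (Rmin_r _ _))).
  replace (x - 0)%C with x in P1 by ring. rewrite <- (E x Hx P1) in H2.
  eapply Rle_trans; [apply Cmod_tri3 with (y := F x)|]. rewrite (Cmod_minus_sym (F 0)). lra.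
Qed.

Section Transfer.
Context (W U : C -> Prop) (K : C -> C -> C) (f : C -> C) (k0 n0 : nat) (a : Z -> C) (lo hi : Rbar)
  (c0 c1 c2 : R -> C) (w gam : C).
Hypotheses (hlohi : Rbar_lt lo hi) (hKw : meromorphic (K w)) (hk0 : pole_order (K w) 0 k0)
  (hf : meromorphic f) (hn0 : pole_order f 0 n0) (ha : laurent_at0 f n0 a) (hgam : gam <> 0)
  (hC0 : C1_on lo hi c0) (hC1 : C1_on lo hi c1) (hC2 : C1_on lo hi c2)
  (hK0 : forall t, in_itv lo hi t -> ~ pole (K w) (c0 t))
  (hf0 : forall t, in_itv lo hi t -> ~ pole (dil f gam) (c0 t))
  (hc2 : forall t, in_itv lo hi t -> c2 t <> 0)
  (hD1 : deforms (admissible K f w gam) (integrand K f w gam) lo hi c0 c1)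
  (hD2 : deforms (admissible K f w gam) (integrand K f w gam) lo hi c1 c2).

Lemma admissible_loc_holo (z : C) : admissible K f w gam z -> z <> 0 ->
  loc_holo (K w) z /\ loc_holo (dil f gam) z.
Proof.
  intros Hz Hz0. unfold admissible in Hz. split.
  - apply not_pole_loc_holo; trivial. tauto.
  - apply dil_loc_holo; trivial. tauto.
Qed.

Lemma integrand_ccont (F : C -> C) (z : C) : integrand K f w gam F -> admissible K f w gam z -> z <> 0 -> ccont F z.
Proof.
  intros HF Hz Hz0. destruct (admissible_loc_holo z Hz Hz0) as [H1 H2].
  apply loc_holo_deriv_at in H1, H2. apply deriv_at_ccont. destruct HF as [|m].
  - apply (deriv_at_mult (K w) (dil f gam)); trivial.
  - apply (deriv_at_mult (K w) (fun z => Czpow z m)); trivial. apply deriv_at_Czpow; trivial.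
Qed.

Lemma contour_int_transfer (F : C -> C) (l : C) : lin_span (integrand K f w gam) F ->
  (forall z, admissible K f w gam z -> loc_holo F z) ->
  is_contour_int lo hi c0 F l -> is_contour_int lo hi c2 F l.
Proof.
  intros HF Hh Hl.
  assert (Hcc : forall F, integrand K f w gam F -> forall z, admissible K f w gam z -> z <> 0 -> ccont F z)
    by (intros; apply integrand_ccont; trivial).
  apply (deforms_contour_int (admissible K f w gam) (lin_span (integrand K f w gam)) lo hi c1); trivial.
  { apply deforms_lin_span; trivial. }
  apply (deforms_contour_int (admissible K f w gam) (lin_span (integrand K f w gam)) lo hi c0); trivial.
  apply deforms_lin_span; trivial.
Qed.

(** [c0] can meet [0] only if neither factor has a pole there, and then the filled-in value is
    [F 0]; [c2] never meets [0]. So patching alters the integrand at neither end of the deformation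
    and makes it holomorphic in between. *)
Lemma patched_transfer (F : C -> C) (G : C -> C) (l : C) (r : R) : lin_span (integrand K f w gam) F ->
  (forall z, admissible K f w gam z -> z <> 0 -> loc_holo F z) -> loc_holo G 0 -> 0 < r ->
  (forall x : C, x <> 0 -> Cmod x < r -> F x = G x) ->
  (~ pole (K w) 0 -> ~ pole (dil f gam) 0 -> G 0 = F 0) ->
  is_contour_int lo hi c0 F l -> is_contour_int lo hi c2 F l.
Proof.
  intros HF Hh HG Hr E E0 Hl.
  assert (H : is_contour_int lo hi c2 (patch F (G 0)) l).
  { apply contour_int_transfer.
    - apply lin_span_ext with F; trivial. intros z Hz. symmetry; apply patch_neq; trivial.
    - intros z Hz. apply patch_loc_holo with r; auto.
    - revert Hl. apply gint_ext; trivial. intros t Ht. f_equal. apply in_open_itv_itv in Ht. unfold patch.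
      destruct (Ceq_dec (c0 t) 0) as [E1|]; trivial.
      assert (H1 := hK0 t Ht). assert (H2 := hf0 t Ht). rewrite E1 in H1, H2 |- *. symmetry; auto. }
  revert H. apply gint_ext; trivial. intros t Ht. f_equal. apply patch_neq, hc2. apply in_open_itv_itv; trivial.
Qed.

Lemma transfer_power (m : nat) (l : C) : (k0 <= m)%nat ->
  is_contour_int lo hi c0 (fun z => K w z * Czpow z (Z.of_nat m))%C l ->
  is_contour_int lo hi c2 (fun z => K w z * Cpow z m)%C l.
Proof.
  intros Hm Hl. destruct (pole_order_quotient _ _ hk0) as [g [Hg [[r [Hr E]] E0]]].
  assert (H : is_contour_int lo hi c2 (fun z => K w z * Czpow z (Z.of_nat m))%C l).
  { apply (patched_transfer _ (fun x => g x * Cpow x (m - k0))%C l r); trivial.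
    - apply lin_span_base. apply integrand_h.
    - intros z Hz Hz0. apply loc_holo_mult; [apply admissible_loc_holo; trivial|].
      apply loc_holo_nonzero; trivial. intros; apply deriv_at_Czpow; trivial.
    - apply loc_holo_mult; trivial. apply loc_holo_entire. intros; apply deriv_at_pow.
    - intros x Hx Hxr. rewrite E, Czpow_nat by trivial.
      replace m with (k0 + (m - k0))%nat at 1 by lia. rewrite Cpow_add_r. field. apply Cpow_nz; trivial.
    - intros HK _. destruct (E0 HK) as [Ek Eg]. rewrite Czpow_nat, Eg, Ek, Nat.sub_0_r. reflexivity. }
  revert H. apply gint_ext; trivial. intros t _. rewrite Czpow_nat. reflexivity.
Qed.

(** The zero of order at least [k0] is split off explicitly, to cancel against the pole of [K w]. *)
Lemma acoef_factor : exists M rho r, 0 < rho /\ 0 < r /\ rho * r < 1 /\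
  (forall n, Cmod (a (Z.of_nat (k0 + n))) <= M * rho ^ n) /\
  forall u : C, u <> 0 -> Cmod u < r ->
    phi f n0 k0 a u = (Cpow u k0 * pseries (fun n => a (Z.of_nat (k0 + n))) u)%C.
Proof.
  destruct (phi_pseries f n0 k0 a ha) as [M [rho [r [Hrho [Hr [Hrr [Hb H]]]]]]].
  exists (M * rho ^ k0), rho, r. split; [|split; [|split; [|split]]]; trivial.
  - intros n. specialize (Hb (k0 + n)%nat). unfold acoef in Hb.
    rewrite (proj2 (Nat.leb_le k0 (k0 + n)) ltac:(lia)) in Hb. rewrite pow_add in Hb. lra.
  - intros u Hu Hur. rewrite H by trivial.
    assert (Hru : rho * Cmod u < 1).
    { apply Rlt_trans with (rho * r); trivial. apply Rmult_lt_compat_l; trivial. }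
    destruct (pseries_lim (acoef k0 a) M rho u ltac:(lra) Hb Hru) as [H1 _].
    assert (Hb2 : forall n, Cmod (a (Z.of_nat (k0 + n))) <= M * rho ^ k0 * rho ^ n).
    { intros n. specialize (Hb (k0 + n)%nat). unfold acoef in Hb.
      rewrite (proj2 (Nat.leb_le k0 (k0 + n)) ltac:(lia)) in Hb. rewrite pow_add in Hb. lra. }
    destruct (pseries_lim (fun n => a (Z.of_nat (k0 + n))) (M * rho ^ k0) rho u ltac:(lra) Hb2 Hru) as [H2 _].
    apply Csum_lim_unique with (1 := H1). intros eps Heps.
    set (P := Cmod (Cpow u k0)). assert (HP : 0 <= P) by apply Cmod_ge_0.
    destruct (H2 (eps / (P + 1)) ltac:(apply Rdiv_lt_0_compat; lra)) as [N HN].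
    exists (k0 + N)%nat. intros n Hn. specialize (HN (n - k0)%nat ltac:(lia)).
    replace n with (k0 + (n - k0))%nat by lia. rewrite Csum_add, Csum_const_0.
    2: { intros i Hi. unfold acoef. rewrite (proj2 (Nat.leb_gt k0 i) Hi). ring. }
    rewrite (Csum_ext _ _ (fun i => Cpow u k0 * (a (Z.of_nat (k0 + i)) * Cpow u i))%C).
    2: { intros i _. unfold acoef. rewrite (proj2 (Nat.leb_le k0 (k0 + i)) ltac:(lia)), Cpow_add_r. ring. }
    rewrite Csum_mult_l. set (S1 := Csum _ _) in *. set (S2 := pseries (fun n => a (Z.of_nat (k0 + n))) u) in *.
    replace (0 + Cpow u k0 * S1 - Cpow u k0 * S2)%C with (Cpow u k0 * (S1 - S2))%C by ring.
    rewrite Cmod_mult. fold P. apply Rle_lt_trans with ((P + 1) * Cmod (S1 - S2)%C).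
    + apply Rmult_le_compat_r; [apply Cmod_ge_0|lra].
    + replace eps with ((P + 1) * (eps / (P + 1))) by (field; lra). apply Rmult_lt_compat_l; lra.
Qed.

Lemma lin_span_Csum (n : nat) (k : nat -> C) (m : nat -> Z) :
  lin_span (integrand K f w gam) (fun z => Csum n (fun j => k j * (K w z * Czpow z (m j)))%C).
Proof.
  induction n as [|n IH].
  - apply lin_span_ext with (fun z => 0 * (K w z * Czpow z 0%Z))%C.
    + intros z _. rewrite Csum_0. ring.
    + apply lin_span_scal, lin_span_base, integrand_h.
  - apply lin_span_ext with (fun z => Csum n (fun j => k j * (K w z * Czpow z (m j)))%C + k n * (K w z * Czpow z (m n)))%C.
    + intros z _. symmetry; apply Csum_S.
    + apply lin_span_plus; trivial. apply lin_span_scal, lin_span_base, integrand_h.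
Qed.

Lemma transfer_phi (g : C) (h : Z -> C -> C) :
  is_contour_int lo hi c0 (fun z => K w z * dil f gam z)%C g ->
  (forall m, is_contour_int lo hi c0 (fun z => K w z * Czpow z m)%C (h m w)) ->
  is_contour_int lo hi c2 (fun z => K w z * phi f n0 k0 a (gam * z))%C (g - gminus n0 k0 a h gam w)%C.
Proof.
  intros Hg Hh.
  set (mj := fun j => (Z.of_nat j - Z.of_nat n0)%Z). set (kj := fun j => (a (mj j) * Czpow gam (mj j))%C).
  assert (Hphi : forall z, (K w z * phi f n0 k0 a (gam * z))%C =
    (K w z * dil f gam z - Csum (n0 + k0) (fun j => kj j * (K w z * Czpow z (mj j)))%C)%C).
  { intros z. unfold phi, dil.
    rewrite (Csum_ext _ (fun j => kj j * (K w z * Czpow z (mj j)))%C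
       (fun j => K w z * (a (mj j) * Czpow (gam * z) (mj j)))%C).
    - rewrite Csum_mult_l. unfold mj. ring.
    - intros j _. unfold kj. rewrite Czpow_mult. ring. }
  destruct (pole_order_quotient _ _ hk0) as [g1 [Hg1 [[r1 [Hr1 E1]] E10]]].
  destruct acoef_factor as [M [rho [r2 [Hrho [Hr2 [Hrr [Hb E2]]]]]]].
  set (q := pseries (fun n => a (Z.of_nat (k0 + n)))) in *.
  assert (Mg : 0 < Cmod gam) by (apply Cmod_gt_0; trivial).
  assert (Hq : loc_holo q 0).
  { exists r2. split; trivial. intros x Hx. apply pseries_deriv_at with (M := M) (rho := rho); trivial.
    replace (x - 0)%C with x in Hx by ring. apply Rlt_trans with (rho * r2); trivial. apply Rmult_lt_compat_l; trivial. }
  apply (patched_transfer _ (fun x => g1 x * (Cpow gam k0 * q (gam * x)))%C _ (Rmin r1 (r2 / Cmod gam))).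
  - apply lin_span_ext with (fun z => K w z * dil f gam z + (- (1)) * Csum (n0 + k0) (fun j => kj j * (K w z * Czpow z (mj j)))%C)%C.
    + intros z _. rewrite Hphi. ring.
    + apply lin_span_plus; [apply lin_span_base, integrand_g|]. apply lin_span_scal, lin_span_Csum.
  - intros z Hz Hz0. destruct (admissible_loc_holo z Hz Hz0) as [H1 H2]. apply loc_holo_mult; trivial.
    apply (loc_holo_minus (dil f gam) (fun z => principal_part n0 k0 a (gam * z)%C)); trivial.
    apply loc_holo_nonzero; trivial. intros x Hx.
    apply (deriv_at_comp (principal_part n0 k0 a) (fun x => gam * x)%C).
    + apply deriv_at_principal_part. apply Cmult_neq_0; trivial.
    + apply deriv_at_mult; [apply deriv_at_const|apply deriv_at_id].
  - apply loc_holo_mult; trivial. apply loc_holo_mult; [apply loc_holo_entire; intros; apply deriv_at_const|].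
    apply (loc_holo_dil q). replace (gam * 0)%C with (RtoC 0) by ring. trivial.
  - apply Rmin_pos; trivial. apply Rdiv_lt_0_compat; trivial.
  - intros x Hx Hxr. assert (P1 := Rlt_le_trans _ _ _ Hxr (Rmin_l _ _)). assert (P2 := Rlt_le_trans _ _ _ Hxr (Rmin_r _ _)).
    rewrite E1 by trivial. rewrite E2.
    + rewrite Cpow_mult_l. field. apply Cpow_nz; trivial.
    + apply Cmult_neq_0; trivial.
    + rewrite Cmod_mult. replace r2 with (Cmod gam * (r2 / Cmod gam)) by (field; lra). apply Rmult_lt_compat_l; trivial.
  (* If [0] is a pole of neither factor then [k0 = n0 = 0]: nothing is subtracted, [phi] is [f], and
     [q] agrees with it at [0] by continuity. *)
  - intros HK Hf. destruct (E10 HK) as [Ek Eg]. rewrite Eg, Ek. f_equal. simpl.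
    replace (gam * 0)%C with (RtoC 0) by ring.
    assert (Hn : n0 = 0%nat).
    { destruct hn0 as [[H _]|H]; trivial. exfalso. apply Hf. exists n0. apply pole_of_order_dil; trivial.
      replace (gam * 0)%C with (RtoC 0) by ring. trivial. }
    assert (Hfh : loc_holo f 0).
    { destruct hn0 as [[_ H]|[H _]]; [apply holo_at_ball; trivial|lia]. }
    assert (E : f 0 = q 0).
    { apply continuous_extension_unique with r2; trivial.
      - apply deriv_at_ccont, loc_holo_deriv_at; trivial.
      - apply deriv_at_ccont, loc_holo_deriv_at; trivial.
      - intros x Hx Hxr. specialize (E2 x Hx Hxr). unfold phi in E2. rewrite Hn, Ek, Csum_0 in E2. simpl in E2.
        replace (f x - 0)%C with (f x) in E2 by ring. rewrite E2. ring. }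
    unfold phi. rewrite Hn, Csum_0, E. ring.
  - apply gint_ext with (fun t => K w (c0 t) * dil f gam (c0 t) * velocity c0 t -
      Csum (n0 + k0) (fun j => kj j * (K w (c0 t) * Czpow (c0 t) (mj j) * velocity c0 t))%C)%C; trivial.
    + intros t _. rewrite Hphi.
      rewrite (Csum_ext _ (fun j => kj j * (K w (c0 t) * Czpow (c0 t) (mj j) * velocity c0 t))%C
        (fun j => velocity c0 t * (kj j * (K w (c0 t) * Czpow (c0 t) (mj j))))%C) by (intros; ring).
      rewrite Csum_mult_l. ring.
    + apply gint_minus; trivial. unfold gminus.
      rewrite (Csum_ext _ _ (fun j => kj j * h (mj j) w)%C) by (intros; unfold kj, mj; ring).
      apply (gint_Csum lo hi (n0 + k0) (fun j t => kj j * (K w (c0 t) * Czpow (c0 t) (mj j) * velocity c0 t))%C); trivial.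
      intros i _. apply gint_mult_l. apply Hh.
Qed.

End Transfer.

(** * Integration against the kernel *)

(** The two-point inequality with [k = R0 / 4]: its right side contributes at most [M * Cmod h] and
    the value difference at [k] another [2 * M * Cmod h]; division by [R0 / 4] gives
    [12 * M / R0]. *)
Lemma holo_lipschitz (f : C -> C) (z h : C) (R0 M : R) : 0 < R0 -> holo_ball f z R0 ->
  (forall w, Cmod (w - z)%C < R0 -> Cmod (f w) <= M) -> Cmod h <= R0 / 4 ->
  Cmod (f (z + h) - f z)%C <= 12 * M / R0 * Cmod h.
Proof.
  intros HR Hf HM Hh. assert (Ph := Cmod_ge_0 h).
  set (k := RtoC (R0 / 4)). assert (Hk : Cmod k = R0 / 4) by (unfold k; rewrite Cmod_R, Rabs_pos_eq; lra).
  assert (H := holo_two_point f z R0 M HR Hf HM h k Hh ltac:(lra)).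
  assert (HM0 : 0 <= M).
  { eapply Rle_trans; [apply Cmod_ge_0|apply (HM z)]. replace (z - z)%C with (RtoC 0) by ring. rewrite Cmod_0; trivial. }
  assert (H1 : Cmod (f (z + k) - f z)%C <= 2 * M).
  { eapply Rle_trans; [apply Cmod_minus_le|].
    assert (A := HM (z + k)%C). replace (z + k - z)%C with k in A by ring. specialize (A ltac:(lra)).
    assert (B := HM z). replace (z - z)%C with (RtoC 0) in B by ring. rewrite Cmod_0 in B. specialize (B HR). lra. }
  assert (H2 : R0 / 4 * Cmod (f (z + h) - f z)%C <= Cmod h * (2 * M) + 8 * M / R0 ^ 2 * (Cmod h * (R0 / 4) * (R0 / 2))).
  { rewrite <- Hk at 1. rewrite <- Cmod_mult.
    replace (k * (f (z + h) - f z))%C with ((k * (f (z + h) - f z) - h * (f (z + k) - f z)) + h * (f (z + k) - f z))%C by ring.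
    eapply Rle_trans; [apply Cmod_triangle|]. rewrite (Cmod_mult h).
    assert (A : Cmod h * Cmod (f (z + k) - f z)%C <= Cmod h * (2 * M)) by (apply Rmult_le_compat_l; trivial).
    rewrite Hk in H.
    assert (B : 8 * M / R0 ^ 2 * (Cmod h * (R0 / 4) * (Cmod h + R0 / 4)) <= 8 * M / R0 ^ 2 * (Cmod h * (R0 / 4) * (R0 / 2))).
    { apply Rmult_le_compat_l.
      - apply Rmult_le_pos; [lra|]. left; apply Rinv_0_lt_compat, pow_lt; trivial.
      - apply Rmult_le_compat_l; [|lra]. apply Rmult_le_pos; lra. }
    lra. }
  apply Rmult_le_reg_l with (R0 / 4); [lra|]. eapply Rle_trans; [exact H2|]. right. field. lra.
Qed.

(** The two-point inequality has the same constant for all [tau], so it may be integrated. *)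
Lemma parametric_CInt_deriv_at (q : R -> C -> C) (z : C) (T R0 M : R) : 0 <= T -> 0 < R0 ->
  (forall tau, 0 <= tau <= T -> holo_ball (q tau) z R0) ->
  (forall tau x, 0 <= tau <= T -> Cmod (x - z)%C < R0 -> Cmod (q tau x) <= M) ->
  (forall tau x, 0 <= tau <= T -> Cmod (x - z)%C < R0 -> ccurve_cont (fun tau => q tau x) tau) ->
  deriv_at (fun x => CInt (fun tau => q tau x) 0 T) z.
Proof.
  intros HT HR Hq HM Hc.
  assert (Hi : forall x, Cmod (x - z)%C < R0 -> is_CInt (fun tau => q tau x) 0 T (CInt (fun tau => q tau x) 0 T)).
  { intros x Hx. apply is_CInt_cont; trivial. intros tau Ht; apply Hc; trivial. }
  apply two_point_deriv_at with (8 * M / R0 ^ 2 * T) (R0 / 4); [lra|]. intros h k Hh Hk.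
  assert (I0 := Hi z ltac:(replace (z - z)%C with (RtoC 0) by ring; rewrite Cmod_0; trivial)).
  assert (Ih := Hi (z + h)%C ltac:(replace (z + h - z)%C with h by ring; lra)).
  assert (Ik := Hi (z + k)%C ltac:(replace (z + k - z)%C with k by ring; lra)).
  assert (II := is_CInt_minus _ _ _ _ _ _ (is_CInt_mult_l k _ _ _ _ (is_CInt_minus _ _ _ _ _ _ Ih I0))
    (is_CInt_mult_l h _ _ _ _ (is_CInt_minus _ _ _ _ _ _ Ik I0))).
  set (Q := Cmod h * Cmod k * (Cmod h + Cmod k)).
  apply is_CInt_Cmod_le_const with (M := 8 * M / R0 ^ 2 * Q) in II; trivial.
  - eapply Rle_trans; [exact II|]. right; ring.
  - intros tau Ht. apply (holo_two_point (q tau) z R0 M HR); trivial.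
    + apply Hq; lra.
    + intros x Hx; apply HM; trivial; lra.
Qed.

(** The difference of the two partial sums of length [S n] is [O(x ^ (S n))] at small real [x], so
    [small_polynomial_zero] applies. *)
Lemma taylor_unique (f : C -> C) (c d : nat -> C) (M1 M2 rho1 rho2 : R) : 0 < rho1 -> 0 < rho2 ->
  (forall z N, Cmod (z - 0)%C < rho1 -> Cmod (f z - Csum N (fun n => c n * Cpow (z - 0) n)%C)%C
      <= M1 * (Cmod (z - 0)%C / rho1) ^ N / (1 - Cmod (z - 0)%C / rho1)) ->
  (forall z N, rho2 * Cmod z < 1 -> Cmod z < rho1 -> Cmod (f z - Csum N (fun n => d n * Cpow z n)%C)%C
      <= M2 * (rho2 * Cmod z) ^ N / (1 - rho2 * Cmod z)) ->
  forall n, c n = d n.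
Proof.
  intros H1 H2 Hc Hd n. apply Cminus_eq_0.
  assert (PM1 : 0 <= M1).
  { assert (H := Hc 0 0%nat). replace (0 - 0)%C with (RtoC 0) in H by ring. rewrite Cmod_0 in H.
    specialize (H H1). unfold Rdiv in H. rewrite Rmult_0_l, Rminus_0_r, Rinv_1, !Rmult_1_r in H.
    eapply Rle_trans; [apply Cmod_ge_0|exact H]. }
  assert (PM2 : 0 <= M2).
  { assert (H := Hd 0 0%nat). rewrite Cmod_0, Rmult_0_r in H.
    specialize (H Rlt_0_1 H1). unfold Rdiv in H. rewrite Rminus_0_r, Rinv_1, !Rmult_1_r in H.
    eapply Rle_trans; [apply Cmod_ge_0|exact H]. }
  apply (small_polynomial_zero (S n) (fun i => c i - d i)%C (2 * M1 / rho1 ^ S n + 2 * M2 * rho2 ^ S n)); [|lia].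
  intros A HA. set (x := Rmin (A / 2) (Rmin (rho1 / 2) (/ (2 * rho2)))).
  assert (Hx : 0 < x).
  { repeat apply Rmin_pos; try lra. apply Rinv_0_lt_compat; lra. }
  assert (X1 : x <= A / 2) by apply Rmin_l.
  assert (X2 : x <= rho1 / 2) by (eapply Rle_trans; [apply Rmin_r|apply Rmin_l]).
  assert (X3 : x <= / (2 * rho2)) by (eapply Rle_trans; [apply Rmin_r|apply Rmin_r]).
  exists x. split; [lra|].
  assert (Hxm : Cmod (RtoC x) = x) by (rewrite Cmod_R, Rabs_pos_eq; lra).
  specialize (Hc (RtoC x) (S n)). specialize (Hd (RtoC x) (S n)).
  replace (RtoC x - 0)%C with (RtoC x) in Hc by ring. rewrite Hxm in Hc, Hd.
  assert (Q2 : rho2 * x <= 1 / 2).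
  { apply Rle_trans with (rho2 * / (2 * rho2)); [apply Rmult_le_compat_l; lra|]. right; field; lra. }
  assert (Q1 : x / rho1 <= 1 / 2).
  { apply Rmult_le_reg_r with rho1; trivial. unfold Rdiv. rewrite Rmult_assoc, Rinv_l; lra. }
  specialize (Hc ltac:(lra)). specialize (Hd ltac:(lra) ltac:(lra)).
  rewrite (Csum_ext _ _ (fun i => c i * Cpow (RtoC x) i - d i * Cpow (RtoC x) i)%C) by (intros; ring).
  rewrite Csum_minus. set (A1 := Csum _ (fun i => c i * _)%C) in *. set (A2 := Csum _ (fun i => d i * _)%C) in *.
  replace (A1 - A2)%C with ((f (RtoC x) - A2) - (f (RtoC x) - A1))%C by ring.
  eapply Rle_trans; [apply Cmod_minus_le|]. rewrite Rmult_plus_distr_r, Rplus_comm.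
  assert (P1 : 0 <= x / rho1) by (left; apply Rdiv_lt_0_compat; trivial).
  assert (P2 : 0 <= rho2 * x) by (apply Rmult_le_pos; lra).
  apply Rplus_le_compat.
  - eapply Rle_trans; [exact Hc|].
    replace (2 * M1 / rho1 ^ S n * x ^ S n) with (M1 * (x / rho1) ^ S n * 2).
    + apply Rmult_le_compat_l; [apply Rmult_le_pos; trivial; apply pow_le; trivial|].
      apply Rle_trans with (/ (/ 2)); [apply Rinv_le_contravar; lra|rewrite Rinv_inv; lra].
    + unfold Rdiv. rewrite Rpow_mult_distr, pow_inv. ring.
  - eapply Rle_trans; [exact Hd|].
    replace (2 * M2 * rho2 ^ S n * x ^ S n) with (M2 * (rho2 * x) ^ S n * 2) by (rewrite Rpow_mult_distr; ring).
    apply Rmult_le_compat_l; [apply Rmult_le_pos; trivial; apply pow_le; trivial|].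
    apply Rle_trans with (/ (/ 2)); [apply Rinv_le_contravar; lra|rewrite Rinv_inv; lra].
Qed.

Lemma pseries_entire (b : nat -> C) (u : C) :
  (forall rho, 0 < rho -> exists M, forall n, Cmod (b n) <= M * rho ^ n) -> deriv_at (pseries b) u.
Proof.
  intros Hb. assert (P := Cmod_ge_0 u). set (rho := / (2 * (Cmod u + 1))).
  assert (Hr : 0 < rho) by (apply Rinv_0_lt_compat; lra).
  destruct (Hb rho Hr) as [M HM]. apply pseries_deriv_at with M rho; trivial.
  apply Rmult_lt_reg_l with (2 * (Cmod u + 1)); [lra|]. unfold rho. rewrite <- Rmult_assoc, Rinv_r; lra.
Qed.

Lemma pseries_bounded (b : nat -> C) (A : R) : 0 <= A ->
  (forall rho, 0 < rho -> exists M, forall n, Cmod (b n) <= M * rho ^ n) ->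
  exists M, forall u, Cmod u <= A -> Cmod (pseries b u) <= M.
Proof.
  intros HA Hb. set (rho := / (2 * (A + 1))).
  assert (Hr : 0 < rho) by (apply Rinv_0_lt_compat; lra).
  destruct (Hb rho Hr) as [M HM]. exists (M * 2). intros u Hu.
  assert (HM0 : 0 <= M) by (eapply Rle_trans; [apply Cmod_ge_0|]; specialize (HM 0%nat); simpl in HM; rewrite Rmult_1_r in HM; exact HM).
  assert (Hq : rho * Cmod u <= 1 / 2).
  { apply Rle_trans with (rho * (A + 1)); [apply Rmult_le_compat_l; lra|]. unfold rho. right; field; lra. }
  destruct (pseries_lim b M rho u ltac:(lra) HM ltac:(lra)) as [_ H]. specialize (H 0%nat).
  rewrite Csum_0 in H. simpl in H. replace (pseries b u - 0)%C with (pseries b u) in H by ring.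
  eapply Rle_trans; [exact H|]. rewrite Rmult_1_r. apply Rmult_le_compat_l; trivial.
  apply Rle_trans with (/ (/ 2)); [apply Rinv_le_contravar; lra|rewrite Rinv_inv; lra].
Qed.

Lemma laplace_tail (u : R -> C) (P kap T : R) (l : C) : 0 < kap -> 0 <= T ->
  (forall t, 0 <= t -> ccurve_cont u t) -> (forall t, 0 <= t -> Cmod (u t) <= P * exp (- kap * t)) ->
  gint 0 p_infty u l -> Cmod (CInt u 0 T - l)%C <= P / kap * exp (- kap * T).
Proof.
  intros Hk HT Hc Hu Hl.
  assert (HP : 0 <= P).
  { specialize (Hu 0 (Rle_refl _)). rewrite Rmult_0_r, exp_0, Rmult_1_r in Hu.
    eapply Rle_trans; [apply Cmod_ge_0|exact Hu]. }
  apply le_epsilon; intros eps Heps. rewrite gint_eps in Hl.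
  assert (Hev : filter_prod (end_filter 0) (end_filter p_infty) (fun ab => fst ab = 0 /\ T < snd ab)).
  { apply Filter_prod with (fun x => x = 0) (fun y => T < y); [reflexivity|exists T; trivial|auto]. }
  destruct (filter_ex _ (filter_and _ _ Hev (Hl eps Heps))) as [[x y] [[H1 H2] [I [HI1 HI2]]]]; simpl in *. subst x.
  assert (J1 := is_CInt_cont u 0 T HT ltac:(intros; apply Hc; lra)).
  assert (J2 := is_CInt_cont u T y ltac:(lra) ltac:(intros; apply Hc; lra)).
  rewrite (is_CInt_unique2 _ _ _ _ _ HI1 (is_CInt_Chasles _ _ _ _ _ _ J1 J2)) in HI2.
  assert (B : Cmod (CInt u T y) <= P * ((exp (- kap * T) - exp (- kap * y)) / kap)).
  { apply is_CInt_Cmod_le with u (fun t => P * exp (- kap * t)) T y; trivial; [lra|intros; apply Hu; lra|].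
    apply (is_RInt_scal (V := R_NormedModule)). apply is_RInt_exp_decay; lra. }
  replace (CInt u 0 T - l)%C with ((CInt u 0 T + CInt u T y - l) - CInt u T y)%C by ring.
  eapply Rle_trans; [apply Cmod_minus_le|].
  assert (Ey := exp_pos (- kap * y)).
  assert (P * ((exp (- kap * T) - exp (- kap * y)) / kap) <= P / kap * exp (- kap * T)).
  { replace (P * ((exp (- kap * T) - exp (- kap * y)) / kap)) with (P / kap * (exp (- kap * T) - exp (- kap * y))) by (field; lra).
    apply Rmult_le_compat_l; [|lra]. apply Rmult_le_pos; trivial. left; apply Rinv_0_lt_compat; trivial. }
  lra.
Qed.

Section Kernel.
Context (lo hi : Rbar) (c : R -> C) (K1 : C -> C) (M : R).
Hypotheses (hlohi : Rbar_lt lo hi)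
  (hdom : dominating lo hi (fun t => Cmod (K1 (c t) * velocity c t)%C) M)
  (hC1 : C1_on lo hi c) (hKc : forall t, in_itv lo hi t -> ccont K1 (c t)).

Definition kernel_int (G : C -> C) (l : C) : Prop := is_contour_int lo hi c (fun z => K1 z * G z)%C l.

Lemma kernel_int_ext (G G' : C -> C) (l : C) :
  (forall t, in_itv lo hi t -> G (c t) = G' (c t)) -> kernel_int G l -> kernel_int G' l.
Proof.
  intros E. apply gint_ext; trivial. intros t Ht. rewrite E; trivial. apply in_open_itv_itv; trivial.
Qed.

Lemma kernel_int_minus (G G' : C -> C) (l m : C) :
  kernel_int G l -> kernel_int G' m -> kernel_int (fun z => G z - G' z)%C (l - m)%C.
Proof.
  intros H1 H2. apply gint_ext with (3 := gint_minus _ _ _ _ _ _ H1 H2); trivial. intros; ring.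
Qed.

Lemma kernel_int_mult (k : C) (G : C -> C) (l : C) :
  kernel_int G l -> kernel_int (fun z => k * G z)%C (k * l)%C.
Proof.
  intros H. apply gint_ext with (3 := gint_mult_l _ _ k _ _ H); trivial. intros; ring.
Qed.

Lemma kernel_int_Csum (n : nat) (G : nat -> C -> C) (l : nat -> C) :
  (forall i, (i < n)%nat -> kernel_int (G i) (l i)) -> kernel_int (fun z => Csum n (fun i => G i z)) (Csum n l).
Proof.
  intros H. apply gint_ext with (3 := gint_Csum lo hi n _ l hlohi H); trivial.
  intros t _. rewrite (Csum_ext _ _ (fun i => K1 (c t) * velocity c t * G i (c t))%C) by (intros; ring).
  rewrite Csum_mult_l. ring.
Qed.

Lemma kernel_int_weight (G : C -> C) (k t : R) : Cmod (G (c t)) <= k ->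
  Cmod (K1 (c t) * G (c t) * velocity c t)%C <= k * Cmod (K1 (c t) * velocity c t)%C.
Proof.
  intros H. replace (K1 (c t) * G (c t) * velocity c t)%C with (G (c t) * (K1 (c t) * velocity c t))%C by ring.
  rewrite Cmod_mult. apply Rmult_le_compat_r; [apply Cmod_ge_0|trivial].
Qed.

Lemma in_itv_ex : exists t, in_itv lo hi t.
Proof. destruct (filter_ex _ (ends_eventually lo hi hlohi)) as [[x y] [H _]]. exists x; exact H. Qed.

Lemma kernel_int_bound (G : C -> C) (k : R) (l : C) :
  (forall t, in_itv lo hi t -> Cmod (G (c t)) <= k) -> kernel_int G l -> Cmod l <= k * M.
Proof.
  intros HG Hl.
  assert (Hk : 0 <= k) by (destruct in_itv_ex as [t Ht]; eapply Rle_trans; [apply Cmod_ge_0|exact (HG t Ht)]).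
  apply gint_bound with (5 := Hl) (w := fun t => Cmod (K1 (c t) * velocity c t)%C); trivial.
  intros t Ht. apply kernel_int_weight, HG, in_open_itv_itv; trivial.
Qed.

Lemma kernel_int_exists (G : C -> C) (k : R) :
  (forall t, in_itv lo hi t -> ccont G (c t)) -> (forall t, in_itv lo hi t -> Cmod (G (c t)) <= k) ->
  exists l, kernel_int G l.
Proof.
  intros Hc HG.
  assert (Hk : 0 <= k) by (destruct in_itv_ex as [t Ht]; eapply Rle_trans; [apply Cmod_ge_0|exact (HG t Ht)]).
  destruct (gint_exists lo hi (fun t => Cmod (K1 (c t) * velocity c t)%C) M
    (fun t => K1 (c t) * G (c t) * velocity c t)%C k) as [l [Hl _]]; trivial.
  - apply (contour_loc_integrable lo hi c (fun z => K1 z * G z)%C); trivial.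
    intros t Ht eps Heps.
    revert eps Heps. change (ccont (fun z => K1 z * G z)%C (c t)).
    assert (A := hKc t Ht). assert (B := Hc t Ht). clear - A B.
    intros eps Heps. set (z := c t) in *.
    assert (P1 := Cmod_ge_0 (K1 z)). assert (P2 := Cmod_ge_0 (G z)).
    destruct (A (eps / (2 * (1 + Cmod (G z))))) as [d1 [Hd1 H1]]; [apply Rdiv_lt_0_compat; lra|].
    destruct (B (Rmin 1 (eps / (2 * (1 + Cmod (K1 z)))))) as [d2 [Hd2 H2]]; [apply Rmin_pos; [lra|apply Rdiv_lt_0_compat; lra]|].
    exists (Rmin d1 d2); split; [apply Rmin_pos; trivial|]; intros x Hx.
    specialize (H1 x (Rlt_le_trans _ _ _ Hx (Rmin_l _ _))).
    specialize (H2 x (Rlt_le_trans _ _ _ Hx (Rmin_r _ _))).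
    assert (H3 := Rlt_le_trans _ _ _ H2 (Rmin_l _ _)). assert (H4 := Rlt_le_trans _ _ _ H2 (Rmin_r _ _)).
    replace (K1 x * G x - K1 z * G z)%C with ((K1 x - K1 z) * G x + K1 z * (G x - G z))%C by ring.
    eapply Rle_lt_trans; [apply Cmod_triangle|]; rewrite !Cmod_mult.
    assert (Hgx : Cmod (G x) <= 1 + Cmod (G z)).
    { replace (G x) with ((G x - G z) + G z)%C by ring. eapply Rle_trans; [apply Cmod_triangle|]. lra. }
    assert (Cmod (K1 x - K1 z) * Cmod (G x) < eps / 2).
    { apply Rle_lt_trans with (Cmod (K1 x - K1 z) * (1 + Cmod (G z))).
      - apply Rmult_le_compat_l; [apply Cmod_ge_0|trivial].
      - replace (eps / 2) with (eps / (2 * (1 + Cmod (G z))) * (1 + Cmod (G z))) by (field; lra).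
        apply Rmult_lt_compat_r; lra. }
    assert (Cmod (K1 z) * Cmod (G x - G z) <= eps / 2).
    { apply Rle_trans with ((1 + Cmod (K1 z)) * (eps / (2 * (1 + Cmod (K1 z))))).
      - apply Rmult_le_compat; try lra. apply Cmod_ge_0.
      - right; field; lra. }
    lra.
  - intros t Ht. apply kernel_int_weight, HG, in_open_itv_itv; trivial.
  - exists l; exact Hl.
Qed.

Context (V : C -> Prop) (theta al : R) (L : list (R * nat)) (psi : C -> C -> C) (b : nat -> C).
Hypotheses (hVo : open (T := C_UniformSpace) V) (hVr : forall xi, ray theta xi -> V xi)
  (hpsi : forall t, in_itv lo hi t -> holo_on V (psi (c t)))
  (hbd : forall t, in_itv lo hi t -> forall xi, V xi ->
     Cmod (psi (c t) xi) <= exp (al * Cmod xi) * poly_bound L (Cmod xi))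
  (hb : forall rho, 0 < rho -> exists Mb, forall n, Cmod (b n) <= Mb * rho ^ n)
  (hform : forall t, in_itv lo hi t -> forall xi, V xi -> psi (c t) xi = (c t * pseries b (c t * xi))%C).

Definition borel_int (xi : C) : C :=
  RInt_gen (V := C_R_CompleteNormedModule) (fun t => K1 (c t) * psi (c t) xi * velocity c t)%C
    (end_filter lo) (end_filter hi).

Lemma deriv_at_entire_form (xi z : C) : deriv_at (fun z => z * pseries b (z * xi))%C z.
Proof.
  apply deriv_at_mult; [apply deriv_at_id|].
  apply (deriv_at_comp (pseries b) (fun z => z * xi)%C); [apply pseries_entire; trivial|].
  apply deriv_at_mult; [apply deriv_at_id|apply deriv_at_const].
Qed.

(** On the contour [psi] coincides with the entire form, which supplies the continuity in [z]; the
    growth bound, independent of the point of the contour, supplies the majorant. *)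
Lemma borel_int_correct (xi : C) : V xi -> kernel_int (fun z => psi z xi) (borel_int xi).
Proof.
  intros Hxi.
  destruct (kernel_int_exists (fun z => z * pseries b (z * xi))%C (exp (al * Cmod xi) * poly_bound L (Cmod xi))) as [l Hl].
  - intros t Ht. apply deriv_at_ccont, deriv_at_entire_form.
  - intros t Ht. rewrite <- hform; auto.
  - apply (kernel_int_ext _ (fun z => psi z xi)) in Hl.
    + exact (gint_correct _ _ _ _ Hl).
    + intros t Ht. rewrite <- hform; auto.
Qed.

Lemma growth_bound : exists P A, 0 <= P /\ 0 <= A /\ forall x, 0 <= x -> exp (al * x) * poly_bound L x <= P * exp (A * x).
Proof.
  destruct (poly_bound_exp L 1 Rlt_0_1) as [P [HP H]]. exists P, (Rabs al + 1).
  assert (PA := Rabs_pos al). split; trivial. split; [lra|]. intros x Hx.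
  apply Rle_trans with (exp (al * x) * (P * exp (1 * x))).
  - apply Rmult_le_compat_l; [left; apply exp_pos|auto].
  - replace ((Rabs al + 1) * x) with (Rabs al * x + 1 * x) by ring. rewrite exp_plus.
    assert (exp (al * x) <= exp (Rabs al * x)).
    { assert (al * x <= Rabs al * x) by (apply Rmult_le_compat_r; trivial; apply Rle_abs).
      destruct (Req_dec (al * x) (Rabs al * x)) as [->|]; [lra|]. left; apply exp_increasing; lra. }
    assert (E := exp_pos (1 * x)).
    replace (exp (al * x) * (P * exp (1 * x))) with (P * exp (1 * x) * exp (al * x)) by ring.
    replace (P * (exp (Rabs al * x) * exp (1 * x))) with (P * exp (1 * x) * exp (Rabs al * x)) by ring.
    apply Rmult_le_compat_l; trivial. apply Rmult_le_pos; lra.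
Qed.

Lemma borel_int_growth : exists P A, forall xi, V xi -> Cmod (borel_int xi) <= P * exp (A * Cmod xi).
Proof.
  destruct growth_bound as [P [A [HP [HA H]]]]. exists (P * M), A. intros xi Hxi.
  replace (P * M * exp (A * Cmod xi)) with (P * exp (A * Cmod xi) * M) by ring.
  apply kernel_int_bound with (2 := borel_int_correct xi Hxi). intros t Ht.
  eapply Rle_trans; [apply hbd; trivial|]. apply H, Cmod_ge_0.
Qed.

(** Disc and bound do not depend on [t]; all uniformity along the contour rests on this. [R0 <= 1]
    bounds [Cmod x] by [Cmod xi + 1]. *)
Lemma psi_locally_bounded (xi : C) : V xi -> exists R0 M1, 0 < R0 <= 1 /\ 0 <= M1 /\
  forall x, Cmod (x - xi)%C < R0 -> V x /\ forall t, in_itv lo hi t -> deriv_at (psi (c t)) x /\ Cmod (psi (c t) x) <= M1.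
Proof.
  intros Hxi. assert (Ho := hVo xi Hxi). apply locally_Cmod in Ho. destruct Ho as [r [Hr Ho]].
  destruct growth_bound as [P [A [HP [HA H]]]].
  exists (Rmin r 1), (P * exp (A * (Cmod xi + 1))). split; [split; [apply Rmin_pos; lra|apply Rmin_r]|].
  split; [apply Rmult_le_pos; trivial; left; apply exp_pos|].
  intros x Hx. assert (H1 := Rlt_le_trans _ _ _ Hx (Rmin_l _ _)). assert (H2 := Rlt_le_trans _ _ _ Hx (Rmin_r _ _)).
  split; auto. intros t Ht. split.
  - apply loc_holo_deriv_at. apply holo_at_ball. apply hpsi; auto.
  - eapply Rle_trans; [apply hbd; auto|]. eapply Rle_trans; [apply H, Cmod_ge_0|]. apply Rmult_le_compat_l; trivial.
    assert (Hle : A * Cmod x <= A * (Cmod xi + 1)).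
    { apply Rmult_le_compat_l; trivial. replace x with (xi + (x - xi))%C by ring.
      eapply Rle_trans; [apply Cmod_triangle|]. lra. }
    destruct (Req_dec (A * Cmod x) (A * (Cmod xi + 1))) as [->|]; [lra|]. left; apply exp_increasing; lra.
Qed.

(** The two-point inequality holds for every [psi (c t)] with one constant; integration multiplies
    it by the mass [M] of the kernel. *)
Lemma borel_int_deriv_at (xi : C) : V xi -> deriv_at borel_int xi.
Proof.
  intros Hxi. destruct (psi_locally_bounded xi Hxi) as [R0 [M1 [HR [HM1 H]]]].
  apply two_point_deriv_at with (8 * M1 / R0 ^ 2 * M) (R0 / 4); [lra|]. intros h k Hh Hk.
  assert (I0 := borel_int_correct xi Hxi).
  assert (Ih := borel_int_correct (xi + h)%C (proj1 (H (xi + h)%C ltac:(replace (xi + h - xi)%C with h by ring; lra)))).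
  assert (Ik := borel_int_correct (xi + k)%C (proj1 (H (xi + k)%C ltac:(replace (xi + k - xi)%C with k by ring; lra)))).
  assert (II := kernel_int_minus _ _ _ _ (kernel_int_mult k _ _ (kernel_int_minus _ _ _ _ Ih I0))
    (kernel_int_mult h _ _ (kernel_int_minus _ _ _ _ Ik I0))).
  set (Q := Cmod h * Cmod k * (Cmod h + Cmod k)).
  apply kernel_int_bound with (k := 8 * M1 / R0 ^ 2 * Q) in II.
  - eapply Rle_trans; [exact II|]. right; ring.
  - intros t Ht. apply (holo_two_point (psi (c t)) xi R0 M1); trivial; [lra| |].
    + intros x Hx; apply (proj2 (H x Hx) t Ht).
    + intros x Hx; apply (proj2 (H x Hx) t Ht).
Qed.

Lemma V_0 : V 0.
Proof. apply hVr. exists 0. split; [lra|]. ring. Qed.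

(** The Taylor remainder of [psi (c t)] is bounded independently of [t], so the series may be
    integrated term by term although the contour is unbounded. *)
Lemma borel_int_series (bet : nat -> C) :
  (forall n, kernel_int (fun z => b n * Cpow z (S n))%C (bet n)) ->
  exists r, 0 < r /\ forall xi, Cmod xi < r -> Csum_lim (fun n => bet n * Cpow xi n)%C (borel_int xi).
Proof.
  intros Hbet. destruct (psi_locally_bounded 0 V_0) as [R0 [M1 [HR [HM1 H]]]].
  assert (HT : forall t, in_itv lo hi t -> forall z N, Cmod (z - 0)%C < R0 / 2 ->
    Cmod (psi (c t) z - Csum N (fun n => b n * Cpow (c t) (S n) * Cpow (z - 0) n)%C)%C
      <= M1 * (Cmod (z - 0)%C / (R0 / 2)) ^ N / (1 - Cmod (z - 0)%C / (R0 / 2))).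
  { intros t Ht. destruct (Taylor (psi (c t)) 0 R0 (R0 / 2) M1) as [cc [_ Hcc]].
    - intros x Hx; apply (proj2 (H x Hx) t Ht).
    - lra.
    - intros x Hx; apply (proj2 (H x Hx) t Ht).
    (* The power series of the entire form has a remainder bound that degrades with [Cmod (c t)],
       the one from [Taylor] does not. Identifying the coefficients makes the uniform bound
       available for the explicit ones. *)
    - assert (E : forall n, cc n = (b n * Cpow (c t) (S n))%C).
      { destruct (hb 1 Rlt_0_1) as [Mb HMb]. assert (Pc := Cmod_ge_0 (c t)).
        apply taylor_unique with (psi (c t)) M1 (Cmod (c t) * Mb) (R0 / 2) (Cmod (c t) + 1); trivial; try lra.
        intros z N Hz1 Hz2. rewrite hform; trivial.
        2: { apply H. replace (z - 0)%C with z by ring. lra. }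
        assert (Pz := Cmod_ge_0 z).
        assert (Hlt : 1 * Cmod (c t * z)%C <= (Cmod (c t) + 1) * Cmod z) by (rewrite Cmod_mult; nra).
        destruct (pseries_lim b Mb 1 (c t * z)%C ltac:(lra) HMb ltac:(lra)) as [_ Hp]. specialize (Hp N).
        rewrite (Csum_ext _ _ (fun n => c t * (b n * Cpow (c t * z) n))%C).
        2: { intros i _. rewrite Cpow_mult_l. simpl. ring. }
        rewrite Csum_mult_l. set (S1 := Csum _ _) in *. set (S2 := pseries _ _) in *.
        replace (c t * S2 - c t * S1)%C with (c t * (S2 - S1))%C by ring. rewrite Cmod_mult.
        assert (HMb0 : 0 <= Mb) by (eapply Rle_trans; [apply Cmod_ge_0|]; specialize (HMb 0%nat); simpl in HMb; rewrite Rmult_1_r in HMb; exact HMb).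
        apply Rle_trans with (Cmod (c t) * (Mb * ((Cmod (c t) + 1) * Cmod z) ^ N / (1 - (Cmod (c t) + 1) * Cmod z)));
          [|right; field; lra].
        apply Rmult_le_compat_l; trivial. eapply Rle_trans; [exact Hp|].
        assert (Pq : 0 <= 1 * Cmod (c t * z)%C) by (rewrite Rmult_1_l; apply Cmod_ge_0).
        apply Rmult_le_compat.
        + apply Rmult_le_pos; trivial. apply pow_le; trivial.
        + left; apply Rinv_0_lt_compat; lra.
        + apply Rmult_le_compat_l; trivial. apply pow_incr; lra.
        + apply Rinv_le_contravar; lra. }
      intros z N Hz. specialize (Hcc z N Hz).
      rewrite (Csum_ext _ _ (fun n => cc n * Cpow (z - 0) n)%C); trivial. intros; rewrite E; trivial. }
  exists (R0 / 4). split; [lra|]. intros xi Hxi.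
  assert (Hxi0 : (xi - 0)%C = xi) by ring.
  assert (HVxi : V xi) by (apply H; rewrite Hxi0; lra).
  set (q := Cmod xi / (R0 / 2)).
  assert (Hq : 0 <= q < 1).
  { unfold q. split; [apply Rmult_le_pos; [apply Cmod_ge_0|left; apply Rinv_0_lt_compat; lra]|].
    apply Rmult_lt_reg_r with (R0 / 2); [lra|]. unfold Rdiv at 1. rewrite Rmult_assoc, Rinv_l; lra. }
  intros eps Heps. destruct (geom_lim (M1 / (1 - q) * M) q eps Hq Heps) as [N HN]. exists N. intros n Hn.
  specialize (HN n Hn). eapply Rle_lt_trans; [|exact HN].
  replace (M1 / (1 - q) * M * q ^ n) with (M1 * q ^ n / (1 - q) * M) by (field; lra).
  rewrite Cmod_minus_sym.
  assert (HS := kernel_int_Csum n (fun i z => Cpow xi i * (b i * Cpow z (S i)))%C (fun i => Cpow xi i * bet i)%C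
    (fun i _ => kernel_int_mult _ _ _ (Hbet i))).
  rewrite (Csum_ext n _ (fun i => Cpow xi i * bet i)%C) by (intros; ring).
  apply kernel_int_bound with (2 := kernel_int_minus _ _ _ _ (borel_int_correct xi HVxi) HS).
  intros t Ht. specialize (HT t Ht xi n). rewrite Hxi0 in HT. specialize (HT ltac:(lra)). fold q in HT.
  rewrite (Csum_ext n _ (fun n => b n * Cpow (c t) (S n) * Cpow xi n)%C) by (intros; ring). exact HT.
Qed.

(** * Exchange of the Laplace integral and the contour integral *)

Context (s : C) (kap P : R) (Fl : C -> C) (l : C).
Hypotheses (hkap : 0 < kap)
  (hP : forall t tau, in_itv lo hi t -> 0 <= tau ->
     Cmod (Cexp (- (RtoC tau * s)) * psi (c t) (RtoC tau * cis theta) * cis theta)%C <= P * exp (- kap * tau))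
  (hFl : forall t, in_itv lo hi t ->
     gint 0 p_infty (fun tau => Cexp (- (RtoC tau * s)) * psi (c t) (RtoC tau * cis theta) * cis theta)%C (Fl (c t)))
  (hl : kernel_int Fl l).

(** The second variable is complex, so that estimates for holomorphic functions apply; it is later
    restricted to real [tau]. *)
Definition lap_integrand (z x : C) : C := (Cexp (- (x * s)) * psi z (x * cis theta) * cis theta)%C.

Definition lap_partial (T : R) (z : C) : C := CInt (fun tau => lap_integrand z (RtoC tau)) 0 T.

Lemma V_ray (tau : R) : 0 <= tau -> V (RtoC tau * cis theta)%C.
Proof. intros H. apply hVr. exists tau; split; trivial. Qed.

Lemma lap_integrand_deriv_at (t : R) (x : C) : in_itv lo hi t -> V (x * cis theta)%C -> deriv_at (lap_integrand (c t)) x.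
Proof.
  intros Ht Hx. apply deriv_at_mult; [|apply deriv_at_const]. apply deriv_at_mult.
  - apply (deriv_at_comp Cexp (fun x => - (x * s))%C); [eexists; apply has_cderiv_Cexp|].
    apply deriv_at_opp, deriv_at_mult; [apply deriv_at_id|apply deriv_at_const].
  - apply (deriv_at_comp (psi (c t)) (fun x => x * cis theta)%C).
    + apply loc_holo_deriv_at. apply holo_at_ball. apply hpsi; trivial.
    + apply deriv_at_mult; [apply deriv_at_id|apply deriv_at_const].
Qed.

Lemma lap_integrand_cont (t tau : R) : in_itv lo hi t -> 0 <= tau ->
  ccurve_cont (fun tau => lap_integrand (c t) (RtoC tau)) tau.
Proof.
  intros Ht Htau. apply (ccont_curve (lap_integrand (c t)) RtoC); [|apply ccurve_cont_RtoC].
  apply deriv_at_ccont, lap_integrand_deriv_at; trivial. apply V_ray; trivial.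
Qed.

(** A bound on a complex disc, common to all points of the contour, yields one Lipschitz constant in
    [tau] for all of them. *)
Lemma lap_integrand_lipschitz (tau0 : R) : 0 <= tau0 -> exists r Lip, 0 < r /\ 0 <= Lip /\
  forall t tau, in_itv lo hi t -> Rabs (tau - tau0) < r ->
    Cmod (lap_integrand (c t) (RtoC tau) - lap_integrand (c t) (RtoC tau0))%C <= Lip * Rabs (tau - tau0).
Proof.
  intros Ht0. destruct (psi_locally_bounded _ (V_ray tau0 Ht0)) as [R0 [M1 [HR [HM1 H]]]].
  set (M2 := exp ((tau0 + 1) * Cmod s) * M1).
  assert (HM2 : 0 <= M2) by (apply Rmult_le_pos; trivial; left; apply exp_pos).
  exists (R0 / 4), (12 * M2 / R0). split; [lra|]. split.
  { apply Rmult_le_pos; [lra|left; apply Rinv_0_lt_compat; lra]. }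
  intros t tau Ht Htau.
  assert (Hin : forall x, Cmod (x - RtoC tau0)%C < R0 -> Cmod (x * cis theta - RtoC tau0 * cis theta)%C < R0).
  { intros x Hx. replace (x * cis theta - RtoC tau0 * cis theta)%C with ((x - RtoC tau0) * cis theta)%C by ring.
    rewrite Cmod_mult, Cmod_cis, Rmult_1_r. trivial. }
  replace (RtoC tau) with (RtoC tau0 + RtoC (tau - tau0))%C by (rewrite RtoC_minus; ring).
  rewrite <- (Cmod_R (tau - tau0)).
  apply holo_lipschitz; try lra.
  - intros x Hx. apply lap_integrand_deriv_at; trivial. apply (H _ (Hin x Hx)).
  - intros x Hx. unfold lap_integrand. rewrite !Cmod_mult, Cmod_cis, Rmult_1_r. unfold M2.
    apply Rmult_le_compat; try apply Cmod_ge_0.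
    + rewrite Cmod_Cexp. assert (Hle : Re (- (x * s))%C <= (tau0 + 1) * Cmod s).
      { eapply Rle_trans; [apply Rle_abs|]. eapply Rle_trans; [apply re_le_Cmod|]. rewrite Cmod_opp, Cmod_mult.
        apply Rmult_le_compat_r; [apply Cmod_ge_0|]. replace x with (RtoC tau0 + (x - RtoC tau0))%C by ring.
        eapply Rle_trans; [apply Cmod_triangle|]. rewrite Cmod_R, Rabs_pos_eq by trivial. lra. }
      destruct (Req_dec (Re (- (x * s))%C) ((tau0 + 1) * Cmod s)) as [->|]; [lra|]. left; apply exp_increasing; lra.
    + apply (H _ (Hin x Hx)); trivial.
  - rewrite Cmod_R. lra.
Qed.

Lemma lap_P_nonneg : 0 <= P.
Proof.
  destruct in_itv_ex as [t Ht]. assert (H := hP t 0 Ht (Rle_refl _)). rewrite Rmult_0_r, exp_0, Rmult_1_r in H.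
  eapply Rle_trans; [apply Cmod_ge_0|exact H].
Qed.

Lemma lap_partial_CInt (t x y : R) : in_itv lo hi t -> 0 <= x <= y ->
  is_CInt (fun tau => lap_integrand (c t) (RtoC tau)) x y (lap_partial y (c t) - lap_partial x (c t))%C.
Proof.
  intros Ht Hxy.
  assert (H1 := is_CInt_cont (fun tau => lap_integrand (c t) (RtoC tau)) 0 x ltac:(lra) ltac:(intros; apply lap_integrand_cont; trivial; lra)).
  assert (H2 := is_CInt_cont (fun tau => lap_integrand (c t) (RtoC tau)) x y ltac:(lra) ltac:(intros; apply lap_integrand_cont; trivial; lra)).
  assert (H3 := is_CInt_cont (fun tau => lap_integrand (c t) (RtoC tau)) 0 y ltac:(lra) ltac:(intros; apply lap_integrand_cont; trivial; lra)).
  assert (E := is_CInt_unique2 _ _ _ _ _ H3 (is_CInt_Chasles _ _ _ _ _ _ H1 H2)).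
  unfold lap_partial. rewrite E.
  match goal with |- is_RInt _ _ _ ?v => replace v with (CInt (fun tau => lap_integrand (c t) (RtoC tau)) x y) by ring end.
  exact H2.
Qed.

Lemma lap_partial_exists (T : R) : 0 <= T -> exists D, kernel_int (lap_partial T) D.
Proof.
  intros HT.
  (* [psi] is controlled at points of the contour only; [G] replaces it by the entire form and is
     differentiable at every [z]. *)
  set (G := fun z => CInt (fun tau => Cexp (- (RtoC tau * s)) * (z * pseries b (z * (RtoC tau * cis theta))) * cis theta)%C 0 T).
  assert (HG : forall z, deriv_at G z).
  { intros z. assert (Pz := Cmod_ge_0 z).
    destruct (pseries_bounded b ((Cmod z + 1) * T)) as [Mb HMb]; trivial; [apply Rmult_le_pos; lra|].
    assert (Hd : forall tau x, deriv_at (fun z => Cexp (- (RtoC tau * s)) * (z * pseries b (z * (RtoC tau * cis theta))) * cis theta)%C x).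
    { intros tau x. apply deriv_at_mult; [|apply deriv_at_const]. apply deriv_at_mult; [apply deriv_at_const|].
      apply deriv_at_entire_form. }
    apply parametric_CInt_deriv_at with 1 (exp (T * Cmod s) * ((Cmod z + 1) * Mb)); trivial; [lra| | |].
    - intros tau Htau x Hx. apply Hd.
    - intros tau x Htau Hx. rewrite !Cmod_mult, Cmod_cis, Rmult_1_r.
      assert (Hx1 : Cmod x <= Cmod z + 1).
      { replace x with (z + (x - z))%C by ring. eapply Rle_trans; [apply Cmod_triangle|]. lra. }
      apply Rmult_le_compat; [apply Cmod_ge_0|apply Rmult_le_pos; apply Cmod_ge_0| |].
      + rewrite Cmod_Cexp. assert (Hle : Re (- (RtoC tau * s))%C <= T * Cmod s).
        { eapply Rle_trans; [apply Rle_abs|]. eapply Rle_trans; [apply re_le_Cmod|]. rewrite Cmod_opp, Cmod_mult, Cmod_R, Rabs_pos_eq by lra.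
          apply Rmult_le_compat_r; [apply Cmod_ge_0|lra]. }
        destruct (Req_dec (Re (- (RtoC tau * s))%C) (T * Cmod s)) as [->|]; [lra|]. left; apply exp_increasing; lra.
      + apply Rmult_le_compat; try apply Cmod_ge_0; trivial. apply HMb.
        rewrite !Cmod_mult, Cmod_cis, Rmult_1_r, Cmod_R, Rabs_pos_eq by lra.
        apply Rmult_le_compat; try lra. apply Cmod_ge_0.
    - intros tau x _ _.
      apply (ccont_curve (fun y => Cexp (- (y * s)) * (x * pseries b (x * (y * cis theta))) * cis theta)%C RtoC); [|apply ccurve_cont_RtoC].
      apply deriv_at_ccont. apply deriv_at_mult; [|apply deriv_at_const]. apply deriv_at_mult.
      + apply (deriv_at_comp Cexp (fun x => - (x * s))%C); [eexists; apply has_cderiv_Cexp|].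
        apply deriv_at_opp, deriv_at_mult; [apply deriv_at_id|apply deriv_at_const].
      + apply deriv_at_mult; [apply deriv_at_const|].
        apply (deriv_at_comp (pseries b) (fun y => x * (y * cis theta))%C); [apply pseries_entire; trivial|].
        apply deriv_at_mult; [apply deriv_at_const|]. apply deriv_at_mult; [apply deriv_at_id|apply deriv_at_const]. }
  assert (HGe : forall t, in_itv lo hi t -> G (c t) = lap_partial T (c t)).
  { intros t Ht. assert (H := lap_partial_CInt t 0 T Ht ltac:(lra)).
    assert (H0 : lap_partial 0 (c t) = 0).
    { apply (is_CInt_unique2 (fun tau => lap_integrand (c t) (RtoC tau)) 0 0).
      - apply is_CInt_cont; [lra|]. intros; apply lap_integrand_cont; trivial; lra.
      - apply is_CInt_point. }
    rewrite H0 in H. replace (lap_partial T (c t) - 0)%C with (lap_partial T (c t)) in H by ring.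
    apply (is_RInt_unique (V := C_R_CompleteNormedModule)).
    revert H. apply is_CInt_ext; trivial. intros tau Htau. unfold lap_integrand. rewrite hform; trivial.
    apply V_ray; lra. }
  destruct (kernel_int_exists G (P * T)) as [D HD].
  - intros t Ht. apply deriv_at_ccont, HG.
  - intros t Ht. rewrite HGe by trivial. replace T with (T - 0) by ring.
    apply is_CInt_Cmod_le_const with (fun tau => lap_integrand (c t) (RtoC tau)); [lra| |].
    + intros tau Htau. eapply Rle_trans; [apply (hP t tau Ht); lra|]. rewrite <- (Rmult_1_r P) at 2.
      apply Rmult_le_compat_l; [apply lap_P_nonneg|]. rewrite <- exp_0.
      assert (0 < kap * tau) by (apply Rmult_lt_0_compat; lra). left; apply exp_increasing; lra.
    + replace (T - 0) with T by ring. apply is_CInt_cont; trivial. intros; apply lap_integrand_cont; trivial; lra.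
  - exists D. revert HD. apply kernel_int_ext. exact HGe.
Qed.

Definition lap_borel (tau : R) : C := (Cexp (- (RtoC tau * s)) * borel_int (RtoC tau * cis theta) * cis theta)%C.

Lemma lap_borel_correct (tau : R) : 0 <= tau -> kernel_int (fun z => lap_integrand z (RtoC tau)) (lap_borel tau).
Proof.
  intros Ht. assert (H := kernel_int_mult (Cexp (- (RtoC tau * s)) * cis theta)%C _ _ (borel_int_correct _ (V_ray tau Ht))).
  unfold lap_borel.
  replace (Cexp (- (RtoC tau * s)) * borel_int (RtoC tau * cis theta) * cis theta)%C with
    (Cexp (- (RtoC tau * s)) * cis theta * borel_int (RtoC tau * cis theta))%C by ring.
  revert H. apply kernel_int_ext. intros t _. unfold lap_integrand. ring.
Qed.

Lemma lap_borel_cont (tau : R) : 0 <= tau -> ccurve_cont lap_borel tau.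
Proof.
  intros Ht. apply (ccont_curve (fun x => Cexp (- (x * s)) * borel_int (x * cis theta) * cis theta)%C RtoC); [|apply ccurve_cont_RtoC].
  apply deriv_at_ccont. apply deriv_at_mult; [|apply deriv_at_const]. apply deriv_at_mult.
  - apply (deriv_at_comp Cexp (fun x => - (x * s))%C); [eexists; apply has_cderiv_Cexp|].
    apply deriv_at_opp, deriv_at_mult; [apply deriv_at_id|apply deriv_at_const].
  - apply (deriv_at_comp borel_int (fun x => x * cis theta)%C).
    + apply borel_int_deriv_at, V_ray; trivial.
    + apply deriv_at_mult; [apply deriv_at_id|apply deriv_at_const].
Qed.

(* The difference of the two sides is additive in the interval and [o] of its length. *)
Lemma lap_exchange (T : R) (D : C) : 0 <= T -> kernel_int (lap_partial T) D -> CInt lap_borel 0 T = D.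
Proof.
  intros HT HD.
  assert (HM : 0 <= M).
  { destruct (filter_ex _ (ends_eventually lo hi hlohi)) as [[x y] [Hx [Hy Hxy]]]; simpl in *.
    eapply Rle_trans; [|apply (dom_bound _ _ _ _ hdom x y Hx Hy); lra].
    apply (is_RInt_ge_0 (fun t => Cmod (K1 (c t) * velocity c t)%C) x y); [lra| |intros; apply Cmod_ge_0].
    apply (dom_int _ _ _ _ hdom); trivial; lra. }
  assert (Hint : forall x y, 0 <= x <= y -> is_CInt lap_borel x y (CInt lap_borel x y)).
  { intros x y Hxy. apply is_CInt_cont; [lra|]. intros; apply lap_borel_cont; lra. }
  assert (Hkey : forall eps, 0 < eps -> forall Dx Dy x y, x = 0 -> y = T ->
     kernel_int (lap_partial x) Dx -> kernel_int (lap_partial y) Dy ->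
     Cmod (CInt lap_borel x y - (Dy - Dx))%C <= eps * (y - x)).
  { intros eps Heps Dx Dy x y -> ->.  revert Dx Dy.
    apply (interval_ind (fun x y => forall Dx Dy, kernel_int (lap_partial x) Dx -> kernel_int (lap_partial y) Dy ->
       Cmod (CInt lap_borel x y - (Dy - Dx))%C <= eps * (y - x))); trivial.
    - intros x y z Hx Hz H1 H2 Dx Dz HDx HDz. destruct (lap_partial_exists y ltac:(lra)) as [Dy HDy].
      specialize (H1 Dx Dy HDx HDy). specialize (H2 Dy Dz HDy HDz).
      rewrite (is_CInt_unique2 _ _ _ _ _ (Hint x z ltac:(lra)) (is_CInt_Chasles _ _ _ _ _ _ (Hint x y ltac:(lra)) (Hint y z ltac:(lra)))).
      replace (CInt lap_borel x y + CInt lap_borel y z - (Dz - Dx))%C with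
        ((CInt lap_borel x y - (Dy - Dx)) + (CInt lap_borel y z - (Dz - Dy)))%C by ring.
      eapply Rle_trans; [apply Cmod_triangle|]. lra.
    - intros x Hx. destruct (lap_integrand_lipschitz x ltac:(lra)) as [r [Lip [Hr [HLip H]]]].
      set (d := Rmin r (eps / (2 * (Lip * M + 1)))).
      assert (HLM : 0 <= Lip * M) by (apply Rmult_le_pos; trivial).
      assert (Hd : 0 < d) by (apply Rmin_pos; trivial; apply Rdiv_lt_0_compat; lra).
      assert (Hd1 : d <= r) by apply Rmin_l.
      assert (Hd2 : Lip * M * d <= eps / 2).
      { apply Rle_trans with ((Lip * M + 1) * (eps / (2 * (Lip * M + 1)))).
        - apply Rmult_le_compat; try lra. apply Rmin_r.
        - right; field; lra. }
      assert (Hloc : forall u v, 0 <= u <= v -> (forall tau, u <= tau <= v -> Rabs (tau - x) < d) ->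
        forall Du Dv, kernel_int (lap_partial u) Du -> kernel_int (lap_partial v) Dv ->
         Cmod (CInt lap_borel u v - (Dv - Du))%C <= eps * (v - u)).
      { intros u v Huv Hcl Du Dv HDu HDv.
        assert (Hx0 := lap_borel_correct x ltac:(lra)).
        (* Both sides are compared with [(v - u) * lap_borel x]; the Lipschitz bound gives each an
           error of at most [Lip * d * M * (v - u)], that is, half of what is allowed. *)
        assert (A1 : Cmod (CInt lap_borel u v - RtoC (v - u) * lap_borel x)%C <= eps / 2 * (v - u)).
        { apply is_CInt_Cmod_le_const with (fun tau => lap_borel tau - lap_borel x)%C; [lra| |].
          - intros tau Htau. apply Rle_trans with (Lip * d * M); [|lra].
            apply kernel_int_bound with (2 := kernel_int_minus _ _ _ _ (lap_borel_correct tau ltac:(lra)) Hx0).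
            intros t Ht. specialize (Hcl tau ltac:(lra)). eapply Rle_trans; [apply H; trivial; lra|].
            apply Rmult_le_compat_l; lra.
          - apply is_CInt_minus; [apply Hint; trivial|]. apply is_CInt_const. }
        assert (A2 : Cmod (Dv - Du - RtoC (v - u) * lap_borel x)%C <= Lip * d * (v - u) * M).
        { apply kernel_int_bound with (2 := kernel_int_minus _ _ _ _ (kernel_int_minus _ _ _ _ HDv HDu) (kernel_int_mult (RtoC (v - u)) _ _ Hx0)).
          intros t Ht. apply is_CInt_Cmod_le_const with (fun tau => lap_integrand (c t) (RtoC tau) - lap_integrand (c t) (RtoC x))%C; [lra| |].
          - intros tau Htau. specialize (Hcl tau ltac:(lra)). eapply Rle_trans; [apply H; trivial; lra|].
            apply Rmult_le_compat_l; lra.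
          - apply is_CInt_minus; [apply lap_partial_CInt; trivial|]. apply is_CInt_const. }
        assert (A3 : Lip * d * (v - u) * M <= eps / 2 * (v - u)).
        { replace (Lip * d * (v - u) * M) with (Lip * M * d * (v - u)) by ring. apply Rmult_le_compat_r; lra. }
        replace (CInt lap_borel u v - (Dv - Du))%C with ((CInt lap_borel u v - RtoC (v - u) * lap_borel x) -
          (Dv - Du - RtoC (v - u) * lap_borel x))%C by ring.
        eapply Rle_trans; [apply Cmod_minus_le|]. lra. }
      exists d; split; trivial; split; intros y Hy Hyd; apply Hloc; try lra; intros tau Htau; apply Rabs_def1; lra. }
  assert (H0 : kernel_int (lap_partial 0) 0).
  { destruct (lap_partial_exists 0 (Rle_refl _)) as [D0 HD0]. replace (RtoC 0) with D0; trivial.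
    apply Cmod_eq_0, Rle_antisym; [|apply Cmod_ge_0]. replace 0 with (0 * M) by ring.
    apply kernel_int_bound with (2 := HD0). intros t Ht.
    assert (E : lap_partial 0 (c t) = 0).
    { apply (is_CInt_unique2 (fun tau => lap_integrand (c t) (RtoC tau)) 0 0).
      - apply is_CInt_cont; [lra|]. intros; apply lap_integrand_cont; trivial; lra.
      - apply is_CInt_point. }
    rewrite E, Cmod_0. lra. }
  apply Cminus_eq_0, Cmod_le_small. intros eps Heps.
  assert (H := Hkey (eps / (T + 1)) ltac:(apply Rdiv_lt_0_compat; lra) 0 D 0 T eq_refl eq_refl H0 HD).
  replace (CInt lap_borel 0 T - (D - 0))%C with (CInt lap_borel 0 T - D)%C in H by ring.
  eapply Rle_trans; [exact H|]. apply Rle_trans with (eps / (T + 1) * (T + 1)); [|right; field; lra].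
  apply Rmult_le_compat_l; [left; apply Rdiv_lt_0_compat; lra|lra].
Qed.

(** The Laplace integral beyond [T] is at most [P / kap * exp (- kap * T)] at every point of the
    contour. It stays small after integration against the kernel, and the exchange on [[0, T]]
    passes to the limit. *)
Lemma lap_borel_gint : gint 0 p_infty lap_borel l.
Proof.
  apply gint_eps. intros eps Heps.
  assert (HPk : 0 <= P / kap) by (apply Rmult_le_pos; [apply lap_P_nonneg|left; apply Rinv_0_lt_compat; trivial]).
  set (A := P / kap * Rabs M + 1). assert (HA : 0 < A).
  { unfold A. assert (0 <= P / kap * Rabs M) by (apply Rmult_le_pos; trivial; apply Rabs_pos). lra. }
  destruct (exp_decay_small kap (eps / (2 * A)) hkap ltac:(apply Rdiv_lt_0_compat; lra)) as [T0 [HT0 HT]].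
  apply Filter_prod with (fun x => x = 0) (fun y => T0 < y); [reflexivity|exists T0; trivial|].
  intros x T -> HTT; simpl. exists (CInt lap_borel 0 T). split.
  { apply is_CInt_cont; [lra|]. intros; apply lap_borel_cont; lra. }
  destruct (lap_partial_exists T ltac:(lra)) as [D HD]. rewrite (lap_exchange T D) by (trivial; lra).
  specialize (HT T HTT). assert (E := exp_pos (- kap * T)).
  apply Rle_lt_trans with (P / kap * exp (- kap * T) * M).
  - apply kernel_int_bound with (2 := kernel_int_minus _ _ _ _ HD hl). intros t Ht.
    apply laplace_tail; trivial; try lra.
    + intros tau Htau. apply lap_integrand_cont; trivial.
    + intros tau Htau. apply hP; trivial.
    + apply hFl; trivial.
  - apply Rle_lt_trans with (A * exp (- kap * T)).
    + assert (M <= Rabs M) by apply Rle_abs.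
      replace (P / kap * exp (- kap * T) * M) with (P / kap * M * exp (- kap * T)) by ring.
      apply Rmult_le_compat_r; [lra|]. unfold A.
      assert (P / kap * M <= P / kap * Rabs M) by (apply Rmult_le_compat_l; trivial). lra.
    + apply Rle_lt_trans with (A * (eps / (2 * A))); [apply Rmult_le_compat_l; lra|].
      replace (A * (eps / (2 * A))) with (eps / 2) by (field; lra). lra.
Qed.

End Kernel.

(** * Borel summability *)

Section Fibre.

Variables (K : C -> C -> C) (f : C -> C) (k0 n0 : nat) (a : Z -> C) (lo hi : Rbar).
Variables (c0 c1 c2 : R -> C) (w : C) (U V : C -> Prop) (M theta al : R) (L : list (R * nat)).
Variables (psi : C -> C -> C) (h : Z -> C -> C) (g : C -> C) (gam0 : C).
Hypothesis hlohi : Rbar_lt lo hi.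
Hypothesis hKw : meromorphic (K w).
Hypothesis hk0 : pole_order (K w) 0 k0.
Hypothesis hf : meromorphic f.
Hypothesis hn0 : pole_order f 0 n0.
Hypothesis ha : laurent_at0 f n0 a.
Hypothesis hC0 : C1_on lo hi c0.
Hypothesis hC1 : C1_on lo hi c1.
Hypothesis hC2 : C1_on lo hi c2.
Hypothesis hK0 : forall t, in_itv lo hi t -> ~ pole (K w) (c0 t).
Hypothesis hf0 : forall gam, U gam -> forall t, in_itv lo hi t -> ~ pole (dil f gam) (c0 t).
Hypothesis hK2 : forall t, in_itv lo hi t -> ~ pole (K w) (c2 t) /\ c2 t <> 0.
Hypothesis hD1 : forall gam, U gam -> deforms (admissible K f w gam) (integrand K f w gam) lo hi c0 c1.
Hypothesis hD2 : forall gam, Usec U theta al gam -> deforms (admissible K f w gam) (integrand K f w gam) lo hi c1 c2.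
Hypothesis hg : forall gam, U gam -> is_contour_int lo hi c0 (fun z => (K w z * dil f gam z)%C) (g gam).
Hypothesis hh : forall m, is_contour_int lo hi c0 (fun z => (K w z * Czpow z m)%C) (h m w).
Hypothesis hU : open U.
Hypothesis hV : ray_domain theta V.
Hypothesis hdom : dominating lo hi (fun t => Cmod (K w (c2 t) * velocity c2 t)%C) M.
Hypothesis hpsi : forall t, in_itv lo hi t -> is_inverse_laplace theta (Usec U theta al) V
  (fun gam => phi f n0 k0 a (gam * c2 t)%C) (psi (c2 t)).
Hypothesis hbd : forall t, in_itv lo hi t -> forall xi, V xi ->
  Cmod (psi (c2 t) xi) <= exp (al * Cmod xi) * poly_bound L (Cmod xi).
Hypothesis hgam0 : Usec U theta al gam0.

Lemma Usec_nonzero (gam : C) : Usec U theta al gam -> gam <> 0.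
Proof. intros [_ [t [[H _] _]]]. exact H. Qed.

Lemma V_origin : V 0.
Proof. destruct hV as [_ [_ H]]. apply H. exists 0. split; [lra|]. ring. Qed.

Let hKc (t : R) (Ht : in_itv lo hi t) : ccont (K w) (c2 t).
Proof. apply deriv_at_ccont, loc_holo_deriv_at, not_pole_loc_holo; trivial. apply hK2; trivial. Qed.

Let hb (rho : R) (Hrho : 0 < rho) : exists Mb, forall n, Cmod (bcoef k0 a n) <= Mb * rho ^ n.
Proof. exact (bcoef_bound f n0 k0 a rho ha Hrho). Qed.

Lemma psi_germ (t : R) (Ht : in_itv lo hi t) : acoef k0 a 0 = 0 /\ exists r, 0 < r /\
  forall xi, Cmod xi < r -> psi (c2 t) xi = (c2 t * pseries (bcoef k0 a) (c2 t * xi))%C.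
Proof.
  apply inverse_laplace_germ with f n0 U V theta al L gam0; trivial.
  - apply hK2; trivial.
  - apply hpsi; trivial.
  - apply hbd; trivial.
Qed.

(** For [k0 = 0] the series [gplus] starts with [a 0 * h 0], and membership in [gamma O(W)[[gamma]]]
    requires this term to vanish. *)
Lemma acoef_0 : acoef k0 a 0 = 0.
Proof. destruct (in_itv_ex lo hi hlohi) as [t Ht]. apply (psi_germ t Ht). Qed.

Let hform (t : R) (Ht : in_itv lo hi t) (xi : C) (Hxi : V xi) :
  psi (c2 t) xi = (c2 t * pseries (bcoef k0 a) (c2 t * xi))%C.
Proof.
  destruct (psi_germ t Ht) as [_ [r [Hr H]]]. destruct hV as [Vo [Vc _]].
  apply (identity_connected V (psi (c2 t)) (fun xi => c2 t * pseries (bcoef k0 a) (c2 t * xi))%C 0 r); trivial.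
  - intros z Hz. destruct (hpsi t Ht) as [Hh _]. exact (proj1 (holo_at_ball _ _) (Hh z Hz)).
  - intros z _. apply loc_holo_entire. intros x. apply deriv_at_mult; [apply deriv_at_const|].
    apply (deriv_at_comp (pseries (bcoef k0 a)) (fun x => c2 t * x)%C); [apply pseries_entire; trivial|].
    apply deriv_at_mult; [apply deriv_at_const|apply deriv_at_id].
  - exact V_origin.
  - intros z Hz. apply H. replace (z - 0)%C with z in Hz by ring. exact Hz.
Qed.

Let hVo : open V := proj1 hV.
Let hVr : forall xi, ray theta xi -> V xi := proj2 (proj2 hV).
Let hpsih (t : R) (Ht : in_itv lo hi t) : holo_on V (psi (c2 t)) := proj1 (hpsi t Ht).

Let B := borel_int lo hi c2 (K w) psi.

(** For [S n >= k0] the power cancels the pole of [K w] at [0], and the integral moves to [c2] along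
    the deformations belonging to [gam0]; for smaller indices both sides vanish. *)
Lemma borel_coef (n : nat) :
  kernel_int lo hi c2 (K w) (fun z => (bcoef k0 a n * Cpow z (S n))%C) (borel (gplus k0 a h) n w).
Proof.
  unfold borel, gplus, bcoef, acoef. destruct (Nat.leb_spec k0 (S n)) as [Hk|Hk].
  - destruct hgam0 as [HU _].
    assert (H := transfer_power U U K f k0 lo hi c0 c1 c2 w gam0 hlohi hKw hk0 hf (Usec_nonzero _ hgam0) hC0 hC1 hC2
      hK0 (hf0 _ HU) (fun t Ht => proj2 (hK2 t Ht)) (hD1 _ HU) (hD2 _ hgam0) (S n) _ Hk (hh (Z.of_nat (S n)))).
    replace (a (Z.of_nat (S n)) * h (Z.of_nat (S n)) w / RtoC (INR (fact n)))%C with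
      (a (Z.of_nat (S n)) / RtoC (INR (fact n)) * h (Z.of_nat (S n)) w)%C by (unfold Cdiv; ring).
    apply (kernel_int_mult lo hi c2 (K w) hlohi _ (fun z => Cpow z (S n))). exact H.
  - destruct (kernel_int_exists lo hi c2 (K w) M hlohi hdom hC2 hKc (fun _ => RtoC 0) 0) as [l Hl].
    + intros t _. apply deriv_at_ccont, deriv_at_const.
    + intros t _. rewrite Cmod_0. lra.
    + assert (H := kernel_int_mult lo hi c2 (K w) hlohi 0 _ _ Hl).
      replace (0 / RtoC (INR (fact n)))%C with (0 * l)%C by (unfold Cdiv; ring).
      revert H. apply kernel_int_ext; trivial. intros t _. unfold Cdiv. ring.
Qed.

Lemma borel_int_continuation : is_continuation (fun n => borel (gplus k0 a h) n w) V B.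
Proof.
  split.
  - intros z Hz. apply (proj2 (holo_at_ball _ _)).
    destruct (proj1 (locally_Cmod z V) (hVo z Hz)) as [r [Hr H]]. exists r. split; trivial.
    intros x Hx. apply (borel_int_deriv_at lo hi c2 (K w) M hlohi hdom hC2 hKc V al L psi (bcoef k0 a)); auto.
  - apply (proj2 (locally_Cmod _ _)).
    destruct (borel_int_series lo hi c2 (K w) M hlohi hdom hC2 hKc V theta al L psi (bcoef k0 a) hVo hVr hpsih hbd hb hform
      _ borel_coef) as [r [Hr H]].
    exists r. split; trivial. intros xi Hxi. replace (xi - 0)%C with xi in Hxi by ring.
    exact (proj2 (is_series_Csum_lim _ _) (H xi Hxi)).
Qed.

Lemma borel_int_contour (xi : C) : V xi ->
  is_contour_int lo hi c2 (fun z => (K w z * psi z xi)%C) (B xi).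
Proof.
  exact (borel_int_correct lo hi c2 (K w) M hlohi hdom hC2 hKc V al L psi (bcoef k0 a) hbd hb hform xi).
Qed.

Lemma borel_int_exp_growth : exists P A, forall xi, V xi -> Cmod (B xi) <= P * exp (A * Cmod xi).
Proof.
  exact (borel_int_growth lo hi c2 (K w) M hlohi hdom hC2 hKc V al L psi (bcoef k0 a) hbd hb hform).
Qed.

Lemma borel_int_laplace (gam : C) : Usec U theta al gam -> exists l,
  is_laplace theta B gam l /\ g gam = (gminus n0 k0 a h gam w + l)%C.
Proof.
  intros Hgam. assert (Hg0 := Usec_nonzero gam Hgam).
  destruct (proj1 (Usec_iff U theta al gam Hg0) Hgam) as [HU Hs].
  set (s := (cis theta / gam)%C) in *.
  assert (Hxi : forall t : R, Cexp (- (RtoC t * cis theta / gam))%C = Cexp (- (RtoC t * s))%C).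
  { intros t. f_equal. unfold s, Cdiv. ring. }
  (* Half of the gap [Re s - al] absorbs the polynomial bound, the other half remains as decay in
     [tau]. *)
  set (kap := (Re s - al) / 2). assert (Hkap : 0 < kap) by (unfold kap; lra).
  destruct (poly_bound_exp L kap Hkap) as [P [HP HPb]].
  assert (Hl := transfer_phi U U K f k0 n0 a lo hi c0 c1 c2 w gam hlohi hKw hk0 hf hn0 ha Hg0 hC0 hC1 hC2
      hK0 (hf0 _ HU) (fun t Ht => proj2 (hK2 t Ht)) (hD1 _ HU) (hD2 _ Hgam) _ h (hg _ HU) hh).
  exists (g gam - gminus n0 k0 a h gam w)%C. split; [|ring].
  assert (HL := lap_borel_gint lo hi c2 (K w) M hlohi hdom hC2 hKc V theta al L psi (bcoef k0 a) hVo hVr hpsih hbd hb hform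
    s kap P (fun z => phi f n0 k0 a (gam * z)%C) (g gam - gminus n0 k0 a h gam w)%C Hkap).
  apply (gint_ext 0 p_infty (lap_borel lo hi c2 (K w) theta psi s)); [exact I| |apply HL; trivial].
  - intros t _. unfold lap_borel. cbv zeta. rewrite Hxi. reflexivity.
  - intros t tau Ht Htau. rewrite !Cmod_mult, Cmod_cis, Rmult_1_r, Cmod_exp_line.
    assert (Hray : V (RtoC tau * cis theta)%C) by (apply hVr; exists tau; split; trivial).
    assert (H := hbd t Ht _ Hray). rewrite Cmod_mult, Cmod_cis, Rmult_1_r, Cmod_R, Rabs_pos_eq in H by trivial.
    apply Rle_trans with (exp (- Re s * tau) * (exp (al * tau) * (P * exp (kap * tau)))).
    + apply Rmult_le_compat_l; [left; apply exp_pos|]. eapply Rle_trans; [exact H|].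
      apply Rmult_le_compat_l; [left; apply exp_pos|]. apply HPb; trivial.
    + right. replace (- kap * tau) with (- Re s * tau + (al * tau + kap * tau)) by (unfold kap; field).
      rewrite !exp_plus. ring.
  - intros t Ht. destruct (hpsi t Ht) as [_ H]. specialize (H gam Hgam).
    apply (gint_ext 0 p_infty) with (3 := H); [exact I|]. intros tau _. cbv zeta. rewrite Hxi. reflexivity.
Qed.

End Fibre.

Theorem theorem2
  (* the domain W and the kernel K *)
  (W : C -> Prop) (K : C -> C -> C)
  (hWopen : open W) (hWconn : connected_set W)
  (hK : meromorphic2 W K)
  (hKslice : forall w, W w -> ~ (forall z, pole_divisor W K w z))
  (hKw : forall w, W w -> meromorphic (K w))
  (k0 : nat) (hk0 : forall w, W w -> pole_order (K w) (RtoC 0) k0)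
  (* the curves Gamma_w *)
  (lo hi : Rbar) (hlohi : Rbar_lt lo hi)
  (Gam : C -> R -> C)
  (hGamFam : continuous_family W lo hi Gam)
  (hGam : forall w, W w -> piecewise_smooth_curve lo hi (Gam w))
  (hGamK : forall w, W w -> forall t, in_itv lo hi t -> ~ pole (K w) (Gam w t))
  (* the parameter set U *)
  (U : C -> Prop)
  (hUopen : open U) (hUconn : connected_set U) (hUne : exists gam, U gam)
  (hU0 : ~ U (RtoC 0))
  (hU0cl : forall N : C -> Prop, locally (RtoC 0) N -> exists gam, U gam /\ N gam)
  (* the function f and its Laurent series *)
  (f : C -> C) (hf : meromorphic f)
  (n0 : nat) (hn0 : pole_order f (RtoC 0) n0)
  (a : Z -> C) (ha : laurent_at0 f n0 a)
  (hGamf : forall w gam, W w -> U gam ->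
     forall t, in_itv lo hi t -> ~ pole (dil f gam) (Gam w t))
  (* the integrals g_gamma and h_m *)
  (g : C -> C -> C)
  (hg : forall w gam, W w -> U gam ->
     is_contour_int lo hi (Gam w) (fun z => Cmult (K w z) (dil f gam z)) (g gam w))
  (hgholo : forall gam, U gam -> holo_on W (g gam))
  (h : Z -> C -> C)
  (hh : forall (m : Z) w, W w ->
     is_contour_int lo hi (Gam w) (fun z => Cmult (K w z) (Czpow z m)) (h m w))
  (hhholo : forall m : Z, holo_on W (h m))
  (* the contours tilde Gamma_w *)
  (b c delta1 delta2 : R)
  (hb : 0 < b) (hc : 0 < c) (hdelta1 : 0 < delta1) (hdelta2 : 0 < delta2)
  (hdelta : 0 < delta1 - delta2)
  (cW cU : C -> R)
  (hcW : forall w, W w -> 0 < cW w) (hcU : forall gam, U gam -> c <= cU gam)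
  (d : nat) (tGam : C -> R -> C)
  (htGam : forall w, W w -> contour d lo hi (tGam w))
  (htDef : forall w gam, W w -> U gam ->
     deforms (admissible K f w gam) (integrand K f w gam) lo hi (Gam w) (tGam w))
  (htE : condE W U K f k0 n0 b delta1 delta2 cW cU lo hi tGam (fun _ _ => True))
  (* the direction theta and the growth exponent *)
  (theta : R) (alpha : C -> R)
  (* the contours bar Gamma_w *)
  (bGam : C -> R -> C)
  (hbGam : forall w, W w -> exists d' : nat, contour d' lo hi (bGam w))
  (hbK : forall w, W w -> forall t, in_itv lo hi t ->
     ~ pole (K w) (bGam w t) /\ bGam w t <> RtoC 0)
  (hbDef : forall w gam, W w -> Usec U theta (alpha w) gam ->
     deforms (admissible K f w gam) (integrand K f w gam) lo hi (tGam w) (bGam w))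
  (r : C -> R) (hr : forall w, W w -> 0 < r w)
  (hbE : condE W U K f k0 n0 b delta1 delta2 cW cU lo hi bGam
           (fun w z => ~ Cmod z < r w))
  (* the inverse Laplace transforms psi z of phi_z *)
  (L : list (R * nat))
  (V : C -> C -> Prop) (hV : forall w, W w -> ray_domain theta (V w))
  (psi : C -> C -> C)
  (hpsi : forall w, W w -> forall t, in_itv lo hi t ->
     is_inverse_laplace theta (Usec U theta (alpha w)) (V w)
       (fun gam => phi f n0 k0 a (Cmult gam (bGam w t))) (psi (bGam w t)))
  (hpsibd : forall w, W w -> forall t, in_itv lo hi t -> forall xi, V w xi ->
     Cmod (psi (bGam w t) xi)
       <= exp (alpha w * Cmod xi) * poly_bound L (Cmod xi))
  (gam0 : C) (hgam0 : forall w, W w -> Usec U theta (alpha w) gam0) :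
  borel_summable W theta (gplus k0 a h) /\
  exists B : C -> C -> C, forall w, W w ->
    is_continuation (fun n => borel (gplus k0 a h) n w) (V w) (B w) /\
    (forall xi, V w xi ->
       is_contour_int lo hi (bGam w) (fun z => Cmult (K w z) (psi z xi)) (B w xi)) /\
    (forall gam, Usec U theta (alpha w) gam ->
       exists l : C, is_laplace theta (B w) gam l /\
         g gam w = Cplus (gminus n0 k0 a h gam w) l).
Proof.
  set (B := fun w => borel_int lo hi (bGam w) (K w) psi).
  (* Integrability is decided at the non-compact ends, which eventually lie outside the disc of
     radius [r w], where conditions (E) hold. *)
  assert (Hdom : forall w, W w -> exists M, dominating lo hi (fun t => Cmod (K w (bGam w t) * velocity (bGam w) t)%C) M).
  { intros w Hw. destruct (hbGam w Hw) as [d' Hd']. destruct hbE as [E1 [E2 _]].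
    apply (kernel_dominating d' lo hi (bGam w) (K w) b (cW w) delta1 (r w) k0); trivial.
    - intros t Ht. apply deriv_at_ccont, loc_holo_deriv_at, not_pole_loc_holo; auto. apply hbK; trivial.
    - apply hr; trivial.
    - left; apply hcW; trivial.
    - intros t v. apply E1; trivial.
    - intros t. apply E2; trivial. }
  assert (HC0 : forall w, W w -> C1_on lo hi (Gam w)).
  { intros w Hw x y Hx Hy. apply (piecewise_smooth_curve_C1 lo hi); auto. }
  assert (HC1 : forall w, W w -> C1_on lo hi (tGam w)).
  { intros w Hw x y Hx Hy. apply (contour_piecewise_C1 d lo hi); auto. }
  assert (HC2 : forall w, W w -> C1_on lo hi (bGam w)).
  { intros w Hw x y Hx Hy. destruct (hbGam w Hw) as [d' Hd']. apply (contour_piecewise_C1 d' lo hi); auto. }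
  assert (Hcont : forall w, W w -> is_continuation (fun n => borel (gplus k0 a h) n w) (V w) (B w)).
  { intros w Hw. destruct (Hdom w Hw) as [M HM].
    apply (borel_int_continuation K f k0 n0 a lo hi (Gam w) (tGam w) (bGam w) w U (V w) M theta (alpha w) L psi h gam0); auto. }
  split; [split; [split|]|].
  - intros m w Hw. unfold gplus. destruct (k0 <=? m)%nat.
    + apply (proj2 (holo_at_ball _ _)).
      destruct (proj1 (holo_at_ball _ _) (hhholo (Z.of_nat m) w Hw)) as [r1 [Hr1 H]]. exists r1. split; trivial.
      intros x Hx. apply deriv_at_mult; [apply deriv_at_const|exact (H x Hx)].
    + apply (proj2 (holo_at_ball _ _)), loc_holo_entire. intros; apply deriv_at_const.
  - intros w Hw. assert (H := acoef_0 K f k0 n0 a lo hi (bGam w) w U (V w) theta (alpha w) L psi gam0).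
    unfold gplus, acoef in *. destruct (k0 <=? 0)%nat; trivial. rewrite H; auto. ring.
  - intros w Hw. exists (V w), (B w). split; [auto|]. split; [auto|]. destruct (Hdom w Hw) as [M HM].
    destruct (borel_int_exp_growth K f k0 n0 a lo hi (bGam w) w U (V w) M theta (alpha w) L psi gam0) as [P [A H]]; auto.
    exists P, A. intros xi Hxi. apply H. apply (hV w Hw). exact Hxi.
  - exists B. intros w Hw. split; [auto|]. destruct (Hdom w Hw) as [M HM]. split.
    + apply (borel_int_contour K f k0 n0 a lo hi (bGam w) w U (V w) M theta (alpha w) L psi gam0); auto.
    + apply (borel_int_laplace K f k0 n0 a lo hi (Gam w) (tGam w) (bGam w) w U (V w) M theta (alpha w) L psi h (fun gam => g gam w) gam0); auto.
Qed.
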